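(* Let $\Omega$ be one of $\mathbb{T}^2$, $\mathbb{R}^2$, or $\mathbb{T}\times\mathbb{R}$. Let $\Psi$ be a Fourier multiplier with symbol $\psi=\psi(|\xi|)$ satisfying, for some $\Xi_0>0$, $$\psi(|\xi|)\ge\log(10+|\xi|)\qquad\text{for } |\xi|>\Xi_0 .$$ For $\kappa>0$ and $\delta>0$ consider the dissipative generalized surface quasi-geostrophic equation $$\partial_t\theta^\delta+u^\delta\cdot\nabla\theta^\delta+\kappa\Psi\theta^\delta=0,\qquad u^\delta=\nabla^\perp(10+\Lambda)^{-\delta}\theta^\delta \qquad (\ast_{\delta})$$ on $\Omega$. Given any $\kappa>0$ and initial data $\theta_0\in H^s(\Omega)$ with $s>4$, there exists a unique global solution $\theta^\delta\in L^\infty([0,\infty);H^s(\Omega))$ to $(\ast_\delta)$ with initial data $\theta_0$ for all $\delta\in(0,\delta^* )$, where $\delta^*\in(0,1)$ is a constant depending only on $\kappa$, $s$, and $\|\theta_0\|_{H^s}$, and satisfies $$\lim_{\|\theta_0\|_{H^s}\to\infty}\delta^*=0 .$$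
   Context: Notation: $\theta^\delta(t,\cdot):\Omega\to\mathbb{R}$; $\nabla^\perp=(-\partial_{x_2},\partial_{x_1})^\top$; $\Lambda=(-\Delta)^{1/2}$ is the Fourier multiplier with symbol $|\xi|$; $(10+\Lambda)^{-\delta}$ is the Fourier multiplier with symbol $(10+|\xi|)^{-\delta}$. $\kappa\Psi\theta^\delta$ plays the role of a dissipation term. $H^s$ is the usual $L^2$-based inhomogeneous Sobolev space; the norm may be taken as $\|f\|_{H^s}^2=\int(10+|\xi|)^{2s}|\widehat f(\xi)|^2\,d\xi$ (with the sum/integral over the frequencies dual to $\Omega$).
   Formalization: The symbol ψ is additionally assumed nonnegative on [0,∞) (and Borel measurable); without ψ≥0 the claim fails, e.g. ψ(1)=-1 on T² with θ₀=cos x₁ gives e^{κt}cos x₁. The constant δ* may depend on the threshold Ξ₀ of the fixed Ψ. *)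

(* Defs.v *)
From HB Require Import structures.
From mathcomp Require Import all_boot all_order all_algebra.
From mathcomp Require Import all_classical all_reals all_analysis.
From mathcomp Require Import complex.

Set Implicit Arguments.
Unset Strict Implicit.
Unset Printing Implicit Defensive.
Import Order.TTheory GRing.Theory Num.Theory.
Import numFieldNormedType.Exports.

Local Open Scope classical_set_scope.
Local Open Scope ring_scope.
Local Open Scope complex_scope.

(* The circle is R/2piZ: its functions are the 2pi-periodic functions on R and
   its frequencies are the integers.  A function on any of the three domains is
   thus a function on R * R, and periodicity is forced by the Fourier
   representation [is_fourier] below. *)
Inductive domain := Torus | Plane | Cylinder.

Definition periodic1 (Om : domain) : bool :=
  match Om with Torus | Cylinder => true | Plane => false end.

Definition periodic2 (Om : domain) : bool :=
  match Om with Torus => true | Plane | Cylinder => false end.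

Section frequencies.
Context {R : realType}.
Local Open Scope ereal_scope.
Local Notation line := (measurableTypeR R).

Definition nat_counting : set line -> \bar R :=
  mseries (fun n => \d_(n%:R : line)) 0.

Definition negz_counting : set line -> \bar R :=
  mseries (fun n => \d_(- n.+1%:R : line)%R) 0.

HB.instance Definition _ := Measure.on nat_counting.
HB.instance Definition _ := Measure.on negz_counting.

Definition integer_counting : set line -> \bar R :=
  measure_add nat_counting negz_counting.

HB.instance Definition _ := Measure.on integer_counting.

Lemma mseries_dirac_lty (f : nat -> line) (A : set line) (N : nat) :
  (forall n, (N <= n)%N -> ~ A (f n)) -> mseries (R := R) (fun n => \d_(f n)) 0 A < +oo.
Proof.
move=> fA; rewrite /mseries (@nneseries_split R _ 0 N)//.
rewrite [X in _ + X]eseries0 ?adde0 ?add0n; last first.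
  by move=> i Ni _; rewrite /= diracE memNset//; exact: fA.
by apply: lte_sum_pinfty => i _; rewrite /= diracE ltry.
Qed.

Lemma integer_counting_sigma_finite : sigma_finite setT integer_counting.
Proof.
exists (fun n => [set` `[- n%:R, n%:R]%R] : set line).
  apply/esym/seteqP; split=> // x _; exists (Num.truncn `|x|%R).+1 => //=.
  have := truncnS_gt `|x|%R; rewrite in_itv/= -ler_norml; exact: ltW.
move=> n; split=> //; rewrite /integer_counting measure_addE lte_add_pinfty//.
  apply: (@mseries_dirac_lty _ _ n.+1) => k nk /=.
  by rewrite in_itv/= ler_nat => /andP[_]; rewrite leqNgt nk.
apply: (@mseries_dirac_lty _ _ n) => k nk /=.
by rewrite in_itv/= lerN2 ler_nat => /andP[]; rewrite leqNgt ltnS nk.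
Qed.

HB.instance Definition _ := Measure_isSigmaFinite.Build _ _ _
  integer_counting integer_counting_sigma_finite.

Definition line_freq (periodic : bool) : {sigma_finite_measure set line -> \bar R} :=
  match periodic with
  | true => integer_counting
  | false => lebesgue_measure
  end.

Definition freq (Om : domain) : {measure set (line * line) -> \bar R} :=
  line_freq (periodic1 Om) \x line_freq (periodic2 Om).

End frequencies.

Section fourier.
Context {R : realType}.
Local Notation line := (measurableTypeR R).
Implicit Types (Om : domain) (f : R * R -> R) (x k : R * R).

Definition cmeasurable d (T : measurableType d) (g : T -> R[i]) :=
  measurable_fun setT (fun y => complex.Re (g y)) /\
  measurable_fun setT (fun y => complex.Im (g y)).

Definition cint d (T : measurableType d) (mu : {measure set T -> \bar R})
    (D : set T) (g : T -> R[i]) : R[i] :=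
  (\int[mu]_(y in D) complex.Re (g y)) +i* (\int[mu]_(y in D) complex.Im (g y)).

Definition cis (a : R) : R[i] := cos a +i* sin a.

Definition dot x k : R := x.1 * k.1 + x.2 * k.2.

Definition modulus k : R := Num.sqrt (k.1 ^+ 2 + k.2 ^+ 2).

Definition fourier_inv Om (g : R * R -> R[i]) x : R[i] :=
  cint (freq Om) setT (fun k => g k * cis (dot x k)).

(* [g] is the Fourier transform of [f], through absolutely convergent inversion.
   Every element of H^s with s > 1 has an integrable Fourier transform, so such
   an [f] is the continuous representative of its class. *)
Definition is_fourier Om f (g : R * R -> R[i]) :=
  [/\ cmeasurable (g : line * line -> R[i]),
      (freq Om).-integrable setT (fun k => (Normc.normc (g k))%:E)
    & forall x, (f x)%:C = fourier_inv Om g x].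

(* Determined up to a (freq Om)-null set; the value is junk when [f] has no
   integrable Fourier transform. *)
Definition hat Om f : R * R -> R[i] :=
  xget (fun=> 0) [set g | is_fourier Om f g].

Definition sobolev_norm Om (s : R) f : \bar R :=
  Lnorm (freq Om) 2%:E
    (fun k => ((10 + modulus k) `^ s * Normc.normc (hat Om f k))%:E).

Definition sobolev Om (s : R) f :=
  (exists g, is_fourier Om f g) /\ (sobolev_norm Om s f < +oo)%E.

(* The real part is harmless: a real radial symbol preserves the Hermitian
   symmetry of the Fourier transform of a real function. *)
Definition multiplier Om (m : R -> R) f x : R :=
  complex.Re (fourier_inv Om (fun k => (m (modulus k))%:C * hat Om f k) x).

Definition partial1 f x : R := derive1 (fun a : R => f (a, x.2)) x.1.
Definition partial2 f x : R := derive1 (fun b : R => f (x.1, b)) x.2.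

Definition velocity Om (delta : R) f x : R * R :=
  let F := multiplier Om (fun r => (10 + r) `^ (- delta)) f in
  (- partial2 F x, partial1 F x).

Definition advection Om (delta : R) f x : R :=
  let u := velocity Om delta f x in u.1 * partial1 f x + u.2 * partial2 f x.

(* Elements of L^oo([0,oo); H^s), as functions of time up to a.e. equality;
   joint measurability of the Fourier transform is strong measurability in
   time. *)
Definition Linfty_sobolev Om (s : R) (theta : R -> R * R -> R) :=
  exists (g : R -> R * R -> R[i]) (M : R),
    [/\ cmeasurable (fun p : line * (line * line) => g p.1 p.2),
        {ae lebesgue_measure, forall t : R, 0 <= t ->
          is_fourier Om (theta t) (g t)}
      & {ae lebesgue_measure, forall t : R, 0 <= t ->
          (sobolev_norm Om s (theta t) <= M%:E)%E}].

(* The equation d/dt theta + u . grad theta + kappa Psi theta = 0 integrated in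
   time from the initial datum [theta0], and read on the Fourier side: the symbol
   [psi] has no upper bound, so Psi theta is defined only through its Fourier
   transform psi(|k|) * hat theta.  [g] and [h] are jointly measurable
   versions of the transforms of theta and u . grad theta. *)
Definition solves Om (psi : R -> R) (kappa delta : R) (theta0 : R * R -> R)
    (theta : R -> R * R -> R) :=
  exists g h : R -> R * R -> R[i],
    [/\ cmeasurable (fun p : line * (line * line) => g p.1 p.2),
        cmeasurable (fun p : line * (line * line) => h p.1 p.2),
        {ae lebesgue_measure, forall t : R, 0 <= t ->
          is_fourier Om (theta t) (g t) /\
          is_fourier Om (advection Om delta (theta t)) (h t)}
      & {ae freq Om, forall k, {ae lebesgue_measure, forall t : R, 0 <= t ->
          g t k = hat Om theta0 k -
            cint lebesgue_measure `[0, t] (fun tau : R =>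
              h tau k + (kappa * psi (modulus k))%:C * g tau k)}}].

End fourier.

(* Main.v *)
(* On the Fourier side the equation reads g' = - B(g, g) - kappa psi g, where B is
   an integral over triads p + l + k = 0.  After symmetrization over the triad the
   H^s energy form of B carries, besides the cross product of p and l, the factor
     W(a) (m(b) - m(c)) + cyclic,   m(r) = (10 + r)^(- delta),   W = (10 + r)^(2 s),
   which is at most a constant times delta times a product of two weights
   (10 + r)^s sqrt(log (10 + r)) and of (min (a, b, c))^2.  Hence
     d/dt |g|_s^2 <= (C delta (1 + |g|_s^2) - 2 kappa) |sqrt(log) g|_s^2 + lower order,
   so that for small delta the H^s norm never exceeds a bound fixed in advance.

   Solutions are limits of an explicit Euler scheme with the frequencies truncated
   to {|k| <= n, psi(|k|) <= n}; the same cancellation with weight 1 gives an L2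
   stability estimate (Gronwall), which yields both the convergence of a fast
   subsequence and uniqueness.  The return to the physical side rests on the
   injectivity of g |-> int g(k) e^(i x.k) on L1: the bounded multipliers that
   preserve the kernel form an algebra that contains sin(x.k + b) and is closed under
   bounded limits, hence contains all Borel functions. *)

Require Import Defs.
From HB Require Import structures.
From mathcomp Require Import all_boot all_order all_algebra.
From mathcomp Require Import all_classical all_reals all_analysis.
From mathcomp Require Import measurable_realfun.
From mathcomp Require Import complex ring lra.
Import Order.TTheory GRing.Theory Num.Theory.
Import numFieldNormedType.Exports.

Set Implicit Arguments.
Unset Strict Implicit.
Unset Printing Implicit Defensive.

Local Open Scope classical_set_scope.
Local Open Scope ring_scope.

(** * Symbols of the equation *)

(** A dissipation of logarithmic strength cannot absorb a derivative, so the nonlinear term may lose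
    at most a logarithm; symmetrization trades the derivative for the factor delta. The squared
    shortest side then falls on one factor of the trilinear form, which has to be integrable as (10
    + |k|)^2 |g|. By Young this costs (10 + |k|)^(-4), integrable in two dimensions, and (10 +
    |k|)^8 |g|^2, whence [4 <= s]. That L1 norm is controlled by the H^s norm itself, so the
    smallness of delta is measured against a bound [Mb] that the evolution must respect for all
    time. The logarithm is available only beyond [Xi0]; below, the L2 norm takes over, which the
    nonlinearity conserves. Since psi has no upper bound, psi |g|^2 is not controlled in advance:
    the stability estimate squares the equation at a fixed frequency, as a scalar equation in time,
    drops the dissipation by its sign, and only then integrates in k. In periodic directions the
    frequency measure charges integers only, so translation invariance holds almost everywhere and
    the pointwise estimates carry it as a hypothesis. *)

Section symbol_inequalities.
Context {R : realType}.
Implicit Types (p l k : R * R) (s delta x y a b c : R).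

(** The symbol of the bilinear form grad^perp F . grad f, with p the frequency of F and l that of f:
    the two factors i of the derivatives produce the sign. *)
Definition cross p l : R := p.2 * l.1 - p.1 * l.2.
Definition msym delta x : R := (10 + x) `^ (- delta).
Definition wsym s x : R := (10 + x) `^ (2 * s).
Definition lsym x : R := ln (10 + x).
(** Its square is the H^s energy weight times the logarithm that the dissipation supplies, so two
    such factors are exactly what the dissipation can absorb. *)
Definition vsym s x : R := (10 + x) `^ s * Num.sqrt (lsym x).

Lemma modulus_ge0 k : 0 <= modulus k.
Proof. exact: sqrtr_ge0. Qed.

Lemma modulus_sqr k : modulus k ^+ 2 = k.1 ^+ 2 + k.2 ^+ 2.
Proof. by rewrite sqr_sqrtr// addr_ge0 ?sqr_ge0. Qed.

Lemma modulusN k : modulus (- k) = modulus k.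
Proof. by rewrite /modulus /= !sqrrN. Qed.

Lemma ler_sqr_ge0 x y : 0 <= y -> x ^+ 2 <= y ^+ 2 -> x <= y.
Proof.
move=> y0 xy; rewrite leNgt; apply/negP => yx.
have : y ^+ 2 < x ^+ 2 by rewrite ltr_pXn2r// nnegrE// (le_trans y0)// ltW.
by rewrite ltNge xy.
Qed.

(** Lagrange's identity: the squares of the cross product and of the scalar product add up to the
    product of the squared moduli. *)
Lemma cross_le p l : `|cross p l| <= modulus p * modulus l.
Proof.
apply: ler_sqr_ge0; first by rewrite mulr_ge0 ?modulus_ge0.
rewrite exprMn !modulus_sqr real_normK ?num_real// /cross.
have : 0 <= (p.1 * l.1 + p.2 * l.2) ^+ 2 by exact: sqr_ge0.
nra.
Qed.

Lemma modulusD p l : modulus (p + l) <= modulus p + modulus l.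
Proof.
apply: ler_sqr_ge0; first by rewrite addr_ge0 ?modulus_ge0.
have : (p.1 * l.1 + p.2 * l.2) <= modulus p * modulus l.
  apply: ler_sqr_ge0; first by rewrite mulr_ge0 ?modulus_ge0.
  rewrite exprMn !modulus_sqr.
  have : 0 <= (p.2 * l.1 - p.1 * l.2) ^+ 2 by exact: sqr_ge0.
  nra.
rewrite sqrrD !modulus_sqr /= => h.
nra.
Qed.

Lemma modulus_abs1 k : `|k.1| <= modulus k.
Proof.
apply: ler_sqr_ge0; first exact: modulus_ge0.
by rewrite real_normK ?num_real// modulus_sqr lerDl sqr_ge0.
Qed.

Lemma modulus_abs2 k : `|k.2| <= modulus k.
Proof.
apply: ler_sqr_ge0; first exact: modulus_ge0.
by rewrite real_normK ?num_real// modulus_sqr lerDr sqr_ge0.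
Qed.

(** The shift by 10 exceeds e, so the logarithm never drops below 1 and can be inserted into a bound
    at will. The estimate e <= 4 is exp(-1/2) >= 1/2, inverted and squared. *)
Lemma lsym_ge1 x : 0 <= x -> 1 <= lsym x.
Proof.
move=> x0; rewrite /lsym -[leLHS]expRK ler_ln ?posrE ?expR_gt0//; last by lra.
have : expR 1 <= 4 :> R.
  have := @expR_ge1Dx R (- (1/2)).
  rewrite (_ : expR 1 = (expR (- (1/2))) ^- 2); last first.
    by rewrite -exprVn -expRN opprK -expRM_natl; congr expR; lra.
  have := expR_gt0 (- (1/2) : R).
  set e := expR _ => e0 e1; rewrite -[leRHS]invrK lef_pV2 ?posrE ?exprn_gt0//; nra.
lra.
Qed.

Lemma ln_le_sub1 x : 0 < x -> ln x <= x - 1.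
Proof. by move=> x0; have := @le_ln1Dx R (x - 1); rewrite addrCA subrr addr0; apply; lra. Qed.

Lemma msym_le1 delta x : 0 <= delta -> 0 <= x -> 0 <= msym delta x <= 1.
Proof.
move=> d0 x0; rewrite /msym powR_ge0/= powRN invf_le1 ?powR_gt0//; last by lra.
by rewrite -[leLHS](@powRr0 R (10 + x)) ler_powR//; lra.
Qed.

(** In the variable u = ln (10 + x) the multiplier is exp (- delta u), which is delta-Lipschitz for
    u >= 0. This is the source of the small factor delta; its price is a logarithm when the two
    moduli are far apart. *)
Lemma msym_sub_le_ln delta x y : 0 <= delta -> 0 <= x -> x <= y ->
  0 <= msym delta x - msym delta y <= delta * (ln (10 + y) - ln (10 + x)).
Proof.
move=> d0 x0 xy; rewrite /msym.
have ? : 0 < 10 + x by lra. have ? : 0 < 10 + y by lra.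
rewrite /powR !gt_eqF//.
set u := ln (10 + x); set v := ln (10 + y).
have uv : u <= v by rewrite /u /v ler_ln ?posrE//; lra.
have u1 : 0 <= u by rewrite ln_ge0//; lra.
have -> : expR (- delta * v) = expR (- delta * u) * expR (- (delta * (v - u))).
  by rewrite -expRD; congr expR; lra.
have e0 := expR_gt0 (- delta * u).
have e1 : expR (- delta * u) <= 1 by rewrite -(@expR0 R) ler_expR; nra.
have h := expR_ge1Dx (- (delta * (v - u))).
have h1 : expR (- (delta * (v - u))) <= 1 by rewrite -(@expR0 R) ler_expR; nra.
have h2 := expR_gt0 (- (delta * (v - u))).
apply/andP; split; nra.
Qed.

(** The form for moduli close to each other: ln r <= r - 1 replaces the logarithm by the relative
    increment, so no logarithm is lost. *)
Lemma msym_sub_le delta x y : 0 <= delta -> 0 <= x -> x <= y ->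
  0 <= msym delta x - msym delta y <= delta * ((y - x) / (10 + x)).
Proof.
move=> d0 x0 xy; have /andP[-> h] := msym_sub_le_ln d0 x0 xy.
apply: (le_trans h); apply: ler_wpM2l => //.
have x1 : 0 < 10 + x by lra. have y1 : 0 < 10 + y by lra.
rewrite -ln_div ?posrE//; apply: le_trans (ln_le_sub1 _) _; first exact: divr_gt0.
rewrite le_eqVlt; apply/orP; left; apply/eqP; field; lra.
Qed.

Lemma wsym_ge0 s x : 0 <= wsym s x. Proof. exact: powR_ge0. Qed.

Lemma wsym_le s x y : 0 <= s -> 0 <= x -> x <= y -> wsym s x <= wsym s y.
Proof. by move=> s0 x0 xy; rewrite /wsym ge0_ler_powR ?nnegrE//; lra. Qed.

(** The exponential form again, with exponent 2 s. The remaining factor 2 passes from the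
    denominator 10 + x to 10 + y, which the doubling hypothesis permits. *)
Lemma wsym_sub_le s x y : 0 <= s -> 0 <= x -> x <= y -> 10 + y <= 2 * (10 + x) ->
  wsym s y - wsym s x <= 4 * s * ((y - x) / (10 + y)) * wsym s y.
Proof.
move=> s0 x0 xy y2; rewrite /wsym /powR.
have ? : 0 < 10 + x by lra. have ? : 0 < 10 + y by lra.
rewrite !gt_eqF//.
set u := ln (10 + x); set v := ln (10 + y).
have h : v - u <= 2 * ((y - x) / (10 + y)).
  rewrite /u /v -ln_div ?posrE//; apply: le_trans (ln_le_sub1 _) _; first exact: divr_gt0.
  have -> : (10 + y) / (10 + x) - 1 = (y - x) / (10 + x) by field; lra.
  rewrite mulrCA ler_wpM2l ?subr_ge0//.
  rewrite -[leLHS]mul1r ler_pdivrMr// mulrAC ler_pdivlMr// mul1r; lra.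
have -> : expR (2 * s * u) = expR (2 * s * v) * expR (- (2 * s * (v - u))).
  by rewrite -expRD; congr expR; lra.
have e0 := expR_gt0 (2 * s * v).
have h' := expR_ge1Dx (- (2 * s * (v - u))).
set z := (y - x) / (10 + y) in h *.
have : s * (v - u) <= s * (2 * z) by exact: ler_wpM2l.
nra.
Qed.

Lemma vsym_ge0 s x : 0 <= vsym s x.
Proof. by rewrite mulr_ge0 ?powR_ge0 ?sqrtr_ge0. Qed.

Lemma vsym_sqr s x : 0 <= x -> vsym s x ^+ 2 = wsym s x * lsym x.
Proof.
move=> x0; rewrite exprMn sqr_sqrtr; last by have := lsym_ge1 x0; lra.
by rewrite /wsym (mulrC 2 s) powRrM powR_mulrn ?powR_ge0.
Qed.

(** Under doubling the power costs 2^s and the logarithm at most doubles, because ln 2 is below it;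
    a further factor 2 is more than enough for its square root. *)
Lemma vsym_le s x y : 0 <= s -> 0 <= x -> x <= y -> 10 + y <= 2 * (10 + x) ->
  vsym s y <= 2 `^ (s + 1) * vsym s x.
Proof.
move=> s0 x0 xy y2.
rewrite /vsym powRD; last by rewrite (_ : (2 == 0 :> R) = false) ?implybT//; apply/negbTE; lra.
rewrite powRr1; last by lra.
rewrite mulrACA -powRM ?mulr_ge0//; [|lra..].
apply: ler_pM; rewrite ?powR_ge0 ?sqrtr_ge0//.
  by rewrite ge0_ler_powR ?nnegrE//; lra.
apply: ler_sqr_ge0; first by rewrite mulr_ge0 ?sqrtr_ge0.
have h1 := lsym_ge1 x0; have h2 := lsym_ge1 (le_trans x0 xy).
rewrite exprMn !sqr_sqrtr; [|lra..].
have : lsym y <= ln (2 * (10 + x)) by rewrite /lsym ler_ln ?posrE//; lra.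
rewrite lnM ?posrE; [|lra..].
have : ln 2 <= lsym x by rewrite /lsym ler_ln ?posrE//; lra.
rewrite -/(lsym x); lra.
Qed.

(** The 3 by 3 determinant with rows 1, W, m evaluated at a, b, c: it is alternating, and it
    vanishes when W or m is constant. *)
Definition wdet s delta a b c : R :=
  wsym s a * (msym delta b - msym delta c) +
  wsym s b * (msym delta c - msym delta a) +
  wsym s c * (msym delta a - msym delta b).

(** In the sorted case 4 s comes from the variation of W, 1 from that of m, and 2^(s + 1) from
    moving one weight from the longest side to the middle one. *)
Definition Ktriad s : R := (4 * s + 1) * 2 `^ (s + 1).

Lemma Ktriad_ge0 s : 0 <= s -> 0 <= Ktriad s.
Proof. by move=> s0; rewrite mulr_ge0 ?powR_ge0//; lra. Qed.

(** The triangle inequality bounds the gap between the two longer sides by the shortest side b,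
    while a / (10 + u) is at most 1. So a relative increment turns a factor a of the cross product
    into b. *)
Lemma sub_frac_le (a c b u : R) : 0 <= a -> a <= u -> a <= c -> c <= a + b ->
  (c - a) * (a / (10 + u)) <= b.
Proof.
move=> a0 au ac cab; have p : 0 < 10 + u by lra.
by rewrite mulrA ler_pdivrMr//; nra.
Qed.

(** Here b is the shortest side and c the longest. The cross product contributes a b, and one
    increment between the comparable sides a and c turns a into b, hence b^2. The logarithm enters
    only through m(b) - m(c), whose arguments may be far apart. *)
Lemma wdet_sorted s delta a b c A : 0 <= s -> 0 <= delta -> 0 <= b -> b <= a -> a <= c ->
  c <= a + b -> `|A| <= a * b ->
  `|A * wdet s delta a b c| <= Ktriad s * delta * (b ^+ 2 * (vsym s a * vsym s c)).
Proof.
move=> s0 d0 b0 ba ac cab HA.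
have a0 : 0 <= a by lra. have c0 : 0 <= c by lra.
have c2 : 10 + c <= 2 * (10 + a) by lra.
have VV : wsym s c * lsym c <= 2 `^ (s + 1) * (vsym s a * vsym s c).
  rewrite -vsym_sqr// expr2 mulrA ler_wpM2r ?vsym_ge0//; exact: vsym_le.
(* Expansion after subtracting the column of c: each of the two products contains exactly one
   difference between the comparable sides a and c. *)
have -> : wdet s delta a b c = - ((wsym s c - wsym s a) * (msym delta b - msym delta c)) +
   (wsym s c - wsym s b) * (msym delta a - msym delta c).
  rewrite /wdet; ring.
have h1 := wsym_sub_le s0 a0 ac c2.
have h1' : 0 <= wsym s c - wsym s a by rewrite subr_ge0; exact: wsym_le.
have /andP[h2' h2] := msym_sub_le_ln d0 b0 (le_trans ba ac).
have /andP[h3' h3] := msym_sub_le d0 a0 ac.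
have h4' : 0 <= wsym s c - wsym s b by rewrite subr_ge0; apply: wsym_le => //; lra.
have h4 : wsym s c - wsym s b <= wsym s c by rewrite gerBl wsym_ge0.
have L1 := lsym_ge1 c0.
have lb : 0 <= ln (10 + b) by rewrite ln_ge0//; lra.
have h2c : msym delta b - msym delta c <= delta * lsym c.
  apply: (le_trans h2); apply: ler_wpM2l => //; rewrite /lsym; lra.
have w0 := wsym_ge0 s c.
pose WL := wsym s c * lsym c.
have t1 : a * b * ((wsym s c - wsym s a) * (msym delta b - msym delta c)) <= 4 * s * delta * b ^+ 2 * WL.
  apply: (@le_trans _ _ (a * b * (4 * s * ((c - a) / (10 + c)) * wsym s c * (delta * lsym c)))).
    by rewrite ler_wpM2l ?mulr_ge0// ler_pM.
  have -> : a * b * (4 * s * ((c - a) / (10 + c)) * wsym s c * (delta * lsym c)) =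
    4 * s * delta * (b * ((c - a) * (a / (10 + c)))) * WL by rewrite /WL; ring.
  rewrite ler_wpM2r ?mulr_ge0 ?(le_trans ler01 L1)//.
  rewrite ler_wpM2l ?mulr_ge0// expr2 ler_wpM2l//.
  exact: sub_frac_le.
(* No logarithm arises in this term; it is inserted at the end to match the first one. *)
have t2 : a * b * ((wsym s c - wsym s b) * (msym delta a - msym delta c)) <= delta * b ^+ 2 * WL.
  apply: (@le_trans _ _ (a * b * (wsym s c * (delta * ((c - a) / (10 + a)))))).
    by rewrite ler_wpM2l ?mulr_ge0// ler_pM.
  have -> : a * b * (wsym s c * (delta * ((c - a) / (10 + a)))) =
    delta * (b * ((c - a) * (a / (10 + a)))) * wsym s c by ring.
  apply: ler_pM; rewrite ?mulr_ge0 ?divr_ge0 ?invr_ge0 ?subr_ge0 ?addr_ge0//.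
    rewrite ler_wpM2l// expr2 ler_wpM2l//.
    exact: sub_frac_le.
  by rewrite /WL ler_peMr.
rewrite normrM.
apply: (@le_trans _ _ (a * b * ((wsym s c - wsym s a) * (msym delta b - msym delta c) +
   (wsym s c - wsym s b) * (msym delta a - msym delta c)))).
  apply: ler_pM => //.
  apply: (le_trans (ler_normD _ _)).
  by rewrite normrN (ger0_norm (mulr_ge0 h1' h2')) (ger0_norm (mulr_ge0 h4' h3')).
rewrite mulrDr.
apply: (@le_trans _ _ ((4 * s + 1) * delta * b ^+ 2 * WL)).
  by apply: (le_trans (lerD t1 t2)); rewrite le_eqVlt; apply/orP; left; apply/eqP; ring.
rewrite /Ktriad.
have -> : (4 * s + 1) * 2 `^ (s + 1) * delta * (b ^+ 2 * (vsym s a * vsym s c)) =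
 (4 * s + 1) * delta * b ^+ 2 * (2 `^ (s + 1) * (vsym s a * vsym s c)) by ring.
have s1 : 0 <= 4 * s + 1 by rewrite addr_ge0// mulr_ge0.
by rewrite ler_wpM2l// !mulr_ge0// sqr_ge0.
Qed.

(** The determinant is alternating, so its absolute value may be computed in sorted order. The sum
    of the three candidate bounds dominates the relevant one and spares later integrals a case
    distinction. *)
Lemma wdet_le s delta a b c A : 0 <= s -> 0 <= delta -> 0 <= a -> 0 <= b -> 0 <= c ->
  a <= b + c -> b <= a + c -> c <= a + b ->
  `|A| <= a * b -> `|A| <= b * c -> `|A| <= a * c ->
  `|A * wdet s delta a b c| <= Ktriad s * delta *
    (a ^+ 2 * (vsym s b * vsym s c) + b ^+ 2 * (vsym s a * vsym s c) + c ^+ 2 * (vsym s a * vsym s b)).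
Proof.
move=> s0 d0 a0 b0 c0 abc bac cab Aab Abc Aac.
have K0 : 0 <= Ktriad s * delta by rewrite mulr_ge0// Ktriad_ge0.
have Pa : 0 <= a ^+ 2 * (vsym s b * vsym s c) by rewrite mulr_ge0 ?sqr_ge0// mulr_ge0// vsym_ge0.
have Pb : 0 <= b ^+ 2 * (vsym s a * vsym s c) by rewrite mulr_ge0 ?sqr_ge0// mulr_ge0// vsym_ge0.
have Pc : 0 <= c ^+ 2 * (vsym s a * vsym s b) by rewrite mulr_ge0 ?sqr_ge0// mulr_ge0// vsym_ge0.
have E1 x y z : `|A * wdet s delta x y z| = `|A * wdet s delta y x z|.
  by rewrite -normrN -mulrN; congr (`|A * _|); rewrite /wdet; ring.
have E2 x y z : `|A * wdet s delta x y z| = `|A * wdet s delta x z y|.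
  by rewrite -normrN -mulrN; congr (`|A * _|); rewrite /wdet; ring.
have main b' a' c' : 0 <= b' -> b' <= a' -> a' <= c' -> c' <= a' + b' -> `|A| <= a' * b' ->
   b' ^+ 2 * (vsym s a' * vsym s c') <= a ^+ 2 * (vsym s b * vsym s c) + b ^+ 2 * (vsym s a * vsym s c) + c ^+ 2 * (vsym s a * vsym s b) ->
  `|A * wdet s delta a' b' c'| <= Ktriad s * delta *
    (a ^+ 2 * (vsym s b * vsym s c) + b ^+ 2 * (vsym s a * vsym s c) + c ^+ 2 * (vsym s a * vsym s b)).
  move=> h1 h2 h3 h4 h5 h6.
  by apply: le_trans (@wdet_sorted s delta a' b' c' A _ _ _ _ _ _ _) _ => //; exact: ler_wpM2l.
set S := _ + _ in main *.
have la : a ^+ 2 * (vsym s b * vsym s c) <= S by rewrite /S -addrA lerDl addr_ge0.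
have lb : b ^+ 2 * (vsym s a * vsym s c) <= S by rewrite /S addrAC lerDr addr_ge0.
have lc : c ^+ 2 * (vsym s a * vsym s b) <= S by rewrite /S lerDr addr_ge0.
have swap x y : `|A| <= x * y -> `|A| <= y * x by rewrite mulrC.
(* Six of the eight patterns are orderings of the sides; the other two are cyclic and
   contradictory. *)
case: (leP a b) => ab; case: (leP b c) => bc; case: (leP a c) => ac.
- rewrite E1; apply: (main a b c a0 ab bc _ (swap _ _ Aab) la); by rewrite addrC.
- by have := lt_le_trans ac (le_trans ab bc); rewrite ltxx.
- rewrite E2 E1; apply: (main a c b a0 ac (ltW bc) _ (swap _ _ Aac)); first by rewrite addrC.
  by rewrite [vsym s c * _]mulrC.
- by rewrite E2; exact: (main c a b c0 (ltW ac) ab bac Aac lc).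
- exact: (main b a c b0 (ltW ab) ac cab Aab lb).
- rewrite E1 E2 E1; apply: (main b c a b0 bc (ltW ac) _ (swap _ _ Abc)); first by rewrite addrC.
  by rewrite [vsym s c * _]mulrC.
- by have := lt_trans bc (lt_le_trans ab ac); rewrite ltxx.
- rewrite E1 E2; apply: (main c b a c0 (ltW bc) (ltW ab) abc Abc).
  by rewrite [vsym s b * _]mulrC.
Qed.

(** The L2 counterpart of the determinant bound. The cross product of p and l equals that of p + l
    and l, so it can be measured with the shorter of p and p + l, and the relative increment of m
    then yields a second factor |l|. No power of p survives. *)
Lemma cross_msym_le delta p l : 0 <= delta ->
  `|cross p l * (msym delta (modulus p) - msym delta (modulus (p + l)))| <=
  delta * modulus l ^+ 2.
Proof.
move=> d0; set c := p + l.
have cpl : cross p l = cross c l by rewrite /cross /c /=; ring.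
have h1 := cross_le p l. have h2 := cross_le c l. rewrite -cpl in h2.
have p0 := modulus_ge0 p. have c0 := modulus_ge0 c. have l0 := modulus_ge0 l.
have t1 : modulus p <= modulus c + modulus l.
  by have := modulusD c (- l); rewrite modulusN /c addrK.
have t2 : modulus c <= modulus p + modulus l by exact: modulusD.
rewrite normrM.
have key x y z : 0 <= x -> x <= y -> y <= x + modulus l -> 0 <= z -> z <= x * modulus l ->
   z * (msym delta x - msym delta y) <= delta * modulus l ^+ 2.
  move=> x0 xy yl z0 zx.
  have /andP[m0 m1] := msym_sub_le d0 x0 xy.
  apply: (@le_trans _ _ (x * modulus l * (delta * ((y - x) / (10 + x))))); first exact: ler_pM.
  have -> : x * modulus l * (delta * ((y - x) / (10 + x))) = delta * (modulus l * ((y - x) * (x / (10 + x)))) by ring.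
  rewrite ler_wpM2l// expr2 ler_wpM2l//.
  by apply: sub_frac_le => //; rewrite -lerBlDl.
case: (leP (modulus p) (modulus c)) => pc.
  have /andP[m0 _] := msym_sub_le d0 p0 pc.
  by rewrite (ger0_norm m0); apply: key.
have /andP[m0 _] := msym_sub_le d0 c0 (ltW pc).
by rewrite (distrC (msym _ _)) (ger0_norm m0); apply: key => //; exact: ltW.
Qed.

End symbol_inequalities.

(** * Real-valued integrals *)

Section real_integrals.
Context d {T : measurableType d} {R : realType} (mu : {measure set T -> \bar R}).
Implicit Types f g h : T -> R.

(** Replacing G by max (F, G), which is almost everywhere equal to G, turns the almost everywhere
    bound into a pointwise one. *)
Lemma ge0_le_integral_ae (F G : T -> \bar R) : measurable_fun setT F -> measurable_fun setT G ->
  (forall x, 0 <= F x)%E -> {ae mu, forall x, (F x <= G x)%E} ->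
  (\int[mu]_x F x <= \int[mu]_x G x)%E.
Proof.
move=> mF mG F0 FG.
pose G' x := (Order.max (F x) (G x)).
have -> : (\int[mu]_x G x = \int[mu]_x G' x)%E.
  apply: ae_eq_integral => //; first exact: measurable_maxe.
  by apply: filterS FG => x FG _; rewrite /G' max_r.
apply: ge0_le_integral => //; first exact: measurable_maxe.
by move=> x _; rewrite /G' le_max lexx.
Qed.

Definition itg f := mu.-integrable setT (EFin \o f).

Lemma itg_meas f : itg f -> measurable_fun setT f.
Proof. by move=> /measurable_int /measurable_EFinP. Qed.

Lemma itgP f : measurable_fun setT f -> (\int[mu]_x `|f x|%:E < +oo)%E -> itg f.
Proof. by move=> mf h; apply/integrableP; split; [exact/measurable_EFinP|]. Qed.

Lemma itg_lty f : itg f -> (\int[mu]_x `|f x|%:E < +oo)%E.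
Proof. by move=> /integrableP[]. Qed.

Lemma itg_mono_ae f g : measurable_fun setT f -> itg g ->
  {ae mu, forall x, `|f x| <= g x} -> itg f.
Proof.
move=> mf ig fg; apply: itgP => //; apply: le_lt_trans (itg_lty ig).
apply: ge0_le_integral_ae.
- by apply/measurable_EFinP; exact: measurableT_comp.
- by apply/measurable_EFinP; apply: measurableT_comp => //; exact: itg_meas.
- by move=> x; rewrite lee_fin.
- apply: filterS fg => x fg; rewrite lee_fin; exact: le_trans fg (ler_norm _).
Qed.

Lemma itg_mono f g : measurable_fun setT f -> itg g ->
  (forall x, `|f x| <= g x) -> itg f.
Proof. by move=> mf ig fg; apply: itg_mono_ae ig _ => //; exact: aeW. Qed.

Lemma itg_ext f g : itg f -> f =1 g -> itg g.
Proof. by move=> h /funext <-. Qed.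

Lemma itgD f g : itg f -> itg g -> itg (fun x => f x + g x).
Proof.
move=> h1 h2; have := integrableD measurableT h1 h2.
by apply: eq_integrable => // x _.
Qed.

Lemma itgB f g : itg f -> itg g -> itg (fun x => f x - g x).
Proof.
move=> h1 h2; have := integrableB measurableT h1 h2.
by apply: eq_integrable => // x _.
Qed.

Lemma itgZ c f : itg f -> itg (fun x => c * f x).
Proof.
move=> h1; have := integrableZl measurableT c h1.
by apply: eq_integrable => // x _.
Qed.

Lemma itgN f : itg f -> itg (fun x => - f x).
Proof. by move=> /(itgZ (-1)) /itg_ext; apply => x; rewrite mulN1r. Qed.

Lemma itg_norm f : itg f -> itg (fun x => `|f x|).
Proof.
move=> h; apply: (@itg_mono_ae _ (fun x => `|f x|)).
- by apply: measurableT_comp => //; exact: itg_meas.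
- by apply: itgP; [apply: measurableT_comp => //; exact: itg_meas|
    under eq_integral do rewrite normr_id; exact: itg_lty].
- by apply: aeW => x; rewrite normr_id.
Qed.

Lemma Rint_EFin f : itg f -> (\int[mu]_x f x)%:E = (\int[mu]_x (f x)%:E)%E.
Proof. by move=> h; rewrite fineK//; exact: integrable_fin_num. Qed.

Lemma Rint_D f g : itg f -> itg g ->
  \int[mu]_x (f x + g x) = \int[mu]_x f x + \int[mu]_x g x.
Proof. by move=> *; rewrite RintegralD. Qed.

Lemma Rint_B f g : itg f -> itg g ->
  \int[mu]_x (f x - g x) = \int[mu]_x f x - \int[mu]_x g x.
Proof. by move=> *; rewrite RintegralB. Qed.

Lemma Rint_Z c f : itg f -> \int[mu]_x (c * f x) = c * \int[mu]_x f x.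
Proof. by move=> *; rewrite RintegralZl. Qed.

Lemma Rint_N f : itg f -> \int[mu]_x (- f x) = - \int[mu]_x f x.
Proof.
move=> h; rewrite -mulN1r -Rint_Z//; apply: eq_Rintegral => x _; exact/esym/mulN1r.
Qed.

Lemma Rint_le_ae f g : itg f -> itg g -> {ae mu, forall x, f x <= g x} ->
  \int[mu]_x f x <= \int[mu]_x g x.
Proof.
move=> h1 h2 fg; rewrite -subr_ge0 -Rint_B//.
have := itgB h2 h1; set k := (fun _ => _) => h.
rewrite /Rintegral.
rewrite (_ : (\int[mu]_x (g x - f x)%:E)%E = \int[mu]_x (`|k x|)%:E)%E.
  by apply: fine_ge0; apply: integral_ge0 => x _; rewrite lee_fin.
apply: ae_eq_integral => //; first by apply/measurable_EFinP; exact: (itg_meas h).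
  by apply/measurable_EFinP; apply: measurableT_comp => //; exact: (itg_meas h).
by apply: filterS fg => x fg _; rewrite /k ger0_norm ?subr_ge0.
Qed.

Lemma Rint_le f g : itg f -> itg g -> (forall x, f x <= g x) ->
  \int[mu]_x f x <= \int[mu]_x g x.
Proof. by move=> h1 h2 fg; apply: Rint_le_ae => //; exact: aeW. Qed.

Lemma Rint_norm_le f : itg f -> `|\int[mu]_x f x| <= \int[mu]_x `|f x|.
Proof. by move=> h; apply: le_normr_Rintegral. Qed.

Lemma Rint_norm_bound f g : measurable_fun setT f -> itg g ->
  {ae mu, forall x, `|f x| <= g x} -> `|\int[mu]_x f x| <= \int[mu]_x g x.
Proof.
move=> mf ig fg; have h := itg_mono_ae mf ig fg.
by apply: le_trans (Rint_norm_le h) _; apply: Rint_le_ae => //; exact: itg_norm.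
Qed.

Lemma Rint_ae_eq f g : measurable_fun setT f -> measurable_fun setT g ->
  {ae mu, forall x, f x = g x} -> \int[mu]_x f x = \int[mu]_x g x.
Proof.
move=> mf mg fg; congr fine; apply: ae_eq_integral => //; try exact/measurable_EFinP.
by apply: filterS fg => x -> _.
Qed.

Lemma itg_ae_eq f g : itg f -> measurable_fun setT g ->
  {ae mu, forall x, f x = g x} -> itg g.
Proof.
move=> h mg fg; apply: itg_mono_ae (itg_norm h) _ => //.
by apply: filterS fg => x ->.
Qed.

Lemma itg_le_fin f c : measurable_fun setT f -> (forall x, 0 <= f x) ->
  (\int[mu]_x (f x)%:E <= c%:E)%E -> itg f /\ \int[mu]_x f x <= c.
Proof.
move=> mf f0 h.
have i : itg f.
  apply: itgP => //; apply: (@le_lt_trans _ _ (\int[mu]_x (f x)%:E)%E).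
    by under eq_integral do rewrite ger0_norm//.
  by rewrite (le_lt_trans h)// ltry.
by split => //; rewrite -lee_fin Rint_EFin.
Qed.

Lemma itg_lt_fin f : measurable_fun setT f -> (forall x, 0 <= f x) ->
  (\int[mu]_x (f x)%:E < +oo)%E -> itg f.
Proof.
move=> mf f0 h; apply: itgP => //.
by under eq_integral do rewrite ger0_norm//.
Qed.

Lemma itg_sum n (F : nat -> T -> R) : (forall i, itg (F i)) ->
  itg (fun x => \sum_(i < n) F i x).
Proof.
move=> h; elim: n => [|n IH].
  apply: itg_ext (itgZ 0 (h 0%N)) _ => x; rewrite big_ord0; exact: mul0r.
apply: itg_ext (itgD IH (h n)) _ => x; by rewrite big_ord_recr.
Qed.

Lemma Rint_sum n (F : nat -> T -> R) : (forall i, itg (F i)) ->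
  \int[mu]_x (\sum_(i < n) F i x) = \sum_(i < n) \int[mu]_x F i x.
Proof.
move=> h; elim: n => [|n IH].
  rewrite big_ord0 -[RHS](mul0r (\int[mu]_x F 0%N x)) -Rint_Z//; apply: eq_Rintegral => x _.
  by rewrite big_ord0; exact/esym/mul0r.
rewrite big_ord_recr/= -IH -Rint_D//; last exact: itg_sum.
by apply: eq_Rintegral => x _; rewrite big_ord_recr.
Qed.

End real_integrals.

(** * Iterated integrals and the exchange of almost everywhere quantifiers *)

Section products.
Context d1 d2 {T1 : measurableType d1} {T2 : measurableType d2} {R : realType}.
Variables (m1 : {sigma_finite_measure set T1 -> \bar R}).
Variables (m2 : {sigma_finite_measure set T2 -> \bar R}).
Implicit Types F : T1 * T2 -> R.

Lemma measurable_sect1 d (U : measurableType d) (F : T1 * T2 -> U) x :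
  measurable_fun setT F -> measurable_fun setT (fun y => F (x, y)).
Proof. by move=> h; apply: measurableT_comp => //; exact: measurable_pair1. Qed.

Lemma measurable_sect2 d (U : measurableType d) (F : T1 * T2 -> U) y :
  measurable_fun setT F -> measurable_fun setT (fun x => F (x, y)).
Proof. by move=> h; apply: measurableT_comp => //; exact: measurable_pair2. Qed.

(** No integrability is assumed: positive and negative parts are measurable by Tonelli, and [fine]
    maps the undefined cases measurably to a default value. *)
Lemma measurable_Rint1 F : measurable_fun setT F ->
  measurable_fun setT (fun x => \int[m2]_y F (x, y)).
Proof.
move=> mF; apply: measurableT_comp => //.
have mE : measurable_fun setT (EFin \o F) by exact/measurable_EFinP.
rewrite (_ : (fun x => _) = (fun x => \int[m2]_y (EFin \o F)^\+ (x, y) - \int[m2]_y (EFin \o F)^\- (x, y)))%E.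
  apply: emeasurable_funB.
    by apply: measurable_fun_fubini_tonelli_F => //; exact: measurable_funepos.
  by apply: measurable_fun_fubini_tonelli_F => //; exact: measurable_funeneg.
apply/funext => x; rewrite [LHS]integralE.
under eq_integral do rewrite (funepos_comp (EFin \o F) (fun y => (x, y)))/=.
by under [X in (_ - X)%E = _]eq_integral do rewrite (funeneg_comp (EFin \o F) (fun y => (x, y)))/=.
Qed.

Lemma itg_prod F : measurable_fun setT F ->
  (\int[m1]_x \int[m2]_y `|F (x, y)|%:E < +oo)%E -> itg (m1 \x m2)%E F.
Proof.
move=> mF h; have mE : measurable_fun setT (EFin \o F) by exact/measurable_EFinP.
exact: (integrable12ltyP m1 m2 mE).2.
Qed.

Lemma itg_prod2 F : measurable_fun setT F ->
  (\int[m2]_y \int[m1]_x `|F (x, y)|%:E < +oo)%E -> itg (m1 \x m2)%E F.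
Proof.
move=> mF h; have mE : measurable_fun setT (EFin \o F) by exact/measurable_EFinP.
exact: (integrable21ltyP m1 m2 mE).2.
Qed.

Lemma itg_prod_lty F : itg (m1 \x m2)%E F ->
  (\int[m1]_x \int[m2]_y `|F (x, y)|%:E < +oo)%E.
Proof. by move=> h; have /= := (integrable12ltyP m1 m2 (measurable_int _ h)).1 h. Qed.

Lemma itg_ae1 F : itg (m1 \x m2)%E F -> {ae m1, forall x, itg m2 (fun y => F (x, y))}.
Proof. by move=> h; exact: (ae_integrable1 h). Qed.

Lemma itg_ae2 F : itg (m1 \x m2)%E F -> {ae m2, forall y, itg m1 (fun x => F (x, y))}.
Proof. by move=> h; exact: (ae_integrable2 h). Qed.

Lemma measurable_swap d (U : measurableType d) (F : T1 * T2 -> U) :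
  measurable_fun setT F -> measurable_fun setT (fun p : T2 * T1 => F (p.2, p.1)).
Proof.
by move=> h; apply: measurableT_comp => //; apply: measurable_fun_pair;
  [exact: measurable_snd|exact: measurable_fst].
Qed.

Lemma itg_Rint1 F : itg (m1 \x m2)%E F -> itg m1 (fun x => \int[m2]_y F (x, y)).
Proof.
move=> h; have mF := itg_meas h.
have i : itg m1 (fun x => \int[m2]_y `|F (x, y)|).
  apply: itgP; first by apply: (@measurable_Rint1 (fun z => `|F z|)); exact: measurableT_comp.
  apply: le_lt_trans (itg_prod_lty h).
  apply: ge0_le_integral_ae.
  - apply/measurable_EFinP; apply: measurableT_comp => //; apply: (@measurable_Rint1 (fun z => `|F z|)); exact: measurableT_comp.
  - apply: (@measurable_fun_fubini_tonelli_F _ _ _ _ _ m2 (fun z => `|F z|%:E)) => //.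
    by apply/measurable_EFinP; exact: measurableT_comp.
  - by move=> x; rewrite lee_fin.
  - apply: filterS (itg_ae1 h) => x ix.
    rewrite ger0_norm; last by apply: Rintegral_ge0.
    by rewrite Rint_EFin//; exact: itg_norm.
apply: itg_mono_ae i _; first exact: measurable_Rint1.
by apply: filterS (itg_ae1 h) => x ix; exact: Rint_norm_le.
Qed.

Lemma Rint_fubini1 F : itg (m1 \x m2)%E F ->
  \int[m1]_x (\int[m2]_y F (x, y)) = \int[(m1 \x m2)%E]_z F z.
Proof.
move=> h; rewrite /Rintegral -(integral12_prod_meas1 h); congr fine.
apply: ae_eq_integral => //.
- by apply/measurable_EFinP; apply: measurable_Rint1; exact: (itg_meas h).
- exact: (measurable_fubini_F h).
- apply: filterS (itg_ae1 h) => x ix _.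
  by rewrite fineK//; exact: (integrable_fin_num measurableT ix).
Qed.

(** Tonelli for the indicator of the complement: a nonnegative double integral vanishes in one order
    exactly when it does in the other. The equation is known for almost every frequency at almost
    every time, and this gives the opposite order. *)
Lemma measurable_ae_ae (A : set (T1 * T2)) : measurable A ->
  {ae m1, forall x, {ae m2, forall y, A (x, y)}} ->
  {ae m2, forall y, {ae m1, forall x, A (x, y)}}.
Proof.
move=> mA h.
pose F (z : T1 * T2) := (\1_(~` A) z)%:E : \bar R.
have mC : measurable (~` A) by exact: measurableC.
have mF : measurable_fun setT F by apply/measurable_EFinP.
have F0 z : (0 <= F z)%E by rewrite lee_fin.
have z1 : (\int[m1]_x \int[m2]_y F (x, y) = 0)%E.
  transitivity (\int[m1]_x (cst 0%E x))%E; last by rewrite integral0.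
  apply: ae_eq_integral => //; first exact: measurable_fun_fubini_tonelli_F.
  apply: filterS h => x hx _.
  transitivity (\int[m2]_x (cst 0%E x))%E; last by rewrite integral0.
  apply: ae_eq_integral => //; first exact: measurable_sect1.
  by apply: filterS hx => y Axy _; rewrite /F indicE memNset.
rewrite fubini_tonelli// in z1.
have z2 : {ae m2, forall y, (\int[m1]_x F (x, y))%E = 0%E}.
  have mG : measurable_fun setT (fun y => \int[m1]_x F (x, y))%E.
    exact: measurable_fun_fubini_tonelli_G.
  have /(ae_eq_integral_abs _ measurableT) : (\int[m2]_y `|\int[m1]_x F (x, y)| = 0)%E.
    by under eq_integral do rewrite gee0_abs ?integral_ge0//.
  by move=> /(_ mG); apply: filterS => y /= /(_ I).
apply: filterS z2 => y hy.
have mG : measurable_fun setT (fun x => F (x, y)) by exact: measurable_sect2.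
have /(ae_eq_integral_abs _ measurableT) : (\int[m1]_x `|F (x, y)| = 0)%E.
  by under eq_integral do rewrite gee0_abs//.
move=> /(_ mG); apply: filterS => x /= /(_ I).
rewrite /F indicE; case: (boolP ((x, y) \in ~` A)) => [_ /= []/eqP|]; first by rewrite oner_eq0.
by rewrite notin_setE /= => /contrapT.
Qed.

End products.

Section products_swap.
Context d1 d2 {T1 : measurableType d1} {T2 : measurableType d2} {R : realType}.
Variables (m1 : {sigma_finite_measure set T1 -> \bar R}).
Variables (m2 : {sigma_finite_measure set T2 -> \bar R}).
Implicit Types F : T1 * T2 -> R.

Lemma itg_swap F : itg (m1 \x m2)%E F -> itg (m2 \x m1)%E (fun p => F (p.2, p.1)).
Proof.
move=> h; apply: itg_prod2 => //=; last exact: itg_prod_lty.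
by apply: measurable_swap; exact: (itg_meas h).
Qed.

Lemma Rint_fubini F : itg (m1 \x m2)%E F ->
  \int[m1]_x (\int[m2]_y F (x, y)) = \int[m2]_y (\int[m1]_x F (x, y)).
Proof.
move=> h; rewrite Rint_fubini1//.
have := Rint_fubini1 (itg_swap h) => /= ->.
rewrite /Rintegral -(integral12_prod_meas1 h).
rewrite -(@integral21_prod_meas1 _ _ _ _ _ m2 m1 (EFin \o (fun p => F (p.2, p.1)))) //.
exact: itg_swap.
Qed.

End products_swap.

Section generic_products.
Context d1 d2 {T1 : measurableType d1} {T2 : measurableType d2} {R : realType}.
Variables (m1 : {sigma_finite_measure set T1 -> \bar R}).
Variables (m2 : {sigma_finite_measure set T2 -> \bar R}).

Lemma Rint_swap (F : T1 * T2 -> R) : itg (m1 \x m2)%E F ->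
  \int[(m2 \x m1)%E]_z F (z.2, z.1) = \int[(m1 \x m2)%E]_z F z.
Proof.
move=> h; rewrite -(Rint_fubini1 (itg_swap h))/=.
by rewrite -(Rint_fubini h) (Rint_fubini1 h).
Qed.

Lemma itg_tensor (f : T1 -> R) (g : T2 -> R) : itg m1 f -> itg m2 g ->
  itg (m1 \x m2)%E (fun z => f z.1 * g z.2) /\
  \int[(m1 \x m2)%E]_z (f z.1 * g z.2) = (\int[m1]_k f k) * (\int[m2]_k g k).
Proof.
move=> hf hg; have mf := itg_meas hf; have mg := itg_meas hg.
have i : itg (m1 \x m2)%E (fun z => f z.1 * g z.2).
  apply: itg_prod => /=.
    by apply: measurable_funM; [exact: (measurableT_comp mf measurable_fst)|exact: (measurableT_comp mg measurable_snd)].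
  have Hg := Rint_EFin (itg_norm hg); have Hf := Rint_EFin (itg_norm hf).
  rewrite (_ : (\int[m1]_x _ = \int[m1]_x (`|f x| * \int[m2]_y `|g y|)%:E)%E).
    rewrite -Rint_EFin ?ltry//.
    by apply: itg_ext (itgZ (\int[m2]_y `|g y|) (itg_norm hf)) _ => x; rewrite mulrC.
  apply: eq_integral => x _; under eq_integral do rewrite normrM.
  by rewrite -Rint_EFin; [rewrite Rint_Z//; exact: itg_norm|apply: itgZ; exact: itg_norm].
split => //; rewrite -(Rint_fubini1 i)/=.
under eq_Rintegral do rewrite Rint_Z//.
by rewrite RintegralZr.
Qed.
End generic_products.

(** * Complex-valued functions on the frequency space *)

Lemma measurable_sqrt (R : realType) : measurable_fun [set: R] (@Num.sqrt R).
Proof. by apply: continuous_measurable_fun; exact: sqrt_continuous. Qed.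

Section complex_functions.
Context {R : realType}.
Implicit Types z w : R[i].
Local Notation Re := complex.Re.
Local Notation Im := complex.Im.
Local Notation cabs := Normc.normc.

Definition nsq z : R := Re z ^+ 2 + Im z ^+ 2.

Lemma nsq_ge0 z : 0 <= nsq z.
Proof. by rewrite addr_ge0 ?sqr_ge0. Qed.

Lemma cabs_ge0 z : 0 <= cabs z.
Proof. by case: z => a b; exact: sqrtr_ge0. Qed.

Lemma cabs_sqr z : cabs z ^+ 2 = nsq z.
Proof. by case: z => a b; rewrite /= sqr_sqrtr// addr_ge0 ?sqr_ge0. Qed.

Lemma cabsE z : cabs z = Num.sqrt (nsq z).
Proof. by case: z. Qed.

Lemma cabsM z w : cabs (z * w) = cabs z * cabs w.
Proof. exact: Normc.normcM. Qed.

Lemma cReM z w : Re (z * w) = Re z * Re w - Im z * Im w.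
Proof. by case: z => a b; case: w. Qed.

Lemma cImM z w : Im (z * w) = Re z * Im w + Im z * Re w.
Proof. by case: z => a b; case: w => c e /=. Qed.

Lemma cReD z w : Re (z + w) = Re z + Re w.
Proof. by case: z; case: w. Qed.

Lemma cImD z w : Im (z + w) = Im z + Im w.
Proof. by case: z; case: w. Qed.

Lemma cReN z : Re (- z) = - Re z.
Proof. by case: z. Qed.

Lemma cImN z : Im (- z) = - Im z.
Proof. by case: z. Qed.

Lemma cReB z w : Re (z - w) = Re z - Re w.
Proof. by rewrite cReD cReN. Qed.

Lemma cImB z w : Im (z - w) = Im z - Im w.
Proof. by rewrite cImD cImN. Qed.

Lemma cReZ (a : R) z : Re (a%:C%C * z) = a * Re z.
Proof. by case: z => x y; rewrite /= mul0r subr0. Qed.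

Lemma cImZ (a : R) z : Im (a%:C%C * z) = a * Im z.
Proof. by case: z => x y; rewrite /= mul0r addr0. Qed.

Lemma cReC z : Re (z^*)%C = Re z. Proof. by case: z. Qed.
Lemma cImC z : Im (z^*)%C = - Im z. Proof. by case: z. Qed.

Lemma complex_ext z w : Re z = Re w -> Im z = Im w -> z = w.
Proof. by case: z => a b; case: w => c e /= -> ->. Qed.

Lemma cabs_Re z : `|Re z| <= cabs z.
Proof.
apply: ler_sqr_ge0; rewrite ?cabs_ge0// cabs_sqr real_normK ?num_real//.
by rewrite lerDl sqr_ge0.
Qed.

Lemma cabs_Im z : `|Im z| <= cabs z.
Proof.
apply: ler_sqr_ge0; rewrite ?cabs_ge0// cabs_sqr real_normK ?num_real//.
by rewrite lerDr sqr_ge0.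
Qed.

Lemma cabs_le z : cabs z <= `|Re z| + `|Im z|.
Proof.
apply: ler_sqr_ge0; rewrite ?addr_ge0// cabs_sqr sqrrD !real_normK ?num_real//.
rewrite /nsq; have : 0 <= `|Re z| * `|Im z| by rewrite mulr_ge0. lra.
Qed.

Lemma cabsD z w : cabs (z + w) <= cabs z + cabs w.
Proof.
apply: ler_sqr_ge0; first by rewrite addr_ge0 ?cabs_ge0.
have h : Re z * Re w + Im z * Im w <= cabs z * cabs w.
  apply: ler_sqr_ge0; first by rewrite mulr_ge0 ?cabs_ge0.
  rewrite exprMn !cabs_sqr /nsq.
  have : 0 <= (Re z * Im w - Im z * Re w) ^+ 2 by exact: sqr_ge0.
  nra.
rewrite sqrrD !cabs_sqr /nsq cReD cImD; nra.
Qed.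

Lemma cabsN z : cabs (- z) = cabs z.
Proof. by rewrite !cabsE /nsq cReN cImN !sqrrN. Qed.

Lemma cabs_conj z : cabs (z^*)%C = cabs z.
Proof. by rewrite !cabsE /nsq cReC cImC sqrrN. Qed.

Lemma cabs_real (a : R) : cabs a%:C%C = `|a|.
Proof. by rewrite cabsE /nsq /= expr0n addr0 sqrtr_sqr. Qed.

Lemma cabs0 : cabs (0 : R[i]) = 0.
Proof. by rewrite cabsE /nsq /= expr0n addr0 sqrtr0. Qed.

Lemma cabs_eq0 z : cabs z = 0 -> z = 0.
Proof.
move=> h; have := cabs_Re z; have := cabs_Im z; rewrite h !normr_le0 => /eqP i /eqP r.
exact: complex_ext.
Qed.

Section measurability.
Context d {T : measurableType d}.
Implicit Types f g : T -> R[i].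

Lemma cmeas_Re f : cmeasurable f -> measurable_fun setT (fun x => Re (f x)).
Proof. by case. Qed.

Lemma cmeas_Im f : cmeasurable f -> measurable_fun setT (fun x => Im (f x)).
Proof. by case. Qed.

Lemma cmeasD f g : cmeasurable f -> cmeasurable g -> cmeasurable (fun x => f x + g x).
Proof.
move=> [fr fi] [gr gi]; split.
  by under eq_fun do rewrite cReD; exact: measurable_funD.
by under eq_fun do rewrite cImD; exact: measurable_funD.
Qed.

Lemma cmeasN f : cmeasurable f -> cmeasurable (fun x => - f x).
Proof.
move=> [fr fi]; split.
  by under eq_fun do rewrite cReN; exact: measurableT_comp.
by under eq_fun do rewrite cImN; exact: measurableT_comp.
Qed.

Lemma cmeasB f g : cmeasurable f -> cmeasurable g -> cmeasurable (fun x => f x - g x).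
Proof. by move=> mf mg; apply: cmeasD => //; exact: cmeasN. Qed.

Lemma cmeasM f g : cmeasurable f -> cmeasurable g -> cmeasurable (fun x => f x * g x).
Proof.
move=> [fr fi] [gr gi]; split.
  by under eq_fun do rewrite cReM; apply: measurable_funB; exact: measurable_funM.
by under eq_fun do rewrite cImM; apply: measurable_funD; exact: measurable_funM.
Qed.

Lemma cmeas_real (a : T -> R) : measurable_fun setT a -> cmeasurable (fun x => (a x)%:C%C).
Proof. by move=> ma; split => //=; exact: measurable_cst. Qed.

Lemma cmeas_conj f : cmeasurable f -> cmeasurable (fun x => (f x)^*%C).
Proof.
move=> [fr fi]; split.
  by under eq_fun do rewrite cReC.
by under eq_fun do rewrite cImC; exact: measurableT_comp.
Qed.

Lemma cmeas_cst z : cmeasurable (fun _ : T => z).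
Proof. by split; exact: measurable_cst. Qed.

Lemma cmeas_nsq f : cmeasurable f -> measurable_fun setT (fun x => nsq (f x)).
Proof. by move=> [fr fi]; apply: measurable_funD; exact: measurable_funX. Qed.

Lemma cmeas_cabs f : cmeasurable f -> measurable_fun setT (fun x => cabs (f x)).
Proof.
move=> mf; under eq_fun do rewrite cabsE.
by apply: measurableT_comp; [exact: measurable_sqrt|exact: cmeas_nsq].
Qed.

Lemma cmeas_ext f g : cmeasurable f -> f =1 g -> cmeasurable g.
Proof. by move=> h /funext <-. Qed.

End measurability.

Lemma cmeas_comp d1 d2 (T1 : measurableType d1) (T2 : measurableType d2)
  (f : T2 -> R[i]) (h : T1 -> T2) : cmeasurable f -> measurable_fun setT h ->
  cmeasurable (fun x => f (h x)).
Proof. by move=> [fr fi] mh; split; [exact: (measurableT_comp fr mh)|exact: (measurableT_comp fi mh)]. Qed.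

Lemma cmeas_cint d1 d2 (T1 : measurableType d1) (T2 : measurableType d2)
  (m2 : {sigma_finite_measure set T2 -> \bar R}) (F : T1 * T2 -> R[i]) : cmeasurable F ->
  cmeasurable (fun x => cint m2 setT (fun y => F (x, y))).
Proof.
move=> [fr fi]; rewrite /cint; split => /=.
  exact: (measurable_Rint1 m2 fr).
exact: (measurable_Rint1 m2 fi).
Qed.

End complex_functions.

Section frequency_space.
Context {R : realType}.

(* [R * R] with the Borel structure carrying [freq]; the alias makes it a
   measurable abelian group. *)
Definition freqsp : Type := (R * R)%type.
HB.instance Definition _ := GRing.Zmodule.copy freqsp (R * R)%type.
HB.instance Definition _ := Measurable.copy freqsp (measurableTypeR R * measurableTypeR R)%type.
End frequency_space.
Arguments freqsp R : clear implicits.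

Section frequency_maps.
Context {R : realType}.
Local Notation K := (freqsp R).
Local Notation line := (measurableTypeR R).

Lemma measurable_freq1 : measurable_fun (setT : set K) (fun k : K => k.1 : R).
Proof. exact: (@measurable_fst _ _ line line). Qed.

Lemma measurable_freq2 : measurable_fun (setT : set K) (fun k : K => k.2 : R).
Proof. exact: (@measurable_snd _ _ line line). Qed.

Context d {T : measurableType d}.
Implicit Types f g : T -> K.

Lemma measurable_freqP f :
  measurable_fun setT (fun x => (f x).1 : R) ->
  measurable_fun setT (fun x => (f x).2 : R) -> measurable_fun setT f.
Proof.
move=> f1 f2; apply: (@measurable_fun_pairP _ _ _ T line line f).2; split; exact.
Qed.

Lemma measurable_freqD f g : measurable_fun setT f -> measurable_fun setT g ->
  measurable_fun setT (fun x => f x + g x).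
Proof.
move=> mf mg; apply: measurable_freqP; (apply: measurable_funD; [refine (measurableT_comp _ mf)|refine (measurableT_comp _ mg)]).
- exact: measurable_freq1.
- exact: measurable_freq1.
- exact: measurable_freq2.
- exact: measurable_freq2.
Qed.

Lemma measurable_freqN f : measurable_fun setT f -> measurable_fun setT (fun x => - f x).
Proof.
move=> mf; apply: measurable_freqP.
- exact: (measurableT_comp (@oppr_measurable _ _) (measurableT_comp measurable_freq1 mf)).
- exact: (measurableT_comp (@oppr_measurable _ _) (measurableT_comp measurable_freq2 mf)).
Qed.

Lemma measurable_freqB f g : measurable_fun setT f -> measurable_fun setT g ->
  measurable_fun setT (fun x => f x - g x).
Proof. by move=> mf mg; apply: measurable_freqD => //; exact: measurable_freqN. Qed.

Lemma measurable_modulus f : measurable_fun setT f -> measurable_fun setT (fun x => modulus (f x)).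
Proof.
move=> mf; rewrite /modulus; apply: (measurableT_comp (@measurable_sqrt R)).
apply: measurable_funD; apply: measurable_funX.
- exact: (measurableT_comp measurable_freq1 mf).
- exact: (measurableT_comp measurable_freq2 mf).
Qed.

Lemma measurable_cross f g : measurable_fun setT f -> measurable_fun setT g ->
  measurable_fun setT (fun x => cross (f x) (g x)).
Proof.
move=> mf mg; apply: measurable_funB; apply: measurable_funM.
- exact: (measurableT_comp measurable_freq2 mf).
- exact: (measurableT_comp measurable_freq1 mg).
- exact: (measurableT_comp measurable_freq1 mf).
- exact: (measurableT_comp measurable_freq2 mg).
Qed.

Lemma measurable_powR10 (a : T -> R) q : measurable_fun setT a ->
  measurable_fun setT (fun x => (10 + a x) `^ q).
Proof.
move=> ma; apply: (@measurableT_comp _ _ _ _ _ _ (fun x : R => x `^ q)); first exact: measurable_powR.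
exact: measurable_funD.
Qed.

Lemma measurable_lsym (a : T -> R) : measurable_fun setT a ->
  measurable_fun setT (fun x => lsym (a x)).
Proof.
move=> ma; apply: (measurableT_comp (@measurable_ln R)); exact: measurable_funD.
Qed.

Lemma measurable_vsym (a : T -> R) s : measurable_fun setT a ->
  measurable_fun setT (fun x => vsym s (a x)).
Proof.
move=> ma; apply: measurable_funM; first exact: measurable_powR10.
by apply: (measurableT_comp (@measurable_sqrt R)); exact: measurable_lsym.
Qed.

End frequency_maps.

Section slices.
Context d1 d2 {T1 : measurableType d1} {T2 : measurableType d2} {R : realType}.
Variable F : T1 * T2 -> R[i].

Lemma cmeas_slice1 x : cmeasurable F -> cmeasurable (fun y => F (x, y)).
Proof. by case=> mr mi; split; [exact: (measurable_sect1 x mr)|exact: (measurable_sect1 x mi)]. Qed.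

Lemma cmeas_slice2 y : cmeasurable F -> cmeasurable (fun x => F (x, y)).
Proof. by case=> mr mi; split; [exact: (measurable_sect2 y mr)|exact: (measurable_sect2 y mi)]. Qed.

End slices.

(** * Reflections and translations of the frequency measure *)

Section invariance.
Context {R : realType}.
Local Notation K := (freqsp R).
Variable mu : {sigma_finite_measure set K -> \bar R}.
Local Notation Re := complex.Re.
Local Notation Im := complex.Im.
Local Notation cabs := Normc.normc.

Definition refl_invariant := forall F : K -> \bar R, measurable_fun setT F ->
  (forall k, 0 <= F k)%E -> (\int[mu]_k F (- k)%R = \int[mu]_k F k)%E.

(* Only almost every translation preserves [mu]: those by frequencies. *)
Definition shift_invariant := {ae mu, forall k, forall F : K -> \bar R,
  measurable_fun setT F -> (forall l, 0 <= F l)%E ->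
  (\int[mu]_l F (k - l)%R = \int[mu]_l F l)%E}.

Hypothesis mu_refl : refl_invariant.
Hypothesis mu_shift : shift_invariant.

Lemma measurable_oppK d (U : measurableType d) (F : K -> U) : measurable_fun setT F ->
  measurable_fun setT (fun k : K => F (- k)).
Proof. by move=> mF; apply: (measurableT_comp mF); exact: measurable_freqN. Qed.

Lemma measurable_subK d (U : measurableType d) (F : K -> U) k : measurable_fun setT F ->
  measurable_fun setT (fun l : K => F (k - l)).
Proof. by move=> mF; apply: (measurableT_comp mF); exact: measurable_freqB. Qed.

Lemma cmeas_opp (f : K -> R[i]) : cmeasurable f -> cmeasurable (fun k : K => f (- k)).
Proof. by case=> fr fi; split; exact: (measurable_oppK (F := fun k => _ (f k))). Qed.

Lemma cmeas_sub (f : K -> R[i]) k : cmeasurable f -> cmeasurable (fun l : K => f (k - l)).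
Proof. by case=> fr fi; split; exact: (measurable_subK (F := fun k => _ (f k))). Qed.

Lemma integral_refl (F : K -> \bar R) : measurable_fun setT F ->
  (\int[mu]_k F (- k)%R = \int[mu]_k F k)%E.
Proof.
move=> mF; rewrite [LHS]integralE [RHS]integralE; congr (_ - _)%E.
  by rewrite -[RHS](mu_refl (measurable_funepos mF)); [apply: eq_integral => ? _; rewrite !funeposE|exact: funepos_ge0].
by rewrite -[RHS](mu_refl (measurable_funeneg mF)); [apply: eq_integral => ? _; rewrite !funenegE|exact: funeneg_ge0].
Qed.

Lemma integral_shift : {ae mu, forall k, forall F : K -> \bar R, measurable_fun setT F ->
  (\int[mu]_l F (k - l)%R = \int[mu]_l F l)%E}.
Proof.
apply: filterS mu_shift => k H F mF.
rewrite [LHS]integralE [RHS]integralE; congr (_ - _)%E.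
  by rewrite -[RHS](H _ (measurable_funepos mF)); [apply: eq_integral => ? _; rewrite !funeposE|exact: funepos_ge0].
by rewrite -[RHS](H _ (measurable_funeneg mF)); [apply: eq_integral => ? _; rewrite !funenegE|exact: funeneg_ge0].
Qed.

Lemma itg_refl (f : K -> R) : itg mu f -> itg mu (fun k => f (- k)).
Proof.
move=> h; have mf := itg_meas h; apply: itgP; first exact: measurable_oppK.
rewrite (@integral_refl (fun k => `|f k|%:E)); first exact: itg_lty.
by apply/measurable_EFinP; exact: measurableT_comp.
Qed.

Lemma Rint_refl (f : K -> R) : measurable_fun setT f -> \int[mu]_k f (- k) = \int[mu]_k f k.
Proof. by move=> h; congr fine; apply: (@integral_refl (EFin \o f)); exact/measurable_EFinP. Qed.

Lemma itg_shift : {ae mu, forall k, forall f : K -> R, itg mu f ->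
  itg mu (fun l => f (k - l)) /\ \int[mu]_l f (k - l) = \int[mu]_l f l}.
Proof.
apply: filterS integral_shift => k H f h; have mf := itg_meas h; split.
  apply: itgP; first exact: measurable_subK.
  rewrite (H (fun k => `|f k|%:E)); first exact: itg_lty.
  by apply/measurable_EFinP; exact: measurableT_comp.
by congr fine; apply: (H (EFin \o f)); exact/measurable_EFinP.
Qed.

(** On triads c + l + p = 0 this exchanges c and p and keeps l. Together with the swap of
    coordinates it generates all six permutations of a triad. *)
Definition shear (z : K * K) : K * K := (- z.1 - z.2, z.2).

Lemma measurable_shear : measurable_fun setT shear.
Proof.
apply: measurable_fun_pair; last exact: measurable_snd.
by apply: measurable_freqB; [apply: measurable_freqN; exact: measurable_fst|exact: measurable_snd].
Qed.

(** For fixed l the map c -> - c - l is a reflection followed by a translation by l. Since only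
    translations by almost every l are available, l must be the outer variable of Tonelli's
    theorem. *)
Lemma ge0_integral_shear (F : K * K -> \bar R) : measurable_fun setT F -> (forall z, 0 <= F z)%E ->
  (\int[mu \x mu]_z F (shear z) = \int[mu \x mu]_z F z)%E.
Proof.
move=> mF F0.
have mFs : measurable_fun setT (F \o shear) by apply: measurableT_comp => //; exact: measurable_shear.
rewrite (fubini_tonelli2 (F \o shear) mFs (fun z => F0 _)) (fubini_tonelli2 F mF F0).
apply: ae_eq_integral => //.
- exact: (measurable_fun_fubini_tonelli_G (F \o shear) mFs (fun z => F0 _)).
- exact: (measurable_fun_fubini_tonelli_G F mF F0).
apply: filterS mu_shift => l H _; rewrite /fubini_G /shear /=.
have mFl : measurable_fun setT (fun c => F (c, l)) by exact: measurable_sect2.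
rewrite -(@mu_refl (fun c => F (- c - l, l))); last first.
- by move=> k.
- apply: (@measurableT_comp _ _ _ _ _ _ (fun c => F (c, l)) _ (fun c : K => - c - l)) => //.
  by apply: measurable_freqB => //; exact: measurable_freqN.
under eq_integral do rewrite opprK -opprB.
rewrite (H (fun x => F (- x, l)))//; last exact: (measurable_oppK mFl).
exact: (mu_refl mFl).
Qed.

Lemma itg_shear (F : K * K -> R) : itg (mu \x mu)%E F -> itg (mu \x mu)%E (F \o shear).
Proof.
move=> h; have mF := itg_meas h; apply: itgP.
  by apply: measurableT_comp => //; exact: measurable_shear.
rewrite (@ge0_integral_shear (fun z => `|F z|%:E))//; first exact: itg_lty.
by apply/measurable_EFinP; exact: measurableT_comp.
Qed.

Lemma Rint_shear (F : K * K -> R) : measurable_fun setT F ->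
  \int[(mu \x mu)%E]_z F (shear z) = \int[(mu \x mu)%E]_z F z.
Proof.
move=> mF; have mE : measurable_fun setT (EFin \o F) by exact/measurable_EFinP.
congr fine; rewrite [LHS]integralE [RHS]integralE; congr (_ - _)%E.
  by rewrite -[RHS](ge0_integral_shear (measurable_funepos mE)); [apply: eq_integral => ? _; rewrite !funeposE|exact: funepos_ge0].
by rewrite -[RHS](ge0_integral_shear (measurable_funeneg mE)); [apply: eq_integral => ? _; rewrite !funenegE|exact: funeneg_ge0].
Qed.

(* AM-GM in place of the Hoelder and Young inequalities. *)
Lemma triad_young (a b e : K -> R) : measurable_fun setT a -> measurable_fun setT e ->
  (forall k, 0 <= b k) -> itg mu b ->
  itg mu (fun k => a k ^+ 2) -> itg mu (fun k => e k ^+ 2) ->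
  itg (mu \x mu)%E (fun z => b z.2 * (a z.1 * e (- z.1 - z.2))) /\
  \int[(mu \x mu)%E]_z (b z.2 * `|a z.1 * e (- z.1 - z.2)|) <=
  2^-1 * (\int[mu]_k b k * (\int[mu]_k a k ^+ 2 + \int[mu]_k e k ^+ 2)).
Proof.
move=> ma me b0 ib ia ie.
have [i1 E1] := itg_tensor ia ib; have [i2 E2] := itg_tensor ie ib.
have i2' := itg_shear i2; have E2' := Rint_shear (itg_meas i2).
pose G z := 2^-1 * (a z.1 ^+ 2 * b z.2 + e (- z.1 - z.2) ^+ 2 * b z.2) : R.
have iG : itg (mu \x mu)%E G by apply: itgZ; apply: itgD.
have mb := itg_meas ib.
have mF : measurable_fun setT (fun z : K * K => a z.1 * e (- z.1 - z.2)).
  apply: measurable_funM; first exact: (measurableT_comp ma measurable_fst).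
  apply: (measurableT_comp me); apply: measurable_freqB; last exact: measurable_snd.
  by apply: measurable_freqN; exact: measurable_fst.
have mb2 : measurable_fun setT (fun z : K * K => b z.2) by exact: (measurableT_comp mb measurable_snd).
have FG z : b z.2 * `|a z.1 * e (- z.1 - z.2)| <= G z.
  rewrite /G -mulrDl mulrA [leRHS]mulrC ler_wpM2l// normrM.
  rewrite -[in leRHS](real_normK (num_real (a z.1))) -[in leRHS](real_normK (num_real (e _))).
  by have := sqr_ge0 (`|a z.1| - `|e (- z.1 - z.2)|); rewrite sqrrB; lra.
have i : itg (mu \x mu)%E (fun z => b z.2 * (a z.1 * e (- z.1 - z.2))).
  apply: itg_mono iG _; first exact: measurable_funM.
  by move=> z; rewrite normrM (ger0_norm (b0 _)); exact: FG.
split => //.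
have EG : \int[(mu \x mu)%E]_z G z = 2^-1 * (\int[mu]_k b k * (\int[mu]_k a k ^+ 2 + \int[mu]_k e k ^+ 2)).
  rewrite Rint_Z; last exact: itgD.
  rewrite Rint_D// E1.
  have -> : \int[(mu \x mu)%E]_x (e (- x.1 - x.2) ^+ 2 * b x.2) = \int[mu]_k e k ^+ 2 * \int[mu]_k b k.
    by rewrite -E2 -E2'.
  by congr (_ * _); ring.
rewrite -EG; apply: Rint_le => //.
by apply: itg_ext (itg_norm i) _ => z; rewrite normrM (ger0_norm (b0 _)).
Qed.

End invariance.

(** * The nonlinearity on the Fourier side *)

Section advection.
Context {R : realType}.
Local Notation K := (freqsp R).
Variable mu : {sigma_finite_measure set K -> \bar R}.
Local Notation Re := complex.Re.
Local Notation Im := complex.Im.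
Local Notation cabs := Normc.normc.
Implicit Types (f g e : K -> R[i]) (k l p : K) (s delta : R).

Hypothesis mu_refl : refl_invariant mu.
Hypothesis mu_shift : shift_invariant mu.

(** Singles out the genuine frequencies: on the torus it fails off the lattice, where the integral
    defining [adv] samples the wrong points. Pointwise bounds on [adv] are stated at such k. *)
Definition shift_at k := forall F : K -> R, itg mu F ->
  itg mu (fun l => F (k - l)) /\ \int[mu]_l F (k - l) = \int[mu]_l F l.

Lemma ae_shift_at : {ae mu, forall k, shift_at k}.
Proof. exact: itg_shift. Qed.

Definition ksym delta p l : R := cross p l * msym delta (modulus p).

(* The Fourier transform of [u . grad theta], as a bilinear form. *)
Definition adv delta f g k : R[i] :=
  cint mu setT (fun l => (ksym delta (k - l) l)%:C%C * (f (k - l) * g l)).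

Definition ew s g k : R := wsym s (modulus k) * nsq (g k).

Lemma ksym_le_cross delta p l : 0 <= delta -> `|ksym delta p l| <= `|cross p l|.
Proof.
move=> d0; have /andP[m0 m1] := msym_le1 d0 (modulus_ge0 p).
by rewrite /ksym normrM (ger0_norm m0) ler_piMr.
Qed.

Lemma ksym_le delta p l : 0 <= delta -> `|ksym delta p l| <= modulus p * modulus l.
Proof. by move=> d0; apply: le_trans (ksym_le_cross _ _ d0) (cross_le _ _). Qed.

(** The cross product of k - l and l equals that of k and l, so one of the two derivatives can be
    moved to the output frequency. The factor at k - l then carries no weight and may be measured in
    L2 alone. *)
Lemma ksym_le_l delta k l : 0 <= delta -> `|ksym delta (k - l) l| <= modulus k * modulus l.
Proof.
move=> d0; apply: le_trans (ksym_le_cross _ _ d0) _.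
have -> : cross (k - l) l = cross k l by rewrite /cross /=; ring.
exact: cross_le.
Qed.

Lemma ksym_le_r delta k l : 0 <= delta -> `|ksym delta (k - l) l| <= modulus k * modulus (k - l).
Proof.
move=> d0; apply: le_trans (ksym_le_cross _ _ d0) _.
have -> : cross (k - l) l = - cross k (k - l) by rewrite /cross /=; ring.
by rewrite normrN; exact: cross_le.
Qed.

Lemma measurable_ksym delta d (T : measurableType d) (p l : T -> K) :
  measurable_fun setT p -> measurable_fun setT l ->
  measurable_fun setT (fun x => ksym delta (p x) (l x)).
Proof.
move=> mp ml; apply: measurable_funM; first exact: measurable_cross.
by apply: measurable_powR10; exact: measurable_modulus.
Qed.

Lemma measurable_ew s g : cmeasurable g -> measurable_fun setT (ew s g).
Proof.
move=> mg; apply: measurable_funM; last exact: cmeas_nsq.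
by apply: measurable_powR10; exact: (measurable_modulus (f := id)).
Qed.

Lemma ew_ge0 s g k : 0 <= ew s g k.
Proof. by rewrite mulr_ge0 ?wsym_ge0 ?nsq_ge0. Qed.

Lemma cmeas_adv delta d (S : measurableType d) (f g : S * K -> R[i]) :
  cmeasurable f -> cmeasurable g ->
  cmeasurable (fun z : S * K => adv delta (fun k => f (z.1, k)) (fun k => g (z.1, k)) z.2).
Proof.
move=> mf mg; apply: (@cmeas_cint R _ _ (S * K)%type K mu (fun z : (S * K) * K => (ksym delta (z.1.2 - z.2) z.2)%:C%C *
  (f (z.1.1, z.1.2 - z.2) * g (z.1.1, z.2)))).
have m1 : measurable_fun setT (fun z : (S * K) * K => z.1.1).
  by apply: (measurableT_comp measurable_fst); exact: measurable_fst.
have m2 : measurable_fun setT (fun z : (S * K) * K => z.1.2 - z.2).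
  apply: measurable_freqB; last exact: measurable_snd.
  by apply: (measurableT_comp measurable_snd); exact: measurable_fst.
have m3 : measurable_fun setT (fun z : (S * K) * K => z.2) by exact: measurable_snd.
apply: cmeasM; first by apply: cmeas_real; exact: measurable_ksym.
by apply: cmeasM; [apply: (cmeas_comp mf)|apply: (cmeas_comp mg)]; exact: measurable_fun_pair.
Qed.

Lemma cmeas_adv0 delta f g : cmeasurable f -> cmeasurable g -> cmeasurable (adv delta f g).
Proof.
move=> mf mg.
have h := @cmeas_adv delta _ unit (fun z => f z.2) (fun z => g z.2)
   (cmeas_comp mf measurable_snd) (cmeas_comp mg measurable_snd).
by apply: (cmeas_comp (h := fun k => (tt, k)) h); exact: measurable_fun_pair.
Qed.

Lemma cmeas_adv_integrand delta f g k : cmeasurable f -> cmeasurable g ->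
  cmeasurable (fun l => (ksym delta (k - l) l)%:C%C * (f (k - l) * g l)).
Proof.
move=> mf mg; apply: cmeasM.
  by apply: cmeas_real; apply: measurable_ksym => //; exact: measurable_freqB.
by apply: cmeasM => //; exact: cmeas_sub.
Qed.

Lemma adv_bound delta f g k (G : K -> R) : cmeasurable f -> cmeasurable g -> itg mu G ->
  (forall l, `|ksym delta (k - l) l| * (cabs (f (k - l)) * cabs (g l)) <= G l) ->
  [/\ itg mu (fun l => Re ((ksym delta (k - l) l)%:C%C * (f (k - l) * g l))),
      itg mu (fun l => Im ((ksym delta (k - l) l)%:C%C * (f (k - l) * g l))),
      `|Re (adv delta f g k)| <= \int[mu]_l G l &
      `|Im (adv delta f g k)| <= \int[mu]_l G l].
Proof.
move=> mf mg iG h; have [mr mi] := cmeas_adv_integrand delta k mf mg.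
have h' l : cabs ((ksym delta (k - l) l)%:C%C * (f (k - l) * g l)) <= G l.
  by rewrite !cabsM cabs_real; exact: h.
split.
- by apply: itg_mono iG _ => // l; apply: le_trans (cabs_Re _) (h' l).
- by apply: itg_mono iG _ => // l; apply: le_trans (cabs_Im _) (h' l).
- by apply: Rint_norm_bound => //; apply: aeW => l; apply: le_trans (cabs_Re _) (h' l).
- by apply: Rint_norm_bound => //; apply: aeW => l; apply: le_trans (cabs_Im _) (h' l).
Qed.

Lemma wsym_pow s x n : 0 <= x -> n%:R <= 2 * s -> (10 + x) ^+ n <= wsym s x.
Proof.
move=> x0 ns; rewrite /wsym -powR_mulrn; last by lra.
by apply: ler_powR => //; lra.
Qed.

Lemma wsym_pow_cabs s g k n : (n + n)%:R <= 2 * s ->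
  ((10 + modulus k) ^+ n * cabs (g k)) ^+ 2 <= ew s g k.
Proof.
move=> ns; rewrite exprMn cabs_sqr /ew ler_wpM2r ?nsq_ge0// -exprM muln2 -addnn.
exact: wsym_pow (modulus_ge0 _) _.
Qed.

Lemma adv_itg s delta f g k : 0 <= delta -> 1 <= s -> cmeasurable f -> cmeasurable g ->
  itg mu (ew s f) -> itg mu (ew s g) -> shift_at k ->
  [/\ itg mu (fun l => Re ((ksym delta (k - l) l)%:C%C * (f (k - l) * g l))),
      itg mu (fun l => Im ((ksym delta (k - l) l)%:C%C * (f (k - l) * g l))) &
      itg mu (fun l => `|ksym delta (k - l) l| * (cabs (f (k - l)) * cabs (g l)))].
Proof.
move=> d0 s1 mf mg ef eg sk.
pose G l := 2^-1 * (ew s f (k - l) + ew s g l).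
have iG : itg mu G by apply: itgZ; apply: itgD => //; exact: (sk _ ef).1.
have hG l : `|ksym delta (k - l) l| * (cabs (f (k - l)) * cabs (g l)) <= G l.
  have h0 g' k' : ((10 + modulus k') * cabs (g' k')) ^+ 2 <= ew s g' k'.
    by have := @wsym_pow_cabs s g' k' 1; rewrite expr1; apply; rewrite /=; lra.
  have h1 := h0 f (k - l); have h2 := h0 g l.
  apply: (@le_trans _ _ ((10 + modulus (k - l)) * cabs (f (k - l)) * ((10 + modulus l) * cabs (g l)))).
    rewrite mulrACA; apply: ler_pM; rewrite ?mulr_ge0 ?cabs_ge0//.
    apply: le_trans (ksym_le _ _ d0) _.
    by apply: ler_pM; rewrite ?modulus_ge0// lerDr.
  rewrite /G; set a := _ * cabs (f _) in h1 *; set b := _ * cabs (g _) in h2 *.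
  by have := sqr_ge0 (a - b); rewrite sqrrB; lra.
have [h1 h2 _ _] := adv_bound mf mg iG hG.
split => //; apply: itg_mono iG _.
  apply: measurable_funM.
    by apply: measurableT_comp => //; apply: measurable_ksym => //; exact: measurable_freqB.
  by apply: measurable_funM; [exact: (cmeas_cabs (cmeas_sub k mf))|exact: cmeas_cabs].
by move=> l; rewrite ger0_norm ?hG// mulr_ge0// mulr_ge0// cabs_ge0.
Qed.

(** The weight at k is split by k = (k - l) + l and puts two extra powers on one factor, which makes
    three in all, hence [3 <= s]. Squared, the bound decays like (10 + |k|)^(-4) and places the
    nonlinearity in L2. The constant 4 is 2 from the integrand times 2 from the real and imaginary
    parts. *)
Lemma adv_decay s delta f g k : 0 <= delta -> 3 <= s -> cmeasurable f -> cmeasurable g ->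
  itg mu (ew s f) -> itg mu (ew s g) -> shift_at k ->
  (10 + modulus k) ^+ 2 * cabs (adv delta f g k) <=
  4 * (\int[mu]_l ew s f l + \int[mu]_l ew s g l).
Proof.
move=> d0 s3 mf mg ef eg sk; set x := 10 + modulus k.
have x0 : 0 < x ^+ 2 by rewrite exprn_gt0// /x; have := modulus_ge0 k; lra.
have [if' Ef'] := sk _ ef.
pose G l := (x ^+ 2)^-1 * (2 * (ew s f (k - l) + ew s g l)).
have iG : itg mu G by apply: itgZ; apply: itgZ; apply: itgD.
have hG l : `|ksym delta (k - l) l| * (cabs (f (k - l)) * cabs (g l)) <= G l.
  have h1 n : (n <= 3)%N -> ((10 + modulus (k - l)) ^+ n * cabs (f (k - l))) ^+ 2 <= ew s f (k - l).
    move=> n3; apply: wsym_pow_cabs; have : (n + n)%:R <= (3 + 3)%:R :> R by rewrite ler_nat leq_add.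
    by rewrite -[(3+3)%:R]/(6%:R); lra.
  have h2 n : (n <= 3)%N -> ((10 + modulus l) ^+ n * cabs (g l)) ^+ 2 <= ew s g l.
    move=> n3; apply: wsym_pow_cabs; have : (n + n)%:R <= (3 + 3)%:R :> R by rewrite ler_nat leq_add.
    by rewrite -[(3+3)%:R]/(6%:R); lra.
  have := modulus_ge0 (k - l); have := modulus_ge0 l => l0 p0.
  have xyz : x <= (10 + modulus (k - l)) + (10 + modulus l).
    by have := modulusD (k - l) l; rewrite subrK /x; lra.
  have kk := @ksym_le delta (k - l) l d0.
  move: (h1 1%N isT) (h1 3%N isT) (h2 1%N isT) (h2 3%N isT) => {h1 h2}; rewrite !expr1.
  move: kk xyz l0 p0 (cabs_ge0 (f (k - l))) (cabs_ge0 (g l)) (modulus_ge0 k).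
  rewrite /G; move: (ew s f (k - l)) (ew s g l) (cabs (f _)) (cabs (g l)) => A B a b.
  move: (modulus (k - l)) (modulus l) => y z kk xyz z0 y0 a0 b0 k0 h1 h2 h3 h4.
  rewrite ler_pdivlMl//.
  apply: (@le_trans _ _ (x ^+ 2 * ((10 + y) * (10 + z) * (a * b)))).
    rewrite ler_wpM2l ?(ltW x0)// ler_wpM2r ?mulr_ge0//.
    by apply: le_trans kk _; apply: ler_pM => //; lra.
  have x2 : x ^+ 2 <= 2 * ((10 + y) ^+ 2 + (10 + z) ^+ 2).
    apply: (@le_trans _ _ (((10 + y) + (10 + z)) ^+ 2)).
      by rewrite ler_pXn2r// nnegrE /x; lra.
    by have := sqr_ge0 ((10 + y) - (10 + z)); rewrite sqrrB sqrrD; lra.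
  apply: (@le_trans _ _ (2 * ((10 + y) ^+ 2 + (10 + z) ^+ 2) * ((10 + y) * (10 + z) * (a * b)))).
    by rewrite ler_wpM2r// !mulr_ge0//; lra.
  have e1 := sqr_ge0 ((10 + y) ^+ 3 * a - (10 + z) * b).
  have e2 := sqr_ge0 ((10 + y) * a - (10 + z) ^+ 3 * b).
  (* Cubic and linear weights are paired crosswise, so that the arithmetic-geometric inequality
     leaves four squares, each below an energy density. *)
  have -> : 2 * ((10 + y) ^+ 2 + (10 + z) ^+ 2) * ((10 + y) * (10 + z) * (a * b)) =
    2 * ((10 + y) ^+ 3 * a * ((10 + z) * b) + (10 + y) * a * ((10 + z) ^+ 3 * b)) by ring.
  move: e1 e2; rewrite !sqrrB.
  move: ((10 + y) ^+ 3 * a) ((10 + z) ^+ 3 * b) ((10 + y) * a) ((10 + z) * b) h1 h2 h3 h4 => u v u' v'.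
  lra.
have [_ _ h1 h2] := adv_bound mf mg iG hG.
have EG : \int[mu]_l G l = (x ^+ 2)^-1 * (2 * (\int[mu]_l ew s f l + \int[mu]_l ew s g l)).
  by rewrite Rint_Z ?Rint_Z ?Rint_D ?Ef'//; [exact: itgD|apply: itgZ; exact: itgD].
rewrite -ler_pdivlMl//; apply: le_trans (cabs_le _) _.
rewrite EG in h1 h2; lra.
Qed.

(** Here f is small in L2 and g merely bounded in H^s. Young's inequality with parameter [lam]
    comparable to the L2 size of f makes the right side of that size, at the cost of |k|. It serves
    with [lam] equal to the time step and to (1/4)^n. *)
Lemma adv_small s delta lam f g k : 0 <= delta -> 1 <= s -> 0 < lam -> cmeasurable f -> cmeasurable g ->
  itg mu (fun l => nsq (f l)) -> itg mu (ew s g) -> shift_at k ->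
  cabs (adv delta f g k) <= modulus k * (lam^-1 * \int[mu]_l nsq (f l) + lam * \int[mu]_l ew s g l) /\
  cabs (adv delta g f k) <= modulus k * (lam^-1 * \int[mu]_l nsq (f l) + lam * \int[mu]_l ew s g l).
Proof.
move=> d0 s1 lam0 mf mg ef eg sk.
have [if' Ef'] := sk _ ef. have [ig' Eg'] := sk _ eg.
have key (a b x : R) (z : K) B : 0 <= a -> 0 <= b -> x <= modulus k * modulus z ->
    ((10 + modulus z) * b) ^+ 2 <= B ->
    x * (a * b) <= modulus k * (2^-1 * (lam^-1 * a ^+ 2 + lam * B)).
  move=> a0 b0 hx hB.
  apply: (@le_trans _ _ (modulus k * modulus z * (a * b))); first by rewrite ler_wpM2r ?mulr_ge0.
  rewrite -mulrA ler_wpM2l ?modulus_ge0//.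
  have z0 := modulus_ge0 z.
  apply: (@le_trans _ _ (a * ((10 + modulus z) * b))).
    by rewrite mulrCA ler_wpM2l// ler_wpM2r// lerDr.
  move: ((10 + modulus z) * b) hB => u hB.
  apply: (@le_trans _ _ (2^-1 * (lam^-1 * a ^+ 2 + lam * u ^+ 2))); last first.
    by rewrite ler_wpM2l// lerD2l ler_wpM2l// ltW.
  have -> : 2^-1 * (lam^-1 * a ^+ 2 + lam * u ^+ 2) = a * u + 2^-1 * lam^-1 * (a - lam * u) ^+ 2.
    by field; rewrite gt_eqF.
  by rewrite lerDl mulr_ge0 ?sqr_ge0// mulr_ge0 ?invr_ge0// ltW.
have h1 n g' k' : (n <= 1)%N -> ((10 + modulus k') * cabs (g' k')) ^+ 2 <= ew s g' k'.
  by move=> _; have := @wsym_pow_cabs s g' k' 1; rewrite expr1; apply; rewrite /=; lra.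
pose G1 l := modulus k * (2^-1 * (lam^-1 * nsq (f (k - l)) + lam * ew s g l)).
pose G2 l := modulus k * (2^-1 * (lam^-1 * nsq (f l) + lam * ew s g (k - l))).
have iG1 : itg mu G1 by do 2 apply: itgZ; apply: itgD; exact: itgZ.
have iG2 : itg mu G2 by do 2 apply: itgZ; apply: itgD; exact: itgZ.
have E1 : \int[mu]_l G1 l = modulus k * (2^-1 * (lam^-1 * \int[mu]_l nsq (f l) + lam * \int[mu]_l ew s g l)).
  have i1 := itgZ lam^-1 if'; have i2 := itgZ lam eg; have i3 := itgD i1 i2.
  by rewrite /G1 Rint_Z; [rewrite Rint_Z// Rint_D// !Rint_Z// Ef'|exact: itgZ].
have E2 : \int[mu]_l G2 l = modulus k * (2^-1 * (lam^-1 * \int[mu]_l nsq (f l) + lam * \int[mu]_l ew s g l)).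
  have i1 := itgZ lam^-1 ef; have i2 := itgZ lam ig'; have i3 := itgD i1 i2.
  by rewrite /G2 Rint_Z; [rewrite Rint_Z// Rint_D// !Rint_Z// Eg'|exact: itgZ].
split; apply: le_trans (cabs_le _) _.
  have hG l : `|ksym delta (k - l) l| * (cabs (f (k - l)) * cabs (g l)) <= G1 l.
    rewrite /G1 -cabs_sqr; apply: key; rewrite ?cabs_ge0//; first exact: ksym_le_l.
    exact: (h1 0%N).
  by have [_ _] := adv_bound mf mg iG1 hG; rewrite E1; lra.
have hG l : `|ksym delta (k - l) l| * (cabs (g (k - l)) * cabs (f l)) <= G2 l.
  rewrite /G2 -cabs_sqr (mulrC (cabs _)); apply: key; rewrite ?cabs_ge0//; first exact: ksym_le_r.
  exact: (h1 0%N).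
by have [_ _] := adv_bound mg mf iG2 hG; rewrite E2; lra.
Qed.

Lemma nsqD_le (z w : R[i]) : nsq (z + w) <= 2 * (nsq z + nsq w).
Proof.
rewrite /nsq cReD cImD.
have := sqr_ge0 (Re z - Re w); have := sqr_ge0 (Im z - Im w); nra.
Qed.

Lemma nsqN (z : R[i]) : nsq (- z) = nsq z.
Proof. by rewrite /nsq cReN cImN !sqrrN. Qed.

Lemma nsqM (z w : R[i]) : nsq (z * w) = nsq z * nsq w.
Proof. by rewrite -!cabs_sqr cabsM exprMn. Qed.

Lemma nsq_real (a : R) : nsq (a%:C%C) = a ^+ 2.
Proof. by rewrite -cabs_sqr cabs_real real_normK// num_real. Qed.

Lemma nsqZ (a : R) (z : R[i]) : nsq (a%:C%C * z) = a ^+ 2 * nsq z.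
Proof. by rewrite nsqM nsq_real. Qed.

Lemma nsq0 : nsq (0 : R[i]) = 0.
Proof. by rewrite -cabs_sqr cabs0 expr0n. Qed.

Lemma nsq_eq0 (z : R[i]) : nsq z = 0 -> z = 0.
Proof. by move=> h; apply: cabs_eq0; rewrite cabsE h sqrtr0. Qed.

Lemma itg_ewD s f g : cmeasurable f -> cmeasurable g -> itg mu (ew s f) -> itg mu (ew s g) ->
  itg mu (ew s (fun k => f k + g k)).
Proof.
move=> mf mg ef eg; apply: itg_mono (itgZ 2 (itgD ef eg)) _.
  by apply: measurable_ew; exact: cmeasD.
move=> k; rewrite ger0_norm ?ew_ge0// /ew -mulrDr mulrCA ler_wpM2l ?wsym_ge0//.
exact: nsqD_le.
Qed.

Lemma ewN s f k : ew s (fun k => - f k) k = ew s f k.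
Proof. by rewrite /ew nsqN. Qed.

Lemma itg_ewB s f g : cmeasurable f -> cmeasurable g -> itg mu (ew s f) -> itg mu (ew s g) ->
  itg mu (ew s (fun k => f k - g k)).
Proof.
move=> mf mg ef eg; apply: itg_ewD => //; first exact: cmeasN.
by apply: itg_ext eg _ => k; rewrite ewN.
Qed.

Lemma itg_ewZ s (a : R) f : itg mu (ew s f) -> itg mu (ew s (fun k => a%:C%C * f k)).
Proof. by move=> ef; apply: itg_ext (itgZ (a ^+ 2) ef) _ => k; rewrite /ew nsqZ mulrCA. Qed.

Lemma itg_nsq s g : 0 <= s -> cmeasurable g -> itg mu (ew s g) -> itg mu (fun k => nsq (g k)).
Proof.
move=> s0 mg eg; apply: itg_mono eg _; first exact: cmeas_nsq.
move=> k; rewrite ger0_norm ?nsq_ge0// /ew ler_peMl ?nsq_ge0//.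
by have := @wsym_pow s (modulus k) 0 (modulus_ge0 _); rewrite expr0; apply; lra.
Qed.

Lemma cintD (F G : K -> R[i]) :
  itg mu (fun k => Re (F k)) -> itg mu (fun k => Im (F k)) ->
  itg mu (fun k => Re (G k)) -> itg mu (fun k => Im (G k)) ->
  cint mu setT (fun k => F k + G k) = cint mu setT F + cint mu setT G.
Proof.
move=> fr fi gr gi; apply: complex_ext; rewrite /cint /=.
  by under eq_Rintegral do rewrite cReD; rewrite Rint_D.
by under eq_Rintegral do rewrite cImD; rewrite Rint_D.
Qed.

Lemma cintB (F G : K -> R[i]) :
  itg mu (fun k => Re (F k)) -> itg mu (fun k => Im (F k)) ->
  itg mu (fun k => Re (G k)) -> itg mu (fun k => Im (G k)) ->
  cint mu setT (fun k => F k - G k) = cint mu setT F - cint mu setT G.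
Proof.
move=> fr fi gr gi; apply: complex_ext; rewrite /cint /=.
  by under eq_Rintegral do rewrite cReB; rewrite Rint_B.
by under eq_Rintegral do rewrite cImB; rewrite Rint_B.
Qed.

(** Polarization at the midpoint m. The midpoint inherits by convexity any common H^s bound of f and
    g, as well as their Hermitian symmetry. *)
Lemma adv_diff s delta f g k : 0 <= delta -> 1 <= s -> shift_at k ->
  cmeasurable f -> cmeasurable g -> itg mu (ew s f) -> itg mu (ew s g) ->
  let e := fun k => f k - g k in let m := fun k => (2^-1 : R)%:C%C * (f k + g k) in
  adv delta f f k - adv delta g g k = adv delta e m k + adv delta m e k.
Proof.
move=> d0 s1 sk mf mg ef eg e m.
have me : cmeasurable e by exact: cmeasB.
have mm : cmeasurable m by apply: cmeasM; [exact: cmeas_cst|exact: cmeasD].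
have ee : itg mu (ew s e) by exact: itg_ewB.
have em : itg mu (ew s m) by apply: itg_ewZ; exact: itg_ewD.
have [r1 i1 _] := adv_itg d0 s1 mf mf ef ef sk.
have [r2 i2 _] := adv_itg d0 s1 mg mg eg eg sk.
have [r3 i3 _] := adv_itg d0 s1 me mm ee em sk.
have [r4 i4 _] := adv_itg d0 s1 mm me em ee sk.
rewrite /adv -cintD// -cintB//; congr cint; apply/funext => l.
rewrite /e /m; set h := (2^-1)%:C%C.
have hh : h + h = 1 by apply: complex_ext; rewrite ?cReD ?cImD /=; lra.
by rewrite -[LHS]mulr1 -hh; ring.
Qed.

End advection.

(** * Triad cancellations *)

Lemma sqr10_le (R : realType) (x : R) : 0 <= x -> x ^+ 2 <= (10 + x) ^+ 2.
Proof. by move=> x0; rewrite ler_pXn2r ?nnegrE//; lra. Qed.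

Lemma le_sqr10 (R : realType) (x : R) : 0 <= x -> x <= (10 + x) ^+ 2.
Proof. by move=> x0; nra. Qed.

Section triads.
Context {R : realType}.
Local Notation K := (freqsp R).
Variable mu : {sigma_finite_measure set K -> \bar R}.
Local Notation Re := complex.Re.
Local Notation Im := complex.Im.
Local Notation cabs := Normc.normc.
Implicit Types (f g e : K -> R[i]) (k l p : K) (s delta : R) (z : K * K).

Hypothesis mu_refl : refl_invariant mu.
Hypothesis mu_shift : shift_invariant mu.
Local Notation mu2 := (mu \x mu)%E.

Definition hermsym g := forall k, g (- k) = ((g k)^*)%C.

Lemma hermB f g : hermsym f -> hermsym g -> hermsym (fun k => f k - g k).
Proof. by move=> hf hg k; rewrite hf hg rmorphB. Qed.

Lemma hermD f g : hermsym f -> hermsym g -> hermsym (fun k => f k + g k).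
Proof. by move=> hf hg k; rewrite hf hg rmorphD. Qed.

Lemma hermZ (a : R) f : hermsym f -> hermsym (fun k => a%:C%C * f k).
Proof.
by move=> hf k; rewrite hf; apply: complex_ext; rewrite ?(cReC, cImC, cReZ, cImZ) ?mulrN.
Qed.

(** The triad attached to z is (z.1, third z, z.2), of sum zero; the output frequency of [adv]
    corresponds to - z.1. *)
Definition third z : K := - z.1 - z.2.

Lemma third_shear z : third (shear z) = z.1.
Proof. by rewrite /third /shear /= opprD !opprK addrK. Qed.

Lemma third_swap z : third (z.2, z.1) = third z.
Proof. by rewrite /third /= addrC. Qed.

Lemma measurable_third : measurable_fun setT third.
Proof.
by apply: measurable_freqB; [apply: measurable_freqN; exact: measurable_fst|exact: measurable_snd].
Qed.

Definition tri3 g1 g2 g3 z : R := Re (g1 z.1 * (g2 (third z) * g3 z.2)).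

Lemma tri3_le g1 g2 g3 z : `|tri3 g1 g2 g3 z| <= cabs (g1 z.1) * (cabs (g2 (third z)) * cabs (g3 z.2)).
Proof. by rewrite -!cabsM; exact: cabs_Re. Qed.

Lemma measurable_tri3 g1 g2 g3 : cmeasurable g1 -> cmeasurable g2 -> cmeasurable g3 ->
  measurable_fun setT (tri3 g1 g2 g3).
Proof.
move=> m1 m2 m3; apply: cmeas_Re; apply: cmeasM.
  by apply: (cmeas_comp m1); exact: measurable_fst.
apply: cmeasM; first by apply: (cmeas_comp m2); exact: measurable_third.
by apply: (cmeas_comp m3); exact: measurable_snd.
Qed.

(** Hermitian symmetry rewrites the conjugate of e at k as e at - k. The reflection c = - k then
    puts the three factors on an equal footing over triads of sum zero, the form in which
    permutations act. *)
Lemma adv_pairing delta (w : K -> R) e f g : measurable_fun setT w ->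
  cmeasurable e -> cmeasurable f -> cmeasurable g -> hermsym e ->
  (forall k, w (- k) = w k) -> (forall k, 0 <= w k) ->
  itg mu2 (fun z => w z.1 * cabs (e z.1) *
     (`|ksym delta (third z) z.2| * (cabs (f (third z)) * cabs (g z.2)))) ->
  [/\ itg mu (fun k => w k * Re ((e k)^*%C * adv mu delta f g k)),
      itg mu2 (fun z => w z.1 * ksym delta (third z) z.2 * tri3 e f g z) &
      \int[mu]_k (w k * Re ((e k)^*%C * adv mu delta f g k)) =
      \int[mu2]_z (w z.1 * ksym delta (third z) z.2 * tri3 e f g z)].
Proof.
move=> mw me mf mg he we w0 imaj.
pose Phi z := w z.1 * ksym delta (third z) z.2 * tri3 e f g z.
have mPhi : measurable_fun setT Phi.
  apply: measurable_funM; last exact: measurable_tri3.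
  apply: measurable_funM; first exact: (measurableT_comp mw measurable_fst).
  by apply: measurable_ksym; [exact: measurable_third|exact: measurable_snd].
have iPhi : itg mu2 Phi.
  apply: itg_mono imaj _ => // z; rewrite /Phi !normrM (ger0_norm (w0 _)).
  rewrite -mulrA -[leRHS]mulrA ler_wpM2l// [leRHS]mulrCA ler_wpM2l//.
  exact: tri3_le.
pose J k := w k * Re ((e k)^*%C * adv mu delta f g k).
have mJ : measurable_fun setT J.
  apply: measurable_funM => //; apply: cmeas_Re; apply: cmeasM; first exact: cmeas_conj.
  exact: cmeas_adv0.
pose H c := \int[mu]_l Phi (c, l).
have iH : itg mu H := itg_Rint1 iPhi.
have ae_JH : {ae mu, forall c, J (- c) = H c}.
  apply: filterS (itg_ae1 imaj) => c ic; rewrite /J we he.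
  rewrite (_ : ((e c)^*^*)%C = e c); last by apply: complex_ext; rewrite ?cReC ?cImC ?opprK.
  (* Integrability in l alone is recovered by dividing by the outer factor; where that factor
     vanishes, both sides are zero. *)
  have [we0|we0] := eqVneq (w c * cabs (e c)) 0.
    have Phi0 l : Phi (c, l) = 0.
      move/eqP: we0; rewrite mulf_eq0 => /orP[/eqP w00|/eqP/cabs_eq0 e00].
        by rewrite /Phi /= w00 !mul0r.
      by rewrite /Phi /tri3 /= e00 mul0r /= mulr0.
    have -> : H c = 0 by rewrite /H; under eq_Rintegral do rewrite Phi0; rewrite Rintegral_cst// mul0r.
    move/eqP: we0; rewrite mulf_eq0 => /orP[/eqP->|/eqP/cabs_eq0->]; first by rewrite mul0r.
    by rewrite mul0r /= mulr0.
  have iG : itg mu (fun l => `|ksym delta (- c - l) l| * (cabs (f (- c - l)) * cabs (g l))).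
    apply: itg_ext (itgZ (w c * cabs (e c))^-1 ic) _ => l /=.
    by rewrite /third /= mulKf.
  have [ir ii _ _] := adv_bound mf mg iG (fun l => lexx _).
  rewrite cReM mulrBr /adv /cint /= mulrA mulrA -Rint_Z// -[X in _ - X]Rint_Z//.
  rewrite -Rint_B; [|exact: itgZ..].
  apply: eq_Rintegral => l _; rewrite /Phi /tri3 /third /= cReZ cImZ [in RHS]cReM; ring.
have iJ' : itg mu (fun c => J (- c)).
  apply: itg_ae_eq iH _ _; first exact: measurable_oppK.
  by apply: filterS ae_JH => c ->.
have iJ : itg mu J by apply: itg_ext (itg_refl mu_refl iJ') _ => k; rewrite /= opprK.
split => //; rewrite -(Rint_fubini1 iPhi) -(Rint_refl mu_refl mJ).
exact: (Rint_ae_eq (measurable_oppK mJ) (itg_meas iH) ae_JH).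
Qed.

Lemma itg_swap2 (F : K * K -> R) : itg mu2 F -> itg mu2 (fun z => F (z.2, z.1)).
Proof. exact: itg_swap. Qed.

Lemma Rint_swap2 (F : K * K -> R) : itg mu2 F -> \int[mu2]_z F (z.2, z.1) = \int[mu2]_z F z.
Proof. exact: Rint_swap. Qed.

Lemma cross_third_swap z : cross (third (z.2, z.1)) z.1 = - cross (third z) z.2.
Proof. rewrite /cross /third /=; ring. Qed.

Lemma cross_third_shear z : cross (third (shear z)) z.2 = - cross (third z) z.2.
Proof. rewrite /cross /third /=; ring. Qed.

Lemma tri3_swap g z : tri3 g g g (z.2, z.1) = tri3 g g g z.
Proof. by rewrite /tri3 third_swap /=; congr Re; ring. Qed.

Lemma tri3_shear g1 g3 z : tri3 g1 g1 g3 (shear z) = tri3 g1 g1 g3 z.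
Proof. by rewrite /tri3 third_shear /=; congr Re; rewrite -/(third z); ring. Qed.

Let M k := modulus k.

(* Summing over the six permutations of a triad replaces the symbol by an
   alternating determinant, which vanishes at [delta = 0]: the nonlinearity costs
   only [delta] times a logarithm, and the dissipation absorbs it. *)
Lemma symmetrize s delta g :
  itg mu2 (fun z => wsym s (M z.1) * ksym delta (third z) z.2 * tri3 g g g z) ->
  itg mu2 (fun z => cross (third z) z.2 * wdet s delta (M z.1) (M (third z)) (M z.2) * tri3 g g g z) /\
  6 * \int[mu2]_z (wsym s (M z.1) * ksym delta (third z) z.2 * tri3 g g g z) =
  \int[mu2]_z (cross (third z) z.2 * wdet s delta (M z.1) (M (third z)) (M z.2) * tri3 g g g z).
Proof.
move=> i1; set J := \int[mu2]_z _.
pose W := wsym s; pose m := msym delta.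
pose X z := cross (third z) z.2 * tri3 g g g z.
(* The cross product changes sign under each transposition while the trilinear product does not, so
   X is odd under the permutation group. *)
have Xs z : X (z.2, z.1) = - X z by rewrite /X cross_third_swap tri3_swap mulNr.
have Xt z : X (shear z) = - X z.
  by rewrite /X tri3_shear -mulNr -cross_third_shear.
have step a b a' b' : (forall z, a' z = a (z.2, z.1)) -> (forall z, b' z = b (z.2, z.1)) ->
    itg mu2 (fun z => W (a z) * m (b z) * X z) ->
    itg mu2 (fun z => W (a' z) * m (b' z) * X z) /\
    \int[mu2]_z (W (a' z) * m (b' z) * X z) = - \int[mu2]_z (W (a z) * m (b z) * X z).
  move=> ha hb i; have i' := itg_swap2 i; have E := Rint_swap2 i.
  have e z : W (a' z) * m (b' z) * X z = - (W (a (z.2, z.1)) * m (b (z.2, z.1)) * X (z.2, z.1)).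
    by rewrite ha hb Xs mulrN opprK.
  split; first by apply: itg_ext (itgN i') _ => z; rewrite e.
  by rewrite -E -(Rint_N i'); congr Rintegral; apply/funext => z; exact: e.
have stept a b a' b' : (forall z, a' z = a (shear z)) -> (forall z, b' z = b (shear z)) ->
    itg mu2 (fun z => W (a z) * m (b z) * X z) ->
    itg mu2 (fun z => W (a' z) * m (b' z) * X z) /\
    \int[mu2]_z (W (a' z) * m (b' z) * X z) = - \int[mu2]_z (W (a z) * m (b z) * X z).
  move=> ha hb i; have i' := itg_shear mu_refl mu_shift i.
  have E := Rint_shear mu_refl mu_shift (itg_meas i).
  have e z : W (a' z) * m (b' z) * X z = - (W (a (shear z)) * m (b (shear z)) * X (shear z)).
    by rewrite ha hb Xt mulrN opprK.
  split; first by apply: itg_ext (itgN i') _ => z; rewrite e.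
  by rewrite -E -(Rint_N i'); congr Rintegral; apply/funext => z; exact: e.
pose c z := M z.1; pose l z := M z.2; pose p z := M (third z).
have cs z : l z = c (z.2, z.1) by []. have ls z : c z = l (z.2, z.1) by [].
have ps z : p z = p (z.2, z.1) by rewrite /p third_swap.
have ct z : p z = c (shear z) by []. have lt z : l z = l (shear z) by [].
have pt z : c z = p (shear z) by rewrite /p third_shear.
pose F (a b : K * K -> R) z := W (a z) * m (b z) * X z.
have icp : itg mu2 (F c p).
  by apply: itg_ext i1 _ => z; rewrite /F /ksym /X /W /m /c /p /=; ring.
have JE : \int[mu2]_z F c p z = J.
  by congr Rintegral; apply/funext => z; rewrite /F /ksym /X /W /m /c /p; ring.
(* The five other placements of W and m on the triad are reached by transpositions; their integrals
   are plus or minus J according to parity, which matches the signs of the determinant and accounts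
   for the factor 6. *)
have [ilp Elp] : itg mu2 (F l p) /\ \int[mu2]_z F l p z = - \int[mu2]_z F c p z := step _ _ _ _ cs ps icp.
have [ipc Epc] : itg mu2 (F p c) /\ \int[mu2]_z F p c z = - \int[mu2]_z F c p z := stept _ _ _ _ ct pt icp.
have [ilc Elc] : itg mu2 (F l c) /\ \int[mu2]_z F l c z = - \int[mu2]_z F l p z := stept _ _ _ _ lt pt ilp.
have [icl Ecl] : itg mu2 (F c l) /\ \int[mu2]_z F c l z = - \int[mu2]_z F l c z := step _ _ _ _ ls cs ilc.
have [ipl Epl] : itg mu2 (F p l) /\ \int[mu2]_z F p l z = - \int[mu2]_z F p c z := step _ _ _ _ ps cs ipc.
pose A z := F c p z - F c l z; pose B z := F p l z - F p c z; pose C z := F l c z - F l p z.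
have iA : itg mu2 A := itgB icp icl. have iB : itg mu2 B := itgB ipl ipc.
have iC : itg mu2 C := itgB ilc ilp.
have EA : \int[mu2]_z A z = _ := Rint_B icp icl. have EB : \int[mu2]_z B z = _ := Rint_B ipl ipc.
have EC : \int[mu2]_z C z = _ := Rint_B ilc ilp.
pose AB z := A z + B z.
have iAB : itg mu2 AB := itgD iA iB. have EAB : \int[mu2]_z AB z = _ := Rint_D iA iB.
have e z : cross (third z) z.2 * wdet s delta (M z.1) (M (third z)) (M z.2) * tri3 g g g z = AB z + C z.
  rewrite /AB /A /B /C /F /wdet /X /c /p /l /W /m.
  move: (cross _ _) (tri3 _ _ _ _) (wsym s (M z.1)) (wsym s (M z.2)) (wsym s (M (third z))) => *.
  move: (msym _ (M z.1)) (msym _ (M z.2)) (msym _ (M (third z))) => *; ring.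
split; first by apply: itg_ext (itgD iAB iC) _ => z; rewrite e.
have -> : \int[mu2]_z (cross (third z) z.2 * wdet s delta (M z.1) (M (third z)) (M z.2) * tri3 g g g z) =
  \int[mu2]_z (AB z + C z) by congr Rintegral; apply/funext => z; exact: e.
have E := Rint_D iAB iC.
clearbody AB A B C F J.
rewrite E EAB EA EB EC Epl Ecl Elc Epc Elp JE; ring.
Qed.

Lemma third_sum z : z.1 + z.2 + third z = 0.
Proof. by rewrite /third -opprD subrr. Qed.

Lemma triad_moduli z : [/\ M z.1 <= M (third z) + M z.2, M (third z) <= M z.1 + M z.2,
  M z.2 <= M z.1 + M (third z), `|cross (third z) z.2| <= M z.1 * M (third z) &
  `|cross (third z) z.2| <= M (third z) * M z.2 /\ `|cross (third z) z.2| <= M z.1 * M z.2].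
Proof.
have h k l p : k + l + p = 0 -> M p <= M k + M l.
  move=> h; have -> : p = - (k + l) by apply/eqP; rewrite -addr_eq0 addrC h.
  by rewrite /M modulusN; exact: modulusD.
have c1 : cross (third z) z.2 = - cross z.1 z.2 by rewrite /cross /third /=; ring.
have c2 : cross (third z) z.2 = cross z.1 (third z) by rewrite /cross /third /=; ring.
have t := third_sum z; split.
- by apply: h; rewrite addrC addrA (addrC z.1) addrAC -addrA addrC -t; rewrite addrC (addrC (third z)) (addrC z.1).
- exact: h.
- by apply: h; rewrite addrAC.
- by rewrite c2; exact: cross_le.
- split; first exact: cross_le.
  by rewrite c1 normrN; exact: cross_le.
Qed.

(** The factor that carries the squared shortest side, to be measured in L1; the two other factors
    of a triad carry [aw] and are measured in L2. *)
Definition bw g k : R := (10 + modulus k) ^+ 2 * cabs (g k).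
Definition aw s g k : R := vsym s (modulus k) * cabs (g k).

Lemma bw_ge0 g k : 0 <= bw g k.
Proof. by rewrite mulr_ge0 ?cabs_ge0 ?sqr_ge0. Qed.

Lemma aw_ge0 s g k : 0 <= aw s g k.
Proof. by rewrite mulr_ge0 ?cabs_ge0 ?vsym_ge0. Qed.

Lemma aw_sqr s g k : aw s g k ^+ 2 = wsym s (modulus k) * lsym (modulus k) * nsq (g k).
Proof. by rewrite exprMn cabs_sqr vsym_sqr// modulus_ge0. Qed.

Lemma measurable_bw g : cmeasurable g -> measurable_fun setT (bw g).
Proof.
move=> mg; apply: measurable_funM; last exact: cmeas_cabs.
apply: measurable_funX; apply: measurable_funD => //.
exact: (measurable_modulus (f := id)).
Qed.

Lemma measurable_aw s g : cmeasurable g -> measurable_fun setT (aw s g).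
Proof.
move=> mg; apply: measurable_funM; last exact: cmeas_cabs.
by apply: measurable_vsym; exact: (measurable_modulus (f := id)).
Qed.

(** The three terms of [wdet_le] are the images Y, Y1, Y2 of one integrand under permutations of the
    triad, hence the factor 3. *)
Lemma wdet_bound s delta g : 0 <= s -> 0 <= delta -> cmeasurable g ->
  itg mu (bw g) -> itg mu (fun k => aw s g k ^+ 2) ->
  itg mu2 (fun z => cross (third z) z.2 * wdet s delta (M z.1) (M (third z)) (M z.2) * tri3 g g g z) ->
  `|\int[mu2]_z (cross (third z) z.2 * wdet s delta (M z.1) (M (third z)) (M z.2) * tri3 g g g z)| <=
  3 * Ktriad s * delta * (\int[mu]_k bw g k * \int[mu]_k aw s g k ^+ 2).
Proof.
move=> s0 d0 mg ib ia iF.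
have ma := measurable_aw s mg.
have [i3 E3] := triad_young mu_refl mu_shift ma ma (bw_ge0 g) ib ia ia.
pose Y z := bw g z.2 * (aw s g z.1 * aw s g (third z)).
have iY : itg mu2 Y by exact: i3.
have Y0 z : 0 <= Y z by apply: mulr_ge0; [exact: bw_ge0|apply: mulr_ge0; exact: aw_ge0].
have EY : \int[mu2]_z Y z <= \int[mu]_k bw g k * \int[mu]_k aw s g k ^+ 2.
  have -> : \int[mu2]_z Y z = \int[mu2]_z (bw g z.2 * `|aw s g z.1 * aw s g (- z.1 - z.2)|).
    congr Rintegral; apply/funext => z; rewrite ger0_norm//.
    by apply: mulr_ge0; exact: aw_ge0.
  by apply: le_trans E3 _; lra.
pose Y1 z := Y (z.2, z.1). pose Y2 z := Y1 (shear z).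
have iY1 : itg mu2 Y1 := itg_swap2 iY.
have EY1 : \int[mu2]_z Y1 z = \int[mu2]_z Y z := Rint_swap2 iY.
have iY2 : itg mu2 Y2 := itg_shear mu_refl mu_shift iY1.
have EY2 : \int[mu2]_z Y2 z = \int[mu2]_z Y z by rewrite -EY1; exact: (Rint_shear mu_refl mu_shift (itg_meas iY1)).
have iS := itgD (itgD iY1 iY2) iY.
apply: (@le_trans _ _ (\int[mu2]_z (Ktriad s * delta * (Y1 z + Y2 z + Y z)))); last first.
  rewrite Rint_Z// Rint_D// ?Rint_D//; last exact: itgD.
  rewrite EY1 EY2.
  have -> : 3 * Ktriad s * delta * (\int[mu]_k bw g k * \int[mu]_k aw s g k ^+ 2) =
    Ktriad s * delta * (3 * (\int[mu]_k bw g k * \int[mu]_k aw s g k ^+ 2)) by ring.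
  apply: ler_wpM2l; first by apply: mulr_ge0 => //; exact: Ktriad_ge0.
  move: EY; move: (\int[mu2]_z Y z) (_ * \int[mu]_k (aw s g k ^+ 2)) => u v h; lra.
apply: Rint_norm_bound; first exact: itg_meas iF.
  exact: itgZ.
apply: aeW => z; rewrite normrM.
have [t1 t2 t3 c1 [c2 c3]] := triad_moduli z.
have h := wdet_le s0 d0 (modulus_ge0 z.1) (modulus_ge0 (third z)) (modulus_ge0 z.2) t1 t2 t3 c1 c2 c3.
apply: (le_trans (ler_pM (normr_ge0 _) (normr_ge0 _) h (tri3_le _ _ _ _))).
rewrite /= -(mulrA (Ktriad s * delta)); apply: ler_wpM2l; first by apply: mulr_ge0 => //; exact: Ktriad_ge0.
rewrite /Y2 /Y1 /Y /= third_swap -[third (_, _)]/(third ((shear z).2, (shear z).1)) third_swap third_shear.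
rewrite -/(third z) /bw /aw.
move: (modulus_ge0 z.1) (modulus_ge0 (third z)) (modulus_ge0 z.2).
move: (cabs_ge0 (g z.1)) (cabs_ge0 (g (third z))) (cabs_ge0 (g z.2)).
move: (vsym_ge0 s (modulus z.1)) (vsym_ge0 s (modulus (third z))) (vsym_ge0 s (modulus z.2)).
rewrite /M; move: (vsym s (modulus z.1)) (vsym s (modulus (third z))) (vsym s (modulus z.2)).
move: (cabs (g z.1)) (cabs (g (third z))) (cabs (g z.2)) (modulus z.1) (modulus (third z)) (modulus z.2).
move=> g1 g2 g3 m1 m2 m3 v1 v2 v3 v10 v20 v30 g10 g20 g30 m10 m20 m30.
have sq := @sqr10_le R.
rewrite !mulrDl; apply: lerD; first apply: lerD.
- have -> : m1 ^+ 2 * (v2 * v3) * (g1 * (g2 * g3)) = m1 ^+ 2 * (g1 * (v2 * g2 * (v3 * g3))) by ring.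
  have -> : (10 + m1) ^+ 2 * g1 * (v3 * g3 * (v2 * g2)) = (10 + m1) ^+ 2 * (g1 * (v2 * g2 * (v3 * g3))) by ring.
  by rewrite ler_wpM2r ?sq// !mulr_ge0.
- have -> : m2 ^+ 2 * (v1 * v3) * (g1 * (g2 * g3)) = m2 ^+ 2 * (g2 * (v1 * g1 * (v3 * g3))) by ring.
  have -> : (10 + m2) ^+ 2 * g2 * (v3 * g3 * (v1 * g1)) = (10 + m2) ^+ 2 * (g2 * (v1 * g1 * (v3 * g3))) by ring.
  by rewrite ler_wpM2r ?sq// !mulr_ge0.
- have -> : m3 ^+ 2 * (v1 * v2) * (g1 * (g2 * g3)) = m3 ^+ 2 * (g3 * (v1 * g1 * (v2 * g2))) by ring.
  have -> : (10 + m3) ^+ 2 * g3 * (v1 * g1 * (v2 * g2)) = (10 + m3) ^+ 2 * (g3 * (v1 * g1 * (v2 * g2))) by ring.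
  by rewrite ler_wpM2r ?sq// !mulr_ge0.
Qed.

End triads.

Lemma alternating_sum0 (R : realType) (a b c : R) : 1 * (b - c) + 1 * (c - a) + 1 * (a - b) = 0.
Proof. ring. Qed.

(** * The H^s energy balance and the L2 balance of a difference *)

Section energy.
Context {R : realType}.
Local Notation K := (freqsp R).
Variable mu : {sigma_finite_measure set K -> \bar R}.
Local Notation Re := complex.Re.
Local Notation Im := complex.Im.
Local Notation cabs := Normc.normc.
Implicit Types (f g e : K -> R[i]) (k l p : K) (s delta : R) (z : K * K).

Hypothesis mu_refl : refl_invariant mu.
Hypothesis mu_shift : shift_invariant mu.
Local Notation mu2 := (mu \x mu)%E.

(** The third transposition of the triad, fixing z.1: it is the shear conjugated by the swap. *)
Lemma rotate (F : K * K -> R) : itg mu2 F ->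
  itg mu2 (fun z => F (z.1, third z)) /\
  \int[mu2]_z F (z.1, third z) = \int[mu2]_z F z.
Proof.
move=> iF; pose F1 z := F (z.2, z.1); pose F2 z := F1 (shear z).
have i1 : itg mu2 F1 := itg_swap2 iF.
have E1 : \int[mu2]_z F1 z = \int[mu2]_z F z := Rint_swap2 iF.
have i2 : itg mu2 F2 := itg_shear mu_refl mu_shift i1.
have E2 : \int[mu2]_z F2 z = \int[mu2]_z F1 z := Rint_shear mu_refl mu_shift (itg_meas i1).
have i3 := itg_swap2 i2; have E3 := Rint_swap2 i2.
have e z : F2 (z.2, z.1) = F (z.1, third z) by rewrite /F2 /F1 /shear /third /= addrC.
split; first exact: itg_ext i3 e.
by rewrite -E1 -E2 -E3; congr Rintegral; apply/funext => z; rewrite e.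
Qed.

(** Absolute convergence: both moduli of the symbol are charged to the two slots other than z.1. The
    slot of g takes the two powers allowed in L1 and the remaining slot one power in L2. *)
Lemma itg_trilinear_majorant (w : K -> R) f g delta s : 0 <= delta -> 1 <= s ->
  measurable_fun setT w -> (forall k, 0 <= w k) ->
  cmeasurable f -> cmeasurable g ->
  itg mu (fun k => (w k * cabs (f k)) ^+ 2) -> itg mu (ew s f) -> itg mu (bw g) ->
  itg mu2 (fun z => w z.1 * cabs (f z.1) *
     (`|ksym delta (third z) z.2| * (cabs (f (third z)) * cabs (g z.2)))) /\
  itg mu2 (fun z => bw g z.2 * (w z.1 * cabs (f z.1) * ((10 + modulus (third z)) * cabs (f (third z))))).
Proof.
move=> d0 s1 mw w0 mf mg ia ie ib.
have m10 : measurable_fun setT (fun k : K => 10 + modulus k : R).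
  by apply: measurable_funD => //; exact: (measurable_modulus (f := id)).
have ma : measurable_fun setT (fun k => w k * cabs (f k)).
  by apply: measurable_funM => //; exact: cmeas_cabs.
have me : measurable_fun setT (fun k => (10 + modulus k) * cabs (f k)).
  by apply: measurable_funM => //; exact: cmeas_cabs.
have ie2 : itg mu (fun k => ((10 + modulus k) * cabs (f k)) ^+ 2).
  apply: itg_mono ie _; first exact: measurable_funX.
  move=> k; rewrite ger0_norm ?sqr_ge0//.
  by have := @wsym_pow_cabs R s f k 1; rewrite expr1; apply; rewrite /=; lra.
have [i _] := triad_young mu_refl mu_shift ma me (bw_ge0 g) ib ia ie2.
split; last exact: i.
have m1 : measurable_fun setT (fun z : K * K => z.1) by exact: measurable_fst.
have m2 : measurable_fun setT (fun z : K * K => z.2) by exact: measurable_snd.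
have m3 : measurable_fun setT (fun z : K * K => third z) by exact: measurable_third.
have cf := cmeas_cabs mf; have cg := cmeas_cabs mg.
apply: itg_mono i _.
  apply: measurable_funM; first exact: (measurableT_comp ma m1).
  apply: measurable_funM; first by apply: measurableT_comp => //; exact: measurable_ksym.
  by apply: measurable_funM; [exact: (measurableT_comp cf m3)|exact: (measurableT_comp cg m2)].
move=> z; rewrite -/(third z) /bw.
have a0 : 0 <= w z.1 * cabs (f z.1) by rewrite mulr_ge0 ?cabs_ge0.
have b0 := cabs_ge0 (f (third z)); have c0 := cabs_ge0 (g z.2).
rewrite ger0_norm; last by rewrite mulr_ge0// mulr_ge0// mulr_ge0.
have h := ksym_le (third z) z.2 d0.
have p0 := modulus_ge0 (third z); have l0 := modulus_ge0 z.2.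
rewrite [leRHS]mulrCA ler_wpM2l//.
apply: (@le_trans _ _ ((10 + modulus (third z)) * (10 + modulus z.2) ^+ 2 * (cabs (f (third z)) * cabs (g z.2)))).
  rewrite ler_wpM2r ?mulr_ge0//; apply: le_trans h _.
  apply: ler_pM => //; first by rewrite lerDr.
  exact: le_sqr10.
by rewrite le_eqVlt; apply/orP; left; apply/eqP; ring.
Qed.

(** The constant 1/2 is 3/6: three terms in the determinant bound, six permutations. At s = 0 the
    weight is constant, the determinant vanishes identically, and the nonlinearity conserves the L2
    norm. *)
Lemma adv_energy s delta g : 0 <= delta -> 0 <= s -> cmeasurable g -> hermsym g ->
  (forall s', itg mu (ew s' g)) -> itg mu (bw g) ->
  [/\ itg mu (fun k => wsym s (modulus k) * Re ((g k)^*%C * adv mu delta g g k)),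
      itg mu (fun k => aw s g k ^+ 2),
      `|\int[mu]_k (wsym s (modulus k) * Re ((g k)^*%C * adv mu delta g g k))| <=
        2^-1 * Ktriad s * delta * (\int[mu]_k bw g k * \int[mu]_k aw s g k ^+ 2)
    & s = 0 -> \int[mu]_k (wsym s (modulus k) * Re ((g k)^*%C * adv mu delta g g k)) = 0].
Proof.
move=> d0 s0 mg hg eg ib.
have mw : measurable_fun setT (fun k : K => wsym s (modulus k)).
  by apply: measurable_powR10; exact: (measurable_modulus (f := id)).
have wE x : 0 <= x -> wsym s x ^+ 2 = wsym (s + s) x.
  by move=> x0; rewrite /wsym -powR_mulrn ?powR_ge0// -powRrM; congr (_ `^ _); ring.
have ia : itg mu (fun k => (wsym s (modulus k) * cabs (g k)) ^+ 2).
  by apply: itg_ext (eg (s + s)) _ => k; rewrite exprMn cabs_sqr wE// modulus_ge0.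
(* The logarithm is bounded by a power, so the energy with exponent s + 1 dominates; all energies of
   g are finite here. *)
have iaw : itg mu (fun k => aw s g k ^+ 2).
  apply: itg_mono (eg (s + 1)) _; first by apply: measurable_funX; exact: measurable_aw.
  move=> k; rewrite ger0_norm ?sqr_ge0// aw_sqr /ew ler_wpM2r ?nsq_ge0//.
  have k0 := modulus_ge0 k; have x1 : 0 < 10 + modulus k by lra.
  rewrite /wsym mulrDr mulr1 powRD ?(gt_eqF x1) ?implybT//.
  rewrite ler_wpM2l ?powR_ge0// /lsym.
  apply: le_trans (ln_le_sub1 x1) _; apply: (@le_trans _ _ ((10 + modulus k) `^ 1)).
    by rewrite powRr1; lra.
  by apply: ler_powR; lra.
have [imaj _] := itg_trilinear_majorant d0 (lexx 1) mw (fun k => wsym_ge0 _ _) mg mg ia (eg 1) ib.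
have [i1 i2 E] := adv_pairing mu_refl mw mg mg mg hg
  (fun k => congr1 (wsym s) (modulusN k)) (fun k => wsym_ge0 _ _) imaj.
have [i3 E3] := symmetrize mu_refl mu_shift i2.
split => //.
  rewrite E.
  have h := wdet_bound mu_refl mu_shift s0 d0 mg ib iaw i3.
  rewrite -E3 normrM (@ger0_norm _ 6)// in h.
  have six : 0 < 6 :> R by [].
  rewrite -(ler_pM2l six); apply: le_trans h _.
  by rewrite le_eqVlt; apply/orP; left; apply/eqP; field.
move=> s00; rewrite E.
suff : 6 * \int[mu2]_z (wsym s (modulus z.1) * ksym delta (third z) z.2 * tri3 g g g z) = 0.
  by move=> /eqP; rewrite mulf_eq0 pnatr_eq0 /= => /eqP.
rewrite E3.
under eq_Rintegral => z _.
  have -> : cross (third z) z.2 * wdet s delta (modulus z.1) (modulus (third z)) (modulus z.2) * tri3 g g g z = 0.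
    by rewrite /wdet /wsym s00 mulr0 !powRr0 alternating_sum0 mulr0 mul0r.
  over.
by rewrite Rintegral_cst// mul0r.
Qed.

(** The term with the velocity of g is transport by a divergence-free field and pairs to zero with
    e. The term with the velocity of e becomes, after exchanging the two slots of e, a commutator of
    m across the frequency of g, so that every derivative falls on g. *)
Lemma adv_difference s delta e g : 0 <= delta -> 1 <= s -> cmeasurable e -> cmeasurable g ->
  hermsym e -> hermsym g ->
  itg mu (ew s e) -> itg mu (ew s g) -> itg mu (bw g) ->
  itg mu (fun k => Re ((e k)^*%C * (adv mu delta e g k + adv mu delta g e k))) /\
  `|\int[mu]_k Re ((e k)^*%C * (adv mu delta e g k + adv mu delta g e k))| <=
    2^-1 * delta * (\int[mu]_k bw g k * \int[mu]_k nsq (e k)).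
Proof.
move=> d0 s1 me mg he hg ee eg ib.
have ne : itg mu (fun k => nsq (e k)) by apply: itg_nsq ee => //; lra.
have ia : itg mu (fun k => (1 * cabs (e k)) ^+ 2).
  by apply: itg_ext ne _ => k; rewrite mul1r cabs_sqr.
have m1 : measurable_fun setT (fun _ : K => 1 : R) by exact: measurable_cst.
have [imaj iG] := itg_trilinear_majorant d0 s1 m1 (fun _ => ler01) me mg ia ee ib.
have [j1 i1 E1] := adv_pairing mu_refl m1 me me mg he (fun _ => erefl) (fun _ => ler01) imaj.
have mz1 : measurable_fun setT (fun z : K * K => z.1) by exact: measurable_fst.
have mz2 : measurable_fun setT (fun z : K * K => z.2) by exact: measurable_snd.
have mz3 : measurable_fun setT (fun z : K * K => third z) by exact: measurable_third.
have imaj2 : itg mu2 (fun z => 1 * cabs (e z.1) *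
     (`|ksym delta (third z) z.2| * (cabs (g (third z)) * cabs (e z.2)))).
  have [iG' _] := rotate iG; have ce := cmeas_cabs me; have cg := cmeas_cabs mg.
  apply: itg_mono iG' _.
    apply: measurable_funM.
      by apply: measurable_funM => //; exact: (measurableT_comp ce mz1).
    apply: measurable_funM; first by apply: measurableT_comp => //; exact: measurable_ksym.
    by apply: measurable_funM; [exact: (measurableT_comp cg mz3)|exact: (measurableT_comp ce mz2)].
  move=> z /=; rewrite /bw (_ : third (z.1, third z) = z.2); last first.
    by rewrite /third /= opprD !opprK addrCA addrC addrA subrK || rewrite /third /= opprB opprK; ring.
  have a0 := cabs_ge0 (e z.1); have b0 := cabs_ge0 (g (third z)); have c0 := cabs_ge0 (e z.2).
  rewrite !mul1r ger0_norm; last by rewrite mulr_ge0// mulr_ge0// mulr_ge0.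
  have h := ksym_le (third z) z.2 d0.
  have p0 := modulus_ge0 (third z); have l0 := modulus_ge0 z.2.
  rewrite [leRHS]mulrCA ler_wpM2l//.
  apply: (@le_trans _ _ ((10 + modulus (third z)) ^+ 2 * (10 + modulus z.2) * (cabs (g (third z)) * cabs (e z.2)))).
    rewrite ler_wpM2r ?mulr_ge0//; apply: le_trans h _.
    apply: ler_pM => //; last by rewrite lerDr.
    exact: le_sqr10.
  by rewrite le_eqVlt; apply/orP; left; apply/eqP; ring.
have [j2 i2 E2] := adv_pairing mu_refl m1 me mg me he (fun _ => erefl) (fun _ => ler01) imaj2.
have [i3 E3] := rotate i2.
pose X z := cross (third z) z.2 * tri3 e e g z.
pose P1 z := X z * msym delta (modulus (third z)).
pose P2 z := X z * msym delta (modulus z.2).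
have iP1 : itg mu2 P1 by apply: itg_ext i1 _ => z; rewrite /P1 /X /ksym; ring.
have EP1 : \int[mu]_k (1 * Re ((e k)^*%C * adv mu delta e g k)) = \int[mu2]_z P1 z.
  by rewrite E1; congr Rintegral; apply/funext => z; rewrite /P1 /X /ksym; ring.
have e2 z : 1 * ksym delta (third (z.1, third z)) (third z) * tri3 e g e (z.1, third z) = - P2 z.
  rewrite /P2 /X /tri3 /= (_ : third (z.1, third z) = z.2); last first.
    by rewrite /third /= opprD !opprK addrCA addrC addrA subrK || rewrite /third /= opprB opprK; ring.
  rewrite [g _ * e _]mulrC /ksym /cross; ring.
have iP2 : itg mu2 P2.
  by apply: itg_ext (itgN i3) _ => z /=; rewrite e2 opprK.
have EP2 : \int[mu]_k (1 * Re ((e k)^*%C * adv mu delta g e k)) = - \int[mu2]_z P2 z.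
  by rewrite E2 -E3 -(Rint_N iP2); congr Rintegral; apply/funext => z; rewrite e2.
have hJ k : Re ((e k)^*%C * (adv mu delta e g k + adv mu delta g e k)) =
  1 * Re ((e k)^*%C * adv mu delta e g k) + 1 * Re ((e k)^*%C * adv mu delta g e k).
  by rewrite mulrDr cReD !mul1r.
split; first by apply: itg_ext (itgD j1 j2) _ => k; rewrite hJ.
have -> : \int[mu]_k Re ((e k)^*%C * (adv mu delta e g k + adv mu delta g e k)) =
    \int[mu2]_z (P1 z - P2 z).
  rewrite (Rint_B iP1 iP2) -EP1 -[X in _ = _ + X]EP2 -(Rint_D j1 j2).
  by congr Rintegral; apply/funext => k; exact: hJ.
pose D z := P1 z - P2 z.
have iD : itg mu2 D := itgB iP1 iP2.
have iDs := itg_shear mu_refl mu_shift iD; have EDs := Rint_shear mu_refl mu_shift (itg_meas iD).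
rewrite -/(D _).
(* Adding the shear image cancels the contributions with m at z.2, the frequency of g; what is left
   compares m at the two frequencies of e. *)
pose S z := X z * (msym delta (modulus (third z)) - msym delta (modulus z.1)).
have eS z : D z + D (shear z) = S z.
  rewrite /D /P1 /P2 third_shear /X tri3_shear cross_third_shear /S /X /=.
  move: (tri3 e e g z) (cross (third z) z.2) (msym _ (modulus (third z))) (msym _ (modulus z.1)) (msym _ (modulus z.2)) => *.
  ring.
have ES : 2 * \int[mu2]_z D z = \int[mu2]_z S z.
  rewrite (_ : S = fun z => D z + D (shear z)); last by apply/funext => z; rewrite eS.
  rewrite (Rint_D iD iDs) EDs; ring.
have ma : measurable_fun setT (fun k => cabs (e k)) by exact: cmeas_cabs.
have ia' : itg mu (fun k => cabs (e k) ^+ 2) by apply: itg_ext ne _ => k; rewrite cabs_sqr.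
have [iY EY] := triad_young mu_refl mu_shift ma ma (bw_ge0 g) ib ia' ia'.
have iS : itg mu2 S by apply: itg_ext (itgD iD iDs) eS.
have : `|\int[mu2]_z S z| <= delta * \int[mu2]_z (bw g z.2 * `|cabs (e z.1) * cabs (e (- z.1 - z.2))|).
  have iY' : itg mu2 (fun z => bw g z.2 * `|cabs (e z.1) * cabs (e (- z.1 - z.2))|).
    by apply: itg_ext iY _ => z; rewrite ger0_norm// mulr_ge0 ?cabs_ge0.
  rewrite -(Rint_Z _ iY'); apply: Rint_norm_bound; [exact: itg_meas iS|exact: itgZ|].
  apply: aeW => z; rewrite -/(third z).
  have a0 := cabs_ge0 (e z.1); have b0 := cabs_ge0 (e (third z)); have c0 := cabs_ge0 (g z.2).
  have h := cross_msym_le (third z) z.2 d0.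
  have -> : S z = cross (third z) z.2 * (msym delta (modulus (third z)) - msym delta (modulus (third z + z.2))) * tri3 e e g z.
    rewrite (_ : third z + z.2 = - z.1); last by rewrite /third subrK.
    by rewrite modulusN /S /X; ring.
  rewrite normrM (ger0_norm (mulr_ge0 a0 b0)).
  apply: le_trans (ler_pM (normr_ge0 _) (normr_ge0 _) h (tri3_le _ _ _ _)) _.
  rewrite -mulrA; apply: ler_wpM2l => //.
  have -> : bw g z.2 * (cabs (e z.1) * cabs (e (third z))) =
    (10 + modulus z.2) ^+ 2 * (cabs (e z.1) * (cabs (e (third z)) * cabs (g z.2))) by rewrite /bw; ring.
  apply: ler_wpM2r; first by rewrite !mulr_ge0.
  exact/sqr10_le/modulus_ge0.
rewrite -ES normrM (@ger0_norm _ 2)// => h.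
have two : 0 < 2 :> R by [].
rewrite -(ler_pM2l two); apply: le_trans h _.
apply: le_trans (ler_wpM2l d0 EY) _.
have -> : \int[mu]_k cabs (e k) ^+ 2 = \int[mu]_k nsq (e k).
  by congr Rintegral; apply/funext => k; rewrite cabs_sqr.
by rewrite le_eqVlt; apply/orP; left; apply/eqP; field.
Qed.

End energy.

(** * Truncation and the Euler scheme *)

Section euler.
Context {R : realType}.
Local Notation K := (freqsp R).
Variable mu : {sigma_finite_measure set K -> \bar R}.
Local Notation Re := complex.Re.
Local Notation Im := complex.Im.
Local Notation cabs := Normc.normc.
Implicit Types (f g e : K -> R[i]) (k l p : K).

Hypothesis mu_refl : refl_invariant mu.
Hypothesis mu_shift : shift_invariant mu.

(** The fourth power makes this integrable against all three frequency measures, the dimension being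
    two. *)
Definition decay k : R := ((10 + modulus k) ^+ 4)^-1.
Hypothesis mu_decay : itg mu decay.

Lemma decay_ge0 k : 0 <= decay k.
Proof. by rewrite invr_ge0 exprn_ge0//; have := modulus_ge0 k; lra. Qed.

Lemma adv_nsq_at s delta g k M : 0 <= delta -> 3 <= s -> cmeasurable g ->
  itg mu (ew s g) -> \int[mu]_k ew s g k <= M -> shift_at mu k ->
  nsq (adv mu delta g g k) <= 64 * M ^+ 2 * decay k.
Proof.
move=> d0 s3 mg eg EM sk.
have E0 : 0 <= \int[mu]_k ew s g k by apply: Rintegral_ge0 => l _; exact: ew_ge0.
have dec := adv_decay d0 s3 mg mg eg eg sk.
have k0 := modulus_ge0 k.
rewrite -cabs_sqr /decay ler_pdivlMr; last by rewrite exprn_gt0//; lra.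
have -> : cabs (adv mu delta g g k) ^+ 2 * (10 + modulus k) ^+ 4 =
  ((10 + modulus k) ^+ 2 * cabs (adv mu delta g g k)) ^+ 2 by ring.
have -> : 64 * M ^+ 2 = (8 * M) ^+ 2 by ring.
rewrite ler_pXn2r// ?nnegrE.
- apply: le_trans dec _; lra.
- by rewrite mulr_ge0 ?cabs_ge0// sqr_ge0.
- lra.
Qed.

(** Young with x = 10 + |k|: x^2 |g| is at most half of x^(-4) plus half of x^8 |g|^2. The eighth
    power is where [4 <= s] is used. *)
Lemma bw_itg s g : 4 <= s -> cmeasurable g -> itg mu (ew s g) ->
  itg mu (bw g) /\ \int[mu]_k bw g k <= 2^-1 * (\int[mu]_k decay k + \int[mu]_k ew s g k).
Proof.
move=> s4 mg eg.
have iG := itgZ 2^-1 (itgD mu_decay eg).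
have h k : bw g k <= 2^-1 * (decay k + ew s g k).
  have := @wsym_pow_cabs R s g k 4; rewrite /= => /(_ _)h; have {}h := h ltac:(by lra).
  rewrite /bw /decay; set x := 10 + modulus k in h *.
  have x0 : 0 < x by rewrite /x; have := modulus_ge0 k; lra.
  apply: (@le_trans _ _ (2^-1 * ((x ^+ 4)^-1 + (x ^+ 4 * cabs (g k)) ^+ 2))); last first.
    by rewrite ler_wpM2l// lerD2l.
  have -> : 2^-1 * ((x ^+ 4)^-1 + (x ^+ 4 * cabs (g k)) ^+ 2) =
     x ^+ 2 * cabs (g k) + 2^-1 * ((x ^+ 2)^-1 - x ^+ 4 * cabs (g k)) ^+ 2.
    by field; rewrite gt_eqF.
  by rewrite lerDl mulr_ge0 ?sqr_ge0.
have i : itg mu (bw g).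
  apply: itg_mono iG _; first exact: measurable_bw.
  by move=> k; rewrite ger0_norm ?bw_ge0.
split => //; rewrite -Rint_D// -Rint_Z; last exact: itgD.
exact: Rint_le.
Qed.

(** Stated without integrability because [hermsym] asks for an identity at every k, also where the
    convolution integral diverges; there [fine] returns 0 on both sides. *)
Lemma Rint_opp (f : K -> R) : \int[mu]_k (- f k) = - \int[mu]_k f k.
Proof.
rewrite /Rintegral -fineN integralE [in RHS]integralE.
rewrite (_ : (fun k => (- f k)%:E) = (\- (EFin \o f))%E)//.
rewrite funeposN funenegN.
have : (0 <= \int[mu]_k (EFin \o f)^\+ k)%E by apply: integral_ge0.
have : (0 <= \int[mu]_k (EFin \o f)^\- k)%E by apply: integral_ge0.
rewrite -[(fun k => (f k)%:E)]/(EFin \o f).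
by case: (integral _ _ (EFin \o f)^\+%E) => [a| |] //; case: (integral _ _ (EFin \o f)^\-%E) => [b| |] //= _ _; rewrite opprB.
Qed.

Lemma adv_herm delta g : cmeasurable g -> hermsym g -> hermsym (adv mu delta g g).
Proof.
move=> mg hg k.
have [mr mi] := cmeas_adv_integrand delta k mg mg.
have e l : (ksym delta (- k - - l) (- l))%:C%C * (g (- k - - l) * g (- l)) =
   (((ksym delta (k - l) l)%:C%C * (g (k - l) * g l))^*)%C.
  rewrite (_ : - k - - l = - (k - l)); last by rewrite opprD.
  rewrite !hg (_ : ksym delta (- (k - l)) (- l) = ksym delta (k - l) l); last first.
    by rewrite /ksym modulusN; congr (_ * _); rewrite /cross /=; ring.
  by apply: complex_ext; rewrite ?(cReC, cImC, cReZ, cImZ, cReM, cImM); ring.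
have [mr' mi'] := cmeas_adv_integrand delta (- k) mg mg.
have Er := Rint_refl mu_refl mr'. have Ei := Rint_refl mu_refl mi'.
apply: complex_ext; rewrite ?cReC ?cImC /adv /cint.
  apply: (etrans (esym Er)); congr Rintegral; apply/funext => l.
  by rewrite (e l) cReC.
apply: (etrans (esym Ei)); rewrite -Rint_opp; congr Rintegral; apply/funext => l.
by rewrite (e l) cImC.
Qed.

Variables (psi : R -> R) (kappa delta s : R).
Hypothesis mpsi : measurable_fun setT psi.
Hypothesis psi_ge0 : forall r, 0 <= r -> 0 <= psi r.
Hypotheses (kappa0 : 0 < kappa) (d0 : 0 <= delta) (s4 : 4 <= s).

(* A frequency cut-off making both the nonlinearity and the multiplier bounded. *)
Record cutoff (n : R) (chi : K -> R) : Prop := Cutoff {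
  cut_meas : measurable_fun setT chi;
  cut_ge0 : forall k, 0 <= chi k;
  cut_le1 : forall k, chi k <= 1;
  cut_idem : forall k, chi k * chi k = chi k;
  cut_sym : forall k, chi (- k) = chi k;
  cut_mod : forall k, chi k != 0 -> modulus k <= n;
  cut_psi : forall k, chi k != 0 -> psi (modulus k) <= n }.

Variables (n : R) (chi : K -> R).
Hypotheses (n0 : 0 <= n) (Hchi : cutoff n chi).

(** Minus the time derivative prescribed by the truncated equation. *)
Definition rate g k : R[i] :=
  (chi k)%:C%C * (adv mu delta g g k + (kappa * psi (modulus k))%:C%C * g k).

(** The states of the scheme. Support in the cut-off makes every Sobolev energy finite as soon as
    the L2 norm is, and the class is stable under an Euler step. *)
Record tame g : Prop := Tame {
  tame_meas : cmeasurable g;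
  tame_herm : hermsym g;
  tame_supp : forall k, (chi k)%:C%C * g k = g k;
  tame_nsq : itg mu (fun k => nsq (g k)) }.

Lemma measurable_psimod : measurable_fun setT (fun k : K => psi (modulus k)).
Proof. by apply: (measurableT_comp mpsi); exact: (measurable_modulus (f := id)). Qed.

Lemma chi_nsq (z : R[i]) k : (chi k)%:C%C * z = z -> chi k * nsq z = nsq z.
Proof. by move=> h; rewrite -{2}h nsqZ expr2 (cut_idem Hchi). Qed.

Lemma tame_ew g s' : tame g -> itg mu (ew s' g).
Proof.
move=> tg; apply: itg_mono (itgZ ((10 + n) `^ (2 * `|s'|)) (tame_nsq tg)) _.
  exact: (measurable_ew s' (tame_meas tg)).
move=> k; rewrite ger0_norm ?ew_ge0// /ew -(chi_nsq (tame_supp tg k)).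
have [->|c0] := eqVneq (chi k) 0; first by rewrite !mul0r !mulr0.
rewrite ler_wpM2r ?mulr_ge0 ?nsq_ge0 ?(cut_ge0 Hchi)//.
have k0 := modulus_ge0 k; have kn := cut_mod Hchi c0.
apply: (@le_trans _ _ ((10 + modulus k) `^ (2 * `|s'|))).
  by apply: ler_powR; [lra|have := ler_norm s'; lra].
by rewrite ge0_ler_powR ?nnegrE ?mulr_ge0//; lra.
Qed.

(** Bounds the squared norm of [rate] when the energy is at most M. It may grow without limit with
    the cut-off n, which is harmless because the time step is chosen afterwards. The factor 128 is 2
    times the 64 of [adv_nsq_at]. *)
Definition Kn M : R := 128 * wsym s n * M ^+ 2 * \int[mu]_k decay k + 2 * kappa ^+ 2 * n ^+ 2 * M.

Lemma decay_int_ge0 : 0 <= \int[mu]_k decay k.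
Proof. by apply: Rintegral_ge0 => k _; exact: decay_ge0. Qed.

Lemma Kn_ge0 M : 0 <= M -> 0 <= Kn M.
Proof.
move=> M0; apply: addr_ge0.
  by rewrite mulr_ge0 ?decay_int_ge0// mulr_ge0 ?sqr_ge0// mulr_ge0 ?wsym_ge0.
by rewrite mulr_ge0// mulr_ge0 ?sqr_ge0// mulr_ge0 ?sqr_ge0.
Qed.

Lemma cmeas_rate g : cmeasurable g -> cmeasurable (rate g).
Proof.
move=> mg; apply: cmeasM; first by apply: cmeas_real; exact: (cut_meas Hchi).
apply: cmeasD; first exact: cmeas_adv0.
apply: cmeasM => //; apply: cmeas_real; apply: measurable_funM => //.
exact: measurable_psimod.
Qed.

Lemma rate_nsq_le s' g M : tame g -> 0 <= s' -> s' <= s -> \int[mu]_k ew s g k <= M ->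
  itg mu (ew s' (rate g)) /\ \int[mu]_k ew s' (rate g) k <= Kn M.
Proof.
move=> tg s0 ss EM; have mg := tame_meas tg; have eg := tame_ew s tg.
have E0 : 0 <= \int[mu]_k ew s g k by apply: Rintegral_ge0 => k _; exact: ew_ge0.
pose G k := 128 * wsym s n * M ^+ 2 * decay k + 2 * kappa ^+ 2 * n ^+ 2 * ew s g k.
have iG : itg mu G by apply: itgD; exact: itgZ.
have le : {ae mu, forall k, `|ew s' (rate g) k| <= G k}.
  apply: filterS (ae_shift_at mu_shift) => k sk; rewrite ger0_norm ?ew_ge0// /ew /rate nsqZ.
  have k0 := modulus_ge0 k.
  have G0 : 0 <= G k.
    rewrite /G; apply: addr_ge0.
      by rewrite mulr_ge0 ?decay_ge0// mulr_ge0 ?sqr_ge0// mulr_ge0 ?wsym_ge0.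
    by rewrite mulr_ge0 ?ew_ge0// mulr_ge0 ?sqr_ge0// mulr_ge0 ?sqr_ge0.
  have [c0|c0] := eqVneq (chi k) 0; first by rewrite c0 expr0n mul0r mulr0.
  have kn := cut_mod Hchi c0; have pn := cut_psi Hchi c0; have p0 := psi_ge0 k0.
  have c1 : chi k ^+ 2 <= 1 by rewrite expr2 (cut_idem Hchi) (cut_le1 Hchi).
  have wk : wsym s' (modulus k) <= wsym s (modulus k) by rewrite /wsym; apply: ler_powR; lra.
  have wn : wsym s (modulus k) <= wsym s n by apply: wsym_le => //; lra.
  have s3 : 3 <= s by apply: le_trans s4; rewrite ler_nat.
  have dec2 := adv_nsq_at d0 s3 mg eg EM sk.
  apply: (@le_trans _ _ (wsym s (modulus k) * (2 * (nsq (adv mu delta g g k) + (kappa * n) ^+ 2 * nsq (g k))))).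
    apply: ler_pM => //; rewrite ?wsym_ge0//; first by rewrite mulr_ge0 ?sqr_ge0 ?nsq_ge0.
    apply: (@le_trans _ _ (nsq (adv mu delta g g k + (kappa * psi (modulus k))%:C%C * g k))).
      by rewrite ler_piMl ?nsq_ge0.
    apply: le_trans (nsqD_le _ _) _; rewrite ler_wpM2l// lerD2l nsqZ ler_wpM2r ?nsq_ge0//.
    by rewrite ler_pXn2r ?nnegrE ?mulr_ge0 ?(ltW kappa0)// ler_wpM2l// ltW.
  rewrite mulrDr mulrDr /G; apply: lerD; last first.
    by rewrite /ew le_eqVlt; apply/orP; left; apply/eqP; ring.
  apply: (@le_trans _ _ (wsym s n * (2 * (64 * M ^+ 2 * decay k)))).
    apply: ler_pM; rewrite ?wsym_ge0 ?mulr_ge0 ?nsq_ge0//.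
    by rewrite ler_wpM2l.
  by rewrite le_eqVlt; apply/orP; left; apply/eqP; ring.
have i := itg_mono_ae (measurable_ew s' (cmeas_rate mg)) iG le.
split => //.
apply: (@le_trans _ _ (\int[mu]_k G k)).
  apply: Rint_le_ae => //; apply: filterS le => k; exact: le_trans (ler_norm _).
rewrite Rint_D ?Rint_Z//; [|exact: itgZ..].
rewrite /Kn lerD2l ler_wpM2l// mulr_ge0 ?sqr_ge0// mulr_ge0 ?sqr_ge0//.
Qed.

End euler.

Lemma euler_arith0 (R : realType) (A h z F N2 j k : R) : A <= N2 + j * h * (h * k) ->
  0 <= h * z -> h ^+ 2 * F <= h ^+ 2 * k -> A - 2 * h * z + h ^+ 2 * F <= N2 + (j + 1) * h * (h * k).
Proof. by move=> h1 h2 h3; lra. Qed.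

Lemma half_product (R : realType) (c d b Y k : R) : c * d * (2 * b) * Y <= 2 * k * Y ->
  2^-1 * c * d * (b * Y) <= k * Y * 2^-1.
Proof. by lra. Qed.

(** One step of the H^s balance: E is the energy, I the nonlinear term, Z the dissipation, F the
    squared rate, Y the logarithmic energy, A the squared L2 norm. The nonlinearity costs at most
    half of k Y per unit time, the dissipation yields Y up to C A, and what survives of it damps E
    towards a level below M. *)
Lemma euler_arith (R : realType) (E h k I i Z F Y C A N M K : R) :
  h * - i <= h * I -> h * i <= h * (k * Y * 2^-1) ->
  h ^+ 2 * F <= h * (h * K) -> h * (h * K) <= h * k ->
  h * k * Y <= h * k * (Z + C * A) -> h * k * E <= h * k * Y ->
  h * k * (C * A) <= h * k * (C * (N + 1)) -> (1 - h * k) * E <= (1 - h * k) * M ->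
  h * k * (2 * C * (N + 1) + 1) <= h * k * M ->
  E - 2 * h * (I + k * Z) + h ^+ 2 * F <= M.
Proof. by lra. Qed.

(** * Uniform bounds along the Euler scheme *)

Section euler_iteration.
Context {R : realType}.
Local Notation K := (freqsp R).
Variable mu : {sigma_finite_measure set K -> \bar R}.
Local Notation Re := complex.Re.
Local Notation Im := complex.Im.
Local Notation cabs := Normc.normc.
Implicit Types (f g e : K -> R[i]) (k l p : K).

Hypothesis mu_refl : refl_invariant mu.
Hypothesis mu_shift : shift_invariant mu.
Hypothesis mu_decay : itg mu (@decay R).

Variables (psi : R -> R) (kappa delta s : R).
Hypothesis mpsi : measurable_fun setT psi.
Hypothesis psi_ge0 : forall r, 0 <= r -> 0 <= psi r.
Hypotheses (kappa0 : 0 < kappa) (d0 : 0 <= delta) (s4 : 4 <= s).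
Variables (n : R) (chi : K -> R).
Hypotheses (n0 : 0 <= n) (Hchi : cutoff psi n chi).
Local Notation rate := (rate mu psi kappa delta chi).
Local Notation tame := (tame mu chi).
Local Notation Kn := (Kn mu kappa s n).

Lemma s_ge0 : 0 <= s. Proof. exact: le_trans s4. Qed.

Lemma ew0 g k : ew 0 g k = nsq (g k).
Proof. by rewrite /ew /wsym mulr0 powRr0 mul1r. Qed.

Lemma rate_herm g : cmeasurable g -> hermsym g -> hermsym (rate g).
Proof.
move=> mg hg k; rewrite /rate (cut_sym Hchi) modulusN (adv_herm mu_refl) // hg.
by apply: complex_ext; rewrite ?(cReC, cImC, cReZ, cImZ, cReD, cImD, cReC, cImC, cReZ, cImZ); ring.
Qed.

Lemma rate_supp g k : (chi k)%:C%C * rate g k = rate g k.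
Proof.
rewrite /rate mulrA; congr (_ * _); apply: complex_ext; rewrite ?cReZ ?cImZ /=.
  exact: (cut_idem Hchi).
by rewrite mulr0.
Qed.

Lemma itg_ew0 g : itg mu (ew 0 g) -> itg mu (fun k => nsq (g k)).
Proof. by move=> h; apply: itg_ext h _ => k; rewrite ew0. Qed.

Lemma tame_step h g : tame g -> tame (fun k => g k - h%:C%C * rate g k).
Proof.
move=> tg; have mg := tame_meas tg; have mr := cmeas_rate mu kappa delta mpsi Hchi mg.
have mhr : cmeasurable (fun k => h%:C%C * rate g k) by apply: cmeasM => //; exact: cmeas_cst.
split.
- exact: cmeasB.
- apply: hermB; first exact: tame_herm tg.
  by apply: hermZ; apply: rate_herm => //; exact: tame_herm tg.
- move=> k; rewrite mulrBr (tame_supp tg); congr (_ - _).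
  by rewrite mulrCA rate_supp.
- apply: itg_ew0; apply: itg_ewB => //; first exact: (tame_ew Hchi).
  apply: itg_ewZ.
  exact: (rate_nsq_le mu_shift mu_decay mpsi psi_ge0 kappa0 d0 s4 n0 Hchi tg (lexx 0) s_ge0 (lexx _)).1.
Qed.

Lemma itg_psi s' g : tame g -> itg mu (fun k => psi (modulus k) * ew s' g k).
Proof.
move=> tg; have mg := tame_meas tg.
apply: itg_mono (itgZ n (tame_ew Hchi s' tg)) _.
  by apply: measurable_funM; [exact: measurable_psimod|exact: measurable_ew].
move=> k; have p0 := psi_ge0 (modulus_ge0 k).
rewrite (ger0_norm (mulr_ge0 p0 (ew_ge0 s' g k))) /ew -(chi_nsq Hchi (tame_supp tg k)).
have [->|c0] := eqVneq (chi k) 0; first by rewrite mul0r !mulr0.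
apply: ler_wpM2r; last exact: (cut_psi Hchi).
by rewrite mulr_ge0 ?wsym_ge0// mulr_ge0 ?nsq_ge0 ?(cut_ge0 Hchi).
Qed.

Lemma tame_bw g : tame g -> itg mu (bw g).
Proof. by move=> tg; exact: (bw_itg mu_decay s4 (tame_meas tg) (tame_ew Hchi s tg)).1. Qed.

Lemma nsq_sub_scale (h : R) (a b : R[i]) :
  nsq (a - h%:C%C * b) = nsq a - 2 * h * Re (a^*%C * b) + h ^+ 2 * nsq b.
Proof. by rewrite /nsq cReB cImB cReZ cImZ cReM cReC cImC; ring. Qed.

Lemma Re_conj_self (z : R[i]) : Re (z^*%C * z) = nsq z.
Proof. by rewrite cReM cReC cImC /nsq; ring. Qed.

Lemma conj_rate g k : tame g ->
  Re ((g k)^*%C * rate g k) =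
  Re ((g k)^*%C * adv mu delta g g k) + kappa * psi (modulus k) * nsq (g k).
Proof.
move=> tg; have S := tame_supp tg k.
have Sr : chi k * Re (g k) = Re (g k) by rewrite -[in RHS]S cReZ.
have Si : chi k * Im (g k) = Im (g k) by rewrite -[in RHS]S cImZ.
rewrite /rate mulrCA cReZ mulrDr cReD mulrDr; congr (_ + _).
  rewrite !cReM cReC cImC; rewrite -[in RHS]Sr -[in RHS]Si; ring.
by rewrite mulrCA cReZ Re_conj_self mulrCA (chi_nsq Hchi S).
Qed.

(** An exact identity for the explicit step. The quadratic term in h is the price of explicitness
    and has to be absorbed by the choice of the step. *)
Lemma energy_expand h s' g : tame g -> 0 <= s' -> s' <= s ->
  \int[mu]_k ew s' (fun k => g k - h%:C%C * rate g k) k =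
  \int[mu]_k ew s' g k
  - 2 * h * (\int[mu]_k (wsym s' (modulus k) * Re ((g k)^*%C * adv mu delta g g k)) +
       kappa * \int[mu]_k (psi (modulus k) * ew s' g k))
  + h ^+ 2 * \int[mu]_k ew s' (rate g) k.
Proof.
move=> tg s0 ss.
have mg := tame_meas tg.
have [i1 _ _ _] := adv_energy mu_refl mu_shift d0 s0 mg (tame_herm tg) (fun s' => tame_ew Hchi s' tg) (tame_bw tg).
have i2 := itg_psi s' tg.
have i3 := (rate_nsq_le mu_shift mu_decay mpsi psi_ge0 kappa0 d0 s4 n0 Hchi tg s0 ss (lexx _)).1.
have i0 := tame_ew Hchi s' tg.
pose F1 k := wsym s' (modulus k) * Re ((g k)^*%C * adv mu delta g g k).
pose F2 k := psi (modulus k) * ew s' g k.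
pose F12 k := F1 k + kappa * F2 k.
have i12 : itg mu F12 := itgD i1 (itgZ kappa i2).
have E12 : \int[mu]_k F12 k = \int[mu]_k F1 k + kappa * \int[mu]_k F2 k.
  by rewrite (Rint_D i1 (itgZ kappa i2)) (Rint_Z kappa i2).
pose F4 k := ew s' g k - 2 * h * F12 k.
have i4 : itg mu F4 := itgB i0 (itgZ (2 * h) i12).
have E4 : \int[mu]_k F4 k = \int[mu]_k ew s' g k - 2 * h * \int[mu]_k F12 k.
  by rewrite (Rint_B i0 (itgZ (2 * h) i12)) (Rint_Z (2 * h) i12).
rewrite -E12 -E4 -(Rint_Z (h ^+ 2) i3) -(Rint_D i4 (itgZ (h ^+ 2) i3)).
congr Rintegral; apply/funext => k.
rewrite /F4 /F12 /F1 /F2 /ew nsq_sub_scale (conj_rate _ tg); ring.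
Qed.

Variable Xi0 : R.
Hypothesis Xi00 : 0 < Xi0.
Hypothesis psi_log : forall r, Xi0 < r -> lsym r <= psi r.

(** Below [Xi0] the symbol psi need not dominate the logarithm; there the weight of [aw] is at most
    this constant, and the L2 norm pays for the defect. *)
Definition CX : R := wsym s Xi0 * lsym Xi0.

Lemma CX_ge0 : 0 <= CX.
Proof. by rewrite mulr_ge0 ?wsym_ge0//; have := lsym_ge1 (ltW Xi00); lra. Qed.

Lemma aw_le g : tame g ->
  \int[mu]_k aw s g k ^+ 2 <= \int[mu]_k (psi (modulus k) * ew s g k) + CX * \int[mu]_k ew 0 g k.
Proof.
move=> tg; have mg := tame_meas tg.
have [_ ia _ _] := adv_energy mu_refl mu_shift d0 s_ge0 mg (tame_herm tg) (fun s' => tame_ew Hchi s' tg) (tame_bw tg).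
rewrite -(Rint_Z CX (tame_ew Hchi 0 tg)) -(Rint_D (itg_psi s tg) (itgZ CX (tame_ew Hchi 0 tg))).
apply: Rint_le => //.
  exact: itgD (itg_psi s tg) (itgZ CX (tame_ew Hchi 0 tg)).
move=> k; rewrite aw_sqr ew0 /ew.
have k0 := modulus_ge0 k; have p0 := psi_ge0 k0; have L1 := lsym_ge1 k0.
have w0 := wsym_ge0 s (modulus k); have nk := nsq_ge0 (g k).
rewrite mulrA -mulrDl; apply: ler_wpM2r => //.
have := CX_ge0; have [xk|kx] := ltP Xi0 (modulus k).
  move=> c0; apply: (@le_trans _ _ (psi (modulus k) * wsym s (modulus k))); last by rewrite lerDl.
  by rewrite mulrC; apply: ler_wpM2r => //; exact: psi_log.
move=> _; apply: (@le_trans _ _ CX); last by rewrite lerDr mulr_ge0.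
apply: ler_pM => //; first lra.
  by apply: wsym_le => //; exact: s_ge0.
by rewrite /lsym ler_ln ?posrE; have := Xi00; lra.
Qed.

Lemma ew_le_aw g : tame g -> \int[mu]_k ew s g k <= \int[mu]_k aw s g k ^+ 2.
Proof.
move=> tg; have mg := tame_meas tg.
have [_ ia _ _] := adv_energy mu_refl mu_shift d0 s_ge0 mg (tame_herm tg) (fun s' => tame_ew Hchi s' tg) (tame_bw tg).
apply: Rint_le => //; first exact: (tame_ew Hchi).
move=> k; rewrite aw_sqr /ew ler_wpM2r ?nsq_ge0// ler_peMr ?wsym_ge0//.
exact: lsym_ge1 (modulus_ge0 _).
Qed.

Variables (N2 T h : R) (g0 : K -> R[i]).
Hypotheses (N20 : 0 <= N2) (T0 : 0 <= T) (h0 : 0 <= h).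
(** The level at which damping balances the sources: N2 bounds the initial energy, N2 + 1 the
    squared L2 norm along the scheme, 2 CX (N2 + 1) pays for the low frequencies, and the last 1 for
    the quadratic error of a step. *)
Definition Mb : R := N2 + 2 * CX * (N2 + 1) + 1.

Lemma Mb_ge0 : 0 <= Mb.
Proof.
have c := CX_ge0; have a := N20; have b : 0 <= N2 + 1 by lra.
have := mulr_ge0 c b; rewrite /Mb; lra.
Qed.

(** Makes the nonlinearity at most half as strong as the dissipation while the energy is below [Mb].
    Of the step conditions that follow, [hT] keeps the accumulated L2 error below 1, [hK] makes the
    quadratic error of a step at most h kappa, and [hk] keeps 1 - h kappa nonnegative. *)
Hypothesis small_delta : Ktriad s * delta * (\int[mu]_k decay k + Mb) <= 2 * kappa.
Hypotheses (hT : T * h * Kn Mb <= 1) (hK : h * Kn Mb <= kappa) (hk : h * kappa <= 1).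
Hypotheses (tg0 : tame g0) (Eg0 : \int[mu]_k ew s g0 k <= N2).

Fixpoint euler (j : nat) : K -> R[i] :=
  if j is j'.+1 then fun k => euler j' k - h%:C%C * rate (euler j') k else g0.

Lemma euler_tame j : tame (euler j).
Proof. by elim: j => //= j IH; exact: tame_step. Qed.

Lemma ew0_le_ew g : tame g -> \int[mu]_k ew 0 g k <= \int[mu]_k ew s g k.
Proof.
move=> tg; apply: Rint_le; try exact: (tame_ew Hchi).
move=> k; rewrite /ew ler_wpM2r ?nsq_ge0// /wsym; apply: ler_powR.
  by have := modulus_ge0 k; lra.
by rewrite mulr0 mulr_ge0 ?s_ge0.
Qed.

(** Both bounds are proved in one induction: the H^s step needs the L2 bound for low frequencies,
    and the L2 step needs the H^s bound to control the rate. Exact L2 conservation by the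
    nonlinearity leaves only the quadratic errors. *)
Lemma euler_bound j : j%:R * h <= T ->
  \int[mu]_k ew 0 (euler j) k <= N2 + j%:R * h * (h * Kn Mb) /\
  \int[mu]_k ew s (euler j) k <= Mb.
Proof.
have C0 := CX_ge0; have M0 := Mb_ge0; have K0 := @Kn_ge0 R mu kappa s n Mb M0; have hN := N20; have h00 := h0.
elim: j => [_|j IH hj].
  rewrite !mul0r addr0; split; first exact: le_trans (ew0_le_ew tg0) _.
  apply: le_trans Eg0 _; rewrite /Mb.
  have b : 0 <= N2 + 1 by lra.
  have := mulr_ge0 C0 b; lra.
have hj' : j%:R * h <= T by apply: le_trans hj; rewrite ler_wpM2r// ler_nat.
have [IA IE] := IH hj'; set g := euler j in IA IE.
have tg : tame g := euler_tame j.
have [r0 R0] := rate_nsq_le mu_shift mu_decay mpsi psi_ge0 kappa0 d0 s4 n0 Hchi tg (lexx 0) s_ge0 IE.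
have [r1 R1] := rate_nsq_le mu_shift mu_decay mpsi psi_ge0 kappa0 d0 s4 n0 Hchi tg s_ge0 (lexx s) IE.
have mg := tame_meas tg.
have [_ _ _ J0] := adv_energy mu_refl mu_shift d0 (lexx 0) mg (tame_herm tg) (fun s' => tame_ew Hchi s' tg) (tame_bw tg).
have [_ _ JE _] := adv_energy mu_refl mu_shift d0 s_ge0 mg (tame_herm tg) (fun s' => tame_ew Hchi s' tg) (tame_bw tg).
have Y1 := aw_le tg; have Y2 := ew_le_aw tg.
have B1 := (bw_itg mu_decay s4 mg (tame_ew Hchi s tg)).2.
have Z0 : 0 <= \int[mu]_k (psi (modulus k) * ew 0 g k).
  by apply: Rintegral_ge0 => k _; exact: mulr_ge0 (psi_ge0 (modulus_ge0 k)) (ew_ge0 0 g k).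
have A0 : 0 <= \int[mu]_k ew 0 g k by apply: Rintegral_ge0 => k _; exact: ew_ge0.
have B0 : 0 <= \int[mu]_k bw g k by apply: Rintegral_ge0 => k _; exact: bw_ge0.
have Y0 : 0 <= \int[mu]_k aw s g k ^+ 2 by apply: Rintegral_ge0 => k _; exact: sqr_ge0.
rewrite /= (energy_expand h tg (lexx 0) s_ge0) (energy_expand h tg s_ge0 (lexx s)) (J0 erefl) add0r.
move: IA IE R0 R1 JE Y1 Y2 B1 Z0 A0 B0 Y0; rewrite -/g.
move: (\int[mu]_k ew 0 g k) (\int[mu]_k ew s g k) (\int[mu]_k bw g k) (\int[mu]_k aw s g k ^+ 2).
move: (\int[mu]_k (psi (modulus k) * ew 0 g k)) (\int[mu]_k (psi (modulus k) * ew s g k)).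
move: (\int[mu]_k (wsym s (modulus k) * _)) (\int[mu]_k ew 0 (rate g) k) (\int[mu]_k ew s (rate g) k).
move: small_delta hT hK hk kappa0 d0 (Ktriad_ge0 s_ge0) K0 hj.
rewrite -![j.+1%:R]natr1; move: (j%:R : R) (ler0n R j) => jr jr0.
move: (Kn Mb) (\int[mu]_k decay k) (Ktriad s) => KM c0 Kt.
move=> sd hT' hK' hk' k0 dd0 Kt0 KM0 hj I F0 Fs Z0' Zs A E b Y IA IE R0 R1 JE Y1 Y2 B1 Z0 A0 B0 Y0.
split.
  have q1 : h ^+ 2 * F0 <= h ^+ 2 * KM by rewrite ler_wpM2l ?sqr_ge0.
  have q2 : 0 <= h * (kappa * Z0') by rewrite mulr_ge0// mulr_ge0// ltW.
  exact: euler_arith0.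
(* The L1 norm b is at most half of the decay integral plus [Mb], so the smallness of delta applies
   with room to spare. *)
have key : `|I| <= kappa * Y * 2^-1.
  apply: (le_trans JE).
  have : Kt * delta * (2 * b) <= 2 * kappa.
    apply: le_trans sd; apply: ler_wpM2l; first exact: mulr_ge0.
    lra.
  by move=> h1; exact: half_product (ler_wpM2r Y0 h1).
have : h * `|I| <= h * (kappa * Y * 2^-1) by exact: ler_wpM2l.
have nI : - `|I| <= I by rewrite lerNl ler_normr lexx orbT.
have hI : h * - `|I| <= h * I by exact: ler_wpM2l.
have F : h ^+ 2 * Fs <= h * (h * KM) by rewrite expr2 -mulrA ler_wpM2l// ler_wpM2l.
have F' : h * (h * KM) <= h * kappa by rewrite ler_wpM2l.
have hkk : 0 <= h * kappa by rewrite mulr_ge0// ltW.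
have Y1' : h * kappa * Y <= h * kappa * (Zs + CX * A) by rewrite ler_wpM2l.
have Y2' : h * kappa * E <= h * kappa * Y by rewrite ler_wpM2l.
(* The accumulated error is j h times h Kn, at most T h Kn and so at most 1. *)
have A1 : A <= N2 + 1.
  apply: le_trans IA _; rewrite lerD2l.
  apply: le_trans hT'; rewrite mulrA; apply: ler_wpM2r => //; apply: ler_wpM2r => //.
  by apply: le_trans hj; rewrite ler_wpM2r// lerDl.
have A1' : h * kappa * (CX * A) <= h * kappa * (CX * (N2 + 1)) by rewrite ler_wpM2l// ler_wpM2l.
have M1 : (1 - h * kappa) * E <= (1 - h * kappa) * Mb by rewrite ler_wpM2l// subr_ge0.
have M2 : h * kappa * (2 * CX * (N2 + 1) + 1) <= h * kappa * Mb.
  by rewrite ler_wpM2l// /Mb -addrA lerDr.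
by move=> hIk; exact: (euler_arith hI hIk F F' Y1' Y2' A1' M1 M2).
Qed.

End euler_iteration.

(** * Integration in time *)

Section time.
Context {R : realType}.
Local Notation line := (measurableTypeR R).
Local Notation leb := (@lebesgue_measure R).
Implicit Types (t u T : R) (f : line -> R).

(** The indicator of [0, t] as a real factor: integrals over varying time intervals become integrals
    over the whole line, to which the lemmas on [itg] apply. *)
Definition seg t : line -> R := fun tau => (0 <= tau <= t)%R%:R.

Lemma segE t : seg t = \1_(`[0, t]%classic : set line).
Proof.
apply/funext => x; rewrite /seg indicE; congr (_%:R); congr nat_of_bool.
by apply/idP/idP => [h|]; [rewrite mem_set//= in_itv|rewrite inE/= in_itv].
Qed.

Lemma measurable_seg t : measurable_fun (setT : set line) (seg t).
Proof. by rewrite segE; exact: measurable_indic. Qed.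

Lemma seg_ge0 t u : 0 <= seg t u. Proof. by rewrite /seg ler0n. Qed.
Lemma seg_le1 t u : seg t u <= 1. Proof. by rewrite /seg lern1; case: (_ && _). Qed.

Lemma seg_in t u : 0 <= u <= t -> seg t u = 1.
Proof. by rewrite /seg => ->. Qed.

Lemma seg_out t u : ~~ (0 <= u <= t) -> seg t u = 0.
Proof. by rewrite /seg => /negbTE ->. Qed.

Lemma Rint_seg t f : \int[leb]_(tau in `[0, t]) f tau = \int[leb]_tau (seg t tau * f tau).
Proof.
rewrite Rintegral_mkcond; congr Rintegral; apply/funext => x.
rewrite segE indicE /patch; case: ifPn => _; by rewrite ?mul1r ?mul0r.
Qed.

Lemma seg_itg t : 0 <= t -> itg leb (seg t).
Proof.
move=> t0; apply: itg_lt_fin; [exact: measurable_seg|exact: seg_ge0|].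
rewrite segE integral_indic// setIT.
have := @lebesgue_measure_itv R `[0, t]; rewrite /= => ->.
by case: ifP => _; rewrite ?ltry// -EFinB ltry.
Qed.

Lemma Rint_seg1 t : 0 <= t -> \int[leb]_tau seg t tau = t.
Proof.
move=> t0; rewrite /Rintegral segE integral_indic// setIT.
have := @lebesgue_measure_itv R `[0, t]; rewrite /= => ->.
case: ifPn => //; first by rewrite oppr0 addr0.
by rewrite lte_fin -leNgt => h; apply/esym/eqP; rewrite eq_le h t0.
Qed.

Lemma seg_mul t T u : t <= T -> seg t u * seg T u = seg t u.
Proof.
move=> tT; rewrite /seg; case: (boolP (0 <= u <= t)) => [/andP[-> ut]|_]; last by rewrite mul0r.
by rewrite (le_trans ut tT) mulr1.
Qed.

Lemma itg_seg_le t T f : t <= T -> itg leb (fun u => seg T u * f u) -> itg leb (fun u => seg t u * f u).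
Proof.
move=> tT i.
have i2 : itg leb (fun u => seg t u * (seg T u * f u)).
  apply: itg_mono (itg_norm i) _.
    by apply: measurable_funM; [exact: measurable_seg|exact: itg_meas i].
  by move=> u; rewrite normrM ler_piMl// ger0_norm ?seg_ge0 ?seg_le1.
by apply: itg_ext i2 _ => u; rewrite mulrA seg_mul.
Qed.

Lemma null_point (a : R) : {ae leb, forall u : line, u != a}.
Proof.
exists [set a]; split => //; first exact: lebesgue_measure_set1.
by move=> u /= /negP; rewrite negbK => /eqP.
Qed.

Lemma measurable_le_nat d (S : measurableType d) (f g : S -> R) :
  measurable_fun setT f -> measurable_fun setT g ->
  measurable_fun setT (fun x => (f x <= g x)%R%:R : R).
Proof.
move=> mf mg; rewrite (_ : (fun x => _) = (fun x => if f x <= g x then 1 else 0)); last first.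
  by apply/funext => x; case: ifP.
by apply: measurable_fun_ifT => //; exact: measurable_fun_ler.
Qed.

(** The square of an integral is a double integral; the two triangles are exchanged by the swap, and
    the diagonal is null. This replaces the chain rule for the square of a primitive that need not
    be differentiable. *)
Lemma sq_integral (F : line -> R) : itg leb F ->
  (\int[leb]_u F u) ^+ 2 = 2 * \int[leb]_u (F u * \int[leb]_v ((v <= u)%R%:R * F v)).
Proof.
move=> iF; have mF := itg_meas iF.
have iP : itg (leb \x leb)%E (fun z => F z.1 * F z.2) := (itg_tensor iF iF).1.
have EP := (itg_tensor iF iF).2.
pose P (z : line * line) := F z.1 * F z.2.
pose A (z : line * line) := (z.2 <= z.1)%R%:R * P z.
pose D (z : line * line) := (z.1 == z.2)%:R * P z.
have mle : measurable_fun setT (fun z : line * line => (z.2 <= z.1)%R%:R : R).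
  exact: measurable_le_nat (@measurable_snd _ _ line line) (@measurable_fst _ _ line line).
have meq : measurable_fun setT (fun z : line * line => (z.1 == z.2)%:R : R).
  rewrite (_ : (fun z => _) = (fun z => (z.1 <= z.2)%R%:R * (z.2 <= z.1)%R%:R : R)); last first.
    by apply/funext => z; rewrite eq_le; case: (_ <= _); case: (_ <= _); rewrite ?mul1r ?mul0r.
  apply: measurable_funM => //.
  exact: measurable_le_nat (@measurable_fst _ _ line line) (@measurable_snd _ _ line line).
have sub (b : bool) (x : R) : `|b%:R * x| <= `|x| by case: b; rewrite ?mul1r ?mul0r ?normr0.
have iA : itg (leb \x leb)%E A.
  apply: itg_mono (itg_norm iP) _; first by apply: measurable_funM => //; exact: itg_meas iP.
  by move=> z; exact: sub.
have iD : itg (leb \x leb)%E D.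
  apply: itg_mono (itg_norm iP) _; first by apply: measurable_funM => //; exact: itg_meas iP.
  by move=> z; exact: sub.
have iB := itg_swap iA; have EB := Rint_swap iA.
have ED : \int[(leb \x leb)%E]_z D z = 0.
  rewrite -(Rint_fubini1 iD).
  transitivity (\int[leb]_x (0 : R)); last by rewrite Rintegral_cst// mul0r.
  congr Rintegral; apply/funext => x.
  transitivity (\int[leb]_y (0 : R)); last by rewrite Rintegral_cst// mul0r.
  apply: Rint_ae_eq => //; first exact: (measurable_sect1 _ (itg_meas iD)).
  by apply: filterS (null_point x) => y yx; rewrite /D /= eq_sym (negbTE yx) mul0r.
have sum z : A z + A (z.2, z.1) = P z + D z.
  rewrite /A /D /P /= [F z.2 * F z.1]mulrC; case: (ltgtP z.1 z.2) => _; rewrite ?mul1r ?mul0r ?addr0 ?add0r//.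
have E2 : 2 * \int[(leb \x leb)%E]_z A z = (\int[leb]_u F u) ^+ 2.
  rewrite mulr_natl mulr2n -[in X in _ + X = _]EB -(Rint_D iA iB).
  rewrite (_ : (fun x => _) = (fun z => P z + D z)); last by apply/funext => z; exact: sum.
  by rewrite (Rint_D iP iD) ED addr0 EP expr2.
rewrite -E2 -(Rint_fubini1 iA); congr (_ * _); congr Rintegral; apply/funext => u.
rewrite -Rint_Z; last first.
  apply: itg_mono (itg_norm iF) _; last by move=> v; exact: sub.
  by apply: measurable_funM => //; exact: (measurable_sect1 u mle).
by congr Rintegral; apply/funext => v; rewrite /A /P /=; ring.
Qed.

Lemma measurable_primitive (F : line -> R) : measurable_fun setT F ->
  measurable_fun setT (fun u : line => \int[leb]_v ((v <= u)%R%:R * F v)).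
Proof.
move=> mF; apply: (@measurable_Rint1 _ _ line line R leb (fun z => (z.2 <= z.1)%R%:R * F z.2)).
apply: measurable_funM.
  exact: measurable_le_nat (@measurable_snd _ _ line line) (@measurable_fst _ _ line line).
exact: (measurableT_comp mF measurable_snd).
Qed.

(** The integrated form of (u^2)' = 2 u' u with u' = f. Only integrability of f is at hand, so the
    identity comes from [sq_integral] rather than from differentiation. *)
Lemma ode_square T u0 (u f : line -> R) : measurable_fun setT u ->
  itg leb (fun tau => seg T tau * f tau) ->
  {ae leb, forall t : line, 0 <= t <= T -> u t = u0 + \int[leb]_tau (seg t tau * f tau)} ->
  itg leb (fun tau => seg T tau * (f tau * u tau)) /\
  {ae leb, forall t : line, 0 <= t <= T ->
    u t ^+ 2 = u0 ^+ 2 + 2 * \int[leb]_tau (seg t tau * (f tau * u tau))}.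
Proof.
move=> mu_ iF hu.
pose B := `|u0| + \int[leb]_tau `|seg T tau * f tau|.
have iFu : itg leb (fun tau => seg T tau * (f tau * u tau)).
  apply: (@itg_mono_ae _ _ _ _ _ (fun tau => B * `|seg T tau * f tau|)).
  - apply: (@eq_measurable_fun _ _ line R setT (fun tau => seg T tau * f tau * u tau)).
      by move=> x _; rewrite mulrA.
    by apply: measurable_funM => //; exact: itg_meas iF.
  - by apply: itgZ; exact: itg_norm.
  - apply: filterS hu => t ht; have [tT|tT] := boolP (0 <= t <= T); last first.
      by rewrite seg_out// !mul0r normr0 mulr0.
    have it := itg_seg_le (andP tT).2 iF.
    rewrite mulrA normrM mulrC; apply: ler_wpM2r => //.
    rewrite (ht tT); apply: le_trans (ler_normD _ _) _; rewrite lerD2l.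
    apply: le_trans (Rint_norm_le it) _; apply: Rint_le; [exact: itg_norm|exact: itg_norm|].
    move=> x; rewrite -(seg_mul x (andP tT).2) -mulrA normrM ler_piMl//.
    by rewrite ger0_norm ?seg_ge0 ?seg_le1.
split => //.
apply: filterS (hu) => t ht tT; have [t0 tT'] := andP tT.
pose F tau := seg t tau * f tau.
have iFt : itg leb F := itg_seg_le tT' iF.
have iFut : itg leb (fun tau => seg t tau * (f tau * u tau)) := itg_seg_le tT' iFu.
have sq := sq_integral iFt.
(* The inner primitive is u(x) - u0 by the equation itself, valid for almost every x. *)
have E : \int[leb]_x (F x * \int[leb]_v ((v <= x)%R%:R * F v)) =
   \int[leb]_x (seg t x * (f x * u x) - u0 * F x).
  apply: Rint_ae_eq.
  - by apply: measurable_funM; [exact: itg_meas iFt|apply: measurable_primitive; exact: itg_meas iFt].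
  - exact: itg_meas (itgB iFut (itgZ u0 iFt)).
  - apply: filterS (hu) => x hx; have [xt|xt] := boolP (0 <= x <= t); last first.
      by rewrite /F seg_out// !mul0r mulr0 subr0.
    have [x0 xt'] := andP xt.
    rewrite hx ?x0 ?(le_trans xt' tT')// /F.
    have -> : \int[leb]_v ((v <= x)%R%:R * (seg t v * f v)) = \int[leb]_v (seg x v * f v).
      congr Rintegral; apply/funext => v; rewrite mulrA; congr (_ * _).
      rewrite /seg; case: (leP v x) => vx; rewrite ?andbT ?andbF ?mul0r// mul1r.
      by rewrite (le_trans vx xt') andbT.
    ring.
rewrite (ht tT) sqrrD sq E (Rint_B iFut (itgZ u0 iFt)) (Rint_Z u0 iFt) /F; ring.
Qed.

Lemma seg_exp (c t : R) : 0 < c -> 0 <= t ->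
  itg leb (fun u => seg t u * expR (c * u)) /\
  \int[leb]_u (seg t u * expR (c * u)) = (expR (c * t) - 1) / c.
Proof.
move=> c0 t0.
have mexp : measurable_fun setT (fun u : line => expR (c * u) : R).
  apply: (@continuous_measurable_fun R (fun u => expR (c * u))) => x.
  apply: continuous_comp; last exact: continuous_expR.
  exact: mulrl_continuous.
have i : itg leb (fun u => seg t u * expR (c * u)).
  apply: itg_mono (itgZ (expR (c * t)) (seg_itg t0)) _.
    by apply: measurable_funM => //; exact: measurable_seg.
  move=> u; rewrite normrM (ger0_norm (seg_ge0 _ _)) (ger0_norm (expR_ge0 _)) mulrC.
  have [ut|ut] := boolP (0 <= u <= t); last by rewrite seg_out// !mulr0.
  by rewrite seg_in// !mulr1 ler_expR ler_wpM2l ?(andP ut).2// ltW.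
split => //; rewrite -Rint_seg.
have [->|tn0] := eqVneq t 0; first by rewrite set_itv1 Rintegral_set1 mulr0 expR0 subrr mul0r.
have tp : 0 < t by rewrite lt_neqAle eq_sym tn0.
pose G (u : R) := expR (c * u) / c.
have dG (u : R) : is_derive u 1 G (expR (c * u)).
  have -> : G = c^-1 \*: (expR \o (c \*: id)) by apply/funext => x; rewrite /G /= mulrC.
  by apply: is_derive_eq; rewrite /= -![_ *: _]/(_ * _) mulr1; field; rewrite gt_eqF.
have cexp : continuous (fun u : R => expR (c * u)).
  move=> x; apply: continuous_comp; last exact: continuous_expR.
  exact: mulrl_continuous.
rewrite /Rintegral (@continuous_FTC2 R (fun u => expR (c * u)) G 0 t tp).
- by rewrite /G mulr0 expR0 -EFinB/= -mulrBl.
- exact: continuous_subspaceT.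
- split.
  + by move=> x _; exact: ex_derive.
  + apply: cvg_at_right_filter; apply: differentiable_continuous; exact/derivable1_diffP/ex_derive.
  + apply: cvg_at_left_filter; apply: differentiable_continuous; exact/derivable1_diffP/ex_derive.
- by move=> x _; rewrite derive1E; exact: derive_val.
Qed.

(** Inserting a bound Z exp (2 C t) into the integral inequality gives (a + Z / 2) exp (2 C t).
    Starting from the rough bound Y, the excess over 2 a is halved at each pass and tends to 0. This
    works for y merely measurable and bounded almost everywhere. *)
Lemma gronwall T C a Y (y : line -> R) : 0 < C -> 0 <= a -> 0 <= T ->
  measurable_fun setT y ->
  {ae leb, forall t : line, 0 <= t <= T -> 0 <= y t <= Y} ->
  {ae leb, forall t : line, 0 <= t <= T -> y t <= a + C * \int[leb]_tau (seg t tau * y tau)} ->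
  {ae leb, forall t : line, 0 <= t <= T -> y t <= 2 * a * expR (2 * C * T)}.
Proof.
move=> C0 a0 T0 my yb yg.
have C2 : 0 < 2 * C by rewrite mulr_gt0.
have Yb : {ae leb, forall t : line, 0 <= t <= T -> 0 <= y t <= `|Y|}.
  by apply: filterS yb => t h tT; have /andP[-> yY] := h tT; exact: le_trans (ler_norm _).
have iy t : 0 <= t -> t <= T -> itg leb (fun tau => seg t tau * y tau).
  move=> t0 tT; apply: (@itg_mono_ae _ _ _ _ _ (fun tau => `|Y| * seg t tau)).
  - by apply: measurable_funM => //; exact: measurable_seg.
  - by apply: itgZ; exact: seg_itg.
  - apply: filterS Yb => u hu; have [ut|ut] := boolP (0 <= u <= t); last by rewrite seg_out// mul0r normr0 mulr0.
    have uT : 0 <= u <= T by rewrite (andP ut).1 (le_trans (andP ut).2).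
    by rewrite seg_in// mul1r mulr1; have /andP[y0 yY] := hu uT; rewrite ger0_norm.
have step j : {ae leb, forall t : line, 0 <= t <= T -> y t <= (2 * a + `|Y| * (2 ^+ j)^-1) * expR (2 * C * t)}.
  elim: j => [|j IH].
    apply: filterS Yb => t h tT; have /andP[y0 yY] := h tT; have [t0 _] := andP tT.
    apply: (le_trans yY); rewrite expr0 invr1 mulr1.
    apply: (@le_trans _ _ (2 * a + `|Y|)); first by rewrite lerDr mulr_ge0.
    rewrite ler_peMr//; first by rewrite addr_ge0// mulr_ge0.
    by rewrite -[leLHS](@expR0 R) ler_expR mulr_ge0// ltW.
  set Z := 2 * a + _ in IH.
  have Z0 : 0 <= Z by rewrite /Z addr_ge0// mulr_ge0// invr_ge0 exprn_ge0.
  apply: filterS yg => t h tT; have [t0 tT'] := andP tT.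
  apply: (le_trans (h tT)).
  have [ie Ee] := seg_exp C2 t0.
  have le1 : \int[leb]_tau (seg t tau * y tau) <= Z * ((expR (2 * C * t) - 1) / (2 * C)).
    rewrite -Ee -(Rint_Z Z ie); apply: Rint_le_ae => //; first exact: iy.
      exact: itgZ.
    apply: filterS IH => u hu; have [ut|ut] := boolP (0 <= u <= t); last by rewrite seg_out// !mul0r mulr0.
    have uT : 0 <= u <= T by rewrite (andP ut).1 (le_trans (andP ut).2).
    by rewrite seg_in// !mul1r; exact: hu.
  (* The halving of the excess, with fixed point Z = 2 a. *)
  have -> : 2 * a + `|Y| * (2 ^+ j.+1)^-1 = a + Z / 2.
    by rewrite /Z exprS invfM; field; rewrite ?expf_neq0// pnatr_eq0.
  apply: (@le_trans _ _ (a + C * (Z * ((expR (2 * C * t) - 1) / (2 * C))))).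
    by rewrite lerD2l ler_wpM2l// ltW.
  have e1 : 1 <= expR (2 * C * t) by rewrite -[leLHS](@expR0 R) ler_expR mulr_ge0// ltW.
  have -> : C * (Z * ((expR (2 * C * t) - 1) / (2 * C))) = Z / 2 * (expR (2 * C * t) - 1).
    by field; rewrite gt_eqF.
  move: e1; move: (expR _) => E e1; have : a <= a * E by rewrite ler_peMr.
  nra.
apply: filterS (ae_foralln step) => t h tT; have [t0 tT'] := andP tT.
have e2 : expR (2 * C * t) <= expR (2 * C * T) by rewrite ler_expR ler_wpM2l// ltW.
apply: (@le_trans _ _ (2 * a * expR (2 * C * t))); last by rewrite ler_wpM2l ?mulr_ge0.
apply/ler_addgt0Pr => eps eps0.
have E0 : 0 < expR (2 * C * t) := expR_gt0 _.
have [N hN] : exists N : nat, `|Y| * expR (2 * C * t) / eps <= N%:R.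
  by exists (Num.truncn (`|Y| * expR (2 * C * t) / eps)).+1; exact/ltW/truncnS_gt.
apply: (le_trans (h N tT)); rewrite mulrDl lerD2l mulrAC.
have p0 : 0 < 2 ^+ N :> R by rewrite exprn_gt0.
rewrite ler_pdivrMr// -ler_pdivrMl// mulrC; apply: le_trans hN _.
by rewrite -natrX ler_nat ltnW// ltn_expl.
Qed.

End time.

(** * Stability in L2 *)

Lemma eq_ler (R : realType) (x y : R) : x = y -> x <= y.
Proof. by move=> ->. Qed.

Lemma half_sum_le (R : realType) (x y c : R) : x <= c -> y <= c -> 2^-1 * (x + y) <= c.
Proof. lra. Qed.

Lemma half_mul_le (R : realType) (d b c E M : R) : d * b <= 1 * b -> 0 <= b ->
  b <= 2^-1 * (c + E) -> E <= M -> 2^-1 * d * b <= 2^-1 * (c + M).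
Proof. by move=> h b0 hb EM; rewrite -mulrA ler_wpM2l//; lra. Qed.

Lemma energy_density_abs (R : realType) (e D rho : R[i]) :
  `|- (2 * complex.Re (e^*%C * D)) + (nsq e + nsq rho)| <= 2 * nsq e + nsq D + nsq rho.
Proof.
rewrite cReM cReC cImC /nsq ler_norml.
move: (complex.Re e) (complex.Im e) (complex.Re D) (complex.Im D) (complex.Re rho) (complex.Im rho) => a b c d x y.
have := sqr_ge0 (a - c); have := sqr_ge0 (a + c); have := sqr_ge0 (b - d); have := sqr_ge0 (b + d).
have := sqr_ge0 x; have := sqr_ge0 y; have := sqr_ge0 a; have := sqr_ge0 b => h1 h2 h3 h4 h5 h6 h7 h8.
apply/andP; split; nra.
Qed.

(** The dissipation p is dropped by its sign, and the remainder is split from e by Young's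
    inequality. *)
Lemma energy_density_le (R : realType) (e D rho : R[i]) (p : R) : 0 <= p ->
  2 * (- (complex.Re D + p * complex.Re e + complex.Re rho) * complex.Re e) +
  2 * (- (complex.Im D + p * complex.Im e + complex.Im rho) * complex.Im e) <=
  - (2 * complex.Re (e^*%C * D)) + (nsq e + nsq rho).
Proof.
rewrite cReM cReC cImC /nsq.
move: (complex.Re e) (complex.Im e) (complex.Re D) (complex.Im D) (complex.Re rho) (complex.Im rho) => a b c d x y p0.
have := sqr_ge0 (a + x); have := sqr_ge0 (b + y).
have := mulr_ge0 p0 (sqr_ge0 a); have := mulr_ge0 p0 (sqr_ge0 b) => h1 h2 h3 h4.
nra.
Qed.

Lemma stab_arith (R : realType) (I A y Q c M eps : R) : Q <= 2 * eps -> - I <= A ->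
  A <= 2^-1 * (c + M) * y -> - (2 * I) + (y + Q) <= (1 + (c + M)) * y + 2 * eps.
Proof. nra. Qed.

Lemma measurable_seg2 (R : realType) d (S : measurableType d) (a b : S -> measurableTypeR R) :
  measurable_fun setT a -> measurable_fun setT b ->
  measurable_fun setT (fun x => seg (a x) (b x)).
Proof.
move=> ma mb.
rewrite (_ : (fun x => _) = (fun x => (0 <= b x)%R%:R * (b x <= a x)%R%:R : R)); last first.
  by apply/funext => x; rewrite /seg; case: (_ <= b x); rewrite ?mul1r ?mul0r.
apply: measurable_funM; apply: measurable_le_nat; try exact: measurable_cst.
- exact: mb.
- exact: mb.
- exact: ma.
Qed.

Section stability.
Context {R : realType}.
Local Notation K := (freqsp R).
Local Notation line := (measurableTypeR R).
Local Notation leb := (@lebesgue_measure R).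
Variable mu : {sigma_finite_measure set K -> \bar R}.
Local Notation Re := complex.Re.
Local Notation Im := complex.Im.
Local Notation cabs := Normc.normc.

Hypothesis mu_refl : refl_invariant mu.
Hypothesis mu_shift : shift_invariant mu.
Hypothesis mu_decay : itg mu (@decay R).

Variables (psi : R -> R) (kappa delta s : R).
Hypothesis psi_ge0 : forall r, 0 <= r -> 0 <= psi r.
Hypotheses (kappa0 : 0 < kappa) (d0 : 0 <= delta) (d1 : delta <= 1) (s4 : 4 <= s).

Local Notation N g := (fun t k => adv mu delta (g t) (g t) k).
Local Notation joint g := (fun p : line * K => g p.1 p.2).

(** Interpolated Euler schemes satisfy this with a small [eps], exact solutions with [eps] = 0 and
    zero remainder. One stability estimate for pairs therefore serves both convergence and
    uniqueness. *)
Record approx_sol (T M eps : R) (g0 : K -> R[i]) (g r : line -> K -> R[i]) : Prop := Approx {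
  ap_meas0 : cmeasurable g0;
  ap_meas : cmeasurable (joint g);
  ap_rmeas : cmeasurable (joint r);
  ap_herm : forall t, hermsym (g t);
  ap_bd : {ae leb, forall t : line, 0 <= t <= T ->
    itg mu (ew s (g t)) /\ \int[mu]_k ew s (g t) k <= M};
  ap_rem : {ae leb, forall t : line, 0 <= t <= T ->
    itg mu (fun k => nsq (r t k)) /\ \int[mu]_k nsq (r t k) <= eps};
  ap_eq : {ae mu, forall k, {ae leb, forall t : line, 0 <= t <= T ->
    g t k = g0 k - cint leb `[0, t] (fun tau =>
      adv mu delta (g tau) (g tau) k + (kappa * psi (modulus k))%:C%C * g tau k + r tau k)}} }.

Lemma cmeas_joint_adv (g : line -> K -> R[i]) : cmeasurable (joint g) -> cmeasurable (joint (N g)).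
Proof. by move=> mg; exact: (cmeas_adv mu delta mg mg). Qed.

Lemma itg_slab (F : line * K -> R) (T C : R) : 0 <= T -> measurable_fun setT F ->
  (forall z, 0 <= F z) ->
  {ae leb, forall t : line, 0 <= t <= T -> itg mu (fun k => F (t, k)) /\ \int[mu]_k F (t, k) <= C} ->
  itg (leb \x mu)%E (fun z => seg T z.1 * F z).
Proof.
move=> T0 mF F0 h.
have ms : measurable_fun setT (fun z : line * K => seg T z.1).
  exact: (measurableT_comp (measurable_seg T) measurable_fst).
have mS : measurable_fun setT (fun z : line * K => seg T z.1 * F z) by exact: measurable_funM.
apply: itg_prod => //.
have iC : itg leb (fun t => `|C| * seg T t) by apply: itgZ; exact: seg_itg.
have := itg_lty iC; apply: le_lt_trans; apply: ge0_le_integral_ae.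
- apply: (measurable_fun_fubini_tonelli_F (fun z => `|seg T z.1 * F z|%:E)) => //.
  by apply/measurable_EFinP; exact: measurableT_comp.
- by apply/measurable_EFinP; apply: measurableT_comp => //; exact: itg_meas iC.
- by move=> t; apply: integral_ge0 => k _; rewrite lee_fin.
- apply: filterS h => t ht; have [tT|tT] := boolP (0 <= t <= T); last first.
    under eq_integral => k _ do rewrite seg_out// mul0r normr0.
    by rewrite integral0 lee_fin.
  have [i le] := ht tT; rewrite seg_in// mulr1.
  under eq_integral => k _ do rewrite /= mul1r ger0_norm//.
  by rewrite -(Rint_EFin i) lee_fin normr_id; exact: le_trans le (ler_norm _).
Qed.

(** Tonelli on a slab of finite length, with |x| <= 1 + x^2: an L2 bound in k uniform in time makes
    almost every frequency integrable in time. *)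
Lemma itg_slab_time (F : line * K -> R[i]) (T C : R) : 0 <= T -> cmeasurable F ->
  {ae leb, forall t : line, 0 <= t <= T ->
    itg mu (fun k => nsq (F (t, k))) /\ \int[mu]_k nsq (F (t, k)) <= C} ->
  {ae mu, forall k, itg leb (fun t => seg T t * Re (F (t, k))) /\
                    itg leb (fun t => seg T t * Im (F (t, k)))}.
Proof.
move=> T0 mF h.
have i := itg_slab T0 (cmeas_nsq mF) (fun z => nsq_ge0 _) h.
apply: filterS (itg_ae2 i) => k /= ik.
have [mr mi] := cmeas_slice2 k mF.
have iG := itgD (seg_itg T0) ik.
have key (x y : R) t : x ^+ 2 <= y -> `|seg T t * x| <= seg T t + seg T t * y.
  move=> xy; rewrite normrM (ger0_norm (seg_ge0 _ _)) -{2}[seg T t]mulr1 -mulrDr.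
  apply: ler_wpM2l; first exact: seg_ge0.
  apply: le_trans (_ : 1 + x ^+ 2 <= _); last by rewrite lerD2l.
  by rewrite -[in leRHS](real_normK (num_real x)); have := sqr_ge0 (`|x| - 1); have := normr_ge0 x; nra.
split; apply: itg_mono iG _.
- by apply: measurable_funM => //; exact: measurable_seg.
- by move=> t; apply: key; rewrite lerDl sqr_ge0.
- by apply: measurable_funM => //; exact: measurable_seg.
- by move=> t; apply: key; rewrite lerDr sqr_ge0.
Qed.

Lemma adv_nsq (g : K -> R[i]) M : cmeasurable g -> itg mu (ew s g) -> \int[mu]_k ew s g k <= M ->
  itg mu (fun k => nsq (adv mu delta g g k)) /\
  \int[mu]_k nsq (adv mu delta g g k) <= 64 * M ^+ 2 * \int[mu]_k decay k.
Proof.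
move=> mg eg EM.
have s3 : 3 <= s by apply: le_trans s4; rewrite ler_nat.
have le : {ae mu, forall k, `|nsq (adv mu delta g g k)| <= 64 * M ^+ 2 * decay k}.
  apply: filterS (ae_shift_at mu_shift) => k sk; rewrite ger0_norm ?nsq_ge0//.
  exact: (adv_nsq_at d0 s3 mg eg EM sk).
have iG := itgZ (64 * M ^+ 2) mu_decay.
have i := itg_mono_ae (cmeas_nsq (cmeas_adv0 mu delta mg mg)) iG le.
split => //; rewrite -Rint_Z//; apply: Rint_le_ae => //.
by apply: filterS le => k; exact: le_trans (ler_norm _).
Qed.

Lemma ew_half f g k : ew s (fun k => (2^-1 : R)%:C%C * (f k + g k)) k <= 2^-1 * (ew s f k + ew s g k).
Proof.
rewrite /ew nsqZ -mulrDr [leRHS]mulrCA; apply: ler_wpM2l; first exact: wsym_ge0.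
have := @nsqD_le R (f k) (g k); lra.
Qed.

Section pair.
Variables (T M eps eps' : R) (g0 g0' : K -> R[i]) (g r g' r' : line -> K -> R[i]).
Hypotheses (T0 : 0 <= T) (ha : approx_sol T M eps g0 g r) (ha' : approx_sol T M eps' g0' g' r').
Hypotheses (e0_itg : itg mu (fun k => nsq (g0 k - g0' k))).
Let e t k := g t k - g' t k.
Let rho t k := r t k - r' t k.
Let Dn t k := N g t k - N g' t k.
(** A majorant of the time derivative of |e|^2 at fixed frequency, without the dissipation, whose
    integrability in k is not among the bounds of [approx_sol]. In the rate C below, the 1 comes
    from Young on the remainder, and the rest from [adv_difference] at the midpoint with delta <=
    1. *)
Let H (z : line * K) := - (2 * Re ((e z.1 z.2)^*%C * Dn z.1 z.2)) + (nsq (e z.1 z.2) + nsq (rho z.1 z.2)).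
Let C := 1 + (\int[mu]_k decay k + M).

Lemma stab_meas : [/\ cmeasurable (joint e), cmeasurable (joint rho), cmeasurable (joint Dn) & measurable_fun setT H].
Proof.
have me : cmeasurable (joint e) by apply: cmeasB; [exact: ap_meas ha|exact: ap_meas ha'].
have mr : cmeasurable (joint rho) by apply: cmeasB; [exact: ap_rmeas ha|exact: ap_rmeas ha'].
have md : cmeasurable (joint Dn).
  by apply: cmeasB; apply: cmeas_joint_adv; [exact: ap_meas ha|exact: ap_meas ha'].
split => //; apply: measurable_funD; last by apply: measurable_funD; exact: cmeas_nsq.
apply: measurableT_comp => //; apply: measurable_funM => //.
by apply: cmeas_Re; apply: cmeasM => //; exact: cmeas_conj.
Qed.

Lemma stab_good : {ae leb, forall t : line, 0 <= t <= T ->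
  [/\ itg mu (fun k => nsq (e t k)), \int[mu]_k nsq (e t k) <= 4 * M,
     itg mu (fun k => nsq (rho t k)), \int[mu]_k nsq (rho t k) <= 2 * (eps + eps') &
   [/\ itg mu (fun k => Re ((e t k)^*%C * Dn t k)),
     `|\int[mu]_k Re ((e t k)^*%C * Dn t k)| <= 2^-1 * (\int[mu]_k decay k + M) * \int[mu]_k nsq (e t k),
     itg mu (fun k => nsq (Dn t k)) & \int[mu]_k nsq (Dn t k) <= 256 * M ^+ 2 * \int[mu]_k decay k]]}.
Proof.
have s0 : 0 <= s by exact: le_trans s4.
have s1 : 1 <= s by apply: le_trans s4; rewrite (ler_nat R 1 4).
have [me mr md mH] := stab_meas.
apply: filterS2 (filterI (ap_bd ha) (ap_rem ha)) (filterI (ap_bd ha') (ap_rem ha')) => t [h1 h2] [h1' h2'] tT.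
have {h1}[eg Eg] := h1 tT. have {h2}[ir Er] := h2 tT. have {h1'}[eg' Eg'] := h1' tT. have {h2'}[ir' Er'] := h2' tT.
have mg : cmeasurable (g t) := cmeas_slice1 t (ap_meas ha).
have mg' : cmeasurable (g' t) := cmeas_slice1 t (ap_meas ha').
have mrt : cmeasurable (r t) := cmeas_slice1 t (ap_rmeas ha).
have mrt' : cmeasurable (r' t) := cmeas_slice1 t (ap_rmeas ha').
have ee : itg mu (ew s (e t)) by exact: itg_ewB.
have met : cmeasurable (e t) := cmeas_slice1 t me.
have ne : itg mu (fun k => nsq (e t k)) := itg_nsq s0 met ee.
have diff2 (u v : K -> R[i]) a b : cmeasurable u -> cmeasurable v ->
   itg mu (fun k => nsq (u k)) -> \int[mu]_k nsq (u k) <= a ->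
   itg mu (fun k => nsq (v k)) -> \int[mu]_k nsq (v k) <= b ->
   itg mu (fun k => nsq (u k - v k)) /\ \int[mu]_k nsq (u k - v k) <= 2 * (a + b).
  move=> mu' mv iu Eu iv Ev; have i2 := itgZ 2 (itgD iu iv).
  have le k : nsq (u k - v k) <= 2 * (nsq (u k) + nsq (v k)) by rewrite -(nsqN (v k)); exact: nsqD_le.
  have i : itg mu (fun k => nsq (u k - v k)).
    apply: itg_mono i2 _; first by apply: cmeas_nsq; exact: cmeasB.
    by move=> k; rewrite ger0_norm ?nsq_ge0.
  split => //; apply: le_trans (Rint_le i i2 le) _.
  by rewrite (Rint_Z 2 (itgD iu iv)) (Rint_D iu iv) ler_wpM2l// lerD.
have ew1 (u : K -> R[i]) : cmeasurable u -> itg mu (ew s u) -> \int[mu]_k nsq (u k) <= \int[mu]_k ew s u k.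
  move=> mu' iu; apply: Rint_le => //; first exact: itg_nsq iu.
  move=> k; rewrite /ew ler_peMl ?nsq_ge0//.
  by have := @wsym_pow R s (modulus k) 0 (modulus_ge0 _); rewrite expr0; apply; rewrite mulr_ge0.
have [i1 E1] := diff2 _ _ _ _ mg mg' (itg_nsq s0 mg eg) (le_trans (ew1 _ mg eg) Eg)
   (itg_nsq s0 mg' eg') (le_trans (ew1 _ mg' eg') Eg').
have [i2 E2] := diff2 _ _ _ _ mrt mrt' ir Er ir' Er'.
have [a1 A1] := adv_nsq mg eg Eg. have [a2 A2] := adv_nsq mg' eg' Eg'.
have [i3 E3] := diff2 _ _ _ _ (cmeas_adv0 mu delta mg mg) (cmeas_adv0 mu delta mg' mg') a1 A1 a2 A2.
pose m k := (2^-1 : R)%:C%C * (g t k + g' t k).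
have mm : cmeasurable m by apply: cmeasM; [exact: cmeas_cst|exact: cmeasD].
have em : itg mu (ew s m) by apply: itg_ewZ; exact: itg_ewD.
have Em : \int[mu]_k ew s m k <= M.
  have i := itgZ 2^-1 (itgD eg eg').
  apply: le_trans (Rint_le em i (ew_half _ _)) _.
  by rewrite (Rint_Z _ (itgD eg eg')) (Rint_D eg eg'); exact: half_sum_le.
have hm : hermsym m by apply: hermZ; apply: hermD; [exact: ap_herm ha t|exact: ap_herm ha' t].
have he : hermsym (e t) by apply: hermB; [exact: ap_herm ha t|exact: ap_herm ha' t].
have [ib Eb] := bw_itg mu_decay s4 mm em.
have [j J] := adv_difference mu_refl mu_shift d0 s1 met mm he hm ee em ib.
have DnE : {ae mu, forall k, adv mu delta (e t) m k + adv mu delta m (e t) k = Dn t k}.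
  apply: filterS (ae_shift_at mu_shift) => k sk.
  by rewrite /Dn; exact/esym/(adv_diff d0 s1 sk mg mg' eg eg').
have mDt : cmeasurable (Dn t) := cmeas_slice1 t md.
have mReD : measurable_fun setT (fun k => Re ((e t k)^*%C * Dn t k)).
  by apply: cmeas_Re; apply: cmeasM => //; exact: cmeas_conj.
have aeq : {ae mu, forall k, Re ((e t k)^*%C * (adv mu delta (e t) m k + adv mu delta m (e t) k)) = Re ((e t k)^*%C * Dn t k)}.
  by apply: filterS DnE => k ->.
split => //; first by apply: le_trans E1 _; apply: eq_ler; ring.
split => //.
- exact: itg_ae_eq j mReD aeq.
- rewrite -(Rint_ae_eq (itg_meas j) mReD aeq); apply: (le_trans J).
  have y0 : 0 <= \int[mu]_k nsq (e t k) by apply: Rintegral_ge0 => k _; exact: nsq_ge0.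
  rewrite mulrA; apply: ler_wpM2r => //.
  have b0 : 0 <= \int[mu]_k bw m k by apply: Rintegral_ge0 => k _; exact: bw_ge0.
  exact: half_mul_le (ler_wpM2r b0 d1) b0 Eb Em.
- by apply: le_trans E3 _; apply: eq_ler; ring.
Qed.

Lemma stab_itg : itg (leb \x mu)%E (fun z => seg T z.1 * H z).
Proof.
have [me mr md mH] := stab_meas.
have ine := itg_slab (F := fun z => nsq (e z.1 z.2)) (C := 4 * M) T0 (cmeas_nsq me) (fun z => nsq_ge0 _).
have {}ine := ine ltac:(by apply: filterS stab_good => t ht tT; have [] := ht tT).
have inr := itg_slab (F := fun z => nsq (rho z.1 z.2)) (C := 2 * (eps + eps')) T0 (cmeas_nsq mr) (fun z => nsq_ge0 _).
have {}inr := inr ltac:(by apply: filterS stab_good => t ht tT; have [] := ht tT).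
have ind := itg_slab (F := fun z => nsq (Dn z.1 z.2)) (C := 256 * M ^+ 2 * \int[mu]_k decay k) T0 (cmeas_nsq md) (fun z => nsq_ge0 _).
have {}ind := ind ltac:(by apply: filterS stab_good => t ht tT; have [_ _ _ _ []] := ht tT).
have iG : itg (leb \x mu)%E (fun z => seg T z.1 * (2 * nsq (e z.1 z.2) + nsq (Dn z.1 z.2) + nsq (rho z.1 z.2))).
  by apply: itg_ext (itgD (itgD (itgZ 2 ine) ind) inr) _ => z /=; ring.
have mS : measurable_fun setT (fun z : line * K => seg T z.1 * H z).
  by apply: measurable_funM => //; exact: (measurableT_comp (measurable_seg T) measurable_fst).
apply: itg_mono mS iG _ => z; rewrite normrM (ger0_norm (seg_ge0 _ _)).
apply: ler_wpM2l; first exact: seg_ge0.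
exact: energy_density_abs.
Qed.

(** At a fixed frequency psi is just a number and the equation a scalar one, so [ode_square] applies
    to the real and imaginary parts. The order of quantifiers, frequency first, is forced by
    this. *)
Lemma stab_square : {ae mu, forall k, {ae leb, forall t : line, 0 <= t <= T ->
  nsq (e t k) <= nsq (g0 k - g0' k) + \int[leb]_tau (seg t tau * H (tau, k))}}.
Proof.
have [me mr md mH] := stab_meas.
have Ng := cmeas_joint_adv (ap_meas ha); have Ng' := cmeas_joint_adv (ap_meas ha').
have tN (q : line -> K -> R[i]) (q0 : K -> R[i]) (rr : line -> K -> R[i]) ee :
  approx_sol T M ee q0 q rr -> {ae leb, forall t : line, 0 <= t <= T ->
    itg mu (fun k => nsq (N q t k)) /\ \int[mu]_k nsq (N q t k) <= 64 * M ^+ 2 * \int[mu]_k decay k}.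
  move=> hq; apply: filterS (ap_bd hq) => t h tT; have [i E] := h tT.
  by apply: adv_nsq => //; exact: (cmeas_slice1 t (ap_meas hq)).
have tg (q : line -> K -> R[i]) (q0 : K -> R[i]) (rr : line -> K -> R[i]) ee :
  approx_sol T M ee q0 q rr -> {ae leb, forall t : line, 0 <= t <= T ->
    itg mu (fun k => nsq (q t k)) /\ \int[mu]_k nsq (q t k) <= M}.
  move=> hq; apply: filterS (ap_bd hq) => t h tT; have [i E] := h tT.
  have mq : cmeasurable (q t) := cmeas_slice1 t (ap_meas hq).
  have s0 : 0 <= s by exact: le_trans s4.
  have i' := itg_nsq s0 mq i; split => //; apply: le_trans E; apply: Rint_le => // k.
  rewrite /ew ler_peMl ?nsq_ge0//.
  by have := @wsym_pow R s (modulus k) 0 (modulus_ge0 _); rewrite expr0; apply; rewrite mulr_ge0.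
have A1 := itg_slab_time T0 Ng (tN _ _ _ _ ha).
have A2 := itg_slab_time T0 Ng' (tN _ _ _ _ ha').
have A3 := itg_slab_time T0 (ap_meas ha) (tg _ _ _ _ ha).
have A4 := itg_slab_time T0 (ap_meas ha') (tg _ _ _ _ ha').
have A5 := itg_slab_time T0 (ap_rmeas ha) (ap_rem ha).
have A6 := itg_slab_time T0 (ap_rmeas ha') (ap_rem ha').
have iH := stab_itg.
apply: filterS3 (filterI (filterI A1 A2) (filterI (filterI A3 A4) (filterI A5 A6)))
  (filterI (ap_eq ha) (ap_eq ha')) (itg_ae2 iH) => k [[[a1 b1] [a2 b2]] [[[a3 b3] [a4 b4]] [[a5 b5] [a6 b6]]]] [E E'] iHk.
pose p := kappa * psi (modulus k).
have p0 : 0 <= p by rewrite mulr_ge0 ?(ltW kappa0)// psi_ge0 ?modulus_ge0.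
have mek : cmeasurable (fun t => e t k) := cmeas_slice2 k me.
have main (part : R[i] -> R) :
    (forall z w, part (z - w) = part z - part w) ->
    (forall a b c, part (a + p%:C%C * b + c) = part a + p * part b + part c) ->
    (forall t F, part (cint leb `[0, t] F) = \int[leb]_(tau in `[0, t]) part (F tau)) ->
    measurable_fun setT (fun t : line => part (e t k)) ->
    itg leb (fun t => seg T t * part (N g t k)) -> itg leb (fun t => seg T t * part (N g' t k)) ->
    itg leb (fun t => seg T t * part (g t k)) -> itg leb (fun t => seg T t * part (g' t k)) ->
    itg leb (fun t => seg T t * part (r t k)) -> itg leb (fun t => seg T t * part (r' t k)) ->
    let f t := - (part (Dn t k) + p * part (e t k) + part (rho t k)) in
    itg leb (fun tau => seg T tau * (f tau * part (e tau k))) /\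
    {ae leb, forall t : line, 0 <= t <= T ->
      part (e t k) ^+ 2 = part (g0 k - g0' k) ^+ 2 + 2 * \int[leb]_tau (seg t tau * (f tau * part (e tau k)))}.
  move=> pB pF pC mu_ i1 i2 i3 i4 i5 i6 f.
  pose F1 tau := part (N g tau k) + p * part (g tau k) + part (r tau k).
  pose F2 tau := part (N g' tau k) + p * part (g' tau k) + part (r' tau k).
  have iF1 : itg leb (fun t => seg T t * F1 t).
    by apply: itg_ext (itgD (itgD i1 (itgZ p i3)) i5) _ => t; rewrite /F1; ring.
  have iF2 : itg leb (fun t => seg T t * F2 t).
    by apply: itg_ext (itgD (itgD i2 (itgZ p i4)) i6) _ => t; rewrite /F2; ring.
  have fE t : f t = F2 t - F1 t by rewrite /f /F1 /F2 /Dn /e /rho !pB; ring.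
  have iF : itg leb (fun t => seg T t * f t).
    by apply: itg_ext (itgB iF2 iF1) _ => t; rewrite fE mulrBr.
  apply: ode_square => //.
  apply: filterS2 E E' => t h h' tT; have [t0 tT'] := andP tT.
  have j1 := itg_seg_le tT' iF1; have j2 := itg_seg_le tT' iF2.
  have -> : \int[leb]_tau (seg t tau * f tau) = \int[leb]_tau (seg t tau * F2 tau) - \int[leb]_tau (seg t tau * F1 tau).
    by rewrite -(Rint_B j2 j1); congr Rintegral; apply/funext => x; rewrite fE mulrBr.
  rewrite /e (h tT) (h' tT) !pB !pC !Rint_seg.
  have c1 : \int[leb]_tau (seg t tau * part (adv mu delta (g tau) (g tau) k + (kappa * psi (modulus k))%:C%C * g tau k + r tau k)) =
     \int[leb]_tau (seg t tau * F1 tau) by congr Rintegral; apply/funext => x; rewrite pF.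
  have c2 : \int[leb]_tau (seg t tau * part (adv mu delta (g' tau) (g' tau) k + (kappa * psi (modulus k))%:C%C * g' tau k + r' tau k)) =
     \int[leb]_tau (seg t tau * F2 tau) by congr Rintegral; apply/funext => x; rewrite pF.
  by rewrite c1 c2; ring.
have [jr Er] := main (@complex.Re R) cReB (fun a b c => etrans (cReD _ _) (congr1 (+%R^~ _) (etrans (cReD _ _) (congr1 (+%R _) (cReZ _ _)))))
  (fun t F => erefl) (cmeas_Re mek) a1 a2 a3 a4 a5 a6.
have [ji Ei] := main (@complex.Im R) cImB (fun a b c => etrans (cImD _ _) (congr1 (+%R^~ _) (etrans (cImD _ _) (congr1 (+%R _) (cImZ _ _)))))
  (fun t F => erefl) (cmeas_Im mek) b1 b2 b3 b4 b5 b6.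
apply: filterS2 Er Ei => t hr hi tT; have [t0 tT'] := andP tT.
have kr := itgZ 2 (itg_seg_le tT' jr); have ki := itgZ 2 (itg_seg_le tT' ji).
have kH := itg_seg_le tT' iHk.
rewrite [leLHS]/nsq (hr tT) (hi tT) addrACA; apply: lerD => //.
rewrite -(Rint_Z 2 (itg_seg_le tT' jr)) -(Rint_Z 2 (itg_seg_le tT' ji)) -(Rint_D kr ki).
apply: Rint_le => //; first exact: itgD.
move=> x; have q := ler_wpM2l (seg_ge0 t x) (energy_density_le (e x k) (Dn x k) (rho x k) p0).
by apply: le_trans q; apply: eq_ler; ring.
Qed.

(** The pointwise inequality of [stab_square] is integrated in k, where the cancellation of
    [adv_difference] becomes available, and Gronwall closes the estimate. The rate involves neither
    the cut-off nor psi. *)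
Lemma stability_estimate : 0 <= M -> 0 <= eps -> 0 <= eps' ->
  {ae leb, forall t : line, 0 <= t <= T ->
    \int[mu]_k nsq (g t k - g' t k) <=
    2 * (\int[mu]_k nsq (g0 k - g0' k) + 2 * T * (eps + eps')) * expR (2 * C * T)}.
Proof.
move=> M0 ep0 ep0'.
have [me mr md mH] := stab_meas.
pose y (t : line) := \int[mu]_k nsq (e t k).
have my : measurable_fun setT y by exact: (measurable_Rint1 mu (cmeas_nsq me)).
have c0 : 0 <= \int[mu]_k decay k by apply: Rintegral_ge0 => k _; exact: decay_ge0.
have C0 : 0 < C by rewrite /C; have := addr_ge0 c0 M0; lra.
have y00 : 0 <= \int[mu]_k nsq (g0 k - g0' k) by apply: Rintegral_ge0 => k _; exact: nsq_ge0.
have E0 : 0 <= 2 * T * (eps + eps') by rewrite mulr_ge0 ?addr_ge0// mulr_ge0.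
have yb : {ae leb, forall t : line, 0 <= t <= T -> 0 <= y t <= 4 * M}.
  apply: filterS stab_good => t h tT; have [_ E _ _ _] := h tT; rewrite E andbT.
  by apply: Rintegral_ge0 => k _; exact: nsq_ge0.
have := @gronwall R T C (\int[mu]_k nsq (g0 k - g0' k) + 2 * T * (eps + eps')) (4 * M) y C0 (addr_ge0 y00 E0) T0 my yb.
apply.
have iH : itg (leb \x mu)%E (fun z => seg T z.1 * H z) by exact: stab_itg.
pose q (z : K * line) := nsq (e z.2 z.1) - (nsq (g0 z.1 - g0' z.1) + \int[leb]_tau (seg z.2 tau * H (tau, z.1))).
have mq : measurable_fun setT q.
  apply: measurable_funB; first exact: (measurableT_comp (cmeas_nsq me) (measurable_fun_pair measurable_snd measurable_fst)).
  apply: measurable_funD.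
    have mg0 : measurable_fun setT (fun k => nsq (g0 k - g0' k)).
      by apply: cmeas_nsq; apply: cmeasB; [exact: ap_meas0 ha|exact: ap_meas0 ha'].
    exact: (measurableT_comp mg0 measurable_fst).
  apply: (@measurable_Rint1 _ _ (K * line)%type line R leb (fun w => seg w.1.2 w.2 * H (w.2, w.1.1))).
  have m1 : measurable_fun setT (fun w : (K * line) * line => w.1) by exact: measurable_fst.
  have m2 : measurable_fun setT (fun w : (K * line) * line => w.2) by exact: measurable_snd.
  apply: measurable_funM.
    by apply: measurable_seg2 => //; exact: (measurableT_comp measurable_snd m1).
  apply: (measurableT_comp mH); apply: measurable_fun_pair => //.
  exact: (measurableT_comp measurable_fst m1).
(* The inequality is known at almost every time for almost every frequency; integrating in k at
   fixed t requires the opposite order. *)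
have sw : {ae leb, forall t : line, {ae mu, forall k, 0 <= t <= T -> q (k, t) <= 0}}.
  pose A := [set z : K * line | 0 <= z.2 <= T -> q z <= 0].
  apply: (@measurable_ae_ae _ _ K line R mu leb A); last first.
    apply: filterS stab_square => k; apply: filterS => t h tT.
    by rewrite /A /q /= subr_le0; exact: h.
  have mS : measurable_fun setT (fun z : K * line => seg T z.2 * q z).
    by apply: measurable_funM => //; exact: (measurableT_comp (measurable_seg T) measurable_snd).
  rewrite (_ : A = setT `&` (fun z : K * line => seg T z.2 * q z) @^-1` `]-oo, 0]%classic).
    by apply: mS => //; exact: measurable_itv.
  rewrite setTI; apply/seteqP; split => z /=; rewrite in_itv /= /A /=.
    have [zT h|zT _] := boolP (0 <= z.2 <= T); first by rewrite seg_in// mul1r h.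
    by rewrite seg_out// mul0r.
  by move=> h zT; move: h; rewrite seg_in// mul1r.
have y1 : {ae leb, forall t : line, 0 <= t <= T -> \int[mu]_k H (t, k) <= C * y t + 2 * (eps + eps')}.
  apply: filterS stab_good => t h tT; have [i1 _ i2 E2 [i3 E3 _ _]] := h tT.
  rewrite /H (Rint_D (itgN (itgZ 2 i3)) (itgD i1 i2)) (Rint_D i1 i2) (Rint_N (itgZ 2 i3)) (Rint_Z 2 i3).
  rewrite -/(y t) in E3 *.
  have := ler_norm (- \int[mu]_k Re ((e t k)^*%C * Dn t k)); rewrite normrN => q1.
  exact: stab_arith E2 q1 E3.
apply: filterS2 sw stab_good => t hq hg tT; have [t0 tT'] := andP tT.
have [i1 _ i2 E2 [i3 E3 _ _]] := hg tT.
have iHt : itg (leb \x mu)%E (fun z => seg t z.1 * H z).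
  have mS : measurable_fun setT (fun z : line * K => seg t z.1 * (seg T z.1 * H z)).
    by apply: measurable_funM; [exact: (measurableT_comp (measurable_seg t) measurable_fst)|exact: itg_meas iH].
  have i : itg (leb \x mu)%E (fun z => seg t z.1 * (seg T z.1 * H z)).
    apply: itg_mono mS (itg_norm iH) _ => z.
    by rewrite normrM ler_piMl// ger0_norm ?seg_ge0 ?seg_le1.
  by apply: itg_ext i _ => z; rewrite mulrA seg_mul.
have swH := itg_swap iHt.
have le1 : y t <= \int[mu]_k (nsq (g0 k - g0' k) + \int[leb]_tau (seg t tau * H (tau, k))).
  apply: Rint_le_ae => //; first by apply: itgD => //; exact: (itg_Rint1 swH).
  by apply: filterS hq => k /(_ tT); rewrite /q /= subr_le0.
apply: (le_trans le1); rewrite (Rint_D e0_itg (itg_Rint1 swH)) -addrA lerD2l.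
rewrite -(Rint_fubini iHt) /=.
have iy : itg leb (fun tau => seg t tau * y tau).
  apply: (@itg_mono_ae _ _ _ _ _ (fun tau => 4 * M * seg t tau)).
  - by apply: measurable_funM => //; exact: measurable_seg.
  - by apply: itgZ; exact: seg_itg.
  - apply: filterS yb => x hx; have [xt|xt] := boolP (0 <= x <= t); last by rewrite seg_out// mul0r normr0 mulr0.
    have xT : 0 <= x <= T by rewrite (andP xt).1 (le_trans (andP xt).2 tT').
    by rewrite seg_in// mul1r mulr1; have /andP[q0 q1] := hx xT; rewrite ger0_norm.
have is1 := seg_itg t0.
have iCy1 := itgD (itgZ C iy) (itgZ (2 * (eps + eps')) is1).
have iCy : itg leb (fun tau => seg t tau * (C * y tau + 2 * (eps + eps'))).
  by apply: itg_ext iCy1 _ => x; ring.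
apply: (@le_trans _ _ (\int[leb]_tau (seg t tau * (C * y tau + 2 * (eps + eps'))))).
  apply: Rint_le_ae => //.
  - exact: (itg_Rint1 iHt).
  - apply: filterS2 y1 (itg_ae1 iHt) => x hx ix.
    have [xt|xt] := boolP (0 <= x <= t); last first.
      by rewrite seg_out//; under eq_Rintegral do rewrite /= mul0r; rewrite Rintegral_cst// !mul0r.
    rewrite seg_in// mul1r; under eq_Rintegral do rewrite mul1r.
    by apply: hx; rewrite (andP xt).1 (le_trans (andP xt).2 tT').
have -> : \int[leb]_tau (seg t tau * (C * y tau + 2 * (eps + eps'))) =
    C * \int[leb]_tau (seg t tau * y tau) + 2 * (eps + eps') * t.
  have Es := Rint_Z (2 * (eps + eps')) is1; rewrite (Rint_seg1 t0) in Es.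
  rewrite -Es -(Rint_Z C iy) -(Rint_D (itgZ C iy) (itgZ _ is1)).
  by congr Rintegral; apply/funext => x; ring.
rewrite [leLHS]addrC lerD2r [leRHS]mulrAC; apply: ler_wpM2l => //.
by rewrite mulr_ge0 ?addr_ge0.
Qed.

End pair.
End stability.

(** * Approximate solutions *)

Lemma nsq_convex (R : realType) (lam : R) (z w : R[i]) : 0 <= lam -> lam <= 1 ->
  nsq ((1 - lam)%:C%C * z + lam%:C%C * w) <= (1 - lam) * nsq z + lam * nsq w.
Proof.
rewrite /nsq !cReD !cImD !cReZ !cImZ.
move: (complex.Re z) (complex.Im z) (complex.Re w) (complex.Im w) => a b c d l0 l1.
have l2 : 0 <= lam * (1 - lam) by rewrite mulr_ge0// subr_ge0.
have h := addr_ge0 (mulr_ge0 l2 (sqr_ge0 (a - c))) (mulr_ge0 l2 (sqr_ge0 (b - d))).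
rewrite -subr_ge0; apply: le_trans h _; apply: eq_ler; ring.
Qed.

Lemma convex_le (R : realType) (lam x y c : R) : 0 <= lam -> lam <= 1 -> x <= c -> y <= c ->
  (1 - lam) * x + lam * y <= c.
Proof.
move=> l0 l1 xc yc; have -> : c = (1 - lam) * c + lam * c by ring.
by apply: lerD; apply: ler_wpM2l => //; rewrite subr_ge0.
Qed.

Lemma mod10_gt0 (R : realType) (k : freqsp R) : 0 < 10 + modulus k.
Proof. by have := modulus_ge0 k; lra. Qed.

Section interpolation.
Context {R : realType}.
Local Notation K := (freqsp R).
Local Notation line := (measurableTypeR R).
Local Notation leb := (@lebesgue_measure R).
Variable mu : {sigma_finite_measure set K -> \bar R}.
Local Notation Re := complex.Re.
Local Notation Im := complex.Im.
Local Notation cabs := Normc.normc.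

Hypothesis mu_refl : refl_invariant mu.
Hypothesis mu_shift : shift_invariant mu.
Hypothesis mu_decay : itg mu (@decay R).

Variables (psi : R -> R) (kappa delta s : R).
Hypothesis mpsi : measurable_fun setT psi.
Hypothesis psi_ge0 : forall r, 0 <= r -> 0 <= psi r.
Hypotheses (kappa0 : 0 < kappa) (d0 : 0 <= delta) (s4 : 4 <= s).
Variable Xi0 : R.
Hypothesis Xi00 : 0 < Xi0.
Hypothesis psi_log : forall r, Xi0 < r -> lsym r <= psi r.
Variable N2 : R.
Hypothesis N20 : 0 <= N2.
Local Notation Mb := (Mb s Xi0 N2).
Hypothesis small_delta : Ktriad s * delta * (\int[mu]_k decay k + Mb) <= 2 * kappa.

Variables (n : R) (chi : K -> R).
Hypotheses (n0 : 0 <= n) (Hchi : cutoff psi n chi).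
Local Notation rate := (rate mu psi kappa delta chi).
Local Notation tame := (tame mu chi).
Local Notation Kn := (Kn mu kappa s n Mb).

Variable (g0 : K -> R[i]).
Hypotheses (tg0 : tame g0) (Eg0 : \int[mu]_k ew s g0 k <= N2).

Section step.
Variables (h : R) (J : nat).
Hypothesis h0 : 0 < h.
Let T := J%:R * h.
Hypotheses (hT : T * h * Kn <= 1) (hK : h * Kn <= kappa) (hk : h * kappa <= 1).
Local Notation euler := (euler mu psi kappa delta chi h g0).

(** At nonnegative times [slot] is the indicator of the interval from j h, excluded, to (j + 1) h,
    included; [clock] is its primitive from 0, the time spent in that interval before t. *)
Definition slot (j : nat) (t : R) : R := seg (j.+1%:R * h) t - seg (j%:R * h) t.
Definition clock (j : nat) (t : R) : R := Num.min t (j.+1%:R * h) - Num.min t (j%:R * h).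

(** The piecewise linear interpolant of the scheme, written as a sum over all steps so that joint
    measurability and integration in time are immediate. *)
Definition inter (t : line) (k : K) : R[i] :=
  g0 k - \sum_(0 <= j < J) (clock j t)%:C%C * rate (euler j) k.

(** The residual of the untruncated equation along the interpolant. With this definition the
    equation holds exactly and only the size of the residual needs proof. *)
Definition remainder (t : line) (k : K) : R[i] :=
  \sum_(0 <= j < J) (slot j t)%:C%C * rate (euler j) k -
  (adv mu delta (inter t) (inter t) k + (kappa * psi (modulus k))%:C%C * inter t k).

Lemma euler_tame' j : tame (euler j).
Proof. exact: (euler_tame mu_refl mu_shift mu_decay mpsi psi_ge0 kappa0 d0 s4 n0 Hchi h tg0 j). Qed.

Lemma euler_sum i k : euler i k = g0 k - \sum_(0 <= j < i) h%:C%C * rate (euler j) k.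
Proof.
elim: i => [|i IH]; first by rewrite big_geq// subr0.
by rewrite big_nat_recr//= {1}IH opprD addrA.
Qed.

Lemma clock_past i j t : i%:R * h < t -> (j < i)%N -> clock j t = h.
Proof.
move=> it ji; have ji' : j.+1%:R * h <= i%:R * h by rewrite ler_wpM2r ?ler_nat// ltW.
have jj : j%:R * h <= j.+1%:R * h by rewrite ler_wpM2r ?ler_nat// ltW.
have tj := le_trans ji' (ltW it).
rewrite /clock (min_r tj) (min_r (le_trans jj tj)).
by rewrite -natr1; ring.
Qed.

Lemma clock_now i t : i%:R * h < t -> t <= i.+1%:R * h -> clock i t = t - i%:R * h.
Proof. by move=> it ti; rewrite /clock (min_l ti) min_r// ltW. Qed.

Lemma clock_future i j t : t <= i.+1%:R * h -> (i < j)%N -> clock j t = 0.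
Proof.
move=> ti ij; have ij' : i.+1%:R * h <= j%:R * h by rewrite ler_wpM2r ?ler_nat// ltW.
have jj : j%:R * h <= j.+1%:R * h by rewrite ler_wpM2r ?ler_nat// ltW.
have tj := le_trans ti ij'.
by rewrite /clock (min_l tj) (min_l (le_trans tj jj)) subrr.
Qed.

Lemma slot_eq i j t : i%:R * h < t -> t <= i.+1%:R * h -> slot j t = (j == i)%:R.
Proof.
move=> it ti; have t0 : 0 <= t by apply: le_trans (ltW it); rewrite mulr_ge0// ltW.
rewrite /slot /seg t0 /=; case: (ltngtP j i) => [ji|ij|->].
- have ji' : j.+1%:R * h <= i%:R * h by rewrite ler_wpM2r ?ler_nat// ltW.
  have jj : j%:R * h <= j.+1%:R * h by rewrite ler_wpM2r ?ler_nat// ltW.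
  by rewrite !leNgt (le_lt_trans ji' it) (le_lt_trans jj (le_lt_trans ji' it)) /= subr0.
- have ij' : i.+1%:R * h <= j%:R * h by rewrite ler_wpM2r ?ler_nat// ltW.
  have jj : j%:R * h <= j.+1%:R * h by rewrite ler_wpM2r ?ler_nat// ltW.
  by rewrite (le_trans ti ij') (le_trans (le_trans ti ij') jj) subrr.
- by rewrite ti leNgt it /= subr0.
Qed.

Lemma find_slot t : 0 < t -> t <= T -> exists2 i, (i < J)%N & i%:R * h < t /\ t <= i.+1%:R * h.
Proof.
move=> t0; rewrite /T; elim: J => [|m IH]; first by rewrite mul0r leNgt t0.
have [tm _|tm tm1] := leP t (m%:R * h); last by exists m.
by have [i im ii] := IH tm; exists i => //; exact: leqW.
Qed.

Lemma inter_slot i t k : (i < J)%N -> i%:R * h < t -> t <= i.+1%:R * h ->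
  inter t k = euler i k - (t - i%:R * h)%:C%C * rate (euler i) k.
Proof.
move=> iJ it ti; rewrite /inter euler_sum (@big_cat_nat _ _ _ i)//=; last exact: ltnW.
rewrite [X in _ - (_ + X)]big_ltn// (clock_now it ti) [X in _ + (_ + X)]big_nat_cond.
rewrite [X in _ + (_ + X)]big1; last first.
  by move=> j /andP[/andP[ij _] _]; rewrite (clock_future ti ij) mul0r.
rewrite addr0 opprD addrA; congr (_ - _ - _).
by apply: eq_big_nat => j /andP[_ ji]; rewrite (clock_past it ji).
Qed.

Lemma slot_sum i t (F : nat -> R[i]) : (i < J)%N -> i%:R * h < t -> t <= i.+1%:R * h ->
  \sum_(0 <= j < J) (slot j t)%:C%C * F j = F i.
Proof.
move=> iJ it ti; rewrite big_mkord (bigD1 (Ordinal iJ))//= big1; last first.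
  by move=> j ji; rewrite (slot_eq j it ti) (negbTE (_ : (j : nat) != i))// mul0r.
by rewrite (slot_eq i it ti) eqxx mul1r addr0.
Qed.

Lemma clock_integral j t : 0 <= t ->
  itg leb (fun tau => seg t tau * slot j tau) /\ \int[leb]_tau (seg t tau * slot j tau) = clock j t.
Proof.
move=> t0.
have sm a b tau : seg a tau * seg b tau = seg (Num.min a b) tau.
  rewrite /seg le_min; case: (0 <= tau) => /=; last by rewrite mul0r.
  by case: (tau <= a); rewrite ?mul1r ?mul0r.
have e tau : seg t tau * slot j tau = seg (Num.min t (j.+1%:R * h)) tau - seg (Num.min t (j%:R * h)) tau.
  by rewrite /slot mulrBr !sm.
have a0 i : 0 <= Num.min t (i%:R * h) by rewrite le_min t0 mulr_ge0// ltW.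
have i1 := seg_itg (a0 j.+1); have i2 := seg_itg (a0 j).
split; first by apply: itg_ext (itgB i1 i2) _ => tau; rewrite e.
rewrite /clock -(Rint_seg1 (a0 j.+1)) -(Rint_seg1 (a0 j)) -(Rint_B i1 i2).
by congr Rintegral; apply/funext => tau; exact: e.
Qed.

Lemma cmeas_bigsum d (S : measurableType d) (m : nat) (F : nat -> S -> R[i]) :
  (forall j, cmeasurable (F j)) -> cmeasurable (fun x => \sum_(0 <= j < m) F j x).
Proof.
move=> mF; elim: m => [|m IH].
  by apply: cmeas_ext (cmeas_cst 0) _ => x; rewrite big_geq.
by apply: cmeas_ext (cmeasD IH (mF m)) _ => x; rewrite big_nat_recr.
Qed.

Lemma measurable_clock j : measurable_fun (setT : set line) (clock j).
Proof. by apply: measurable_funB; apply: measurable_minr. Qed.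

Lemma measurable_slot j : measurable_fun (setT : set line) (slot j).
Proof. by apply: measurable_funB; exact: measurable_seg. Qed.

Lemma cmeas_scaled (c : nat -> line -> R) : (forall j, measurable_fun setT (c j)) ->
  cmeasurable (fun p : line * K => \sum_(0 <= j < J) (c j p.1)%:C%C * rate (euler j) p.2).
Proof.
move=> mc; apply: (cmeas_bigsum J (F := fun j (p : line * K) => (c j p.1)%:C%C * rate (euler j) p.2)) => j.
apply: cmeasM; first by apply: cmeas_real; exact: (measurableT_comp (mc j) measurable_fst).
have mr := cmeas_rate mu kappa delta mpsi Hchi (tame_meas (euler_tame' j)).
exact: (cmeas_comp mr measurable_snd).
Qed.

Lemma cmeas_inter : cmeasurable (fun p : line * K => inter p.1 p.2).
Proof.
apply: cmeasB; last exact: (cmeas_scaled measurable_clock).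
exact: (cmeas_comp (tame_meas tg0) measurable_snd).
Qed.

Lemma cmeas_remainder : cmeasurable (fun p : line * K => remainder p.1 p.2).
Proof.
apply: cmeasB; first exact: (cmeas_scaled measurable_slot).
apply: cmeasD; first exact: (cmeas_adv mu delta cmeas_inter cmeas_inter).
apply: cmeasM; last exact: cmeas_inter.
apply: cmeas_real; apply: measurable_funM => //.
exact: (measurableT_comp (measurable_psimod mpsi) measurable_snd).
Qed.

Lemma inter_herm t : hermsym (inter t).
Proof.
have hs m : hermsym (fun k => \sum_(0 <= j < m) (clock j t)%:C%C * rate (euler j) k).
  elim: m => [|m IH].
    rewrite (_ : (fun k => _) = fun=> 0); last by apply/funext => k; rewrite big_geq.
    by move=> k; apply: complex_ext; rewrite ?cReC ?cImC /= ?oppr0.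
  rewrite (_ : (fun k => _) = fun k => \sum_(0 <= j < m) (clock j t)%:C%C * rate (euler j) k + (clock m t)%:C%C * rate (euler m) k).
    apply: (hermD IH); apply: hermZ.
    have tj := euler_tame' m.
    exact: (rate_herm mu_refl kappa delta Hchi (tame_meas tj) (tame_herm tj)).
  by apply/funext => k; rewrite big_nat_recr.
by apply: hermB => //; exact: tame_herm tg0.
Qed.

Lemma cint_bigsum (t : R) (F : nat -> R[i]) : 0 <= t ->
  cint leb `[0, t] (fun tau => \sum_(0 <= j < J) (slot j tau)%:C%C * F j) =
  \sum_(0 <= j < J) (clock j t)%:C%C * F j.
Proof.
move=> t0.
have Rs m (c : nat -> R) : Re (\sum_(0 <= j < m) (c j)%:C%C * F j) = \sum_(j < m) c j * Re (F j).
  by rewrite big_mkord; elim/big_ind2: _ => // [x a y b <- <-|j _]; rewrite ?cReD ?cReZ.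
have Is m (c : nat -> R) : Im (\sum_(0 <= j < m) (c j)%:C%C * F j) = \sum_(j < m) c j * Im (F j).
  by rewrite big_mkord; elim/big_ind2: _ => // [x a y b <- <-|j _]; rewrite ?cImD ?cImZ.
have key (a : nat -> R) : \int[leb]_tau (seg t tau * \sum_(j < J) slot j tau * a j) =
    \sum_(j < J) clock j t * a j.
  have i j : itg leb (fun tau => a j * (seg t tau * slot j tau)) by apply: itgZ; exact: (clock_integral j t0).1.
  transitivity (\int[leb]_tau (\sum_(j < J) a j * (seg t tau * slot j tau))).
    congr Rintegral; apply/funext => tau; rewrite mulr_sumr; apply: eq_bigr => j _; ring.
  rewrite (Rint_sum J i); apply: eq_bigr => j _.
  have [i1 E1] := clock_integral j t0.
  by rewrite (Rint_Z (a j) i1) E1 mulrC.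
apply: complex_ext; rewrite /cint /=.
  rewrite (Rs J (clock ^~ t)) Rint_seg -(key (fun j => Re (F j))); congr Rintegral; apply/funext => tau.
  by rewrite (Rs J (slot ^~ tau)).
rewrite (Is J (clock ^~ t)) Rint_seg -(key (fun j => Im (F j))); congr Rintegral; apply/funext => tau.
by rewrite (Is J (slot ^~ tau)).
Qed.

Lemma euler_Mb i : (i <= J)%N -> \int[mu]_k ew s (euler i) k <= Mb.
Proof.
move=> iJ; have iT : i%:R * h <= T by rewrite ler_wpM2r ?ler_nat// ltW.
exact: (euler_bound mu_refl mu_shift mu_decay mpsi psi_ge0 kappa0 d0 s4 n0 Hchi Xi00 psi_log N20 (ltW h0) small_delta hT hK hk tg0 Eg0 iT).2.
Qed.

(** Inside a step the interpolant is a convex combination of two Euler states, and the energy is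
    convex, so the bound [Mb] persists between grid times. *)
Lemma inter_ew i t : (i < J)%N -> i%:R * h < t -> t <= i.+1%:R * h ->
  \int[mu]_k ew s (inter t) k <= Mb.
Proof.
move=> iJ it ti; pose lam := (t - i%:R * h) / h.
have lam0 : 0 <= lam by rewrite divr_ge0 ?subr_ge0 ?ltW.
have lam1 : lam <= 1 by rewrite ler_pdivrMr// mul1r lerBlDl; move: ti; rewrite -natr1; lra.
have e0 := tame_ew Hchi s (euler_tame' i); have e1 := tame_ew Hchi s (euler_tame' i.+1).
have E0 := euler_Mb (ltnW iJ); have E1 := euler_Mb iJ.
have conv k : inter t k = (1 - lam)%:C%C * euler i k + lam%:C%C * euler i.+1 k.
  have hn0 : h != 0 by rewrite gt_eqF.
  rewrite (inter_slot k iJ it ti) /=; apply: complex_ext.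
    rewrite ?(cReB, cReD, cReZ) /lam; by field.
  rewrite ?(cImB, cImD, cImZ) /lam; by field.
have G0 := itgZ (1 - lam) e0; have G1 := itgZ lam e1.
have met : cmeasurable (inter t) := cmeas_slice1 t cmeas_inter.
have le k : ew s (inter t) k <= (1 - lam) * ew s (euler i) k + lam * ew s (euler i.+1) k.
  rewrite /ew conv !(mulrCA _ (wsym _ _)) -mulrDr; apply: ler_wpM2l; first exact: wsym_ge0.
  exact: nsq_convex.
have iM : itg mu (ew s (inter t)).
  apply: itg_mono (itgD G0 G1) _; first exact: measurable_ew.
  by move=> k; rewrite ger0_norm ?ew_ge0.
apply: le_trans (Rint_le iM (itgD G0 G1) le) _.
rewrite (Rint_D G0 G1) (Rint_Z _ e0) (Rint_Z _ e1).
by apply: convex_le.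
Qed.

Lemma inter_tame i t : (i < J)%N -> i%:R * h < t -> t <= i.+1%:R * h -> tame (inter t).
Proof.
move=> iJ it ti; rewrite (_ : inter t = fun k => euler i k - (t - i%:R * h)%:C%C * rate (euler i) k).
  exact: (tame_step mu_refl mu_shift mu_decay mpsi psi_ge0 kappa0 d0 s4 n0 Hchi _ (euler_tame' i)).
by apply/funext => k; exact: inter_slot.
Qed.

Definition Qn : R := 2 * (16 * n ^+ 2 * (Kn + Mb) ^+ 2 * (10 + n) ^+ 4 * \int[mu]_k decay k + kappa ^+ 2 * n ^+ 2 * Kn).

(** Two sources of error. Outside the cut-off the nonlinearity of the full equation survives and is
    bounded by the tail of [decay]; inside, the rate is frozen at the start of the step, an error of
    order h. *)
Lemma remainder_bound i t : (i < J)%N -> i%:R * h < t -> t <= i.+1%:R * h ->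
  itg mu (fun k => nsq (remainder t k)) /\
  \int[mu]_k nsq (remainder t k) <= 64 * Mb ^+ 2 * \int[mu]_k ((1 - chi k) * decay k) + h ^+ 2 * Qn.
Proof.
have n00 : 0 <= 10 + n by apply: addr_ge0.
move=> iJ it ti; set th := t - i%:R * h.
have th0 : 0 <= th by rewrite subr_ge0 ltW.
have th1 : th <= h by rewrite /th lerBlDl; move: ti; rewrite -natr1; lra.
have th2 : th ^+ 2 <= h ^+ 2 by rewrite ler_pXn2r ?nnegrE// ltW.
set g := inter t; set f := euler i; set F := rate f.
have tg : tame g := inter_tame iJ it ti. have tf : tame f := euler_tame' i.
have Eg := inter_ew iJ it ti; have Ef := euler_Mb (ltnW iJ); rewrite -/g -/f in Eg Ef.
have gE k : g k = f k - th%:C%C * F k := inter_slot k iJ it ti.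
have mg := tame_meas tg; have mf := tame_meas tf.
have mF : cmeasurable F := cmeas_rate mu kappa delta mpsi Hchi mf.
have eg := tame_ew Hchi s tg; have ef := tame_ew Hchi s tf.
have s0 : 0 <= s by exact: le_trans s4.
have s1 : 1 <= s by apply: le_trans s4; rewrite (ler_nat R 1 4).
have M0 : 0 <= Mb := Mb_ge0 s Xi00 N20.
have K0 : 0 <= Kn := @Kn_ge0 R mu kappa s n _ M0.
have [iF0 EF0] := rate_nsq_le mu_shift mu_decay mpsi psi_ge0 kappa0 d0 s4 n0 Hchi tf (lexx 0) s0 Ef.
have rE k : remainder t k = F k - (adv mu delta g g k + (kappa * psi (modulus k))%:C%C * g k).
  by rewrite /remainder (slot_sum _ iJ it ti).
pose G k := 64 * Mb ^+ 2 * ((1 - chi k) * decay k) +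
   2 * (h ^+ 2 * (16 * n ^+ 2 * (Kn + Mb) ^+ 2 * (10 + n) ^+ 4) * decay k + h ^+ 2 * (kappa ^+ 2 * n ^+ 2) * nsq (F k)).
have mchi := cut_meas Hchi.
have idc : itg mu (fun k => (1 - chi k) * decay k).
  apply: itg_mono mu_decay _.
    by apply: measurable_funM; [exact: measurable_funB|exact: itg_meas mu_decay].
  move=> k; have c0 := cut_ge0 Hchi k; have c1 := cut_le1 Hchi k; have dk := decay_ge0 k.
  have c2 : 0 <= 1 - chi k by rewrite subr_ge0.
  by rewrite (ger0_norm (mulr_ge0 c2 dk)) ler_piMl// gerBl.
have inF : itg mu (fun k => nsq (F k)) by exact: itg_ew0.
have EnF : \int[mu]_k nsq (F k) <= Kn.
  by apply: le_trans EF0; apply: eq_ler; congr Rintegral; apply/funext => k; rewrite ew0.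
have iG : itg mu G.
  by apply: itgD; [exact: itgZ|apply: itgZ; apply: itgD; exact: itgZ].
have mr : cmeasurable (remainder t) := cmeas_slice1 t cmeas_remainder.
have le : {ae mu, forall k, `|nsq (remainder t k)| <= G k}.
  apply: filterS (ae_shift_at mu_shift) => k sk; rewrite ger0_norm ?nsq_ge0// rE /G.
  have k0 := modulus_ge0 k; have dk := decay_ge0 k.
  have s3 : 3 <= s by apply: le_trans s4; rewrite ler_nat.
  have dec := adv_nsq_at d0 s3 mg eg Eg sk.
  have q0 : 0 <= h ^+ 2 * (16 * n ^+ 2 * (Kn + Mb) ^+ 2 * (10 + n) ^+ 4).
    apply: mulr_ge0; first exact: sqr_ge0.
    apply: mulr_ge0; last exact: exprn_ge0.
    by apply: mulr_ge0; [apply: mulr_ge0 => //; exact: sqr_ge0|exact: sqr_ge0].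
  have q1 : 0 <= h ^+ 2 * (kappa ^+ 2 * n ^+ 2) by rewrite mulr_ge0 ?sqr_ge0// mulr_ge0 ?sqr_ge0.
  have nF := nsq_ge0 (F k).
  (* Outside the cut-off both the rate and the state vanish, and the remainder is minus the full
     nonlinearity. *)
  have [c0|c0] := eqVneq (chi k) 0.
    have F0 : F k = 0 by rewrite /F /rate c0 mul0r.
    have g0' : g k = 0 by rewrite -(tame_supp tg k) c0 mul0r.
    rewrite F0 g0' mulr0 addr0 sub0r nsqN c0 subr0 mul1r nsq0 mulr0 addr0.
    by apply: (le_trans dec); rewrite lerDl; apply: mulr_ge0 => //; exact: mulr_ge0.
  have c1 : chi k = 1 by apply: (mulfI c0); rewrite (cut_idem Hchi) mulr1.
  have kn := cut_mod Hchi c0; have pn := cut_psi Hchi c0; have p0 := psi_ge0 k0.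
  rewrite c1 subrr mul0r mulr0 add0r.
  pose d k := f k - g k; pose m k := (2^-1 : R)%:C%C * (f k + g k).
  have dE k' : d k' = th%:C%C * F k' by rewrite /d gE opprB addrCA subrr addr0.
  have md : cmeasurable d by exact: cmeasB.
  have mm : cmeasurable m by apply: cmeasM; [exact: cmeas_cst|exact: cmeasD].
  have em : itg mu (ew s m) by apply: itg_ewZ; exact: itg_ewD.
  have Em : \int[mu]_k ew s m k <= Mb.
    apply: le_trans (Rint_le em (itgZ 2^-1 (itgD ef eg)) (ew_half _ _ _)) _.
    by rewrite (Rint_Z _ (itgD ef eg)) (Rint_D ef eg); exact: half_sum_le.
  have ind : itg mu (fun k => nsq (d k)).
    by apply: itg_ext (itgZ (th ^+ 2) inF) _ => k'; rewrite dE nsqZ.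
  have End : \int[mu]_k nsq (d k) <= h ^+ 2 * Kn.
    have -> : \int[mu]_k nsq (d k) = th ^+ 2 * \int[mu]_k nsq (F k).
      by rewrite -(Rint_Z _ inF); congr Rintegral; apply/funext => k'; rewrite dE nsqZ.
    by apply: ler_pM => //; [exact: sqr_ge0|apply: Rintegral_ge0 => k' _; exact: nsq_ge0].
  have ad := adv_diff d0 s1 sk mf mg ef eg.
  (* The parameter is the step h: the squared L2 size of the displacement d is at most h^2 Kn, so
     both parts of Young's inequality are of order h. *)
  have [b1 b2] := adv_small d0 s1 h0 md mm ind em sk.
  have bnd : h^-1 * \int[mu]_k nsq (d k) + h * \int[mu]_k ew s m k <= h * (Kn + Mb).
    rewrite mulrDr; apply: lerD; last by rewrite ler_wpM2l// ltW.
    by rewrite ler_pdivrMl//; apply: le_trans End _; apply: eq_ler; ring.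
  have sum0 : 0 <= h^-1 * \int[mu]_k nsq (d k) + h * \int[mu]_k ew s m k.
    apply: addr_ge0; apply: mulr_ge0; rewrite ?invr_ge0 ?(ltW h0)//; apply: Rintegral_ge0 => l _.
      exact: nsq_ge0.
    exact: ew_ge0.
  have Rk : F k - (adv mu delta g g k + (kappa * psi (modulus k))%:C%C * g k) =
      (adv mu delta d m k + adv mu delta m d k) + (kappa * psi (modulus k) * th)%:C%C * F k.
    have -> : (kappa * psi (modulus k) * th)%:C%C * F k = (kappa * psi (modulus k))%:C%C * d k.
      by rewrite dE; apply: complex_ext; rewrite !(cReZ, cImZ); ring.
    by rewrite -ad /d {1}/F /rate c1 mul1r -/f; ring.
  rewrite Rk; apply: le_trans (nsqD_le _ _) _; apply: ler_wpM2l => //; apply: lerD.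
    have cb : cabs (adv mu delta d m k + adv mu delta m d k) <= 2 * (n * (h * (Kn + Mb))).
      apply: le_trans (cabsD _ _) _; rewrite mulr_natl mulr2n; apply: lerD.
        by apply: (le_trans b1); exact: ler_pM.
      by apply: (le_trans b2); exact: ler_pM.
    rewrite -cabs_sqr; apply: (@le_trans _ _ ((2 * (n * (h * (Kn + Mb)))) ^+ 2)).
      rewrite ler_pXn2r ?nnegrE ?cabs_ge0//; exact: le_trans (cabs_ge0 _) cb.
    (* The bound at hand is constant in k; on the cut-off this factor is at least 1 and makes it
       integrable. *)
    have dn : 1 <= (10 + n) ^+ 4 * decay k.
      rewrite /decay ler_pdivlMr ?mul1r; last by rewrite exprn_gt0 ?mod10_gt0.
      by rewrite ler_pXn2r ?nnegrE ?lerD2l// ltW// mod10_gt0.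
    apply: (@le_trans _ _ (h ^+ 2 * (16 * n ^+ 2 * (Kn + Mb) ^+ 2) * 1)).
      rewrite mulr1; have -> : (2 * (n * (h * (Kn + Mb)))) ^+ 2 = 4 * (h ^+ 2 * (n ^+ 2 * (Kn + Mb) ^+ 2)) by ring.
      have -> : h ^+ 2 * (16 * n ^+ 2 * (Kn + Mb) ^+ 2) = 16 * (h ^+ 2 * (n ^+ 2 * (Kn + Mb) ^+ 2)) by ring.
      apply: ler_wpM2r; last by rewrite ler_nat.
      by apply: mulr_ge0; [exact: sqr_ge0|apply: mulr_ge0; exact: sqr_ge0].
    have -> : h ^+ 2 * (16 * n ^+ 2 * (Kn + Mb) ^+ 2 * (10 + n) ^+ 4) * decay k =
      h ^+ 2 * (16 * n ^+ 2 * (Kn + Mb) ^+ 2) * ((10 + n) ^+ 4 * decay k) by ring.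
    apply: ler_wpM2l => //; apply: mulr_ge0; first exact: sqr_ge0.
    by apply: mulr_ge0; [apply: mulr_ge0 => //; exact: sqr_ge0|exact: sqr_ge0].
  rewrite nsqZ; apply: ler_wpM2r => //; rewrite exprMn mulrC.
  apply: ler_pM; rewrite ?sqr_ge0//.
  rewrite -exprMn ler_pXn2r ?nnegrE ?mulr_ge0 ?(ltW kappa0)//.
  by rewrite ler_wpM2l// ltW.
have ir := itg_mono_ae (cmeas_nsq mr) iG le.
split => //; apply: (@le_trans _ _ (\int[mu]_k G k)).
  by apply: Rint_le_ae => //; apply: filterS le => k; exact: le_trans (ler_norm _).
have i1 := itgZ (64 * Mb ^+ 2) idc.
have i2 := itgZ (h ^+ 2 * (16 * n ^+ 2 * (Kn + Mb) ^+ 2 * (10 + n) ^+ 4)) mu_decay.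
have i3 := itgZ (h ^+ 2 * (kappa ^+ 2 * n ^+ 2)) inF.
rewrite /G (Rint_D i1 (itgZ 2 (itgD i2 i3))) (Rint_Z _ idc) (Rint_Z 2 (itgD i2 i3)) (Rint_D i2 i3).
rewrite (Rint_Z _ mu_decay) (Rint_Z _ inF) lerD2l.
have le3 : h ^+ 2 * (kappa ^+ 2 * n ^+ 2) * \int[mu]_k nsq (F k) <= h ^+ 2 * (kappa ^+ 2 * n ^+ 2) * Kn.
  by apply: ler_wpM2l => //; rewrite mulr_ge0 ?sqr_ge0// mulr_ge0 ?sqr_ge0.
apply: (@le_trans _ _ (2 * (h ^+ 2 * (16 * n ^+ 2 * (Kn + Mb) ^+ 2 * (10 + n) ^+ 4) * \int[mu]_k decay k +
  h ^+ 2 * (kappa ^+ 2 * n ^+ 2) * Kn))).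
  by rewrite ler_wpM2l// lerD2l.
by apply: eq_ler; rewrite /Qn; ring.
Qed.

(** Time 0 lies in no slot, so it is discarded as a null set in the bounds; the integrated equation
    holds there too. *)
Lemma inter_approx eta : h ^+ 2 * Qn <= eta ->
  approx_sol mu psi kappa delta s T Mb (64 * Mb ^+ 2 * \int[mu]_k ((1 - chi k) * decay k) + eta)
    g0 inter remainder.
Proof.
move=> heta; split.
- exact: tame_meas tg0.
- exact: cmeas_inter.
- exact: cmeas_remainder.
- exact: inter_herm.
- apply: filterS (null_point (0 : R)) => t t0 /andP[t0' tT].
  have tp : 0 < t by rewrite lt_def t0.
  have [i iJ [it ti]] := find_slot tp tT.
  by split; [exact: (tame_ew Hchi s (inter_tame iJ it ti))|exact: inter_ew ti].
- apply: filterS (null_point (0 : R)) => t t0 /andP[t0' tT].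
  have tp : 0 < t by rewrite lt_def t0.
  have [i iJ [it ti]] := find_slot tp tT.
  have [ir le] := remainder_bound iJ it ti.
  by split => //; apply: (le_trans le); rewrite lerD2l.
- apply: aeW => k; apply: aeW => t /andP[t0 tT].
  rewrite {1}/inter -(cint_bigsum (fun j => rate (euler j) k) t0); congr (_ - _).
  by congr cint; apply/funext => tau; rewrite /remainder addrC subrK.
Qed.

End step.

(** The step is T / J, with J larger than the four quotients that encode the three step conditions
    and the target [eta]; dividing T exactly makes the last grid time T itself. *)
Lemma exists_approx T eta : 0 < T -> 0 < eta -> exists g r,
  approx_sol mu psi kappa delta s T Mb (64 * Mb ^+ 2 * \int[mu]_k ((1 - chi k) * decay k) + eta) g0 g r.
Proof.
move=> T0 eta0.
have M0 : 0 <= Mb := Mb_ge0 s Xi00 N20.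
have K0 : 0 <= Kn := @Kn_ge0 R mu kappa s n _ M0.
pose B := `|T * T * Kn| + `|T * Kn / kappa| + `|T * kappa| + `|T ^+ 2 * Qn / eta|.
pose J := (Num.truncn B).+1.
have BJ : B <= J%:R by exact/ltW/truncnS_gt.
have J0 : 0 < J%:R :> R by rewrite ltr0n.
have J1 : 1 <= J%:R :> R by rewrite ler1n.
pose h := T / J%:R.
have h0 : 0 < h by exact: divr_gt0.
have TE : J%:R * h = T by rewrite /h mulrCA divff ?mulr1// gt_eqF.
have [b1 b2 b3 b4] : [/\ T * T * Kn <= J%:R, T * Kn / kappa <= J%:R, T * kappa <= J%:R & T ^+ 2 * Qn / eta <= J%:R].
  have n1 := normr_ge0 (T * T * Kn); have n2 := normr_ge0 (T * Kn / kappa).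
  have n3 := normr_ge0 (T * kappa); have n4 := normr_ge0 (T ^+ 2 * Qn / eta).
  split; apply: le_trans (ler_norm _) _; apply: le_trans BJ; rewrite /B.
  - by rewrite -!addrA lerDl !addr_ge0.
  - by rewrite -!addrA addrCA lerDl !addr_ge0.
  - by rewrite addrAC lerDr !addr_ge0.
  - by rewrite lerDr !addr_ge0.
exists (inter h J), (remainder h J).
rewrite -[X in approx_sol _ _ _ _ _ X]TE; apply: inter_approx => //.
- by rewrite TE /h mulrA mulrAC ler_pdivrMr// mul1r.
- by rewrite /h mulrAC ler_pdivrMr// [leRHS]mulrC -ler_pdivrMr.
- by rewrite /h mulrAC ler_pdivrMr// mul1r.
- rewrite /h expr_div_n mulrAC ler_pdivrMr ?exprn_gt0//.
  rewrite -ler_pdivrMl// mulrC; apply: (le_trans b4).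
  by rewrite expr2 ler_peMl// ltW.
Qed.

End interpolation.

(** * Passage to the limit *)

Section limits.
Context {R : realType}.
Local Notation Re := complex.Re.
Local Notation Im := complex.Im.

(* The average makes [mid] odd, also along divergent sequences. *)
Definition mid (u : nat -> R) : R :=
  2^-1 * (fine (limn_esup (fun n => (u n)%:E)) + fine (limn_einf (fun n => (u n)%:E))).

Definition cmid (u : nat -> R[i]) : R[i] :=
  (mid (fun n => Re (u n)) +i* mid (fun n => Im (u n)))%C.

Lemma mid_cvg (u : nat -> R) (l : R) : u @ \oo --> l -> mid u = l.
Proof.
move=> ul; have ul' : (fun n => (u n)%:E) @ \oo --> l%:E by apply: cvg_EFin => //; exact: nearW.
have [h1 h2] := cvg_limn_einf_sup ul'.
by rewrite /mid h1 h2 /=; lra.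
Qed.

Lemma midN (u : nat -> R) : mid (fun n => - u n) = - mid u.
Proof.
rewrite /mid (_ : (fun n => (- u n)%:E) = -%E \o (fun n => (u n)%:E)) //.
by rewrite limn_esupN limn_einfN !fineN; lra.
Qed.

Lemma measurable_mid d (T : measurableType d) (f : nat -> T -> R) :
  (forall n, measurable_fun setT (f n)) -> measurable_fun setT (fun x => mid (f ^~ x)).
Proof.
move=> mf; apply: measurable_funM => //; apply: measurable_funD.
  apply: measurableT_comp => //.
  by apply: measurable_fun_limn_esup => n; exact/measurable_EFinP.
apply: measurableT_comp => //.
rewrite (_ : (fun x => _) = fun x => (- limn_esup (fun n => (- (f n x))%:E))%E).
  apply: measurableT_comp => //; apply: measurable_fun_limn_esup => n.
  by apply/measurable_EFinP; exact: measurableT_comp.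
by [].
Qed.

Lemma cmeas_mid d (T : measurableType d) (f : nat -> T -> R[i]) :
  (forall n, cmeasurable (f n)) -> cmeasurable (fun x => cmid (f ^~ x)).
Proof.
move=> mf; split => /=.
  by apply: (measurable_mid (f := fun n x => Re (f n x))) => n; have [] := mf n.
by apply: (measurable_mid (f := fun n x => Im (f n x))) => n; have [] := mf n.
Qed.

Lemma fast_cvg (u : nat -> R) (B : R) :
  (forall n, `|u n.+1 - u n| <= B * (1 / 2) ^+ n) -> cvgn u.
Proof.
move=> h; pose v n := u n.+1 - u n.
have cv : cvgn (series v).
  apply: normed_cvg; apply: (@series_le_cvg _ (fun n => `|v n|) (fun n => B * (1 / 2) ^+ n)) => //.
  - by move=> n /=; exact: le_trans (normr_ge0 _) (h n).
  - by apply: is_cvg_geometric_series; rewrite ger0_norm//; lra.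
have -> : u = fun n => u 0%N + series v n.
  by apply/funext => n; rewrite /series /= telescope_sumr// addrC subrK.
by apply: is_cvgD => //; exact: is_cvg_cst.
Qed.

Lemma abs_half_pow (B x : R) (n : nat) : 0 <= B -> x ^+ 2 <= B * (1 / 4) ^+ n ->
  `|x| <= (1 + B) * (1 / 2) ^+ n.
Proof.
move=> B0; have h0 : (1 / 4 : R) = (1 / 2) ^+ 2 by rewrite expr2; lra.
have q0 : 0 <= (1 / 2 : R) ^+ n by apply: exprn_ge0; lra.
move=> hx; rewrite -(@ler_pXn2r _ 2)// ?nnegrE ?mulr_ge0 ?addr_ge0//.
rewrite real_normK ?num_real//; apply: (le_trans hx).
rewrite h0 -exprM mulnC exprM [leRHS]exprMn; apply: ler_wpM2r; first exact: sqr_ge0.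
by rewrite sqrrD; have := sqr_ge0 B; lra.
Qed.

Definition ccvg (u : nat -> R[i]) (l : R[i]) :=
  (fun n => Re (u n)) @ \oo --> Re l /\ (fun n => Im (u n)) @ \oo --> Im l.

Lemma cmid_cvg u l : ccvg u l -> cmid u = l.
Proof. by case=> h1 h2; apply: complex_ext => /=; exact: mid_cvg. Qed.

Lemma nsq_cvg u l : ccvg u l -> nsq (u n) @[n --> \oo] --> nsq l.
Proof. by case=> h1 h2; rewrite /nsq; apply: cvgD; rewrite expr2; under eq_fun do rewrite expr2; exact: cvgM. Qed.

Lemma fast_ccvg (u : nat -> R[i]) B : 0 <= B ->
  (forall n, nsq (u n - u n.+1) <= B * (1 / 4) ^+ n) -> ccvg u (cmid u).
Proof.
move=> B0 h.
have c1 : cvgn (fun n => Re (u n)).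
  apply: (@fast_cvg _ (1 + B)) => n; apply: abs_half_pow => //; apply: le_trans (h n).
  by rewrite /nsq cReB -sqrrN opprB lerDl sqr_ge0.
have c2 : cvgn (fun n => Im (u n)).
  apply: (@fast_cvg _ (1 + B)) => n; apply: abs_half_pow => //; apply: le_trans (h n).
  by rewrite /nsq cImB -(sqrrN (Im _ - _)) opprB lerDr sqr_ge0.
by split; rewrite /cmid /=; [rewrite (mid_cvg c1)|rewrite (mid_cvg c2)].
Qed.

End limits.

Section integral_limits.
Context {R : realType} {d} {T : measurableType d}.
Variable mu : {measure set T -> \bar R}.

Lemma fatou_bound (f : nat -> T -> R) (g : T -> R) c : (forall n, itg mu (f n)) ->
  (forall n x, 0 <= f n x) -> (forall x, 0 <= g x) -> (forall n, \int[mu]_x f n x <= c) ->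
  measurable_fun setT g -> {ae mu, forall x, f ^~ x @ \oo --> g x} ->
  itg mu g /\ \int[mu]_x g x <= c.
Proof.
move=> fi f0 g0 fc mg h; apply: itg_le_fin => //.
have mf n : measurable_fun setT (EFin \o f n) by apply/measurable_EFinP; exact: itg_meas.
apply: (@le_trans _ _ (\int[mu]_x limn_einf (fun n => (f n x)%:E))%E).
  apply: ge0_le_integral_ae.
  - exact/measurable_EFinP.
  - rewrite (_ : (fun x => _) = fun x => (- limn_esup (fun n => (- (f n x))%:E))%E).
      apply: measurableT_comp => //; apply: measurable_fun_limn_esup => n.
      by apply/measurable_EFinP; apply: measurableT_comp => //; exact: itg_meas.
    by [].
  - by move=> x; rewrite lee_fin.
  - apply: filterS h => x hx.
    have hx' : (fun n => (f n x)%:E) @ \oo --> (g x)%:E by apply: cvg_EFin => //; exact: nearW.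
    by rewrite (cvg_limn_einf_sup hx').1.
apply: (le_trans (fatou mu measurableT mf _)) => [n x _|]; first by rewrite lee_fin.
rewrite limn_einf_lim; apply: lime_le; first exact: is_cvg_einfs.
apply: nearW => n; rewrite /einfs; apply: (@le_trans _ _ (\int[mu]_x (f n x)%:E)%E).
  by apply: ereal_inf_lbound; exists n => //=.
by rewrite -(Rint_EFin (fi n)) lee_fin.
Qed.

(** The series of 4^n F_n has finite integral, hence a finite sum almost everywhere that bounds each
    term. A rate 16^(-n) in mean thus becomes 4^(-n) pointwise, and 2^(-n) after a square root. *)
Lemma fast_bounded (F : nat -> T -> R) c : (forall n, itg mu (F n)) ->
  (forall n x, 0 <= F n x) -> (forall n, \int[mu]_x F n x <= c * (1 / 16) ^+ n) ->
  {ae mu, forall x, exists2 B, 0 <= B & forall n, F n x <= B * (1 / 4) ^+ n}.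
Proof.
move=> Fi F0 Fc.
pose G n x := 4 ^+ n * F n x.
have p4 n : 0 <= 4 ^+ n :> R by exact: exprn_ge0.
have G0 n x : 0 <= G n x by exact: mulr_ge0.
have iG n : itg mu (G n) by exact: itgZ.
have mG n : measurable_fun setT (EFin \o G n) by apply/measurable_EFinP; exact: itg_meas.
have c0 : 0 <= c.
  by have := Fc 0%N; rewrite expr0 mulr1; apply: le_trans; apply: Rintegral_ge0 => x _; exact: F0.
pose S x := (\sum_(n <oo) (G n x)%:E)%E.
have mS : measurable_fun setT S.
  apply: (ge0_emeasurable_sum (D := setT) (h := fun n => EFin \o G n) (P := xpredT)) => //.
  by move=> k x _ _; rewrite lee_fin.
have S0 x : (0 <= S x)%E by apply: nneseries_ge0 => n _ _; rewrite lee_fin.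
have fS : (\int[mu]_x S x < +oo)%E.
  rewrite /S (integral_nneseries mu measurableT mG); last by move=> n x _; rewrite lee_fin.
  apply: (@le_lt_trans _ _ (\sum_(n <oo) (geometric c (1 / 4) n)%:E)%E).
    apply: lee_nneseries => [n _ _|n _].
      by apply: integral_ge0 => x _; rewrite lee_fin.
    rewrite -(Rint_EFin (iG n)) lee_fin /G (Rint_Z _ (Fi n)) /=.
    apply: (le_trans (ler_wpM2l (p4 n) (Fc n))).
    by apply: eq_ler; rewrite mulrCA -exprMn; congr (_ * _ ^+ _); lra.
  have cg : cvgn (series (geometric c (1 / 4))).
    by apply: is_cvg_geometric_series; rewrite ger0_norm//; lra.
  rewrite (_ : (\sum_(n <oo) _)%E = (limn (series (geometric c (1 / 4))))%:E) ?ltry//.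
  rewrite -EFin_lim//; congr (limn _); apply/funext => n.
  by rewrite /series /= sumEFin.
have iS : mu.-integrable setT S.
  apply/integrableP; split => //.
  by under eq_integral => x _ do rewrite gee0_abs//.
apply: filterS (integrable_ae measurableT iS) => x /(_ I) fx.
exists (fine (S x)); first exact: fine_ge0.
move=> n; have e : (1 / 4 : R) ^+ n = (4 ^+ n)^-1 by rewrite expr_div_n expr1n mul1r.
rewrite e ler_pdivlMr ?exprn_gt0// mulrC -lee_fin fineK//.
rewrite /S (@nneseriesD1 _ (fun n => (G n x)%:E) n xpredT)//; last by move=> i _; rewrite lee_fin.
by rewrite leeDl//; apply: nneseries_ge0 => i _ _; rewrite lee_fin.
Qed.

Lemma ccvg_shift (u : nat -> R[i]) l N : ccvg u l <-> ccvg (fun n => u (n + N)%N) l.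
Proof.
have sh (v : nat -> R) (x : R) : v @ \oo --> x <-> (fun n => v (n + N)%N) @ \oo --> x.
  by rewrite (_ : (fun m => _) = [sequence v (m + N)%N]_m)// cvg_shiftn.
by split => -[c1 c2]; split; [apply/(sh (fun m => complex.Re (u m)))|apply/(sh (fun m => complex.Im (u m)))|
 apply/(sh (fun m => complex.Re (u m)))|apply/(sh (fun m => complex.Im (u m)))].
Qed.

Lemma ccvgBl (u : nat -> R[i]) l z : ccvg u l -> ccvg (fun n => z - u n) (z - l).
Proof.
case=> c1 c2; split.
  rewrite (_ : (fun m => _) = fun m => complex.Re z - complex.Re (u m)); last by apply/funext => m; rewrite cReB.
  by rewrite cReB; apply: cvgB => //; exact: cvg_cst.
rewrite (_ : (fun m => _) = fun m => complex.Im z - complex.Im (u m)); last by apply/funext => m; rewrite cImB.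
by rewrite cImB; apply: cvgB => //; exact: cvg_cst.
Qed.

Lemma pow16_le (n m : nat) : (n <= m)%N -> (1 / 16 : R) ^+ m <= (1 / 16) ^+ n.
Proof. by move=> nm; apply: ler_wiXn2l => //; lra. Qed.

(** Fast Cauchy bounds make the whole sequence, not just a subsequence, converge almost everywhere;
    Fatou then carries the Cauchy estimate to the limit. *)
Lemma l2_limit (f : nat -> T -> R[i]) N : (forall n, cmeasurable (f n)) ->
  (forall n m, (N <= n)%N -> (n <= m)%N -> itg mu (fun x => nsq (f n x - f m x)) /\
     \int[mu]_x nsq (f n x - f m x) <= (1 / 16) ^+ n) ->
  {ae mu, forall x, ccvg (f ^~ x) (cmid (f ^~ x))} /\
  forall n, (N <= n)%N -> itg mu (fun x => nsq (f n x - cmid (f ^~ x))) /\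
    \int[mu]_x nsq (f n x - cmid (f ^~ x)) <= (1 / 16) ^+ n.
Proof.
move=> mf h.
have cv : {ae mu, forall x, ccvg (f ^~ x) (cmid (f ^~ x))}.
  have := fast_bounded (F := fun n x => nsq (f (n + N)%N x - f (n.+1 + N)%N x)) (c := 1).
  have nN n : (n + N <= n.+1 + N)%N by rewrite leq_add2r.
  move=> /(_ (fun n => (h _ _ (leq_addl _ _) (nN n)).1) (fun n x => nsq_ge0 _)).
  have c1 n : \int[mu]_x nsq (f (n + N)%N x - f (n.+1 + N)%N x) <= 1 * (1 / 16) ^+ n.
    by rewrite mul1r; apply: le_trans (pow16_le (leq_addr N n)); exact: (h _ _ (leq_addl _ _) (nN n)).2.
  move=> /(_ c1); apply: filterS => x [B B0 hB].
  have c := (ccvg_shift (f ^~ x) _ N).2 (fast_ccvg B0 hB).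
  by rewrite (cmid_cvg c).
split => // n Nn.
apply: (fatou_bound (f := fun m x => nsq (f n x - f (m + n)%N x))).
- by move=> m; exact: (h n (m + n)%N Nn (leq_addl _ _)).1.
- by move=> m x; exact: nsq_ge0.
- by move=> x; exact: nsq_ge0.
- by move=> m; exact: (h n (m + n)%N Nn (leq_addl _ _)).2.
- by apply: cmeas_nsq; apply: cmeasB => //; exact: cmeas_mid.
- apply: filterS cv => x c; apply: nsq_cvg.
  by apply: ccvgBl; exact: (ccvg_shift (f ^~ x) _ n).1.
Qed.

End integral_limits.

Lemma half_pow_eq0 (R : realType) (x Z : R) : (forall n, `|x| <= Z * (1 / 2) ^+ n) -> x = 0.
Proof.
move=> h.
have z0 : (fun n => Z * (1 / 2 : R) ^+ n) @ \oo --> (0 : R).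
  by apply: (@cvg_geometric R Z (1 / 2)); rewrite ger0_norm; lra.
apply/normr0_eq0/le_anti; rewrite normr_ge0 andbT.
have c : (fun=> `|x|) @ \oo --> `|x| by exact: cvg_cst.
by apply: (ler_cvg_to c z0); apply: nearW => n.
Qed.

(** Squared errors control first powers up to a vanishing constant, so the integrals in time need no
    Cauchy-Schwarz inequality. *)
Lemma cabs_young (R : realType) (z : R[i]) (n : nat) :
  Normc.normc z <= 2 ^+ n * nsq z + (1 / 2) ^+ n.
Proof.
have e : (1 / 2 : R) ^+ n = (2 ^+ n)^-1 by rewrite expr_div_n expr1n mul1r.
rewrite e -cabs_sqr; have := cabs_ge0 z; set x := Normc.normc z => x0.
have p : 0 < 2 ^+ n :> R by exact: exprn_gt0.
have : 0 <= 2 ^+ n * (x - (2 ^+ n)^-1) ^+ 2 by rewrite mulr_ge0 ?sqr_ge0// ltW.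
have -> : 2 ^+ n * (x - (2 ^+ n)^-1) ^+ 2 = 2 ^+ n * x ^+ 2 - 2 * x + (2 ^+ n)^-1.
  by field; rewrite gt_eqF.
by move=> h; lra.
Qed.

Lemma quarter_le_half (R : realType) n : (1 / 4 : R) ^+ n <= (1 / 2) ^+ n.
Proof. by apply: lerXn2r; rewrite ?nnegrE; lra. Qed.

Lemma quarter_gt0 (R : realType) n : 0 < (1 / 4 : R) ^+ n.
Proof. by apply: exprn_gt0; lra. Qed.

Lemma quarter_sqr (R : realType) n : (1 / 4 : R) ^+ n * (1 / 4) ^+ n = (1 / 16) ^+ n.
Proof. by rewrite -exprMn; congr (_ ^+ _); lra. Qed.

Lemma two_quarter (R : realType) n : (2 : R) ^+ n * (1 / 4) ^+ n = (1 / 2) ^+ n.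
Proof. by rewrite -exprMn; congr (_ ^+ _); lra. Qed.

Lemma quarter_le1 (R : realType) n : (1 / 4 : R) ^+ n <= 1.
Proof. by apply: exprn_ile1; lra. Qed.

Lemma majorant_arith (R : realType) (A c q kp x y p a b : R) : 0 <= p -> 0 <= kp -> 0 <= a -> 0 <= b ->
  A <= c * q -> kp * x <= kp * (p * a + q) -> y <= p * b + q ->
  A + kp * x + y <= (c + (kp + 1)) * q + (kp + 1) * (p * (a + b)).
Proof.
move=> p0 k0 a0 b0 h1 h2 h3.
have h4 : 0 <= p * a by exact: mulr_ge0.
have h5 : 0 <= kp * (p * b) by rewrite !mulr_ge0.
have -> : (c + (kp + 1)) * q + (kp + 1) * (p * (a + b)) =
  c * q + kp * (p * a + q) + (p * b + q) + (p * a + kp * (p * b)) by ring.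
by apply: le_trans (lerD (lerD h1 h2) h3) _; rewrite lerDl addr_ge0.
Qed.

Lemma abs3_le (R : realType) (x y z a b c q : R) : `|x| <= a * q -> `|y| <= b * q -> `|z| <= c * q ->
  `|x - y + z| <= (a + b + c) * q.
Proof.
move=> h1 h2 h3; rewrite !mulrDl; apply: (le_trans (ler_normD _ _)); apply: lerD => //.
by apply: (le_trans (ler_normB _ _)); exact: lerD.
Qed.

Section passage.
Context {R : realType}.
Local Notation K := (freqsp R).
Local Notation line := (measurableTypeR R).
Local Notation leb := (@lebesgue_measure R).
Variable mu : {sigma_finite_measure set K -> \bar R}.
Local Notation Re := complex.Re.
Local Notation Im := complex.Im.
Local Notation cabs := Normc.normc.

Hypothesis mu_shift : shift_invariant mu.
Hypothesis mu_decay : itg mu (@decay R).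

Variables (psi : R -> R) (kappa delta s : R).
Hypothesis psi_ge0 : forall r, 0 <= r -> 0 <= psi r.
Hypotheses (kappa0 : 0 < kappa) (d0 : 0 <= delta) (s4 : 4 <= s).
Variables (M : R) (g0 : K -> R[i]).
Hypotheses (M0 : 0 <= M) (mg0 : cmeasurable g0).

Local Notation approx := (approx_sol mu psi kappa delta s).
Local Notation N g := (fun t k => adv mu delta (g t) (g t) k).
Local Notation joint g := (fun p : line * K => g p.1 p.2).

Lemma approx_weaken T T' c e e' f0 f r : T' <= T -> e <= e' -> approx T c e f0 f r -> approx T' c e' f0 f r.
Proof.
move=> TT ee [a1 a2 a3 a4 a5 a6 a7].
have w t : 0 <= t <= T' -> 0 <= t <= T by move=> /andP[-> /le_trans]; exact.
split => //.
- by apply: filterS a5 => t h /w; exact: h.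
- by apply: filterS a6 => t h /w /h [i le]; split => //; exact: le_trans ee.
- by apply: filterS a7 => k; apply: filterS => t h /w; exact: h.
Qed.

Lemma cint_seg_bound (T t : R) (D : line -> R[i]) (G : line -> R) : 0 <= t <= T ->
  cmeasurable D -> itg leb (fun tau => seg T tau * G tau) ->
  {ae leb, forall tau : line, 0 <= tau <= T -> cabs (D tau) <= G tau} ->
  `|Re (cint leb `[0, t] D)| <= \int[leb]_tau (seg T tau * G tau) /\
  `|Im (cint leb `[0, t] D)| <= \int[leb]_tau (seg T tau * G tau).
Proof.
move=> /andP[t0 tT] [m1 m2] iG h; rewrite /cint /= !Rint_seg.
have key (x : line -> R) : measurable_fun setT x -> (forall tau, `|x tau| <= cabs (D tau)) ->
    `|\int[leb]_tau (seg t tau * x tau)| <= \int[leb]_tau (seg T tau * G tau).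
  move=> mx xD; apply: Rint_norm_bound => //.
    by apply: measurable_funM => //; exact: measurable_seg.
  apply: filterS h => tau ht; rewrite normrM (ger0_norm (seg_ge0 _ _)).
  have [i|o] := boolP (0 <= tau <= T); last first.
    by rewrite (seg_out o) (_ : seg t tau = 0) ?mul0r// -(seg_mul tau tT) (seg_out o) mulr0.
  rewrite (seg_in i) mul1r; apply: le_trans (ht i); apply: le_trans (xD tau).
  by rewrite ler_piMl// seg_le1.
by split; apply: key => // tau; [exact: cabs_Re|exact: cabs_Im].
Qed.

Lemma cint_segB (T t : R) (f g : line -> R[i]) : 0 <= t <= T ->
  itg leb (fun tau => seg T tau * Re (f tau)) -> itg leb (fun tau => seg T tau * Im (f tau)) ->
  itg leb (fun tau => seg T tau * Re (g tau)) -> itg leb (fun tau => seg T tau * Im (g tau)) ->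
  cint leb `[0, t] (fun tau => f tau - g tau) = cint leb `[0, t] f - cint leb `[0, t] g.
Proof.
move=> /andP[_ tT] /(itg_seg_le tT) f1 /(itg_seg_le tT) f2 /(itg_seg_le tT) g1 /(itg_seg_le tT) g2.
apply: complex_ext; rewrite ?(cReB, cImB) /cint /= !Rint_seg.
  by rewrite -(Rint_B f1 g1); congr Rintegral; apply/funext => tau; rewrite cReB mulrBr.
by rewrite -(Rint_B f2 g2); congr Rintegral; apply/funext => tau; rewrite cImB mulrBr.
Qed.

Lemma adv_close f g k n : shift_at mu k -> cmeasurable f -> cmeasurable g ->
  itg mu (ew s f) -> itg mu (ew s g) -> \int[mu]_l ew s f l <= M -> \int[mu]_l ew s g l <= M ->
  itg mu (fun l => nsq (f l - g l)) -> \int[mu]_l nsq (f l - g l) <= (1 / 16) ^+ n ->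
  cabs (adv mu delta f f k - adv mu delta g g k) <= modulus k * (2 * (1 + M)) * (1 / 2) ^+ n.
Proof.
move=> sk mf mg ef eg Ef Eg inq Eq.
have s1 : 1 <= s by apply: le_trans s4; rewrite (ler_nat R 1 4).
have k0 := modulus_ge0 k.
pose e := fun l => f l - g l; pose m := fun l => (2^-1 : R)%:C%C * (f l + g l).
have -> : adv mu delta f f k - adv mu delta g g k = adv mu delta e m k + adv mu delta m e k.
  exact: (adv_diff d0 s1 sk mf mg ef eg).
have me : cmeasurable e by exact: cmeasB.
have mm : cmeasurable m by apply: cmeasM; [exact: cmeas_cst|exact: cmeasD].
have em : itg mu (ew s m) by apply: itg_ewZ; exact: itg_ewD.
have Em : \int[mu]_l ew s m l <= M.
  apply: le_trans (Rint_le em (itgZ 2^-1 (itgD ef eg)) (ew_half _ _ _)) _.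
  by rewrite (Rint_Z _ (itgD ef eg)) (Rint_D ef eg); exact: half_sum_le.
have l0 := quarter_gt0 R n.
have [b1 b2] := adv_small d0 s1 l0 me mm inq em sk.
have le : ((1 / 4) ^+ n)^-1 * \int[mu]_l nsq (e l) + (1 / 4) ^+ n * \int[mu]_l ew s m l <= (1 + M) * (1 / 2) ^+ n.
  have q := quarter_le_half R n.
  have h1 : ((1 / 4) ^+ n)^-1 * \int[mu]_l nsq (e l) <= (1 / 4) ^+ n.
    by rewrite ler_pdivrMl//; apply: (le_trans Eq); rewrite quarter_sqr.
  have h2 : (1 / 4) ^+ n * \int[mu]_l ew s m l <= (1 / 4) ^+ n * M by rewrite ler_wpM2l// ltW.
  apply: (le_trans (lerD h1 h2)); rewrite -[X in X + _]mulr1 -mulrDr mulrC.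
  by rewrite ler_wpM2l// addr_ge0.
apply: (le_trans (cabsD _ _)); apply: (le_trans (lerD b1 b2)).
have h := ler_wpM2l k0 le.
apply: (le_trans (lerD h h)); apply: eq_ler; ring.
Qed.

Variables (e : nat -> R) (g0_ : nat -> K -> R[i]) (g_ r_ : nat -> line -> K -> R[i]).
Hypothesis e16 : forall n, e n <= (1 / 16) ^+ n.
Hypothesis i0_ : forall n, itg mu (fun k => nsq (g0 k - g0_ n k)).
Hypothesis e0_ : forall n, \int[mu]_k nsq (g0 k - g0_ n k) <= e n.
Hypothesis ap_ : forall n, approx n.+1%:R M (e n) (g0_ n) (g_ n) (r_ n).
Hypothesis cauchy_ : forall n m, (n <= m)%N -> {ae leb, forall t : line, 0 <= t <= n.+1%:R ->
  \int[mu]_k nsq (g_ n t k - g_ m t k) <= (1 / 16) ^+ n}.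

(** Defined at every time and frequency, so joint measurability and Hermitian symmetry hold
    everywhere, while convergence holds only almost everywhere. It does not depend on a time
    horizon. *)
Definition glim (t : line) (k : K) : R[i] := cmid (fun n => g_ n t k).

Lemma glim_meas : cmeasurable (joint glim).
Proof. by apply: (cmeas_mid (f := fun n => joint (g_ n))) => n; exact: ap_meas (ap_ n). Qed.

Lemma glim_herm t : hermsym (glim t).
Proof.
move=> k; apply: complex_ext => /=; rewrite -?midN; congr mid; apply/funext => n;
  by rewrite (ap_herm (ap_ n) t k); case: (g_ n t k).
Qed.

Lemma lt_slab n m (t : R) : (n <= m)%N -> 0 <= t <= n.+1%:R -> 0 <= t <= m.+1%:R.
Proof. by move=> nm /andP[-> /le_trans]; apply; rewrite ler_nat ltnS. Qed.

Lemma glim_slice n : {ae leb, forall t : line, 0 <= t <= n.+1%:R ->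
  [/\ {ae mu, forall k, ccvg (fun m => g_ m t k) (glim t k)},
      forall m, (n <= m)%N -> itg mu (fun k => nsq (g_ m t k - glim t k)) /\
        \int[mu]_k nsq (g_ m t k - glim t k) <= (1 / 16) ^+ m,
      forall m, (n <= m)%N -> itg mu (ew s (g_ m t)) /\ \int[mu]_k ew s (g_ m t) k <= M
    & itg mu (ew s (glim t)) /\ \int[mu]_k ew s (glim t) k <= M]}.
Proof.
have bd : {ae leb, forall t : line, forall m, 0 <= t <= m.+1%:R ->
    itg mu (ew s (g_ m t)) /\ \int[mu]_k ew s (g_ m t) k <= M}.
  by apply/ae_foralln => m; exact: ap_bd (ap_ m).
have ca : {ae leb, forall t : line, forall m p, (m <= p)%N -> 0 <= t <= m.+1%:R ->
    \int[mu]_k nsq (g_ m t k - g_ p t k) <= (1 / 16) ^+ m}.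
  apply/ae_foralln => m; apply/ae_foralln => p.
  have [mp|_] := boolP (m <= p)%N; last exact: aeW.
  by apply: filterS (cauchy_ mp) => t h _; exact: h.
apply: filterS2 bd ca => t bd ca tn.
have mg m : cmeasurable (g_ m t) := cmeas_slice1 t (ap_meas (ap_ m)).
have bd' m : (n <= m)%N -> itg mu (ew s (g_ m t)) /\ \int[mu]_k ew s (g_ m t) k <= M.
  by move=> nm; apply: bd; exact: lt_slab tn.
have s0 : 0 <= s by apply: le_trans s4; rewrite ler0n.
have [cv l2] := @l2_limit R _ _ mu (fun m => g_ m t) n mg (fun m p nm mp =>
  conj (itg_nsq s0 (cmeasB (mg m) (mg p)) (itg_ewB (mg m) (mg p) (bd' m nm).1 (bd' p (leq_trans nm mp)).1))
   (ca m p mp (lt_slab nm tn))).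
split => //.
apply: (fatou_bound (f := fun m => ew s (g_ (m + n)%N t))).
- by move=> m; exact: (bd' _ (leq_addl _ _)).1.
- by move=> m k; exact: ew_ge0.
- by move=> k; exact: ew_ge0.
- by move=> m; exact: (bd' _ (leq_addl _ _)).2.
- by apply: measurable_ew; exact: cmeas_slice1 glim_meas.
- apply: filterS cv => k c; rewrite /ew; apply: cvgM; first exact: cvg_cst.
  by apply: nsq_cvg; exact: (ccvg_shift (fun m => g_ m t k) _ n).1.
Qed.

(** All squared errors at once on the slab [0, n + 1]. The index m + n ensures that the
    approximation is defined on the whole slab. *)
Let F n m (z : line * K) : R :=
  nsq (g_ (m + n)%N z.1 z.2 - glim z.1 z.2) + nsq (r_ (m + n)%N z.1 z.2).

Lemma F_ge0 n m z : 0 <= F n m z. Proof. by rewrite addr_ge0 ?nsq_ge0. Qed.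

Lemma F_itg n m : itg (leb \x mu)%E (fun z => seg n.+1%:R z.1 * F n m z) /\
  \int[mu]_k \int[leb]_t (seg n.+1%:R t * F n m (t, k)) <= n.+1%:R * (2 * (1 / 16) ^+ m).
Proof.
have T0 : 0 <= n.+1%:R :> R by rewrite ler0n.
have mF : measurable_fun setT (F n m).
  apply: measurable_funD; apply: cmeas_nsq; last exact: ap_rmeas (ap_ _).
  by apply: cmeasB; [exact: ap_meas (ap_ _)|exact: glim_meas].
have bd : {ae leb, forall t : line, 0 <= t <= n.+1%:R ->
    itg mu (fun k => F n m (t, k)) /\ \int[mu]_k F n m (t, k) <= 2 * (1 / 16) ^+ m}.
  apply: filterS2 (glim_slice n) (ap_rem (ap_ (m + n))) => t /= h1 h2 tn.
  have [_ /(_ (m + n)%N (leq_addl _ _))[i1 l1] _ _] := h1 tn.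
  have [i2 l2] := h2 (lt_slab (leq_addl m n) tn).
  split; first exact: itgD.
  rewrite (Rint_D i1 i2) mulr_natl mulr2n; apply: lerD.
    by apply: (le_trans l1); apply: pow16_le; exact: leq_addr.
  by apply: (le_trans l2); apply: (le_trans (e16 _)); apply: pow16_le; exact: leq_addr.
have iF := itg_slab T0 mF (F_ge0 n m) bd; split => //.
rewrite -(Rint_fubini iF) /=.
have iS := itgZ (2 * (1 / 16) ^+ m) (seg_itg T0).
apply: (@le_trans _ _ (\int[leb]_t (2 * (1 / 16) ^+ m * seg n.+1%:R t))).
  apply: Rint_le_ae => //; first exact: (itg_Rint1 iF).
  apply: filterS bd => t h; have [i|o] := boolP (0 <= t <= n.+1%:R).
    rewrite (seg_in i) mulr1 (_ : (fun k => _) = fun k => F n m (t, k)); first exact: (h i).2.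
    by apply/funext => k; rewrite mul1r.
  rewrite (seg_out o) mulr0 (_ : (fun k => _) = fun=> 0); last by apply/funext => k; rewrite mul0r.
  by rewrite /Rintegral integral0.
by rewrite (Rint_Z _ (seg_itg T0)) (Rint_seg1 T0) mulrC.
Qed.

(** The errors decay like 16^(-m) after integration in time and frequency; [fast_bounded] in k gives
    4^(-m) for the time integral at almost every frequency, together with the error of the data. *)
Lemma F_fast n : {ae mu, forall k, exists2 B, 0 <= B & forall m,
  [/\ itg leb (fun t => seg n.+1%:R t * F n m (t, k)),
      \int[leb]_t (seg n.+1%:R t * F n m (t, k)) <= B * (1 / 4) ^+ m
    & nsq (g0 k - g0_ (m + n)%N k) <= B * (1 / 4) ^+ m]}.
Proof.
pose H m k := \int[leb]_t (seg n.+1%:R t * F n m (t, k)) + nsq (g0 k - g0_ (m + n)%N k).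
have I0 m k : 0 <= \int[leb]_t (seg n.+1%:R t * F n m (t, k)).
  by apply: Rintegral_ge0 => t _; rewrite mulr_ge0 ?seg_ge0 ?F_ge0.
have iI m : itg mu (fun k => \int[leb]_t (seg n.+1%:R t * F n m (t, k))).
  exact: (itg_Rint1 (itg_swap (F_itg n m).1)).
have iH m : itg mu (H m) by exact: itgD.
have H0 m k : 0 <= H m k by rewrite addr_ge0 ?nsq_ge0.
have leH m : \int[mu]_k H m k <= (n.+1%:R * 2 + 1) * (1 / 16) ^+ m.
  have -> : (n.+1%:R * 2 + 1) * (1 / 16) ^+ m = n.+1%:R * (2 * (1 / 16) ^+ m) + (1 / 16) ^+ m :> R by ring.
  rewrite (Rint_D (iI m) (i0_ _)); apply: lerD; first exact: (F_itg n m).2.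
  apply: (le_trans (e0_ _)); apply: (le_trans (e16 _)); apply: pow16_le; exact: leq_addr.
have ai : {ae mu, forall k, forall m, itg leb (fun t => seg n.+1%:R t * F n m (t, k))}.
  by apply/ae_foralln => m; exact: (itg_ae2 (F_itg n m).1).
apply: filterS2 ai (fast_bounded iH H0 leH) => k ik [B B0 hB].
exists B => // m; split => //; apply: le_trans (hB m).
  by rewrite /H lerDl nsq_ge0.
by rewrite /H lerDr.
Qed.

Let P (g r : line -> K -> R[i]) k tau :=
  adv mu delta (g tau) (g tau) k + (kappa * psi (modulus k))%:C%C * g tau k + r tau k.

Lemma rhs_itg T c (g r : line -> K -> R[i]) : 0 <= T -> cmeasurable (joint g) -> cmeasurable (joint r) ->
  {ae leb, forall t : line, 0 <= t <= T -> itg mu (ew s (g t)) /\ \int[mu]_k ew s (g t) k <= M} ->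
  {ae leb, forall t : line, 0 <= t <= T -> itg mu (fun k => nsq (r t k)) /\ \int[mu]_k nsq (r t k) <= c} ->
  {ae mu, forall k, cmeasurable (P g r k) /\
    itg leb (fun t => seg T t * Re (P g r k t)) /\ itg leb (fun t => seg T t * Im (P g r k t))}.
Proof.
move=> T0 mg mr bg br.
have s0 : 0 <= s by apply: le_trans s4; rewrite ler0n.
have mg' t : cmeasurable (g t) := cmeas_slice1 t mg.
have mA : cmeasurable (joint (N g)) by exact: cmeas_joint_adv.
have a1 : {ae mu, forall k, itg leb (fun t => seg T t * Re (g t k)) /\ itg leb (fun t => seg T t * Im (g t k))}.
  apply: (itg_slab_time (F := joint g) (C := M) T0 mg); apply: filterS bg => t h /h [i l] /=.
  have i' := itg_nsq s0 (mg' t) i; split => //.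
  apply: le_trans l; apply: Rint_le => // k; rewrite /ew ler_peMl ?nsq_ge0//.
  by have := wsym_pow (n := 0) (modulus_ge0 k) (mulr_ge0 (ler0n R 2) s0); rewrite expr0.
have a2 := itg_slab_time T0 mr br.
have a3 : {ae mu, forall k, itg leb (fun t => seg T t * Re (N g t k)) /\ itg leb (fun t => seg T t * Im (N g t k))}.
  apply: (itg_slab_time (F := joint (N g)) (C := 64 * M ^+ 2 * \int[mu]_k decay k) T0 mA).
  by apply: filterS bg => t h /h [i l] /=; exact: (adv_nsq mu_shift mu_decay d0 s4 (mg' t) i l).
apply: filterS3 a1 a2 a3 => k [r1 m1] [r2 m2] [r3 m3]; split; [|split].
- apply: cmeasD; last exact: cmeas_slice2 k mr.
  apply: cmeasD; first exact: (cmeas_slice2 k mA).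
  by apply: cmeasM; [exact: cmeas_cst|exact: (cmeas_slice2 k mg)].
- apply: itg_ext (itgD (itgD r3 (itgZ (kappa * psi (modulus k)) r1)) r2) _ => t.
  by rewrite /P !cReD cReZ; ring.
- apply: itg_ext (itgD (itgD m3 (itgZ (kappa * psi (modulus k)) m1)) m2) _ => t.
  by rewrite /P !cImD cImZ; ring.
Qed.

(** At a good frequency the defect of the limit equation is a fixed complex number bounded by a
    multiple of 2^(-j) for every j. The factor psi is a constant there, so its growth in k does not
    matter. *)
Lemma glim_eq n : {ae mu, forall k, {ae leb, forall t : line, 0 <= t <= n.+1%:R ->
  glim t k = g0 k - cint leb `[0, t] (P glim (fun _ _ => 0) k)}}.
Proof.
pose T : R := n.+1%:R.
have T0 : 0 <= T by rewrite ler0n.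
have bdl : {ae leb, forall t : line, 0 <= t <= T -> itg mu (ew s (glim t)) /\ \int[mu]_k ew s (glim t) k <= M}.
  by apply: filterS (glim_slice n) => t h /h [].
have z0 : cmeasurable (joint (fun (_ : line) (_ : K) => 0 : R[i])) by exact: cmeas_cst.
have bz : {ae leb, forall t : line, 0 <= t <= T ->
    itg mu (fun _ : K => nsq (0 : R[i])) /\ \int[mu]_k nsq (0 : R[i]) <= 0}.
  apply: aeW => t _; rewrite nsq0; split; last by rewrite /Rintegral integral0.
  by apply: itg_ext (itgZ 0 mu_decay) _ => k; rewrite mul0r.
have Pl := rhs_itg T0 glim_meas z0 bdl bz.
have Pi : {ae mu, forall k, forall m, cmeasurable (P (g_ (m + n)%N) (r_ (m + n)%N) k) /\
    itg leb (fun t => seg T t * Re (P (g_ (m + n)%N) (r_ (m + n)%N) k t)) /\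
    itg leb (fun t => seg T t * Im (P (g_ (m + n)%N) (r_ (m + n)%N) k t))}.
  apply/ae_foralln => m.
  have A : approx T M (e (m + n)%N) (g0_ (m + n)%N) (g_ (m + n)%N) (r_ (m + n)%N).
    apply: approx_weaken (ap_ (m + n)) => //; rewrite /T ler_nat ltnS; exact: leq_addl.
  exact: (rhs_itg T0 (ap_meas A) (ap_rmeas A) (ap_bd A) (ap_rem A)).
have eqs : {ae mu, forall k, forall m, {ae leb, forall t : line, 0 <= t <= T ->
    g_ (m + n)%N t k = g0_ (m + n)%N k - cint leb `[0, t] (P (g_ (m + n)%N) (r_ (m + n)%N) k)}}.
  apply/ae_foralln => m; apply: filterS (ap_eq (ap_ (m + n))) => k; apply: filterS => t h tn.
  by apply: h; exact: (lt_slab (leq_addl m n) tn).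
near=> k.
have sk : shift_at mu k by near: k; exact: ae_shift_at.
have [mPl [rPl iPl]] : cmeasurable (P glim (fun _ _ => 0) k) /\
    itg leb (fun t => seg T t * Re (P glim (fun _ _ => 0) k t)) /\
    itg leb (fun t => seg T t * Im (P glim (fun _ _ => 0) k t)) by near: k; exact: Pl.
have PiK : forall m, cmeasurable (P (g_ (m + n)%N) (r_ (m + n)%N) k) /\
    itg leb (fun t => seg T t * Re (P (g_ (m + n)%N) (r_ (m + n)%N) k t)) /\
    itg leb (fun t => seg T t * Im (P (g_ (m + n)%N) (r_ (m + n)%N) k t)) by near: k; exact: Pi.
have eqk : forall m, {ae leb, forall t : line, 0 <= t <= T ->
    g_ (m + n)%N t k = g0_ (m + n)%N k - cint leb `[0, t] (P (g_ (m + n)%N) (r_ (m + n)%N) k)}.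
  by near: k; exact: eqs.
have [B B0 hB] : exists2 B, 0 <= B & forall m,
  [/\ itg leb (fun t => seg T t * F n m (t, k)),
      \int[leb]_t (seg T t * F n m (t, k)) <= B * (1 / 4) ^+ m
    & nsq (g0 k - g0_ (m + n)%N k) <= B * (1 / 4) ^+ m] by near: k; exact: F_fast.
(* Doubling the index restores the rate 16^(-j) for the integral in time, so that [fast_bounded] can
   be applied a second time, now in t. *)
have Ft : {ae leb, forall t : line, exists2 B', 0 <= B' & forall j, seg T t * F n (j + j) (t, k) <= B' * (1 / 4) ^+ j}.
  apply: (fast_bounded (c := B) (F := fun j t => seg T t * F n (j + j) (t, k))).
  - by move=> j; have [] := hB (j + j)%N.
  - by move=> j t; rewrite mulr_ge0 ?seg_ge0 ?F_ge0.
  - by move=> j; have [_ + _] := hB (j + j)%N; rewrite exprD quarter_sqr.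
pose kp := kappa * psi (modulus k).
have kp0 : 0 <= kp by rewrite mulr_ge0 ?(ltW kappa0)// psi_ge0// modulus_ge0.
pose c1 := modulus k * (2 * (1 + M)).
have c10 : 0 <= c1 by rewrite mulr_ge0 ?modulus_ge0// mulr_ge0// addr_ge0.
pose Z := T * c1 + (kp + 1) * (B + T).
pose D j tau := P glim (fun _ _ => 0) k tau - P (g_ (j + j + n)%N) (r_ (j + j + n)%N) k tau.
(* The first term collects the difference of the nonlinearities and the constants of [cabs_young];
   in the second the factor 2^j is beaten by the rate 16^(-j) of the doubled index. *)
pose G j tau := (c1 + (kp + 1)) * (1 / 2) ^+ j + (kp + 1) * (2 ^+ j * F n (j + j) (tau, k)).
have key j t : 0 <= t <= T ->
   `|Re (cint leb `[0, t] (D j))| <= Z * (1 / 2) ^+ j /\ `|Im (cint leb `[0, t] (D j))| <= Z * (1 / 2) ^+ j.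
  move=> tT; set q := (1 / 2) ^+ j.
  have q0 : 0 <= q by apply: exprn_ge0; rewrite mul1r invr_ge0 ler0n.
  have [iF leF _] := hB (j + j)%N.
  have iG1 := itgZ ((c1 + (kp + 1)) * q) (seg_itg T0).
  have iG2 := itgZ ((kp + 1) * 2 ^+ j) iF.
  have GE tau : seg T tau * G j tau = (c1 + (kp + 1)) * q * seg T tau + (kp + 1) * 2 ^+ j * (seg T tau * F n (j + j) (tau, k)).
    by rewrite /G /q; ring.
  have iG : itg leb (fun tau => seg T tau * G j tau).
    by apply: itg_ext (itgD iG1 iG2) _ => tau; rewrite GE.
  have leG : \int[leb]_tau (seg T tau * G j tau) <= Z * q.
    rewrite (_ : \int[leb]_tau (seg T tau * G j tau) = (c1 + (kp + 1)) * q * T + (kp + 1) * 2 ^+ j * \int[leb]_tau (seg T tau * F n (j + j) (tau, k))); last first.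
      rewrite -[X in _ * q * X](Rint_seg1 T0) -(Rint_Z _ (seg_itg T0)) -(Rint_Z _ iF) -(Rint_D iG1 iG2).
      by congr Rintegral; apply/funext => tau; rewrite GE.
    have k20 : 0 <= (kp + 1) * 2 ^+ j by rewrite mulr_ge0 ?addr_ge0 ?exprn_ge0.
    have h := ler_wpM2l k20 leF.
    have e1 : 2 ^+ j * (1 / 4) ^+ (j + j) <= q.
      by rewrite exprD mulrA two_quarter; apply: ler_piMr => //; exact: quarter_le1.
    have h' : (kp + 1) * 2 ^+ j * (B * (1 / 4) ^+ (j + j)) <= (kp + 1) * B * q.
      rewrite (_ : _ * _ * (B * _) = (kp + 1) * B * (2 ^+ j * (1 / 4) ^+ (j + j))); last by ring.
      by apply: ler_wpM2l => //; rewrite mulr_ge0 ?addr_ge0.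
    apply: (le_trans (lerD (lexx _) (le_trans h h'))); apply: eq_ler; rewrite /Z; ring.
  have mD : cmeasurable (D j) by apply: cmeasB => //; have [] := PiK (j + j)%N.
  have bD : {ae leb, forall tau : line, 0 <= tau <= T -> cabs (D j tau) <= G j tau}.
    apply: filterS (glim_slice n) => tau h /h [_ /(_ _ (leq_addl (j + j) n))[i1 l1] /(_ _ (leq_addl (j + j) n))[i2 l2] [i3 l3]].
    set i := (j + j + n)%N in i1 l1 i2 l2 *.
    have mgi : cmeasurable (g_ i tau) := cmeas_slice1 tau (ap_meas (ap_ i)).
    have mgl : cmeasurable (glim tau) := cmeas_slice1 tau glim_meas.
    have c : cabs (adv mu delta (g_ i tau) (g_ i tau) k - adv mu delta (glim tau) (glim tau) k) <= c1 * q.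
      have l1' : \int[mu]_l nsq (g_ i tau l - glim tau l) <= (1 / 16) ^+ j.
        by apply: (le_trans l1); apply: pow16_le; rewrite /i -addnA leq_addr.
      exact: (adv_close sk mgi mgl i2 i3 l2 l3 i1 l1').
    set A := adv mu delta (g_ i tau) (g_ i tau) k - _ in c.
    have DE : D j tau = - A - kp%:C%C * (g_ i tau k - glim tau k) - r_ i tau k.
      rewrite /D /P /A addr0 -/i -/kp; ring.
    have y1 := cabs_young (g_ i tau k - glim tau k) j.
    have y2 := cabs_young (r_ i tau k) j.
    have y3 := ler_wpM2l kp0 y1.
    have : cabs (D j tau) <= cabs A + kp * cabs (g_ i tau k - glim tau k) + cabs (r_ i tau k).
      rewrite DE; apply: (le_trans (cabsD _ _)); rewrite cabsN; apply: lerD => //.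
      apply: (le_trans (cabsD _ _)); rewrite !cabsN; apply: lerD => //.
      by rewrite cabsM cabs_real ger0_norm.
    move=> /le_trans; apply.
    have n1 := nsq_ge0 (g_ i tau k - glim tau k); have n2 := nsq_ge0 (r_ i tau k).
    rewrite /G /F /= -/i -/q; rewrite -/q in y2 y3.
    exact: majorant_arith (exprn_ge0 j (ler0n R 2)) kp0 n1 n2 c y3 y2.
  have [b1 b2] := cint_seg_bound tT mD iG bD.
  by split; [apply: le_trans b1 leG|apply: le_trans b2 leG].
have eqk' : {ae leb, forall t : line, forall m, 0 <= t <= T ->
    g_ (m + n)%N t k = g0_ (m + n)%N k - cint leb `[0, t] (P (g_ (m + n)%N) (r_ (m + n)%N) k)}.
  by apply/ae_foralln.
apply: filterS2 Ft eqk' => t [B' B'0 hB'] eqt tT.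
pose E := glim t k - (g0 k - cint leb `[0, t] (P glim (fun _ _ => 0) k)).
(* The defect E splits into the error of the state, the error of the data and the integrated error D
   of the right side, each of order 2^(-j). *)
have EE j : E = (glim t k - g_ (j + j + n)%N t k) - (g0 k - g0_ (j + j + n)%N k) + cint leb `[0, t] (D j).
  have [_ [r i]] := PiK (j + j)%N.
  by rewrite (cint_segB tT rPl iPl r i) /E (eqt (j + j)%N tT); ring.
have b1 j : nsq (glim t k - g_ (j + j + n)%N t k) <= B' * (1 / 4) ^+ j.
  apply: le_trans (hB' j); rewrite (seg_in tT) mul1r /F /= -[X in X <= _]nsqN opprB.
  by rewrite lerDl nsq_ge0.
have b2 j : nsq (g0 k - g0_ (j + j + n)%N k) <= B * (1 / 4) ^+ j.
  have [_ _ /le_trans] := hB (j + j)%N; apply; apply: ler_wpM2l => //.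
  by rewrite exprD ler_piMr ?quarter_le1// ltW// quarter_gt0.
have E0 : E = 0.
  apply: complex_ext; rewrite /=.
    apply: (half_pow_eq0 (Z := (1 + B') + (1 + B) + Z)) => j; have [k1 _] := key j t tT.
    rewrite (EE j) cReD cReB; apply: abs3_le => //; apply: abs_half_pow => //.
      by apply: le_trans (b1 j); rewrite /nsq lerDl sqr_ge0.
    by apply: le_trans (b2 j); rewrite /nsq lerDl sqr_ge0.
  apply: (half_pow_eq0 (Z := (1 + B') + (1 + B) + Z)) => j; have [_ k1] := key j t tT.
  rewrite (EE j) cImD cImB; apply: abs3_le => //; apply: abs_half_pow => //.
    by apply: le_trans (b1 j); rewrite /nsq lerDr sqr_ge0.
  by apply: le_trans (b2 j); rewrite /nsq lerDr sqr_ge0.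
by apply/eqP; rewrite -subr_eq0; apply/eqP; exact: E0.
Unshelve. all: by end_near.
Qed.

Lemma passage_to_limit n : approx n.+1%:R M 0 g0 glim (fun _ _ => 0).
Proof.
split.
- exact: mg0.
- exact: glim_meas.
- exact: cmeas_cst.
- exact: glim_herm.
- by apply: filterS (glim_slice n) => t h /h [].
- apply: aeW => t _; rewrite nsq0; split; last by rewrite /Rintegral integral0.
  by apply: itg_ext (itgZ 0 mu_decay) _ => k; rewrite mul0r.
- exact: glim_eq.
Qed.

End passage.

Lemma cauchy_arith (R : realType) (x e1 e2 t : R) : 0 <= t -> x <= 4 * e1 -> e2 <= e1 ->
  2 * (x + 2 * t * (e1 + e2)) <= 8 * (t + 1) * e1.
Proof.
move=> t0 h1 h2; have h3 := ler_wpM2l t0 h2.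
by lra.
Qed.

(** * Choice of the approximations and existence on the Fourier side *)

Section existence.
Context {R : realType}.
Local Notation K := (freqsp R).
Local Notation line := (measurableTypeR R).
Local Notation leb := (@lebesgue_measure R).
Variable mu : {sigma_finite_measure set K -> \bar R}.
Local Notation Re := complex.Re.
Local Notation Im := complex.Im.
Local Notation cabs := Normc.normc.

Hypothesis mu_refl : refl_invariant mu.
Hypothesis mu_shift : shift_invariant mu.
Hypothesis mu_decay : itg mu (@decay R).

Variables (psi : R -> R) (kappa delta s : R).
Hypothesis mpsi : measurable_fun setT psi.
Hypothesis psi_ge0 : forall r, 0 <= r -> 0 <= psi r.
Hypotheses (kappa0 : 0 < kappa) (d0 : 0 <= delta) (d1 : delta <= 1) (s4 : 4 <= s).
Variable Xi0 : R.
Hypothesis Xi00 : 0 < Xi0.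
Hypothesis psi_log : forall r, Xi0 < r -> lsym r <= psi r.
Variable N2 : R.
Hypothesis N20 : 0 <= N2.
Local Notation Mb := (Mb s Xi0 N2).
Hypothesis small_delta : Ktriad s * delta * (\int[mu]_k decay k + Mb) <= 2 * kappa.

Definition lowpass (n : nat) (k : K) : R :=
  ((modulus k <= n%:R)%R : nat)%:R * ((psi (modulus k) <= n%:R)%R : nat)%:R.

Lemma lowpassE n k : lowpass n k = ((modulus k <= n%:R) && (psi (modulus k) <= n%:R))%:R.
Proof. by rewrite /lowpass -natrM mulnb. Qed.

Lemma cutoff_lowpass n : cutoff psi n%:R (lowpass n).
Proof.
split.
- apply: measurable_funM; apply: measurable_le_nat => //; [exact: measurable_modulus|exact: measurable_psimod].
- by move=> k; rewrite lowpassE ler0n.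
- by move=> k; rewrite lowpassE lern1; case: (_ && _).
- by move=> k; rewrite lowpassE; case: (_ && _); rewrite ?mulr1 ?mulr0.
- by move=> k; rewrite !lowpassE modulusN.
- by move=> k; rewrite lowpassE pnatr_eq0 eqb0 negbK => /andP[].
- by move=> k; rewrite lowpassE pnatr_eq0 eqb0 negbK => /andP[].
Qed.

(** Dominated convergence: psi is finite at each frequency, so the cut-off is eventually 1 there. *)
Lemma lowpass_cvg h : itg mu h -> (forall k, 0 <= h k) -> forall e, 0 < e ->
  exists n, \int[mu]_k ((1 - lowpass n k) * h k) <= e.
Proof.
move=> ih h0 e e0; pose F n k := (1 - lowpass n k) * h k.
have mF n : measurable_fun setT (F n).
  by apply: measurable_funM; [apply: measurable_funB => //; exact: cut_meas (cutoff_lowpass n)|exact: itg_meas ih].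
have F0 n k : 0 <= F n k by rewrite mulr_ge0// subr_ge0 (cut_le1 (cutoff_lowpass n)).
have Fh n k : F n k <= h k by rewrite ler_piMl// gerBl (cut_ge0 (cutoff_lowpass n)).
have iF n : itg mu (F n) by apply: itg_mono ih _ => // k; rewrite ger0_norm.
have Fc k : (fun n => (F n k)%:E) @ \oo --> 0%:E.
  apply: cvg_near_cst; exists (Num.truncn (modulus k + `|psi (modulus k)|)).+1 => // n /= hn.
  have m0 := modulus_ge0 k.
  have le : modulus k + `|psi (modulus k)| <= n%:R.
    apply/ltW/(lt_le_trans (truncnS_gt _)); by rewrite ler_nat.
  have l1 : modulus k <= n%:R by apply: le_trans le; rewrite lerDl.
  have l2 : psi (modulus k) <= n%:R.
    by apply: le_trans (ler_norm _) _; apply: le_trans le; rewrite lerDr.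
  by rewrite /F lowpassE l1 l2 subrr mul0r.
have dom : {ae mu, forall k n, setT k -> (`|(F n k)%:E| <= (h k)%:E)%E}.
  by apply: aeW => k n _; rewrite /= lee_fin ger0_norm.
have [_ _ cv] := @dominated_convergence _ _ _ mu setT measurableT (fun n k => (F n k)%:E) (fun=> 0%E)
  (EFin \o h) (fun n => (measurable_EFinP setT (F n)).2 (mF n)) (measurable_cst _)
  (aeW _ (fun k _ => Fc k)) ih dom.
have {}cv : (fun n => (\int[mu]_k F n k)%:E) @ \oo --> 0%:E.
  rewrite integral0 in cv; apply: cvg_trans cv.
  by apply: near_eq_cvg; apply: nearW => n; rewrite (Rint_EFin (iF n)).
have {}cv : (fun n => \int[mu]_k F n k) @ \oo --> (0 : R) by exact: (fine_cvg cv).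
move/cvgrPdist_le : cv => /(_ e e0) [n _ /(_ n (leqnn n))].
by rewrite /= sub0r normrN => /ler_normlW; exists n.
Qed.

Variable g0 : K -> R[i].
Hypotheses (mg0 : cmeasurable g0) (hg0 : hermsym g0) (eg0 : itg mu (ew s g0)).
Hypothesis Eg0 : \int[mu]_k ew s g0 k <= N2.

Local Notation approx := (approx_sol mu psi kappa delta s).

Lemma itg_nsq0 : itg mu (fun k => nsq (g0 k)).
Proof. by apply: (itg_nsq (le_trans (ler0n R 4) s4)). Qed.

Lemma tame_lowpass n : tame mu (lowpass n) (fun k => (lowpass n k)%:C%C * g0 k).
Proof.
have C := cutoff_lowpass n; split.
- by apply: cmeasM => //; apply: cmeas_real; exact: cut_meas C.
- by move=> k; rewrite (cut_sym C) hg0; case: (g0 k) => a b; apply: complex_ext => /=; ring.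
- by move=> k; rewrite mulrA -rmorphM /= (cut_idem C).
- apply: itg_mono itg_nsq0 _.
    by apply: cmeas_nsq; apply: cmeasM => //; apply: cmeas_real; exact: cut_meas C.
  move=> k; rewrite ger0_norm ?nsq_ge0// nsqZ expr2 (cut_idem C) ler_piMl ?nsq_ge0//; exact: cut_le1 C k.
Qed.

Lemma lowpass_ew n : \int[mu]_k ew s (fun k => (lowpass n k)%:C%C * g0 k) k <= N2.
Proof.
have C := cutoff_lowpass n; apply: le_trans Eg0; apply: Rint_le => //.
  exact: (tame_ew C s (tame_lowpass n)).
move=> k; rewrite /ew nsqZ expr2 (cut_idem C) ler_wpM2l ?wsym_ge0//.
by rewrite ler_piMl ?nsq_ge0//; exact: cut_le1 C k.
Qed.

(** One cut-off serves for the initial error and for the tail of [decay], by applying [lowpass_cvg]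
    to their sum. *)
Lemma approx_fast T e : 0 < T -> 0 < e -> exists p : (K -> R[i]) * (line -> K -> R[i]) * (line -> K -> R[i]),
  [/\ itg mu (fun k => nsq (g0 k - p.1.1 k)), \int[mu]_k nsq (g0 k - p.1.1 k) <= e &
      approx T Mb e p.1.1 p.1.2 p.2].
Proof.
move=> T0 e0; pose c := 64 * Mb ^+ 2.
have c0 : 0 <= c by rewrite mulr_ge0 ?sqr_ge0.
(* With this value the tail term c b of the remainder is at most e / 2, and the other half is left
   to the time step. *)
pose b := Num.min e (e / (2 * (c + 1))).
have c10 : 0 < 2 * (c + 1) by lra.
have b0 : 0 < b by rewrite lt_min e0 divr_gt0.
have id : itg mu (@decay R) := mu_decay.
have inq := itg_nsq0.
have [n hn] := lowpass_cvg (itgD inq id) (fun k => addr_ge0 (nsq_ge0 _) (decay_ge0 k)) b0.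
have C := cutoff_lowpass n.
have mchi := cut_meas C.
have low h : itg mu h -> (forall k, 0 <= h k) -> itg mu (fun k => (1 - lowpass n k) * h k).
  move=> ih h0; apply: (itg_mono _ ih).
    by apply: measurable_funM; [exact: measurable_funB|exact: itg_meas ih].
  move=> k; rewrite ger0_norm; first by rewrite ler_piMl// gerBl (cut_ge0 C).
  by rewrite mulr_ge0// subr_ge0 (cut_le1 C).
have sum0 k : 0 <= nsq (g0 k) + decay k := addr_ge0 (nsq_ge0 _) (decay_ge0 k).
have i1 := low _ inq (fun k => nsq_ge0 _); have i2 := low _ id (@decay_ge0 R); have i3 := low _ (itgD inq id) sum0.
have pos k : 0 <= 1 - lowpass n k by rewrite subr_ge0 (cut_le1 C).
have l1 : \int[mu]_k ((1 - lowpass n k) * nsq (g0 k)) <= b.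
  apply: le_trans hn; apply: Rint_le => // k; apply: ler_wpM2l; first exact: pos.
  by rewrite lerDl decay_ge0.
have l2 : \int[mu]_k ((1 - lowpass n k) * decay k) <= b.
  apply: le_trans hn; apply: Rint_le => // k; apply: ler_wpM2l; first exact: pos.
  by rewrite lerDr nsq_ge0.
have e2 : 0 < e / 2 by rewrite divr_gt0.
have [g [r ap]] := exists_approx mu_refl mu_shift mu_decay mpsi psi_ge0 kappa0 d0 s4 Xi00 psi_log N20
  small_delta (ler0n _ n) C (tame_lowpass n) (lowpass_ew n) T0 e2.
exists ((fun k => (lowpass n k)%:C%C * g0 k), g, r) => /=.
have nE k : nsq (g0 k - (lowpass n k)%:C%C * g0 k) = (1 - lowpass n k) * nsq (g0 k).
  rewrite (_ : g0 k - _ = (1 - lowpass n k)%:C%C * g0 k); last first.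
    by apply: complex_ext; rewrite ?(cReB, cImB, cReZ, cImZ); ring.
  rewrite nsqZ; congr (_ * _); have := cut_idem C k; rewrite expr2 => E.
  by rewrite mulrBl mul1r mulrBr mulr1 E subrr subr0.
split.
- by apply: itg_ext i1 _ => k; rewrite nE.
- apply: le_trans (_ : b <= e); last by rewrite ge_min lexx.
  by apply: le_trans l1; apply: eq_ler; congr Rintegral; apply/funext => k; rewrite nE.
- apply: approx_weaken ap => //.
  have le : c * \int[mu]_k ((1 - lowpass n k) * decay k) <= e / 2.
    apply: (le_trans (ler_wpM2l c0 l2)).
    apply: (@le_trans _ _ (c * (e / (2 * (c + 1))))); first by rewrite ler_wpM2l// ge_min lexx orbT.
    rewrite mulrA ler_pdivrMr//; nra.
  by move: le; rewrite /c; lra.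
Qed.

(** The n-th approximation lives on [0, n + 1]. The stability estimate compares two of them on the
    shorter interval, and the uniform H^s bound makes its rate independent of n. *)
Lemma exists_solution : exists g : line -> K -> R[i], forall T,
  approx T Mb 0 g0 g (fun _ _ => 0).
Proof.
have M0 : 0 <= Mb := Mb_ge0 s Xi00 N20.
pose C := 1 + (\int[mu]_k decay k + Mb).
have D0 : 0 <= \int[mu]_k decay k by apply: Rintegral_ge0 => k _; exact: decay_ge0.
have C0 : 0 <= C by apply: addr_ge0 => //; exact: addr_ge0.
(* The last two factors cancel the constant 8 (n + 2) and the exponential of the stability estimate
   on [0, n + 1], leaving the Cauchy rate 16^(-n). *)
pose e n : R := (1 / 16) ^+ n * ((8 * n.+2%:R)^-1 * expR (- (2 * C * n.+1%:R))).
have q16 n : 0 < (1 / 16 : R) ^+ n by apply: exprn_gt0; rewrite divr_gt0 ?ltr0n.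
have w0 n : 0 < (8 * n.+2%:R : R)^-1 by rewrite invr_gt0 mulr_gt0 ?ltr0n.
have w1 n : (8 * n.+2%:R : R)^-1 <= 1 by rewrite invf_le1 ?mulr_gt0 ?ltr0n// -natrM ler1n.
have x0 n : 0 < expR (- (2 * C * n.+1%:R)) := expR_gt0 _.
have C20 n : 0 <= 2 * C * n.+1%:R by rewrite !mulr_ge0.
have x1 n : expR (- (2 * C * n.+1%:R)) <= 1 by rewrite -[leRHS]expR0 ler_expR oppr_le0.
have e0 n : 0 < e n by rewrite /e !mulr_gt0.
have e16 n : e n <= (1 / 16) ^+ n.
  rewrite /e ler_piMr ?(ltW (q16 n))//; apply: mulr_ile1 => //; exact: ltW.
have edec n m : (n <= m)%N -> e m <= e n.
  move=> nm; apply: ler_pM; rewrite ?(ltW (q16 _)) ?mulr_ge0 ?(ltW (w0 _)) ?(ltW (x0 _))//; first exact: pow16_le.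
  apply: ler_pM; rewrite ?(ltW (w0 _)) ?(ltW (x0 _))//.
    by rewrite lef_pV2 ?posrE ?mulr_gt0 ?ltr0n// ler_wpM2l// ler_nat.
  by rewrite ler_expR lerN2; apply: ler_wpM2l; rewrite ?mulr_ge0// ler_nat.
have T0 n : 0 < n.+1%:R :> R by rewrite ltr0n.
have ex n := approx_fast (T0 n) (e0 n).
have /choice [p hp] := ex.
have st n m : (n <= m)%N -> {ae leb, forall t : line, 0 <= t <= n.+1%:R ->
    \int[mu]_k nsq ((p n).1.2 t k - (p m).1.2 t k) <= (1 / 16) ^+ n}.
  move=> nm; have [in1 le1 a1] := hp n; have [in2 le2 a2] := hp m.
  have a2' : approx n.+1%:R Mb (e m) (p m).1.1 (p m).1.2 (p m).2.
    by apply: approx_weaken a2 => //; rewrite ler_nat ltnS.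
  have m1 := ap_meas0 a1; have m2 := ap_meas0 a2.
  have le k : nsq ((p n).1.1 k - (p m).1.1 k) <= 2 * (nsq (g0 k - (p n).1.1 k) + nsq (g0 k - (p m).1.1 k)).
    have -> : (p n).1.1 k - (p m).1.1 k = (g0 k - (p m).1.1 k) + - (g0 k - (p n).1.1 k) by ring.
    by rewrite addrC [X in _ <= 2 * X]addrC; apply: le_trans (nsqD_le _ _) _; rewrite nsqN [X in 2 * X]addrC.
  have i2 := itgZ 2 (itgD in1 in2).
  have i12 : itg mu (fun k => nsq ((p n).1.1 k - (p m).1.1 k)).
    by apply: itg_mono i2 _ => [|k]; [apply: cmeas_nsq; exact: cmeasB|rewrite ger0_norm ?nsq_ge0].
  have l12 : \int[mu]_k nsq ((p n).1.1 k - (p m).1.1 k) <= 4 * e n.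
    apply: le_trans (Rint_le i12 i2 le) _.
    rewrite (Rint_Z _ (itgD in1 in2)) (Rint_D in1 in2).
    have := edec n m nm; move: le1 le2; lra.
  have := stability_estimate mu_refl mu_shift mu_decay psi_ge0 kappa0 d0 d1 s4 (ltW (T0 n)) a1 a2' i12 M0 (ltW (e0 n)) (ltW (e0 m)).
  apply: filterS => t h tn; apply: (le_trans (h tn)).
  rewrite -/C; apply: (@le_trans _ _ (8 * n.+2%:R * e n * expR (2 * C * n.+1%:R))).
    apply: ler_wpM2r; first exact: expR_ge0.
    have := edec n m nm; rewrite -(natr1 n.+1).
    exact: cauchy_arith (ltW (T0 n)) l12.
  apply: eq_ler; rewrite /e; set w := 8 * _; set y := 2 * C * _.
  have wn : w != 0 by rewrite mulf_neq0 ?pnatr_eq0.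
  have -> : w * ((1 / 16) ^+ n * (w^-1 * expR (- y))) * expR y = (1 / 16) ^+ n * (w * w^-1) * (expR y * expR (- y)) by ring.
  by rewrite expRxMexpNx_1 divff// !mulr1.
exists (glim (fun n => (p n).1.2)) => T.
(* The limit is the same for all horizons, so a bounded interval is covered by an integer one. *)
apply: (approx_weaken (T := (Num.truncn T).+1%:R) (e := 0)) => //; first exact/ltW/truncnS_gt.
have [i0 l0 a0] : [/\ forall n, itg mu (fun k => nsq (g0 k - (p n).1.1 k)),
    forall n, \int[mu]_k nsq (g0 k - (p n).1.1 k) <= e n &
    forall n, approx n.+1%:R Mb (e n) (p n).1.1 (p n).1.2 (p n).2].
  by split => n; have [] := hp n.
exact: (passage_to_limit mu_shift mu_decay psi_ge0 kappa0 d0 s4 M0 mg0 e16 i0 l0 a0 st).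
Qed.

End existence.

(** * The frequency measures *)

Section line_measures.
Context {R : realType}.
Local Notation line := (measurableTypeR R).
Local Notation leb := (@lebesgue_measure R).
Local Open Scope ereal_scope.

(** Reflection and translation in one statement: x -> y - x is the form in which they enter a
    convolution, and y = 0 gives the pure reflection. *)
Definition flip_invariant (m : set line -> \bar R) (y : line) := forall F : line -> \bar R,
  measurable_fun setT F -> (forall x, 0 <= F x) -> \int[m]_x F (y - x)%R = \int[m]_x F x.

Lemma measurable_flip (y : line) : measurable_fun (setT : set line) (fun x : line => (y - x)%R : line).
Proof. exact: measurable_funB. Qed.

Lemma lebesgue_flip (y : line) : flip_invariant leb y.
Proof.
move=> F mF F0; pose phi (x : line) : line := (y - x)%R.
have mphi : measurable_fun setT phi := measurable_flip y.
pose m : {measure set line -> \bar R} :=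
  measure_function_pushforward__canonical__measure_function_Measure leb mphi.
(* Uniqueness of Lebesgue measure reduces the claim to intervals. The flip moves the closed end to
   the other side, which does not change the length. *)
have h A : measurable A -> leb A = m A.
  apply: lebesgue_measure_unique => _ [[a b]] _ <-.
  rewrite /m /= /pushforward (_ : phi @^-1` _ = [set` `[y - b, y - a[%R]); last first.
    by apply/seteqP; split => x; rewrite /phi /= !in_itv /=; lra.
  rewrite !lebesgue_measure_itv /= !lte_fin ltrD2l ltrN2; case: ifP => // _.
  by rewrite -!EFinB; congr EFin; ring.
transitivity (\int[m]_x F x).
  by rewrite (ge0_integral_pushforward mphi)// => x _; exact: F0.
by apply: eq_measure_integral => A mA _; apply/esym; exact: h.
Qed.

Lemma integer_integral (F : line -> \bar R) : measurable_fun setT F -> (forall x, 0 <= F x) ->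
  \int[integer_counting]_x F x = \esum_(z in [set: int]) F z%:~R%R.
Proof.
move=> mF F0; rewrite /integer_counting ge0_integral_measure_add//.
rewrite /nat_counting /negz_counting !ge0_integral_measure_series//.
rewrite (esumID [set z : int | (0 <= z)%R])//.
rewrite !setTI; congr (_ + _).
  rewrite (eq_eseriesr (g := fun n => F n%:R%R)); last first.
    by move=> n _; rewrite integral_dirac// diracT mul1e.
  rewrite nneseries_esumT//; apply/esym.
  rewrite (@reindex_esum R _ _ [set: nat] [set z : int | (0 <= z)%R] Posz)//; split.
  - by move=> n _ /=.
  - by move=> m n _ _ [].
  - by move=> [n|n] //= _; exists n.
rewrite (eq_eseriesr (g := fun n => F (- n.+1%:R)%R)); last first.
  by move=> n _; rewrite integral_dirac// diracT mul1e.
rewrite nneseries_esumT//; apply/esym.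
rewrite (@reindex_esum R _ _ [set: nat] (~` [set z : int | (0 <= z)%R]) Negz); last split.
- by apply: eq_esum => n _; rewrite NegzE mulrNz.
- by move=> n _ /=.
- by move=> m n _ _ [].
- by move=> [n|n] //= h; exists n.
Qed.

Lemma integer_flip (c : int) : flip_invariant integer_counting c%:~R%R.
Proof.
move=> F mF F0; rewrite !integer_integral//; last first.
  by apply: (measurableT_comp mF); exact: measurable_flip.
rewrite [RHS](@reindex_esum R _ _ [set: int] [set: int] (fun z => (c - z)%R)).
  by apply: eq_esum => z _; rewrite intrB.
split => //.
- by move=> a b _ _ /addrI /oppr_inj.
- by move=> z _ /=; exists (c - z)%R => //; rewrite opprB addrC subrK.
Qed.

(** The complement of the integers is null for the counting measure, so flips about integers are
    flips about almost every point. *)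
Lemma ae_integer : {ae integer_counting, forall y : line, exists c : int, y = c%:~R%R}.
Proof.
pose A : set line := \bigcup_n [set n%:R%R] `|` \bigcup_n [set (- n.+1%:R)%R].
have mA : measurable A by apply: measurableU; apply: bigcup_measurable => n _; exact: measurable_set1.
exists (~` A); split.
- exact: measurableC.
- have z1 : nat_counting (~` A) = 0.
    by rewrite /nat_counting /mseries eseries0// => i _ _; rewrite /= diracE memNset//= => h; apply: h; left; exists i.
  have z2 : negz_counting (~` A) = 0.
    by rewrite /negz_counting /mseries eseries0// => i _ _; rewrite /= diracE memNset//= => h; apply: h; right; exists i.
  have e : integer_counting (~` A) = nat_counting (~` A) + negz_counting (~` A) by exact: measure_addE.
  by rewrite [LHS]e z1 z2 adde0.
- move=> y /= h; apply: contra_not h => -[[n _ ->]|[n _ ->]].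
    by exists n%:Z.
  by exists (Negz n); rewrite NegzE mulrNz.
Qed.

Lemma line_flip b : {ae line_freq b, forall y : line, flip_invariant (line_freq b) y}.
Proof.
case: b => /=; last by apply: aeW => y; exact: lebesgue_flip.
by apply: filterS ae_integer => y [c ->]; exact: integer_flip.
Qed.

Lemma line_flip0 b : flip_invariant (line_freq b) 0%R.
Proof. by case: b; [exact: (integer_flip 0)|exact: lebesgue_flip]. Qed.

End line_measures.

Section frequency_measure.
Context {R : realType}.
Local Notation K := (freqsp R).
Local Notation line := (measurableTypeR R).
Local Notation leb := (@lebesgue_measure R).

(** A copy of [freq] on [freqsp], which carries at once the group structure and the sigma-finiteness
    needed for Tonelli's theorem. *)
Definition freqS (Om : domain) : set K -> \bar R := @freq R Om.

HB.instance Definition _ Om := isMeasure.Build _ _ _ (freqS Om) (measure0 (@freq R Om))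
  (measure_ge0 (@freq R Om)) (@measure_semi_sigma_additive _ _ _ (@freq R Om)).

Lemma freqS_sigma_finite Om : sigma_finite setT (freqS Om).
Proof.
have /sigma_finiteP[F [TF ndF Foo]] := sigma_finiteT (@line_freq R (periodic1 Om)).
have /sigma_finiteP[G [TG ndG Goo]] := sigma_finiteT (@line_freq R (periodic2 Om)).
exists (fun n => F n `*` G n : set K).
  apply/seteqP; split => // -[x y] _.
  have [n _ Fnx] : (\bigcup_i F i) x by rewrite -TF.
  have [k _ Gky] : (\bigcup_i G i) y by rewrite -TG.
  exists (maxn n k) => //; split => /=.
    by move: x Fnx; exact/subsetPset/ndF/leq_maxl.
  by move: y Gky; exact/subsetPset/ndG/leq_maxr.
move=> k; have [[? ?] [? ?]] := (Foo k, Goo k); split; first exact: (@measurableX _ _ line line).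
have -> : freqS Om (F k `*` G k) = (line_freq (periodic1 Om) (F k) * line_freq (periodic2 Om) (G k))%E.
  exact: product_measure1E.
by rewrite lte_mul_pinfty// ge0_fin_numE.
Qed.

HB.instance Definition _ Om := Measure_isSigmaFinite.Build _ _ _ (freqS Om) (freqS_sigma_finite Om).

Section invariances.
Variable Om : domain.
Local Notation m1 := (line_freq (periodic1 Om)).
Local Notation m2 := (line_freq (periodic2 Om)).

Lemma freqS_tonelli (F : K -> \bar R) : measurable_fun setT F -> (forall k, 0 <= F k)%E ->
  (\int[freqS Om]_k F k = \int[m1]_x \int[m2]_y F (x, y))%E.
Proof. by move=> mF F0; exact: (@fubini_tonelli1 _ _ line line R m1 m2 F mF F0). Qed.

Lemma freqS_flip (k : K) : flip_invariant m1 k.1 -> flip_invariant m2 k.2 ->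
  forall F : K -> \bar R, measurable_fun setT F -> (forall l, 0 <= F l)%E ->
  (\int[freqS Om]_l F (k - l)%R = \int[freqS Om]_l F l)%E.
Proof.
move=> h1 h2 F mF F0.
have mG : measurable_fun setT (fun l : K => F (k - l)%R) by exact: (measurableT_comp mF (measurable_freqB _ _)).
rewrite (freqS_tonelli mG (fun l => F0 _)) (freqS_tonelli mF F0).
rewrite -[RHS]h1; last 2 first.
- exact: (@measurable_fun_fubini_tonelli_F _ _ line line R m2 F).
- by move=> x; apply: integral_ge0.
apply: eq_integral => x _; rewrite -[RHS]h2//.
exact: (@measurable_sect1 _ _ line line _ _ F).
Qed.

Lemma freqS_refl : refl_invariant (freqS Om).
Proof.
move=> F mF F0; rewrite -(freqS_flip (k := 0) _ _ mF F0).
- by apply: eq_integral => k _; rewrite sub0r.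
- exact: line_flip0.
- exact: line_flip0.
Qed.

Lemma ae_freq1 (P : R -> Prop) : {ae m1, forall x : line, P x} -> {ae freqS Om, forall k, P k.1}.
Proof.
move=> [A [mA A0 h]]; exists (A `*` setT : set K); split.
- exact: (@measurableX _ _ line line).
- rewrite [LHS](product_measure1E m1 m2 mA measurableT); apply/eqP; rewrite mule_eq0; apply/orP; left; exact/eqP.
- by move=> k hk; split => //; exact: h.
Qed.

Lemma ae_freq2 (P : R -> Prop) : {ae m2, forall x : line, P x} -> {ae freqS Om, forall k, P k.2}.
Proof.
move=> [A [mA A0 h]]; exists (setT `*` A : set K); split.
- exact: (@measurableX _ _ line line).
- rewrite [LHS](product_measure1E m1 m2 measurableT mA); apply/eqP; rewrite mule_eq0; apply/orP; right; exact/eqP.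
- by move=> k hk; split => //; exact: h.
Qed.

Lemma freqS_shift : shift_invariant (freqS Om).
Proof.
pose mu : {sigma_finite_measure set K -> \bar R} := freqS Om.
have a1 : {ae mu, forall k, flip_invariant m1 k.1} := ae_freq1 (line_flip _).
have a2 : {ae mu, forall k, flip_invariant m2 k.2} := ae_freq2 (line_flip _).
have [A [mA A0 hA]] := a1; have [B [mB B0 hB]] := a2.
exists (A `|` B); split; first exact: measurableU.
  apply/eqP; rewrite -measure_le0; apply: (le_trans (measureU2 _ mA mB)).
  by rewrite [X in (X + _ <= _)%E]A0 [X in (_ + X <= _)%E]B0 adde0.
move=> k /= hk; apply: contrapT => /not_orP[nA nB]; apply: hk.
have h1 : flip_invariant m1 k.1 by apply: contrapT => h; apply: nA; exact: hA.
have h2 : flip_invariant m2 k.2 by apply: contrapT => h; apply: nB; exact: hB.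
exact: freqS_flip.
Qed.

End invariances.

(** The integral over the half line is known from the arctangent; the flip about 0 accounts for the
    other half. *)
Lemma lebesgue_decay : itg leb (fun x => (1 + x ^+ 2)^-1).
Proof.
pose h : line -> R := fun x => (1 + x ^+ 2)^-1.
have mh : measurable_fun setT h by apply: continuous_measurable_fun; exact: continuous_oneDsqrV.
have h0 x : 0 <= h x by rewrite invr_ge0 addr_ge0 ?sqr_ge0.
pose D : set line := `[0, +oo[%classic.
have mD : measurable D by exact: measurable_itv.
pose hp := (EFin \o h) \_ D.
have mhp : measurable_fun setT hp.
  have mhD : measurable_fun D (EFin \o h) by apply/measurable_EFinP; exact: (measurable_funS measurableT _ mh).
  by rewrite /hp; apply/(measurable_restrictT _ mD).
have hp0 x : (0 <= hp x)%E by rewrite /hp patchE; case: ifP => // _; rewrite lee_fin.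
have ihp : (\int[leb]_x hp x < +oo)%E.
  by rewrite /hp -integral_mkcond [X in (X < _)%E](integral0y_oneDsqr R) ltry.
have ihm : (\int[leb]_x hp (0 - x)%R < +oo)%E by rewrite (lebesgue_flip 0 mhp).
apply: itg_lt_fin => //.
apply: (@le_lt_trans _ _ (\int[leb]_x (hp x + hp (0 - x)%R))%E).
  apply: ge0_le_integral_ae.
  - exact/measurable_EFinP.
  - by apply: emeasurable_funD => //; apply: (measurableT_comp mhp); exact: measurable_flip.
  - by move=> x; rewrite lee_fin; exact: h0.
  - apply: aeW => x; have [x0|x0] := leP 0 x.
      rewrite {1}/hp patchE mem_set; last by rewrite /D /= in_itv /= x0.
      by rewrite leeDl.
    apply: (@le_trans _ _ (hp (0 - x)%R)); last by rewrite leeDr.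
    rewrite /hp patchE mem_set /=; first by rewrite /h sub0r sqrrN.
    by rewrite /D /= in_itv /= sub0r oppr_ge0 ltW.
rewrite ge0_integralD//; first exact: lte_add_pinfty.
by apply: (measurableT_comp mhp); exact: measurable_flip.
Qed.

(** Amounts to (n + 1)(n + 2) <= 4 (1 + n^2), and bounds the sum over all integers n >= 0 by 4. *)
Lemma inv_sqr_telescope n : (1 + n%:R ^+ 2)^-1 <= 4 * (n.+1%:R^-1 - n.+2%:R^-1) :> R.
Proof.
rewrite -[n.+2%:R]natr1 -[n.+1%:R]natr1; have : 0 <= n%:R :> R by []; set x : R := n%:R => x0.
have -> : 4 * ((x + 1)^-1 - (x + 1 + 1)^-1) = ((x + 1) * (x + 1 + 1) / 4)^-1.
  by field; apply/andP; split; apply: lt0r_neq0; lra.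
have p : 0 < (x + 1) * (x + 1 + 1) / 4 by rewrite divr_gt0// mulr_gt0//; lra.
rewrite lef_pV2 ?posrE// ?ltr_pwDl ?sqr_ge0//.
by have h := sqr_ge0 (x - 1); have h2 := sqr_ge0 x; nra.
Qed.

Lemma integer_decay : itg integer_counting (fun x : line => (1 + x ^+ 2)^-1).
Proof.
pose h : line -> R := fun x => (1 + x ^+ 2)^-1.
have mh : measurable_fun setT h by apply: continuous_measurable_fun; exact: continuous_oneDsqrV.
have h0 x : 0 <= h x by rewrite invr_ge0 addr_ge0 ?sqr_ge0.
have sum4 : (\sum_(n <oo) (h n%:R)%:E <= 4%:E :> \bar R)%E.
  apply: lime_le; first by apply: is_cvg_nneseries => n _ _; rewrite lee_fin.
  apply: nearW => n; rewrite sumEFin lee_fin.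
  apply: (@le_trans _ _ (4 * (1 - n.+1%:R^-1))).
    elim: n => [|n IH]; first by rewrite big_geq// invr1 subrr mulr0.
    rewrite big_nat_recr//=; apply: le_trans (lerD IH (inv_sqr_telescope n)) _.
    by apply: eq_ler; ring.
  by rewrite ler_piMr// gerBl.
have dirac x : (\int[\d_x]_y (h y)%:E = (h x)%:E)%E.
  by rewrite integral_dirac ?diracT ?mul1e//; exact/measurable_EFinP.
apply: itg_lt_fin => //.
rewrite /integer_counting ge0_integral_measure_add//; last exact/measurable_EFinP.
rewrite /nat_counting /negz_counting !ge0_integral_measure_series//; try exact/measurable_EFinP.
apply: lte_add_pinfty; apply: (@le_lt_trans _ _ 4%:E); rewrite ?ltry//; apply: le_trans sum4.
  by rewrite (eq_eseriesr (g := fun n => (h n%:R)%:E)) // => n _; exact: dirac.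
apply: lee_nneseries => [n _ _|n _]; first by apply: integral_ge0 => y _; rewrite lee_fin; exact: h0.
rewrite dirac lee_fin /h sqrrN lef_pV2 ?posrE ?ltr_pwDl ?sqr_ge0// lerD2l.
by rewrite ler_pXn2r ?nnegrE// ler_nat.
all: by move=> x _; rewrite lee_fin; exact: h0.
Qed.

Lemma line_decay b : itg (line_freq b) (fun x : line => (1 + x ^+ 2)^-1).
Proof. by case: b; [exact: integer_decay|exact: lebesgue_decay]. Qed.

Lemma measurable_decay : measurable_fun setT (@decay R).
Proof.
have -> : @decay R = fun k => (10 + modulus k) `^ (- 4%:R).
  apply/funext => k; rewrite powRN; congr (_^-1).
  by rewrite -powR_mulrn// ltW// mod10_gt0.
by apply: measurable_powR10; exact: measurable_modulus.
Qed.

(** Each factor 1 + k_i^2 is at most (10 + |k|)^2, so the weight is dominated by a product of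
    one-dimensional integrable functions, whichever directions are periodic. *)
Lemma freqS_decay Om : itg (freqS Om) (@decay R).
Proof.
have [i _] := itg_tensor (line_decay (periodic1 Om)) (line_decay (periodic2 Om)).
have i' : itg (freqS Om) (fun k : K => (1 + k.1 ^+ 2)^-1 * (1 + k.2 ^+ 2)^-1) by exact: i.
apply: itg_mono i' _.
  exact: measurable_decay.
move=> k; rewrite ger0_norm ?decay_ge0// /decay -invfM.
have m0 := modulus_ge0 k; have ms := modulus_sqr k.
have q (x y : R) : modulus k ^+ 2 = x ^+ 2 + y ^+ 2 -> 1 + x ^+ 2 <= (10 + modulus k) ^+ 2.
  by have := sqr_ge0 y; nra.
rewrite lef_pV2 ?posrE ?mulr_gt0 ?exprn_gt0 ?mod10_gt0 ?ltr_pwDl ?sqr_ge0//.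
rewrite (_ : 4 = 2 + 2)%N // exprD; apply: ler_pM; rewrite ?addr_ge0 ?sqr_ge0//.
  exact: q ms.
by apply: q; rewrite addrC in ms; exact: ms.
Qed.

End frequency_measure.

(** * Injectivity of the Fourier transform *)

Section sign_iteration.
Context {R : realType}.

(* The iterates converge to the sign on [-1, 1]: the sign is a limit of polynomials. *)
Definition cubic (v : R) : R := (3 * v - v * (v * v)) / 2.

Lemma cubic_bounds v : 0 <= v <= 1 -> v <= cubic v <= 1.
Proof.
move=> /andP[v0 v1]; rewrite /cubic; apply/andP; split.
  have h : 0 <= v * (1 - v ^+ 2) by rewrite mulr_ge0// subr_ge0 expr_le1.
  have -> : (3 * v - v * (v * v)) / 2 = v + v * (1 - v ^+ 2) / 2 by field.
  by rewrite lerDl divr_ge0.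
have h : 0 <= (1 - v) ^+ 2 * (v + 2) by rewrite mulr_ge0 ?sqr_ge0// addr_ge0.
have -> : (3 * v - v * (v * v)) / 2 = 1 - (1 - v) ^+ 2 * (v + 2) / 2 by field.
by rewrite gerBl divr_ge0.
Qed.

Lemma cubicN v : cubic (- v) = - cubic v.
Proof. by rewrite /cubic; field. Qed.

Lemma iter_cubicN n v : iter n cubic (- v) = - iter n cubic v.
Proof. by elim: n => //= n ->; exact: cubicN. Qed.

Lemma iter_cubic_bounds n v : 0 <= v <= 1 -> v <= iter n cubic v <= 1.
Proof.
move=> /[dup] h /andP[v0 v1]; elim: n => [|n /andP[IH1 IH2]] /=; first by rewrite lexx.
have /cubic_bounds/andP[c1 c2] : 0 <= iter n cubic v <= 1 by rewrite IH2 andbT (le_trans v0).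
by rewrite c2 andbT (le_trans IH1).
Qed.

(** The iterates increase and stay below 1, so they converge to a fixed point. The fixed points are
    0 and plus or minus 1, and the limit is at least v > 0. *)
Lemma iter_cubic_cvg_gt0 v : 0 < v <= 1 -> iter n cubic v @[n --> \oo] --> (1 : R).
Proof.
move=> /andP[v0 v1]; have v01 : 0 <= v <= 1 by rewrite ltW.
pose u n := iter n cubic v.
have ub n : v <= u n <= 1 := iter_cubic_bounds n v01.
have nd : nondecreasing_seq u.
  apply/nondecreasing_seqP => n; have /andP[a b] := ub n.
  by have /cubic_bounds/andP[] : 0 <= u n <= 1 by rewrite b andbT (le_trans (ltW v0)).
have cu : cvgn u.
  by apply: nondecreasing_is_cvgn => //; exists 1 => _ [n _ <-]; have /andP[] := ub n.
set l := limn u; have ul : u @ \oo --> l by exact: cu.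
have vl : v <= l.
  by apply: limr_ge => //; apply: nearW => n; have /andP[] := ub n.
have l1 : l <= 1.
  by apply: limr_le => //; apply: nearW => n; have /andP[] := ub n.
have cl : (fun n => cubic (u n)) @ \oo --> cubic l.
  apply: cvgMr_tmp; apply: cvgB; first by apply: cvgMl_tmp.
  by apply: cvgM => //; exact: cvgM.
have cl' : (fun n => cubic (u n)) @ \oo --> l.
  rewrite (_ : (fun n => cubic (u n)) = [sequence u (n + 1)%N]_n) ?cvg_shiftn//.
  by apply/funext => n; rewrite /u /= addn1.
have e : l = cubic l by exact: (cvg_unique _ cl' cl).
have l0 : 0 < l by exact: lt_le_trans vl.
have : l * (1 - l ^+ 2) = 0 by move: e; rewrite /cubic => e; lra.
move=> /eqP; rewrite mulf_eq0 gt_eqF//= subr_eq0 eq_sym sqrf_eq1 => /orP[/eqP l1'|/eqP lN].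
  by move: ul; rewrite l1'.
by move: l0; rewrite lN oppr_gt0 ltr10.
Qed.

Lemma iter_cubic_cvg v : `|v| <= 1 -> iter n cubic v @[n --> \oo] --> Num.sg v.
Proof.
move=> v1; have [v0|v0|->] := ltgtP v 0.
- rewrite ltr0_sg//; have h := @iter_cubic_cvg_gt0 (- v).
  rewrite (_ : (fun n => _) = fun n => - iter n cubic (- v)); last first.
    by apply/funext => n; rewrite iter_cubicN opprK.
  by apply: cvgN; apply: h; rewrite oppr_gt0 v0 -ltr0_norm.
- by rewrite gtr0_sg//; apply: iter_cubic_cvg_gt0; rewrite v0 -(gtr0_norm v0).
- rewrite sgr0; apply: cvg_near_cst; apply: nearW => n.
  by elim: n => //= n ->; rewrite /cubic !mulr0 subrr mul0r.
Qed.

Lemma iter_cubic_le1 n v : `|v| <= 1 -> `|iter n cubic v| <= 1.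
Proof.
move=> v1; wlog v0 : v v1 / 0 <= v.
  move=> h; have [v0|v0] := leP 0 v; first exact: h.
  by rewrite -normrN -iter_cubicN; apply: h; rewrite ?normrN// oppr_ge0 ltW.
have /(iter_cubic_bounds n)/andP[a b] : 0 <= v <= 1 by rewrite v0 -(ger0_norm v0).
by rewrite ger0_norm// (le_trans v0).
Qed.

Lemma sg_sin_small (x : R) : `|x| <= 1 -> Num.sg (sin x) = Num.sg x.
Proof.
have pi1 : 1 < pi :> R by apply: lt_le_trans (pi_ge2 R); rewrite ltr1n.
have pos (y : R) : 0 < y -> y <= 1 -> Num.sg (sin y) = 1.
  by move=> y0 y1; rewrite gtr0_sg// sin_gt0_pi// y0 (le_lt_trans y1).
move=> x1; have [x0|x0|->] := ltgtP x 0; last by rewrite sin0.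
- by rewrite (ltr0_sg x0) -[x]opprK sinN sgrN pos ?oppr_gt0// -ltr0_norm.
- by rewrite (gtr0_sg x0) pos// -(gtr0_norm x0).
Qed.

End sign_iteration.

Section cis_theory.
Context {R : realType}.
Implicit Types (a b : R) (x k : R * R).
Local Notation Re := complex.Re.
Local Notation Im := complex.Im.
Local Notation cabs := Normc.normc.

Lemma cisD a b : cis (a + b) = cis a * cis b :> R[i].
Proof.
rewrite /cis; apply: complex_ext; rewrite ?(cReM, cImM) /= ?cosD ?sinD; first by [].
by rewrite addrC [X in X + _]mulrC [X in _ + X]mulrC addrC mulrC [X in _ + X]mulrC.
Qed.

Lemma cabs_cis a : cabs (cis a) = 1 :> R.
Proof. by rewrite /cis /= cos2Dsin2 sqrtr1. Qed.

Lemma dotDl x y k : dot (x + y) k = dot x k + dot y k.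
Proof. rewrite /dot /=; ring. Qed.

Lemma dotDr x k l : dot x (k + l) = dot x k + dot x l.
Proof. rewrite /dot /=; ring. Qed.

Lemma dotNr x k : dot x (- k) = - dot x k.
Proof. rewrite /dot /=; ring. Qed.

Lemma cisN a : cis (- a) = (cis a)^*%C :> R[i].
Proof. by rewrite /cis cosN sinN. Qed.

(** Euler's formula in the form used for multipliers: a sine is a combination of two characters, and
    each character acts on the transform by translation. *)
Lemma sin_cis a b : (sin (a + b))%:C%C =
  cis b / (2 * 'i)%C * cis a + - (cis (- b) / (2 * 'i)%C) * cis (- a) :> R[i].
Proof.
have wn : (2 * 'i)%C != 0 :> R[i].
  apply/eqP => /(congr1 (fun w : R[i] => Im w)); rewrite cImM /= => h; have : (2 : R) = 0 by lra.
  by apply/eqP; rewrite pnatr_eq0.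
have e : cis (a + b) - cis (- (a + b)) = (2 * 'i)%C * (sin (a + b))%:C%C :> R[i].
  rewrite cisN /cis; apply: complex_ext; rewrite ?(cReB, cImB, cReM, cImM) /=; ring.
move: wn e; set w := (2 * 'i)%C => wn e.
by apply: (mulfI wn); rewrite -e opprD !cisD; field.
Qed.

End cis_theory.

Section injectivity.
Context {R : realType}.
Local Notation K := (freqsp R).
Local Notation line := (measurableTypeR R).
Variable mu : {sigma_finite_measure set K -> \bar R}.
Local Notation Re := complex.Re.
Local Notation Im := complex.Im.
Local Notation cabs := Normc.normc.

Definition fourint (h : K -> R[i]) (x : R * R) : R[i] :=
  cint mu setT (fun k : K => h k * cis (dot x k)).

Definition cL1 (h : K -> R[i]) := cmeasurable h /\ itg mu (fun k => cabs (h k)).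

Lemma cL1_ReIm h : cL1 h -> itg mu (fun k => Re (h k)) /\ itg mu (fun k => Im (h k)).
Proof.
case=> -[mr mi] i; split; apply: itg_mono i _ => // k; [exact: cabs_Re|exact: cabs_Im].
Qed.

Lemma cL1_le h (G : K -> R) : cmeasurable h -> itg mu G -> (forall k, cabs (h k) <= G k) -> cL1 h.
Proof.
move=> mh iG le; split => //; apply: itg_mono iG _; first exact: cmeas_cabs.
by move=> k; rewrite ger0_norm ?cabs_ge0.
Qed.

Lemma cL1D h h' : cL1 h -> cL1 h' -> cL1 (fun k => h k + h' k).
Proof.
case=> m1 i1 [m2 i2]; apply: (cL1_le _ (itgD i1 i2)); first exact: cmeasD.
by move=> k; exact: cabsD.
Qed.

Lemma cL1_bounded (b : K -> R[i]) B h : cmeasurable b -> (forall k, cabs (b k) <= B) ->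
  cL1 h -> cL1 (fun k => b k * h k).
Proof.
move=> mb bB [mh ih]; apply: (cL1_le _ (itgZ B ih)); first exact: cmeasM.
by move=> k; rewrite cabsM ler_wpM2r ?cabs_ge0.
Qed.

Lemma cL1Z c h : cL1 h -> cL1 (fun k => c * h k).
Proof. by apply: (@cL1_bounded (fun=> c) (cabs c)) => //; exact: cmeas_cst. Qed.

Lemma measurable_dot x : measurable_fun setT (fun k : K => dot x k).
Proof.
by apply: measurable_funD; apply: measurable_funM => //.
Qed.

Lemma measurable_sin_comp d (T : measurableType d) (a : T -> R) : measurable_fun setT a ->
  measurable_fun setT (fun x => sin (a x)).
Proof. by move=> ma; apply: (measurableT_comp _ ma); apply: continuous_measurable_fun; exact: continuous_sin. Qed.

Lemma measurable_cos_comp d (T : measurableType d) (a : T -> R) : measurable_fun setT a ->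
  measurable_fun setT (fun x => cos (a x)).
Proof. by move=> ma; apply: (measurableT_comp _ ma); apply: continuous_measurable_fun; exact: continuous_cos. Qed.

Lemma cmeas_cis x : cmeasurable (fun k : K => cis (dot x k)).
Proof.
by split => /=; [apply: measurable_cos_comp|apply: measurable_sin_comp]; exact: measurable_dot.
Qed.

Lemma cL1_cis x h : cL1 h -> cL1 (fun k => h k * cis (dot x k)).
Proof.
move=> ih; rewrite (_ : (fun k => _) = fun k => cis (dot x k) * h k).
  by apply: (cL1_bounded (cmeas_cis x) _ ih) => k; rewrite cabs_cis.
by apply/funext => k; rewrite mulrC.
Qed.

Lemma cint_ext (f g : K -> R[i]) : (forall k, f k = g k) -> cint mu setT f = cint mu setT g.
Proof. by move=> /funext ->. Qed.

Lemma cintD' f g : cL1 f -> cL1 g -> cint mu setT (fun k => f k + g k) = cint mu setT f + cint mu setT g.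
Proof. by move=> /cL1_ReIm[? ?] /cL1_ReIm[? ?]; exact: cintD. Qed.

Lemma cintZ c f : cL1 f -> cint mu setT (fun k => c * f k) = c * cint mu setT f.
Proof.
move=> /cL1_ReIm[r i]; apply: complex_ext; rewrite ?(cReM, cImM) /cint /=.
  rewrite -(Rint_Z _ r) -(Rint_Z _ i) -(Rint_B (itgZ _ r) (itgZ _ i)).
  by congr Rintegral; apply/funext => k; rewrite cReM.
rewrite -(Rint_Z _ r) -(Rint_Z _ i) -(Rint_D (itgZ _ i) (itgZ _ r)).
by congr Rintegral; apply/funext => k; rewrite cImM.
Qed.

Lemma fourintD h h' x : cL1 h -> cL1 h' -> fourint (fun k => h k + h' k) x = fourint h x + fourint h' x.
Proof.
move=> /(cL1_cis x) c /(cL1_cis x) c'; rewrite /fourint -(cintD' c c'); apply: cint_ext => k; ring.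
Qed.

Lemma fourintZ c h x : cL1 h -> fourint (fun k => c * h k) x = c * fourint h x.
Proof. by move=> /(cL1_cis x) i; rewrite /fourint -(cintZ c i); apply: cint_ext => k; ring. Qed.

Lemma fourint_translate y h x : fourint (fun k => cis (dot y k) * h k) x = fourint h (x + y).
Proof. by apply: cint_ext => k; rewrite dotDl cisD; ring. Qed.

Lemma cint_ae_eq f g : cmeasurable f -> cmeasurable g -> {ae mu, forall k, f k = g k} ->
  cint mu setT f = cint mu setT g.
Proof.
move=> [f1 f2] [g1 g2] fg; apply: complex_ext; rewrite /cint /=; apply: Rint_ae_eq => //;
by apply: filterS fg => k ->.
Qed.

Lemma fourint_ae_eq f g x : cmeasurable f -> cmeasurable g -> {ae mu, forall k, f k = g k} ->
  fourint f x = fourint g x.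
Proof.
move=> mf mg fg; apply: cint_ae_eq; try (apply: cmeasM => //; exact: cmeas_cis).
by apply: filterS fg => k ->.
Qed.

Definition null_transform h := cL1 h /\ forall x, fourint h x = 0.

(* Bounded multipliers that preserve a vanishing transform. *)
Definition nulls (F : K -> R) := [/\ measurable_fun setT F, exists B, forall k, `|F k| <= B &
  forall h, null_transform h -> null_transform (fun k => (F k)%:C%C * h k)].

Lemma nullD h h' : null_transform h -> null_transform h' -> null_transform (fun k => h k + h' k).
Proof. by case=> i z [i' z']; split => [|x]; [exact: cL1D|rewrite fourintD// z z' addr0]. Qed.

Lemma nullZ c h : null_transform h -> null_transform (fun k => c * h k).
Proof. by case=> i z; split => [|x]; [exact: cL1Z|rewrite fourintZ// z mulr0]. Qed.

Lemma null_cis y h : null_transform h -> null_transform (fun k => cis (dot y k) * h k).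
Proof.
case=> i z; split => [|x]; last by rewrite fourint_translate.
by apply: (cL1_bounded (cmeas_cis y) _ i) => k; rewrite cabs_cis.
Qed.

Lemma nulls_ext F G : nulls F -> (forall k, F k = G k) -> nulls G.
Proof. by move=> h /funext <-. Qed.

Lemma null_ext h h' : null_transform h -> (forall k, h k = h' k) -> null_transform h'.
Proof. by move=> i /funext <-. Qed.

Lemma nulls_cst c : nulls (fun=> c).
Proof. by split => // [|h ih]; [by exists (`|c|)|exact: nullZ]. Qed.

Lemma nullsD F G : nulls F -> nulls G -> nulls (fun k => F k + G k).
Proof.
case=> m1 [B1 b1] n1 [m2 [B2 b2] n2]; split; first exact: measurable_funD.
  by exists (B1 + B2) => k; apply: le_trans (ler_normD _ _) _; exact: lerD.
move=> h ih; apply: null_ext (nullD (n1 h ih) (n2 h ih)) _ => k.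
by rewrite rmorphD mulrDl.
Qed.

Lemma nullsM F G : nulls F -> nulls G -> nulls (fun k => F k * G k).
Proof.
case=> m1 [B1 b1] n1 [m2 [B2 b2] n2]; split; first exact: measurable_funM.
  by exists (B1 * B2) => k; rewrite normrM; exact: ler_pM.
by move=> h ih; apply: null_ext (n1 _ (n2 h ih)) _ => k; rewrite rmorphM mulrA.
Qed.

Lemma nullsZ c F : nulls F -> nulls (fun k => c * F k).
Proof. exact: nullsM (nulls_cst c). Qed.

Lemma Rint_limit (f : nat -> K -> R) (g G : K -> R) : (forall n, measurable_fun setT (f n)) ->
  measurable_fun setT g -> itg mu G -> (forall n k, `|f n k| <= G k) ->
  (forall k, f ^~ k @ \oo --> g k) -> (forall n, \int[mu]_k f n k = 0) -> \int[mu]_k g k = 0.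
Proof.
move=> mf mg iG fG fg f0.
have mfE n : measurable_fun setT (EFin \o f n) by apply/measurable_EFinP.
have mgE : measurable_fun setT (EFin \o g) by apply/measurable_EFinP.
have cE k : (fun n => (f n k)%:E) @ \oo --> (g k)%:E.
  by apply/fine_cvgP; split; [exact: nearW|exact: fg].
have dom : {ae mu, forall k n, setT k -> (`|(f n k)%:E| <= (G k)%:E)%E}.
  by apply: aeW => k n _; rewrite /= lee_fin.
have [_ _ cv] := @dominated_convergence _ _ _ mu setT measurableT (fun n k => (f n k)%:E) (EFin \o g)
  (EFin \o G) mfE mgE (aeW _ (fun k _ => cE k)) iG dom.
have ifn n : itg mu (f n) by apply: itg_mono iG _.
have c0 : (fun n => \int[mu]_k (f n k)%:E)%E @ \oo --> (0 : \bar R)%E.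
  by apply: cvg_near_cst; apply: nearW => n; rewrite -(Rint_EFin (ifn n)) f0.
by rewrite /Rintegral (cvg_unique _ cv c0).
Qed.

(** Dominated convergence in the vanishing transform, with majorant B |h|; this closes the algebra
    under bounded pointwise limits. *)
Lemma nulls_limit (F : nat -> K -> R) (G : K -> R) B : (forall n, nulls (F n)) ->
  (forall n k, `|F n k| <= B) -> (forall k, F ^~ k @ \oo --> G k) -> nulls G.
Proof.
move=> nF FB cF.
have mF n : measurable_fun setT (F n) by have [] := nF n.
have mG : measurable_fun setT G by apply: (measurable_fun_cvg mF) => k _; exact: cF.
have GB k : `|G k| <= B.
  have c : (fun n => `|F n k|) @ \oo --> `|G k| by apply: cvg_norm; exact: cF.
  have cB : (fun _ : nat => B) @ \oo --> B by exact: cvg_cst.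
  by apply: (ler_cvg_to c cB); apply: nearW => n; exact: FB.
split => //; first by exists B.
move=> h [ih zh].
have iGh : cL1 (fun k => (G k)%:C%C * h k).
  by apply: (cL1_bounded (cmeas_real mG) _ ih) => k; rewrite cabs_real; exact: GB.
split => // x.
have [mh ihx] := cL1_cis x ih.
have iB := itgZ B ihx.
have z n : fourint (fun k => (F n k)%:C%C * h k) x = 0 by have [_ _ /(_ h (conj ih zh)) [_]] := nF n; exact.
have [mr mi] := mh.
have E (C : K -> R) k : ((C k)%:C%C * h k) * cis (dot x k) = (C k)%:C%C * (h k * cis (dot x k)) by rewrite mulrA.
apply: complex_ext; rewrite /fourint /cint /=.
  apply: (@Rint_limit (fun n k => F n k * Re (h k * cis (dot x k))) _ _ _ _ iB).
  - by move=> n; exact: measurable_funM.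
  - by rewrite (_ : (fun k => _) = fun k => G k * Re (h k * cis (dot x k))); [exact: measurable_funM|apply/funext => k; rewrite E cReZ].
  - by move=> n k; rewrite normrM; apply: ler_pM => //; exact: cabs_Re.
  - by move=> k; rewrite E cReZ; apply: cvgM => //; exact: cvg_cst.
  - move=> n; have := congr1 (fun w : R[i] => Re w) (z n); rewrite /fourint /cint /= => <-.
    by congr Rintegral; apply/funext => k; rewrite E cReZ.
apply: (@Rint_limit (fun n k => F n k * Im (h k * cis (dot x k))) _ _ _ _ iB).
- by move=> n; exact: measurable_funM.
- by rewrite (_ : (fun k => _) = fun k => G k * Im (h k * cis (dot x k))); [exact: measurable_funM|apply/funext => k; rewrite E cImZ].
- by move=> n k; rewrite normrM; apply: ler_pM => //; exact: cabs_Im.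
- by move=> k; rewrite E cImZ; apply: cvgM => //; exact: cvg_cst.
- move=> n; have := congr1 (fun w : R[i] => Im w) (z n); rewrite /fourint /cint /= => <-.
  by congr Rintegral; apply/funext => k; rewrite E cImZ.
Qed.

Lemma nulls_sin y b : nulls (fun k => sin (dot y k + b)).
Proof.
split.
- by apply: measurable_sin_comp; apply: measurable_funD => //; exact: measurable_dot.
- by exists 1 => k; rewrite ler_norml sin_geN1 sin_le1.
move=> h nh; have n1 := nullZ (cis b / (2 * 'i)%C) (null_cis y nh).
have n2 := nullZ (- (cis (- b) / (2 * 'i)%C)) (null_cis (- y) nh).
apply: null_ext (nullD n1 n2) _ => k.
rewrite !mulrA -mulrDl; congr (_ * _).
have e : dot (- y) k = - dot y k by rewrite /dot /=; ring.
by rewrite e -sin_cis.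
Qed.

(** The cubic iterates are polynomials in F, hence in the algebra, and they converge boundedly to
    the sign because |F| <= 1. *)
Lemma nulls_sg F : nulls F -> (forall k, `|F k| <= 1) -> nulls (fun k => Num.sg (F k)).
Proof.
move=> nF F1; apply: (@nulls_limit (fun n k => iter n (@cubic R) (F k)) _ 1).
- elim=> [|n IH]; first by apply: nulls_ext nF _ => k.
  apply: nulls_ext (nullsD (nullsZ (3 / 2) IH) (nullsZ (- (1 / 2)) (nullsM IH (nullsM IH IH)))) _ => k /=.
  by rewrite /cubic; field.
- by move=> n k; exact: iter_cubic_le1.
- by move=> k; exact: iter_cubic_cvg.
Qed.

(** Once the argument is scaled below 1 the sine has its sign, so at each k the signs of the scaled
    sines are eventually the sign of the linear function, although the sine itself is periodic. *)
Lemma nulls_sg_dot (y : R * R) (b : R) : nulls (fun k => Num.sg (dot y k + b)).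
Proof.
apply: (@nulls_limit (fun n k => Num.sg (sin (n.+1%:R^-1 * (dot y k + b)))) _ 1).
- move=> n; apply: nulls_sg; last by move=> k; rewrite ler_norml sin_geN1 sin_le1.
  apply: nulls_ext (nulls_sin (n.+1%:R^-1 * y.1, n.+1%:R^-1 * y.2) (n.+1%:R^-1 * b)) _ => k.
  by congr sin; rewrite /dot /=; ring.
- by move=> n k; rewrite normr_sg lern1; case: (_ != 0).
- move=> k; apply: cvg_near_cst; exists (Num.truncn `|dot y k + b|).+1 => // n /= hn.
  rewrite sg_sin_small; first by rewrite sgrM gtr0_sg ?mul1r// invr_gt0.
  rewrite normrM gtr0_norm ?invr_gt0// ler_pdivrMl// mulr1.
  by apply/ltW/(lt_le_trans (truncnS_gt _)); rewrite ler_nat leqW.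
Qed.

Definition null_sets : set (set K) := [set A | nulls (\1_A : K -> R)].

(** With sigma the sign of dot y k - b, the indicator of the open half-plane is (sigma + sigma^2) /
    2, also on the boundary line. *)
Lemma nulls_halfplane (y : R * R) (b : R) : null_sets [set k | b < dot y k].
Proof.
have n1 := nulls_sg_dot y (- b).
apply: nulls_ext (nullsZ (1 / 2) (nullsD n1 (nullsM n1 n1))) _ => k /=.
rewrite indicE; have [h|h] := ltP b (dot y k).
  by rewrite mem_set// gtr0_sg ?subr_gt0//= mulr1n; lra.
rewrite memNset /=; last by rewrite ltNge h.
have [e|l] := eqVneq (dot y k) b; first by rewrite e subrr sgr0 /= mulr0n; lra.
by rewrite ltr0_sg ?subr_lt0 ?lt_neqAle ?l//= mulr0n; lra.
Qed.

Lemma null_setsC A : null_sets A -> null_sets (~` A).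
Proof.
move=> nA; apply: nulls_ext (nullsD (nulls_cst 1) (nullsZ (- 1) nA)) _ => k.
by rewrite !indicE in_setC; case: (k \in A) => /=; lra.
Qed.

Lemma null_setsU A B : null_sets A -> null_sets B -> null_sets (A `|` B).
Proof.
move=> nA nB; apply: nulls_ext (nullsD (nullsD nA nB) (nullsZ (- 1) (nullsM nA nB))) _ => k.
by rewrite !indicE in_setU; case: (k \in A); case: (k \in B) => /=; lra.
Qed.

Lemma null_sets_sigma : sigma_algebra setT null_sets.
Proof.
split.
- by apply: nulls_ext (nulls_cst 0) _ => k; rewrite indicE in_set0.
- by move=> A nA; rewrite setTD; exact: null_setsC.
move=> A nA; apply: (@nulls_limit (fun n => \1_(\bigcup_(i < n) A i)) _ 1).
- elim=> [|n IH]; first by rewrite bigcup_mkord big_ord0; apply: nulls_ext (nulls_cst 0) _ => k; rewrite indicE in_set0.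
  by rewrite bigcup_mkord big_ord_recr -bigcup_mkord; exact: null_setsU.
- by move=> n k; rewrite indicE ger0_norm// lern1; case: (_ \in _).
- move=> k; apply: cvg_near_cst; have [[i _ Aik]|nk] := pselect ((\bigcup_i A i) k).
    exists i.+1 => // n /= hn; rewrite !indicE !mem_set//; first by exists i.
    by exists i.
  apply: nearW => n; rewrite !indicE !memNset//; apply: contra_not nk => -[i _ h]; by exists i.
Qed.

(** The admissible sets form a sigma-algebra that contains the half-planes in both coordinate
    directions, and these generate the product Borel structure. *)
Lemma null_sets_measurable A : measurable A -> null_sets A.
Proof.
have coord (f : K -> line) : (forall b : R, null_sets [set k | b < f k]) ->
    forall B, measurable B -> null_sets (f @^-1` B).
  move=> hf B; move=> mB0; have mB : <<s (@RGenOInfty.G R) >> B by rewrite -[X in X B]RGenOInfty.measurableE.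
  have [s0 sC sU] := null_sets_sigma.
  suff : <<s (@RGenOInfty.G R) >> `<=` [set B | null_sets (f @^-1` B)] by exact.
  apply: smallest_sub.
    split => /=.
    - by rewrite preimage_set0.
    - by move=> C nC; rewrite setTD preimage_setC; exact: null_setsC.
    - by move=> C nC; rewrite preimage_bigcup; exact: sU.
  move=> _ [b ->] /=; rewrite (_ : f @^-1` _ = [set k | b < f k])//.
  by apply/seteqP; split => k /=; rewrite in_itv /= andbT.
have h1 := coord (fun k => k.1) _; have h2 := coord (fun k => k.2) _.
move: A; change (<<s preimage_set_system setT (fst : line * line -> line) measurable `|`
  preimage_set_system setT (snd : line * line -> line) measurable >> `<=` null_sets).
apply: smallest_sub; first exact: null_sets_sigma.
move=> A [[B mB <-]|[B mB <-]]; rewrite setTI.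
  apply: h1 => // b; have := nulls_halfplane (1, 0) b.
  by congr null_sets; apply/seteqP; split => k; rewrite /dot /= mul1r mul0r addr0.
apply: h2 => // b; have := nulls_halfplane (0, 1) b.
by congr null_sets; apply/seteqP; split => k; rewrite /dot /= mul1r mul0r add0r.
Qed.

Lemma null_transform_pos h (a : K -> R) : null_transform h -> measurable_fun setT a ->
  nulls (fun k => Num.sg (a k)).
Proof.
move=> nh ma.
have p (c : K -> R) : measurable_fun setT c -> nulls (\1_([set k | 0 < c k])).
  move=> mc; apply: null_sets_measurable.
  have := mc measurableT _ (measurable_itv `]0, +oo[); rewrite setTI.
  by congr measurable; apply/seteqP; split => k /=; rewrite in_itv /= andbT.
have mN : measurable_fun setT (fun k => - a k) by exact: measurableT_comp.
apply: nulls_ext (nullsD (p _ ma) (nullsZ (- 1) (p _ mN))) _ => k.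
rewrite !indicE; have [l|g|e] := ltgtP (a k) 0.
- by rewrite memNset /= ?mem_set /= ?oppr_gt0 ?ltr0_sg ?l ?add0r ?mulr1// ltNge ltW.
- by rewrite mem_set//= memNset /= ?oppr_gt0 ?gtr0_sg ?mulr0 ?addr0// ltNge ltW.
- by rewrite !memNset /= ?oppr_gt0 ?e ?sgr0 ?mulr0 ?addr0// ltxx.
Qed.

(** Multiplying h by the sign of its real part keeps the transform zero; its value at x = 0 is then
    the L1 norm of the real part, up to the imaginary unit times another real integral. The
    imaginary part is treated alike. *)
Lemma fourint_injective h : null_transform h -> {ae mu, forall k, h k = 0}.
Proof.
move=> nh; have [ih _] := nh; have [[mr mi] _] := ih; have [ir ii] := cL1_ReIm ih.
have z (a : K -> R) : measurable_fun setT a ->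
    \int[mu]_k (Num.sg (a k) * Re (h k)) = 0 /\ \int[mu]_k (Num.sg (a k) * Im (h k)) = 0.
  move=> ma; have [_ _ /(_ h nh) [_ /(_ 0)]] := null_transform_pos nh ma.
  have e k : (Num.sg (a k))%:C%C * h k * cis (dot 0 k) = (Num.sg (a k))%:C%C * h k.
    have -> : dot 0 k = 0 :> R by rewrite /dot /= !mul0r addr0.
    by rewrite /cis cos0 sin0 mulr1.
  move=> H; have := congr1 (fun w : R[i] => Re w) H; have := congr1 (fun w : R[i] => Im w) H.
  rewrite /fourint /cint /= => h2 h1; split; [rewrite -[RHS]h1|rewrite -[RHS]h2]; congr Rintegral;
    by apply/funext => k; rewrite e ?cReZ ?cImZ.
have a0 (a : K -> R) : measurable_fun setT a -> itg mu a -> \int[mu]_k (Num.sg (a k) * a k) = 0 ->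
    {ae mu, forall k, a k = 0}.
  move=> ma ia e.
  have E : (\int[mu]_k `|(a k)%:E| = 0)%E.
    transitivity ((\int[mu]_k (Num.sg (a k) * a k))%:E); last by rewrite e.
    rewrite (eq_integral (fun k => (`|a k|)%:E)) // -(Rint_EFin (itg_norm ia)); congr (_%:E).
    by congr Rintegral; apply/funext => k; rewrite normrEsg.
  have /= h0 := (ae_eq_integral_abs mu measurableT ((measurable_EFinP setT a).2 ma)).1 E.
  by apply: filterS h0 => k /(_ I) [].
have [r0 _] := z _ mr; have [_ i0] := z _ mi.
apply: filterS2 (a0 _ mr ir r0) (a0 _ mi ii i0) => k r i.
by apply: complex_ext.
Qed.

End injectivity.

(** * Transforms of derivatives and products *)

Section inverse_transform.
Context {R : realType}.
Local Notation K := (freqsp R).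
Variable mu : {sigma_finite_measure set K -> \bar R}.
Local Notation Re := complex.Re.
Local Notation Im := complex.Im.
Local Notation cabs := Normc.normc.

Lemma is_derive_cis (A B b c a : R) :
  is_derive a 1 (fun x => A * cos (b + x * c) - B * sin (b + x * c))
    (- (c * (A * sin (b + a * c) + B * cos (b + a * c)))).
Proof.
have d : is_derive a 1 (fun x : R => b + x * c) c.
  by apply: is_derive_eq; rewrite /= /GRing.scale /= ; ring.
have dc : is_derive a 1 (fun x => cos (b + x * c)) (- sin (b + a * c) * c).
  exact: (is_derive1_comp (f := cos) (g := fun x : R => b + x * c)).
have ds : is_derive a 1 (fun x => sin (b + x * c)) (cos (b + a * c) * c).
  exact: (is_derive1_comp (f := sin) (g := fun x : R => b + x * c)).
apply: is_derive_eq; rewrite /GRing.scale /=; ring.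
Qed.

(** Differentiation under the integral sign in a real parameter; the derivative of the integrand is
    dominated by 2 |c| |h|, the factor 2 coming from the real and imaginary parts of h. *)
Lemma derive1_cis_integral (b c : K -> R) h a : measurable_fun setT b -> measurable_fun setT c ->
  cL1 mu h -> itg mu (fun k => `|c k| * cabs (h k)) ->
  derive1 (fun t : R => Re (cint mu setT (fun k => h k * cis (b k + t * c k)))) a =
  Re (cint mu setT (fun k => 'i%C * (c k)%:C%C * h k * cis (b k + a * c k))).
Proof.
move=> mb mc ih ic; have [[mr mi] iabs] := ih; rewrite /cint /=.
pose f (t : R) (k : K) := Re (h k) * cos (b k + t * c k) - Im (h k) * sin (b k + t * c k).
have mbc t : measurable_fun setT (fun k => b k + t * c k).
  by apply: measurable_funD => //; exact: measurable_funM.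
have fE t k : Re (h k * cis (b k + t * c k)) = f t k by rewrite cReM.
have der (t : R) (k : K) : is_derive t 1 (f ^~ k) (- (c k * (Re (h k) * sin (b k + t * c k) + Im (h k) * cos (b k + t * c k)))).
  exact: is_derive_cis.
have dE t k : partial1of2 f t k = - (c k * (Re (h k) * sin (b k + t * c k) + Im (h k) * cos (b k + t * c k))).
  by rewrite partial1of2E; have d := der t k; rewrite derive_val.
have trig (u v w : R) : `|u * sin w + v * cos w| <= `|u| + `|v|.
  apply: le_trans (ler_normD _ _) _; rewrite !normrM; apply: lerD; apply: ler_piMr => //.
    by rewrite ler_norml sin_geN1 sin_le1.
  by rewrite ler_norml cos_geN1 cos_le1.
have mf t : measurable_fun setT (f t).
  by apply: measurable_funB; apply: measurable_funM => //; [exact: measurable_cos_comp|exact: measurable_sin_comp].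
rewrite (_ : (fun t : R => _) = fun t => \int[mu]_k f t k); last first.
  by apply/funext => t; congr Rintegral; apply/funext => k; rewrite fE.
have aI : `]a - 1, a + 1[%classic a by rewrite /= in_itv /= ltrDl ltr01 andbT ltrBlDr ltrDl.
have intf t : `]a - 1, a + 1[%classic t -> mu.-integrable setT (EFin \o f t).
  move=> _; apply: (@itg_mono _ _ _ mu (f t) (fun k => 2 * cabs (h k))) => //; first exact: itgZ.
  move=> k; rewrite -fE; apply: le_trans (cabs_Re _) _; rewrite cabsM cabs_cis mulr1.
  by rewrite mulr_natl mulr2n lerDl cabs_ge0.
have derf t k : `]a - 1, a + 1[%classic t -> setT k -> derivable (f ^~ k) t 1.
  by move=> _ _; have d := der t k; exact: ex_derive.
have G0 k : 0 <= 2 * (`|c k| * cabs (h k)) by rewrite !mulr_ge0 ?cabs_ge0.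
have iG : mu.-integrable setT (EFin \o (fun k => 2 * (`|c k| * cabs (h k)))) := itgZ 2 ic.
have Gub t k : `]a - 1, a + 1[%classic t -> setT k -> `|partial1of2 f t k| <= 2 * (`|c k| * cabs (h k)).
  move=> _ _; rewrite dE normrN normrM mulrCA; apply: ler_wpM2l => //.
  apply: le_trans (trig _ _ _) _; rewrite mulr_natl mulr2n; apply: lerD; [exact: cabs_Re|exact: cabs_Im].
rewrite (differentiation_under_integral measurableT aI intf derf G0 iG Gub).
congr Rintegral; apply/funext => k; rewrite dE !cReM !cImM /=; ring.
Qed.

Hypothesis mu_refl : refl_invariant mu.
Hypothesis mu_shift : shift_invariant mu.

Lemma fourint_real h x : cL1 mu h -> hermsym h -> Im (fourint mu h x) = 0.
Proof.
move=> ih hh; have [[mr mi] _] := cL1_cis x ih.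
have e : \int[mu]_k Im (h k * cis (dot x k)) = - \int[mu]_k Im (h k * cis (dot x k)).
  have [_ ii] := cL1_ReIm (cL1_cis x ih).
  rewrite -[LHS](Rint_refl mu_refl mi) -(Rint_N ii); congr Rintegral; apply/funext => k.
  by rewrite hh dotNr cisN; case: (h k) => u v; rewrite /cis /=; ring.
by rewrite /fourint /cint /=; move: e; lra.
Qed.

Lemma fourint_conj h x : cL1 mu h -> fourint mu (fun k => (h (- k))^*%C) x = (fourint mu h x)^*%C.
Proof.
move=> ih; have [[mr mi] _] := cL1_cis x ih; have [ir ii] := cL1_ReIm (cL1_cis x ih).
rewrite /fourint /cint; apply: complex_ext => /=.
  rewrite -[RHS](Rint_refl mu_refl mr); congr Rintegral; apply/funext => k.
  by rewrite dotNr cisN; case: (h (- k)) => u v; rewrite /cis /=; ring.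
rewrite -(Rint_N ii) -[RHS](Rint_refl mu_refl); last by apply: measurableT_comp.
congr Rintegral; apply/funext => k.
by rewrite dotNr cisN; case: (h (- k)) => u v; rewrite /cis /=; ring.
Qed.

Definition convol (u v : K -> R[i]) (k : K) : R[i] := cint mu setT (fun l : K => u (k - l) * v l).

Lemma measurable_sub12 : measurable_fun setT (fun z : K * K => (z.1 - z.2 : K)).
Proof. by apply: measurable_freqB; [exact: measurable_fst|exact: measurable_snd]. Qed.

Lemma convol_cmeas_integrand (u v : K -> R[i]) : cmeasurable u -> cmeasurable v ->
  cmeasurable (fun z : K * K => u (z.1 - z.2) * v z.2).
Proof.
move=> mu' mv; apply: cmeasM; first exact: (cmeas_comp mu' measurable_sub12).
exact: (cmeas_comp mv measurable_snd).
Qed.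

(** In a convolution the outer integration runs over k with l fixed, while [shift_at] concerns l -
    k; a reflection relates the two. *)
Lemma shift_swap (u : K -> R) l : shift_at mu l -> itg mu u ->
  itg mu (fun k : K => u (k - l)) /\ \int[mu]_k u (k - l) = \int[mu]_k u k.
Proof.
move=> sl iu; have [i e] := sl _ (itg_refl mu_refl iu).
split; first by apply: itg_ext i _ => k; rewrite opprB.
rewrite -(Rint_refl mu_refl (itg_meas iu)) -e; congr Rintegral; apply/funext => k.
by rewrite opprB.
Qed.

Lemma convol_itg u v : cL1 mu u -> cL1 mu v ->
  itg (mu \x mu)%E (fun z : K * K => cabs (u (z.1 - z.2)) * cabs (v z.2)).
Proof.
move=> [mu' iu] [mv iv].
have mF : measurable_fun setT (fun z : K * K => cabs (u (z.1 - z.2)) * cabs (v z.2)).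
  apply: measurable_funM; apply: cmeas_cabs; first exact: (cmeas_comp mu' measurable_sub12).
  exact: (cmeas_comp mv measurable_snd).
apply: itg_prod2 => //=.
have iG := itgZ (\int[mu]_k cabs (u k)) iv.
have := itg_lty iG; apply: le_lt_trans; apply: ge0_le_integral_ae.
- pose Fa (z : K * K) := `|cabs (u (z.1 - z.2)) * cabs (v z.2)|%:E.
  have mFa : measurable_fun setT Fa by apply/measurable_EFinP; exact: measurableT_comp.
  have Fa0 z : (0 <= Fa z)%E by rewrite lee_fin.
  exact: (measurable_fun_fubini_tonelli_G Fa mFa Fa0).
- by apply/measurable_EFinP; apply: measurableT_comp => //; exact: itg_meas iG.
- by move=> l; apply: integral_ge0 => k _; rewrite lee_fin.
- apply: filterS (ae_shift_at mu_shift) => l sl; have [i e] := shift_swap sl iu.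
  have iN := itgZ (cabs (v l)) i.
  rewrite (eq_integral (fun k : K => (cabs (v l) * cabs (u (k - l)))%:E)); last first.
    by move=> k _; rewrite ger0_norm ?mulr_ge0 ?cabs_ge0// mulrC.
  rewrite -(Rint_EFin iN) lee_fin (Rint_Z _ i) e mulrC; exact: ler_norm.
Qed.

Lemma cmeas_swapK (F : K * K -> R[i]) : cmeasurable F -> cmeasurable (fun z : K * K => F (z.2, z.1)).
Proof.
case=> mr mi.
have ms : measurable_fun setT (fun z : K * K => (z.2, z.1)).
  by apply: measurable_fun_pair; [exact: measurable_snd|exact: measurable_fst].
by split; [exact: (measurableT_comp mr ms)|exact: (measurableT_comp mi ms)].
Qed.

Lemma convol_slice u v : cL1 mu u -> cL1 mu v -> {ae mu, forall k, cL1 mu (fun l : K => u (k - l) * v l)}.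
Proof.
move=> hu hv; have [mu' _] := hu; have [mv _] := hv.
apply: filterS (itg_ae1 (convol_itg hu hv)) => k ik.
apply: (cL1_le _ ik) => [|l]; last by rewrite cabsM.
exact: (cmeas_slice1 k (convol_cmeas_integrand mu' mv)).
Qed.

Lemma cint_cabs_le (f : K -> R[i]) : cL1 mu f -> cabs (cint mu setT f) <= 2 * \int[mu]_k cabs (f k).
Proof.
move=> hf; have [mf i] := hf; have [[mr mi] _] := hf; have [ir ii] := cL1_ReIm hf.
apply: le_trans (cabs_le _) _; rewrite mulr_natl mulr2n /cint /=; apply: lerD.
  by apply: (Rint_norm_bound mr i); apply: aeW => k; exact: cabs_Re.
by apply: (Rint_norm_bound mi i); apply: aeW => k; exact: cabs_Im.
Qed.

Lemma convol_cL1 u v : cL1 mu u -> cL1 mu v -> cL1 mu (convol u v).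
Proof.
move=> hu hv; have [mu' _] := hu; have [mv _] := hv.
have mc : cmeasurable (convol u v) by exact: (cmeas_cint mu (convol_cmeas_integrand mu' mv)).
have iF := convol_itg hu hv; split => //.
apply: itg_mono_ae (itgZ 2 (itg_Rint1 iF)) _; first exact: cmeas_cabs.
apply: filterS (convol_slice hu hv) => k hk; rewrite ger0_norm ?cabs_ge0//.
apply: le_trans (cint_cabs_le hk) _; apply: eq_ler; congr (_ * _); congr Rintegral.
by apply/funext => l; rewrite cabsM.
Qed.

Lemma cint_fubini (F : K * K -> R[i]) : itg (mu \x mu)%E (fun z => Re (F z)) ->
  itg (mu \x mu)%E (fun z => Im (F z)) ->
  cint mu setT (fun k => cint mu setT (fun l => F (k, l))) =
  cint mu setT (fun l => cint mu setT (fun k => F (k, l))).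
Proof.
by move=> ir ii; apply: complex_ext; rewrite /cint /=; [exact: (Rint_fubini ir)|exact: (Rint_fubini ii)].
Qed.

(** Fubini, with the character at k split into those at k - l and l. The pointwise manipulations are
    valid only at frequencies where the slice is integrable or translation is allowed, hence the
    almost everywhere comparisons. *)
Lemma fourint_convol u v x : cL1 mu u -> cL1 mu v -> fourint mu (convol u v) x = fourint mu u x * fourint mu v x.
Proof.
move=> hu hv; pose U k := u k * cis (dot x k); pose V k := v k * cis (dot x k).
have hU : cL1 mu U := cL1_cis x hu; have hV : cL1 mu V := cL1_cis x hv.
have [mU _] := hU; have [mV _] := hV.
pose F (z : K * K) := U (z.1 - z.2) * V z.2.
have mF : cmeasurable F := convol_cmeas_integrand mU mV.
have iF := convol_itg hU hV; have [mr mi] := mF.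
have ir : itg (mu \x mu)%E (fun z => Re (F z)).
  by apply: itg_mono iF _ => // z; rewrite -cabsM; exact: cabs_Re.
have ii : itg (mu \x mu)%E (fun z => Im (F z)).
  by apply: itg_mono iF _ => // z; rewrite -cabsM; exact: cabs_Im.
have [mu' _] := hu; have [mv _] := hv.
transitivity (cint mu setT (fun k => cint mu setT (fun l => F (k, l)))).
  have [mc _] := convol_cL1 hu hv.
  apply: cint_ae_eq.
  - by apply: cmeasM => //; exact: cmeas_cis.
  - exact: (cmeas_cint mu mF).
  apply: filterS (convol_slice hu hv) => k hk; rewrite mulrC /convol -(cintZ _ hk).
  apply: cint_ext => l; rewrite /F /U /V /=.
  have -> : cis (dot x k) = cis (dot x (k - l)) * cis (dot x l) by rewrite -cisD -dotDr subrK.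
  ring.
rewrite (cint_fubini ir ii) -[RHS](cintZ _ hV); apply: cint_ae_eq.
- have mF' : cmeasurable (fun z : K * K => F (z.2, z.1)) by exact: cmeas_swapK.
  exact: (cmeas_cint mu mF').
- by apply: cmeasM => //; exact: cmeas_cst.
apply: filterS (ae_shift_at mu_shift) => l sl; rewrite /F /=.
have [iUr iUi] := cL1_ReIm hU.
have [i1 e1] := shift_swap sl iUr; have [i2 e2] := shift_swap sl iUi.
have cU : cint mu setT (fun k : K => U (k - l)) = cint mu setT U.
  by apply: complex_ext; rewrite /cint /=; [exact: e1|exact: e2].
have hUl : cL1 mu (fun k : K => U (k - l)).
  have [m i] := hU; split; last by have [] := shift_swap sl i.
  apply: (cmeas_comp m (_ : measurable_fun setT (fun k : K => k - l))).
  by apply: measurable_freqB.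
rewrite -/(fourint mu u x) [LHS](_ : _ = cint mu setT (fun k => V l * U (k - l))).
  by rewrite (cintZ _ hUl) cU mulrC.
by apply: cint_ext => k; rewrite mulrC.
Qed.

End inverse_transform.

(** * The dictionary between functions and their Fourier transforms *)

Section fourier_side.
Context {R : realType}.
Local Notation K := (freqsp R).
Local Notation Re := complex.Re.
Local Notation Im := complex.Im.
Local Notation cabs := Normc.normc.
Variable Om : domain.
Let mu : {sigma_finite_measure set K -> \bar R} := freqS Om.

Lemma is_fourierP (f : R * R -> R) (g : K -> R[i]) : is_fourier Om f g <->
  cL1 mu g /\ forall x, (f x)%:C%C = fourint mu g x.
Proof. by split => [[a b c]|[[a b] c]]. Qed.

Lemma cL1_ae_eq (g g' : K -> R[i]) : cL1 mu g -> cmeasurable g' -> {ae mu, forall k, g k = g' k} -> cL1 mu g'.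
Proof.
case=> mg ig mg' e; split => //; apply: itg_ae_eq ig _ _; first exact: cmeas_cabs.
by apply: filterS e => k ->.
Qed.

Lemma is_fourier_ae_eq (f : R * R -> R) (g g' : K -> R[i]) : is_fourier Om f g -> cmeasurable g' ->
  {ae mu, forall k, g k = g' k} -> is_fourier Om f g'.
Proof.
move=> /is_fourierP[ig e] mg' gg'; apply/is_fourierP; split; first exact: cL1_ae_eq ig mg' gg'.
by have [mg _] := ig; move=> x; rewrite e; exact: fourint_ae_eq.
Qed.

(** Makes the choice hidden in [hat] immaterial: every integrable transform of f agrees with it
    almost everywhere. *)
Lemma is_fourier_unique (f : R * R -> R) (g g' : K -> R[i]) : is_fourier Om f g -> is_fourier Om f g' ->
  {ae mu, forall k, g k = g' k}.
Proof.
move=> /is_fourierP[ig e] /is_fourierP[ig' e'].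
have n : null_transform mu (fun k => g k + (- 1) * g' k).
  split; first by apply: cL1D => //; exact: cL1Z.
  by move=> x; rewrite (fourintD x ig (cL1Z (- 1) ig')) (fourintZ _ x ig') -e -e' mulN1r subrr.
by apply: filterS (fourint_injective n) => k /eqP; rewrite mulN1r subr_eq0 => /eqP.
Qed.

Lemma is_fourier_hat (f : R * R -> R) (g : K -> R[i]) : is_fourier Om f g -> is_fourier Om f (hat Om f).
Proof. by move=> h; apply: (@xgetPex _ (fun=> 0) [set g | is_fourier Om f g]); exists g. Qed.

Definition D1 (h : K -> R[i]) (k : K) : R[i] := 'i%C * (k.1)%:C%C * h k.
Definition D2 (h : K -> R[i]) (k : K) : R[i] := 'i%C * (k.2)%:C%C * h k.

Lemma cabs_i : cabs ('i%C : R[i]) = 1.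
Proof. by rewrite /= expr0n expr1n add0r sqrtr1. Qed.

Lemma cmeas_freq1 : cmeasurable (fun k : K => 'i%C * (k.1)%:C%C).
Proof. by apply: cmeasM; [exact: cmeas_cst|apply: cmeas_real; exact: measurable_freq1]. Qed.

Lemma cmeas_freq2 : cmeasurable (fun k : K => 'i%C * (k.2)%:C%C).
Proof. by apply: cmeasM; [exact: cmeas_cst|apply: cmeas_real; exact: measurable_freq2]. Qed.

Lemma D1_cL1 (h : K -> R[i]) : cmeasurable h -> itg mu (fun k => modulus k * cabs (h k)) -> cL1 mu (D1 h).
Proof.
move=> mh ih; apply: (cL1_le _ ih); first exact: cmeasM cmeas_freq1 mh.
by move=> k; rewrite /D1 !cabsM cabs_i mul1r cabs_real ler_wpM2r ?cabs_ge0// modulus_abs1.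
Qed.

Lemma D2_cL1 (h : K -> R[i]) : cmeasurable h -> itg mu (fun k => modulus k * cabs (h k)) -> cL1 mu (D2 h).
Proof.
move=> mh ih; apply: (cL1_le _ ih); first exact: cmeasM cmeas_freq2 mh.
by move=> k; rewrite /D2 !cabsM cabs_i mul1r cabs_real ler_wpM2r ?cabs_ge0// modulus_abs2.
Qed.

Lemma D1_herm (h : K -> R[i]) : hermsym h -> hermsym (D1 h).
Proof. by move=> hh k; rewrite /D1 hh /=; case: (h k) => a b; apply: complex_ext => /=; ring. Qed.

Lemma D2_herm (h : K -> R[i]) : hermsym h -> hermsym (D2 h).
Proof. by move=> hh k; rewrite /D2 hh /=; case: (h k) => a b; apply: complex_ext => /=; ring. Qed.

Lemma partial1_fourint (h : K -> R[i]) (x : R * R) : cL1 mu h -> itg mu (fun k => modulus k * cabs (h k)) ->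
  partial1 (fun x => Re (fourint mu h x)) x = Re (fourint mu (D1 h) x).
Proof.
move=> ih i1; have [mh _] := ih.
have ic : itg mu (fun k : K => `|k.1| * cabs (h k)).
  apply: itg_mono i1 _.
    apply: measurable_funM; last exact: cmeas_cabs.
    by apply: measurableT_comp => //; exact: measurable_freq1.
  move=> k; rewrite ger0_norm ?mulr_ge0 ?cabs_ge0//.
  by rewrite ler_wpM2r ?cabs_ge0// modulus_abs1.
have mb : measurable_fun setT (fun k : K => x.2 * k.2) by apply: measurable_funM => //; exact: measurable_freq2.
have := derive1_cis_integral (b := fun k : K => x.2 * k.2) (c := fun k : K => k.1) x.1 mb (@measurable_freq1 R) ih ic.
rewrite /partial1 (_ : (fun t : R => Re (cint _ _ _)) = fun a : R => Re (fourint mu h (a, x.2))); last first.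
  by apply/funext => t; congr Re; apply: cint_ext => k; rewrite /dot /= addrC.
move=> ->; congr Re; apply: cint_ext => k; rewrite /D1 /dot addrC.
by [].
Qed.

Lemma partial2_fourint (h : K -> R[i]) (x : R * R) : cL1 mu h -> itg mu (fun k => modulus k * cabs (h k)) ->
  partial2 (fun x => Re (fourint mu h x)) x = Re (fourint mu (D2 h) x).
Proof.
move=> ih i1; have [mh _] := ih.
have ic : itg mu (fun k : K => `|k.2| * cabs (h k)).
  apply: itg_mono i1 _.
    apply: measurable_funM; last exact: cmeas_cabs.
    by apply: measurableT_comp => //; exact: measurable_freq2.
  move=> k; rewrite ger0_norm ?mulr_ge0 ?cabs_ge0//.
  by rewrite ler_wpM2r ?cabs_ge0// modulus_abs2.
have mb : measurable_fun setT (fun k : K => x.1 * k.1) by apply: measurable_funM => //; exact: measurable_freq1.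
have := derive1_cis_integral (b := fun k : K => x.1 * k.1) (c := fun k : K => k.2) x.2 mb (@measurable_freq2 R) ih ic.
rewrite /partial2 (_ : (fun t : R => Re (cint _ _ _)) = fun a : R => Re (fourint mu h (x.1, a))); last first.
  by apply/funext => t; congr Re; apply: cint_ext => k; rewrite /dot /=.
by move=> ->.
Qed.

Lemma fourint_ReE (h : K -> R[i]) (x : R * R) : cL1 mu h -> hermsym h -> fourint mu h x = (Re (fourint mu h x))%:C%C.
Proof. by move=> ih hh; apply: complex_ext => //=; exact: (fourint_real (@freqS_refl R Om)). Qed.

(** With one integrable moment the derivatives pass under the integral and products become
    convolutions. Hermitian symmetry makes all four factors real, so taking real parts loses
    nothing. *)
Lemma advection_fourier delta (f : R * R -> R) (g : K -> R[i]) : 0 <= delta -> is_fourier Om f g -> hermsym g ->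
  itg mu (fun k => modulus k * cabs (g k)) -> is_fourier Om (advection Om delta f) (adv mu delta g g).
Proof.
move=> d0 fg hg i1; have /is_fourierP[ig fE] := fg; have [mg _] := ig.
have hat_f := is_fourier_hat fg; have /is_fourierP[[mhat _] _] := hat_f.
have hatE := is_fourier_unique fg hat_f.
pose m (k : K) : R := msym delta (modulus k).
have m0 k : 0 <= m k <= 1 by exact: msym_le1 d0 (modulus_ge0 k).
have mm : measurable_fun setT m by apply: measurable_powR10; exact: measurable_modulus.
have cm : cmeasurable (fun k => (m k)%:C%C) by exact: cmeas_real.
pose G k := (m k)%:C%C * g k.
have mG : cmeasurable G by exact: cmeasM.
have leG k : cabs (G k) <= cabs (g k).
  by rewrite /G cabsM cabs_real; have /andP[a b] := m0 k; rewrite ger0_norm// ler_piMl ?cabs_ge0.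
have iG : cL1 mu G by apply: (cL1_le mG ig.2).
have i1G : itg mu (fun k => modulus k * cabs (G k)).
  apply: itg_mono i1 _; first by apply: measurable_funM; [exact: measurable_modulus|exact: cmeas_cabs].
  move=> k; rewrite ger0_norm ?mulr_ge0 ?modulus_ge0 ?cabs_ge0//.
  by rewrite ler_wpM2l ?modulus_ge0.
have hG : hermsym G.
  by move=> k; rewrite /G /m modulusN hg; case: (g k) => a b; apply: complex_ext => /=; ring.
(* The multiplier is defined through [hat], which agrees with g almost everywhere only. *)
have FE : multiplier Om (fun r => (10 + r) `^ (- delta)) f = fun x => Re (fourint mu G x).
  apply/funext => x; congr Re; apply: (fourint_ae_eq (mu := mu)); [exact: cmeasM|exact: mG|].
  by apply: filterS hatE => k <-.
have fR : f = fun x => Re (fourint mu g x) by apply/funext => x; rewrite -fE.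
have [c1 c2 c1G c2G] : [/\ cL1 mu (D1 g), cL1 mu (D2 g), cL1 mu (D1 G) & cL1 mu (D2 G)].
  by split; [exact: D1_cL1|exact: D2_cL1|exact: D1_cL1|exact: D2_cL1].
have sh := @freqS_shift R Om; have rf := @freqS_refl R Om.
have v1 := convol_cL1 rf sh c2G c1; have v2 := convol_cL1 rf sh c1G c2.
have ii : 'i%C * 'i%C = - 1 :> R[i] by apply: complex_ext => /=; ring.
(* The two factors i multiply to -1, which turns the difference of convolutions into the cross
   product with the sign chosen in [cross]. *)
have advE : {ae mu, forall k, - 1 * convol mu (D2 G) (D1 g) k + convol mu (D1 G) (D2 g) k = adv mu delta g g k}.
  apply: filterS2 (convol_slice rf sh c2G c1) (convol_slice rf sh c1G c2) => k h1 h2.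
  rewrite /convol -(cintZ _ h1) -(cintD' (cL1Z _ h1) h2); apply: cint_ext => l.
  rewrite /D1 /D2 /G /ksym /cross -/(m (k - l)).
  have -> : ((((k - l).2 * l.1 - (k - l).1 * l.2) * m (k - l))%:C%C : R[i]) =
      (((k - l).2)%:C * (l.1)%:C - ((k - l).1)%:C * (l.2)%:C)%C * (m (k - l))%:C%C.
    by apply: complex_ext => /=; ring.
  set a := ((k - l).1)%:C%C; set b := ((k - l).2)%:C%C; set c := (m _)%:C%C.
  set u := g (k - l); set v := g l; set p := (l.1)%:C%C; set q := (l.2)%:C%C.
  transitivity (('i%C * 'i%C) * (- (b * p) + a * q) * (c * (u * v))); first by ring.
  by rewrite ii; ring.
have madv : cmeasurable (adv mu delta g g) by exact: cmeas_adv0.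
have cs : cL1 mu (fun k => - 1 * convol mu (D2 G) (D1 g) k + convol mu (D1 G) (D2 g) k).
  exact: (cL1D (cL1Z (- 1) v1) v2).
apply/is_fourierP; split; first exact: cL1_ae_eq cs madv advE.
move=> x; have [mcs _] := cs; rewrite -(fourint_ae_eq x mcs madv advE).
rewrite (fourintD x (cL1Z (- 1) v1) v2) (fourintZ (- 1) x v1) !(fourint_convol rf sh)//.
rewrite /advection /velocity /= FE fR.
rewrite (partial1_fourint x ig i1) (partial2_fourint x ig i1) (partial1_fourint x iG i1G) (partial2_fourint x iG i1G).
rewrite (fourint_ReE x c2G (D2_herm hG)) (fourint_ReE x c1 (D1_herm hg)) (fourint_ReE x c1G (D1_herm hG)) (fourint_ReE x c2 (D2_herm hg)).
by apply: complex_ext => /=; ring.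
Qed.

(** By uniqueness of the transform the norm, defined through the choice [hat], may be computed from
    any transform, in particular from one that is jointly measurable in time. *)
Lemma sobolev_norm_ew (s : R) (f : R * R -> R) (g : K -> R[i]) : is_fourier Om f g ->
  (sobolev_norm Om s f `^ 2 = \int[mu]_k (ew s g k)%:E)%E.
Proof.
move=> fg; have hf := is_fourier_hat fg; have e := is_fourier_unique fg hf.
have /is_fourierP[[mg _] _] := fg; have /is_fourierP[[mh _] _] := hf.
rewrite /sobolev_norm poweR_Lnorm//; transitivity (\int[mu]_k (ew s (hat Om f : K -> R[i]) k)%:E)%E.
  apply: eq_integral => k _.
  have a0 : 0 <= (10 + modulus k) `^ s * cabs (hat Om f k) by rewrite mulr_ge0 ?powR_ge0 ?cabs_ge0.
  transitivity ((`|(10 + modulus k) `^ s * cabs (hat Om f k)| `^ 2%:R)%:E); first by [].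
  congr (_%:E); rewrite ger0_norm// (powR_mulrn 2 a0) exprMn cabs_sqr /ew /wsym; congr (_ * _).
  by rewrite -(powR_mulrn 2 (powR_ge0 _ _)) -powRrM mulrC.
apply: ae_eq_integral => //.
- by apply/measurable_EFinP; exact: measurable_ew.
- by apply/measurable_EFinP; exact: measurable_ew.
- by apply: filterS e => k h _; rewrite /ew h.
Qed.

Lemma sobolev_bound (s M : R) (f : R * R -> R) (g : K -> R[i]) : is_fourier Om f g ->
  (sobolev_norm Om s f <= M%:E)%E -> itg mu (ew s g) /\ \int[mu]_k ew s g k <= M ^+ 2.
Proof.
move=> fg le; have /is_fourierP[[mg _] _] := fg.
apply: itg_le_fin; [exact: measurable_ew|by move=> k; exact: ew_ge0|].
rewrite -(sobolev_norm_ew s fg).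
have n0 : (0 <= sobolev_norm Om s f)%E by exact: Lnorm_ge0.
move: n0 le; case: (sobolev_norm Om s f) => // r; rewrite !lee_fin => r0 rM.
by rewrite /= ?lee_fin (powR_mulrn 2 r0) ler_pXn2r ?nnegrE// (le_trans r0).
Qed.

Lemma sobolev_le (s M : R) (f : R * R -> R) (g : K -> R[i]) : is_fourier Om f g ->
  itg mu (ew s g) -> \int[mu]_k ew s g k <= M ^+ 2 -> 0 <= M -> (sobolev_norm Om s f <= M%:E)%E.
Proof.
move=> fg ie le M0; have := sobolev_norm_ew s fg; rewrite -(Rint_EFin ie).
have n0 : (0 <= sobolev_norm Om s f)%E by exact: Lnorm_ge0.
move: n0; case: (sobolev_norm Om s f) => // [r|]; last by rewrite poweRyr.
rewrite !lee_fin => r0; rewrite /= (powR_mulrn 2 r0) => -[e].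
by rewrite -(@ler_pXn2r _ 2)// ?nnegrE// e.
Qed.

End fourier_side.

(** * Existence and uniqueness *)

Section flow.
Context {R : realType}.
Local Notation K := (freqsp R).
Local Notation line := (measurableTypeR R).
Local Notation leb := (@lebesgue_measure R).
Local Notation Re := complex.Re.
Local Notation Im := complex.Im.
Local Notation cabs := Normc.normc.
Variable Om : domain.
Let mu : {sigma_finite_measure set K -> \bar R} := freqS Om.

(** The transform of a real function is Hermitian only almost everywhere, while the estimates ask
    for it everywhere. This projection repairs it on a null set and, unlike a choice made at each
    time, keeps joint measurability. *)
Definition hermpart (g : K -> R[i]) (k : K) : R[i] := (2^-1 : R)%:C%C * (g k + (g (- k))^*%C).

Lemma hermpart_herm g : hermsym (hermpart g).
Proof.
move=> k; rewrite /hermpart opprK; case: (g k) => a b; case: (g (- k)) => c d.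
by apply: complex_ext => /=; ring.
Qed.

Lemma cmeas_hermpart d (T : measurableType d) (F : T -> K -> R[i]) :
  cmeasurable (fun p : T * K => F p.1 p.2) -> cmeasurable (fun p : T * K => hermpart (F p.1) p.2).
Proof.
move=> mF; apply: cmeasM; first exact: cmeas_cst.
apply: cmeasD => //; apply: cmeas_conj.
have ms : measurable_fun setT (fun p : T * K => (p.1, - p.2)).
  by apply: measurable_fun_pair; [exact: measurable_fst|apply: measurable_freqN; exact: measurable_snd].
exact: (cmeas_comp mF ms).
Qed.

Lemma cmeas_hermpart0 (g : K -> R[i]) : cmeasurable g -> cmeasurable (hermpart g).
Proof.
move=> mg; apply: cmeasM; first exact: cmeas_cst.
by apply: cmeasD => //; apply: cmeas_conj; exact: cmeas_opp.
Qed.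

Lemma fourier_hermpart (f : R * R -> R) (g : K -> R[i]) : is_fourier Om f g ->
  is_fourier Om f (hermpart g) /\ {ae mu, forall k : K, g k = hermpart g k}.
Proof.
move=> fg; have /is_fourierP[ig fE] := fg; have [mg iabs] := ig.
have fg' : is_fourier Om f (fun k => (g (- k))^*%C).
  apply/is_fourierP; split.
    split; first by apply: cmeas_conj; exact: cmeas_opp.
    by apply: itg_ext (itg_refl (@freqS_refl R Om) iabs) _ => k; rewrite cabs_conj.
  move=> x; have -> := fourint_conj (@freqS_refl R Om) x ig.
  by rewrite -[fourint _ _ _]fE; apply: complex_ext => /=; rewrite ?oppr0.
have e : {ae mu, forall k : K, g k = hermpart g k}.
  apply: filterS (is_fourier_unique fg fg') => k gk; rewrite /hermpart -gk.
  by apply: complex_ext; rewrite ?(cReZ, cImZ, cReD, cImD); field.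
by split => //; exact: (is_fourier_ae_eq fg (cmeas_hermpart0 mg) e).
Qed.

Lemma ew_cL1 s (g : K -> R[i]) : 4 <= s -> cmeasurable g -> itg mu (ew s g) ->
  cL1 mu g /\ itg mu (fun k => modulus k * cabs (g k)).
Proof.
move=> s4 mg eg; have [ib _] := bw_itg (@freqS_decay R Om) s4 mg eg.
have h (k : K) : 1 <= (10 + modulus k) ^+ 2 /\ modulus k <= (10 + modulus k) ^+ 2.
  by have := modulus_ge0 k; set x := modulus k => x0; split; nra.
split.
  by apply: (cL1_le mg ib) => k; rewrite /bw; apply: ler_peMl; [exact: cabs_ge0|exact: (h k).1].
apply: itg_mono ib _.
  by apply: measurable_funM; [exact: measurable_modulus|exact: cmeas_cabs].
move=> k; rewrite ger0_norm ?mulr_ge0 ?modulus_ge0 ?cabs_ge0// /bw.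
by apply: ler_wpM2r; [exact: cabs_ge0|exact: (h k).2].
Qed.

Variables (psi : R -> R) (kappa delta s : R).
Hypothesis mpsi : measurable_fun setT psi.
Hypothesis psi_ge0 : forall r, 0 <= r -> 0 <= psi r.
Hypotheses (kappa0 : 0 < kappa) (d0 : 0 <= delta) (d1 : delta <= 1) (s4 : 4 <= s).
Local Notation approx := (approx_sol mu psi kappa delta s).
Local Notation joint g := (fun p : line * K => g p.1 p.2).

(** All estimates live on bounded time intervals; countably many null sets are discarded to reach
    the half line. *)
Lemma ae_time (P : line -> Prop) : (forall n : nat, {ae leb, forall t : line, 0 <= t <= n%:R -> P t}) ->
  {ae leb, forall t : line, 0 <= t -> P t}.
Proof.
move=> h; have h' : {ae leb, forall t : line, forall n : nat, 0 <= t <= n%:R -> P t} by exact/ae_foralln.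
apply: filterS h' => t ht t0; apply: (ht (Num.truncn t).+1).
by rewrite t0 /=; exact/ltW/truncnS_gt.
Qed.

Definition physical (g : line -> K -> R[i]) (t : R) (x : R * R) : R := Re (fourint mu (g t) x).

Lemma physical_fourier (g : K -> R[i]) : cL1 mu g -> hermsym g ->
  is_fourier Om (fun x => Re (fourint mu g x)) g.
Proof. by move=> ig hg; apply/is_fourierP; split => // x; rewrite -fourint_ReE. Qed.

Section solution.
Variables (theta0 : R * R -> R) (M : R) (g0 : K -> R[i]) (g : line -> K -> R[i]).
Hypothesis M0 : 0 <= M.
Hypothesis g0E : {ae mu, forall k : K, hat Om theta0 k = g0 k}.
Hypothesis sol : forall T, approx T M 0 g0 g (fun _ _ => 0).

Let good : {ae leb, forall t : line, 0 <= t ->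
  [/\ itg mu (ew s (g t)), \int[mu]_k ew s (g t) k <= M,
      is_fourier Om (physical g t) (g t)
    & is_fourier Om (advection Om delta (physical g t)) (adv mu delta (g t) (g t))]}.
Proof.
apply: ae_time => n; apply: filterS (ap_bd (sol n%:R)) => t h /h [i le].
have mg : cmeasurable (g t) := cmeas_slice1 t (ap_meas (sol 0)).
have hg := ap_herm (sol 0) t.
have [ic i1] := ew_cL1 s4 mg i; have F := physical_fourier ic hg.
by split => //; exact: advection_fourier.
Qed.

Lemma solution_bounded : Linfty_sobolev Om s (physical g).
Proof.
exists g, (1 + M); split.
- exact: ap_meas (sol 0).
- by apply: filterS good => t h /h [].
- apply: filterS good => t h /h [i le F _]; apply: (sobolev_le F i); last by rewrite addr_ge0.
  by apply: le_trans le _; have := sqr_ge0 M; nra.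
Qed.

Lemma solution_solves : solves Om psi kappa delta theta0 (physical g).
Proof.
exists g, (fun t k => adv mu delta (g t) (g t) k); split.
- exact: ap_meas (sol 0).
- exact: (cmeas_joint_adv mu delta (ap_meas (sol 0))).
- by apply: filterS good => t h /h [_ _].
have eqs : {ae mu, forall k : K, forall n : nat, {ae leb, forall t : line, 0 <= t <= n%:R ->
    g t k = g0 k - cint leb `[0, t] (fun tau =>
      adv mu delta (g tau) (g tau) k + (kappa * psi (modulus k))%:C%C * g tau k + 0)}}.
  by apply/ae_foralln => n; exact: ap_eq (sol n%:R).
have key : {ae mu, forall k : K, {ae leb, forall t : line, 0 <= t ->
    g t k = hat Om theta0 k - cint leb `[0, t] (fun tau =>
      adv mu delta (g tau) (g tau) k + (kappa * psi (modulus k))%:C%C * g tau k)}}.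
  apply: filterS2 g0E eqs => k -> h; apply: ae_time => n; apply: filterS (h n) => t ht tn.
  by rewrite [LHS](ht tn); congr (_ - cint _ _ _); apply/funext => tau; rewrite addr0.
exact: key.
Qed.

Section uniqueness.
Variable theta' : R -> R * R -> R.
Hypothesis bd' : Linfty_sobolev Om s theta'.
Hypothesis solves' : solves Om psi kappa delta theta0 theta'.
Hypothesis mg0 : cmeasurable g0.

(** The Hermitian part of the transform of a competitor is an exact instance of [approx_sol] with
    the same data, so stability with zero errors makes the two transforms agree. *)
Lemma solution_unique : {ae leb, forall t : line, 0 <= t -> forall x, theta' t x = physical g t x}.
Proof.
have [g1 [M1 [_ f1 le1]]] := bd'; have [g2 [h2 [mg2 mh2 f2 eq2]]] := solves'.
have {}mg2 : cmeasurable (joint g2) by exact: mg2.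
have {}mh2 : cmeasurable (joint h2) by exact: mh2.
pose G (t : line) := hermpart (g2 t).
have mG : cmeasurable (joint G) := cmeas_hermpart mg2.
have {}le1 : {ae leb, forall t : line, 0 <= t -> (sobolev_norm Om s (theta' t) <= M1%:E)%E} by exact: le1.
have {}f2 : {ae leb, forall t : line, 0 <= t -> is_fourier Om (theta' t) (g2 t) /\
   is_fourier Om (advection Om delta (theta' t)) (h2 t)} by exact: f2.
have {}eq2 : {ae mu, forall k : K, {ae leb, forall t : line, 0 <= t ->
   g2 t k = hat Om theta0 k - cint leb `[0, t] (fun tau => h2 tau k + (kappa * psi (modulus k))%:C%C * g2 tau k)}}
  by exact: eq2.
have gG : {ae leb, forall t : line, 0 <= t ->
  [/\ itg mu (ew s (G t)) /\ \int[mu]_k ew s (G t) k <= M1 ^+ 2,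
      is_fourier Om (theta' t) (G t),
      {ae mu, forall k : K, g2 t k = G t k} & {ae mu, forall k : K, h2 t k = adv mu delta (G t) (G t) k}]}.
  apply: filterS2 le1 f2 => t le h t0; have [F H] := h t0; have {}le := le t0.
  have [FG e] := fourier_hermpart F; have B := sobolev_bound FG le.
  have mGt : cmeasurable (G t) := cmeas_slice1 t mG.
  have [_ i1] := ew_cL1 s4 mGt B.1.
  split => //; apply: (is_fourier_unique H); exact: (advection_fourier d0 FG (hermpart_herm _) i1).
(* Both identifications, of the state and of its nonlinearity, are encoded as the zero set of one
   measurable function, so that [measurable_ae_ae] can exchange the quantifiers on time and
   frequency. *)
pose W (z : line * K) : R := ((0 <= z.1)%R : nat)%:R *
  (nsq (g2 z.1 z.2 - G z.1 z.2) + nsq (h2 z.1 z.2 - adv mu delta (G z.1) (G z.1) z.2)).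
have mAG : cmeasurable (fun p : line * K => adv mu delta (G p.1) (G p.1) p.2) := cmeas_joint_adv mu delta mG.
have mW : measurable_fun setT W.
  apply: measurable_funM.
    by apply: measurable_le_nat => //; exact: measurable_fst.
  by apply: measurable_funD; apply: cmeas_nsq; exact: cmeasB.
have W0 (z : line * K) : W z = 0 -> 0 <= z.1 -> g2 z.1 z.2 = G z.1 z.2 /\ h2 z.1 z.2 = adv mu delta (G z.1) (G z.1) z.2.
  rewrite /W => e z0; move: e; rewrite z0 mul1r => /eqP.
  rewrite paddr_eq0 ?nsq_ge0// => /andP[/eqP a /eqP b].
  by split; apply/eqP; rewrite -subr_eq0; apply/eqP; exact: nsq_eq0.
have Wk : {ae mu, forall k : K, {ae leb, forall t : line, W (t, k) = 0}}.
  have mA : measurable [set z | W z = 0].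
    by rewrite -[X in measurable X]setTI; exact: (mW measurableT [set 0] (measurable_set1 0)).
  apply: (measurable_ae_ae (A := [set z | W z = 0]) mA).
  apply: filterS gG => t h; have [t0|t0] := boolP (0 <= t); last first.
    by apply: aeW => k; rewrite /W /= (negbTE t0) mul0r.
  have [_ _ a b] := h t0; apply: filterS2 a b => k a b.
  by rewrite /W /= a b !subrr nsq0 addr0 mulr0.
(* A bound common to both solutions; uniqueness requires no smallness relative to it. *)
pose Mx := Num.max M (M1 ^+ 2).
have apG T : approx T Mx 0 g0 G (fun _ _ => 0).
  split.
  - exact: mg0.
  - exact: mG.
  - exact: cmeas_cst.
  - by move=> t; exact: hermpart_herm.
  - apply: filterS gG => t h /andP[t0 _]; have [[i le] _ _ _] := h t0.
    by split => //; rewrite le_max le orbT.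
  - exact: (ap_rem (sol T)).
  - apply: filterS3 g0E eq2 Wk => k e0 e2 wk; have wk2 := wk; apply: filterS2 e2 wk2 => t e w /andP[t0 _].
    have [<- _] := W0 _ w t0; rewrite /= (e t0) e0; congr (_ - _).
    have [m1r m1i] := cmeas_slice2 k mh2; have [m2r m2i] := cmeas_slice2 k mg2.
    have [m3r m3i] := cmeas_slice2 k mAG; have [m4r m4i] := cmeas_slice2 k mG.
    have mseg := measurable_seg t.
    have ms : measurable_fun setT (seg t) := measurable_seg t.
    have mL : cmeasurable (fun tau : line => h2 tau k + (kappa * psi (modulus k))%:C%C * g2 tau k).
      by apply: cmeasD; [split|apply: cmeasM; [exact: cmeas_cst|split]].
    have mR : cmeasurable (fun tau : line => adv mu delta (G tau) (G tau) k + (kappa * psi (modulus k))%:C%C * G tau k + 0).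
      by apply: cmeasD; [apply: cmeasD; [split|apply: cmeasM; [exact: cmeas_cst|split]]|exact: cmeas_cst].
    have eqi : {ae leb, forall tau : line, 0 <= tau -> h2 tau k + (kappa * psi (modulus k))%:C%C * g2 tau k =
       adv mu delta (G tau) (G tau) k + (kappa * psi (modulus k))%:C%C * G tau k + 0}.
      by apply: filterS wk => tau wt tau0; have [/= -> ->] := W0 _ wt tau0; rewrite addr0.
    have [mLr mLi] := mL; have [mRr mRi] := mR.
    apply: complex_ext; rewrite /cint /= !Rint_seg; apply: Rint_ae_eq; try exact: measurable_funM.
      apply: filterS eqi => tau h; have [tau0|tau0] := boolP (0 <= tau); first by rewrite h.
      by rewrite seg_out ?mul0r// negb_and tau0.
    apply: filterS eqi => tau h; have [tau0|tau0] := boolP (0 <= tau); first by rewrite h.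
    by rewrite seg_out ?mul0r// negb_and tau0.
have apg T : approx T Mx 0 g0 g (fun _ _ => 0).
  have [a1 a2 a3 a4 a5 a6 a7] := sol T; split => //.
  by apply: filterS a5 => t h /h [i le]; split => //; rewrite le_max le.
have Mx0 : 0 <= Mx by rewrite le_max M0.
have in0 : itg mu (fun k => nsq (g0 k - g0 k)).
  by apply: itg_ext (itgZ 0 (@freqS_decay R Om)) _ => k; rewrite mul0r subrr nsq0.
have e0 : \int[mu]_k nsq (g0 k - g0 k) = 0.
  rewrite (_ : (fun k => _) = fun=> 0); first by rewrite /Rintegral integral0.
  by apply/funext => k; rewrite subrr nsq0.
have close : {ae leb, forall t : line, 0 <= t -> \int[mu]_k nsq (g t k - G t k) <= 0}.
  apply: ae_time => n.
  have := stability_estimate (@freqS_refl R Om) (@freqS_shift R Om) (@freqS_decay R Om) psi_ge0 kappa0 d0 d1 s4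
    (ler0n R n) (apg n%:R) (apG n%:R) in0 Mx0 (lexx 0) (lexx 0).
  by apply: filterS => t h /h; rewrite e0 !(addr0, mulr0, mul0r).
apply: filterS3 good gG close => t a b c t0.
have [ig _ Fg _] := a t0; have [[iG _] FG _ _] := b t0; have {}c := c t0.
have s0 : 0 <= s by apply: le_trans s4; rewrite ler0n.
have mgt : cmeasurable (g t) := cmeas_slice1 t (ap_meas (sol 0)).
have mGt : cmeasurable (G t) := cmeas_slice1 t mG.
have iD : itg mu (fun k => nsq (g t k - G t k)).
  by apply: (itg_nsq s0); [exact: cmeasB|exact: itg_ewB].
have z : {ae mu, forall k : K, g t k = G t k}.
  have E : (\int[mu]_k `|(nsq (g t k - G t k))%:E| = 0)%E.
    rewrite (eq_integral (fun k => (nsq (g t k - G t k))%:E)); last first.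
      by move=> k _; rewrite gee0_abs// lee_fin nsq_ge0.
    rewrite -(Rint_EFin iD); congr (_%:E); apply/le_anti; rewrite c /=.
    by apply: Rintegral_ge0 => k _; exact: nsq_ge0.
  have /= h0 := (ae_eq_integral_abs mu measurableT ((measurable_EFinP setT _).2 (itg_meas iD))).1 E.
  apply: filterS h0 => k /(_ I) [/nsq_eq0 e].
  by apply/eqP; rewrite -subr_eq0; exact/eqP.
move=> x; have /is_fourierP[_ FGE] := FG; have /is_fourierP[_ FgE] := Fg.
have : (theta' t x)%:C%C = (physical g t x)%:C%C :> R[i].
  by rewrite FGE FgE; apply/esym; exact: fourint_ae_eq.
by case.
Qed.

End uniqueness.
End solution.
End flow.

(** * The threshold on delta and the conclusion *)

Section threshold.
Context {R : realType}.
Variable Xi0 : R.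
Hypothesis Xi00 : 0 < Xi0.

(** Summing over the three domains gives a threshold that does not depend on the domain. *)
Definition decay_bound : R :=
  \int[freqS Torus]_k decay k + \int[freqS Plane]_k decay k + \int[freqS Cylinder]_k decay k.

Lemma decay_freq_ge0 Om : 0 <= \int[@freqS R Om]_k decay k.
Proof. by apply: Rintegral_ge0 => k _; exact: decay_ge0. Qed.

Lemma decay_le_bound Om : \int[@freqS R Om]_k decay k <= decay_bound.
Proof.
have a := decay_freq_ge0 Torus; have b := decay_freq_ge0 Plane; have c := decay_freq_ge0 Cylinder.
rewrite /decay_bound; case: Om.
- by rewrite -addrA lerDl; exact: addr_ge0 b c.
- by rewrite addrAC lerDr; exact: addr_ge0 a c.
- by rewrite lerDr; exact: addr_ge0 a b.
Qed.

Definition growth (s N : R) : R := Ktriad s * (decay_bound + Mb s Xi0 (N ^+ 2)).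

(** The value 1/2 keeps the threshold below 1, the second entry is the smallness required by the
    energy estimate, and (1 + N)^(-1) makes the limit at large data immediate. The energy is a
    squared norm, so [growth] takes N^2; the 1 added to it keeps the denominator positive. *)
Definition deltastar (kappa s N : R) : R :=
  Num.min (1 / 2) (Num.min (kappa / (growth s N + 1)) (1 + N)^-1).

Lemma growth_ge0 s N : 4 < s -> 0 <= growth s N.
Proof.
move=> s4; have s0 : 0 <= s by apply: ltW; apply: lt_trans s4; rewrite ltr0n.
apply: mulr_ge0; first exact: Ktriad_ge0.
apply: addr_ge0; last exact: (Mb_ge0 s Xi00 (sqr_ge0 N)).
exact: le_trans (decay_freq_ge0 Torus) (decay_le_bound Torus).
Qed.

Lemma deltastar_gt0 kappa s N : 0 < kappa -> 4 < s -> 0 <= N -> 0 < deltastar kappa s N < 1.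
Proof.
move=> k0 s4 N0; have g0 := growth_ge0 N s4; apply/andP; split.
  rewrite /deltastar !lt_min; apply/and3P; split; first exact: divr_gt0.
    by apply: divr_gt0 => //; exact: ltr_wpDl.
  by rewrite invr_gt0; exact: ltr_wpDr.
by rewrite /deltastar gt_min ltr_pdivrMr// mul1r ltr1n.
Qed.

Lemma deltastar_cvg kappa s : 0 < kappa -> 4 < s -> deltastar kappa s N @[N --> +oo] --> (0 : R).
Proof.
move=> k0 s4.
have c : (1 + N)^-1 @[N --> +oo] --> (0 : R).
  apply/(@gtr0_cvgV0 _ _ _ _ (fun N : R => 1 + N)); last exact: cvg_addrl.
  by near=> N; have N0 : 0 < N by []; rewrite addr_gt0.
apply: (squeeze_cvgr _ (cvg_cst 0) c); near=> N.
have N0 : 0 <= N by [].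
have /andP[d0 _] := deltastar_gt0 k0 s4 N0.
by rewrite (ltW d0) /= /deltastar !ge_min lexx !orbT.
Unshelve. all: by end_near.
Qed.

Lemma deltastar_small kappa s N delta Om : 0 < kappa -> 4 < s -> 0 <= N -> 0 < delta < deltastar kappa s N ->
  Ktriad s * delta * (\int[@freqS R Om]_k decay k + Mb s Xi0 (N ^+ 2)) <= 2 * kappa.
Proof.
move=> k0 s4 N0 /andP[d0]; rewrite /deltastar !lt_min => /and3P[_ d1 _].
have g0 := growth_ge0 N s4; have K0 : 0 <= Ktriad s.
  by apply: Ktriad_ge0; apply: ltW; apply: lt_trans s4; rewrite ltr0n.
move: d1; rewrite ltr_pdivlMr ?ltr_wpDl// => d1.
apply: (@le_trans _ _ (delta * growth s N)).
  rewrite [Ktriad s * delta]mulrC -mulrA; apply: ler_wpM2l; first exact: ltW.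
  by apply: ler_wpM2l => //; rewrite lerD2r; exact: decay_le_bound.
by move: d1 (ltW d0) k0; rewrite mulrDr mulr1; lra.
Qed.

End threshold.

Theorem theorem3 (R : realType) (Xi0 : R) (Xi0_gt0 : 0 < Xi0) :
  exists deltastar : R -> R -> R -> R,
    (forall kappa s N : R, 0 < kappa -> 4 < s -> 0 <= N ->
       0 < deltastar kappa s N < 1) /\
    (forall kappa s : R, 0 < kappa -> 4 < s ->
       deltastar kappa s N @[N --> +oo] --> (0 : R)) /\
    (forall (Om : domain) (psi : R -> R),
       measurable_fun setT psi ->
       (forall r : R, 0 <= r -> 0 <= psi r) ->
       (forall r : R, Xi0 < r -> ln (10 + r) <= psi r) ->
       forall (kappa s : R) (theta0 : R * R -> R),
       0 < kappa -> 4 < s -> sobolev Om s theta0 ->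
       forall delta : R,
       0 < delta < deltastar kappa s (fine (sobolev_norm Om s theta0)) ->
       exists theta : R -> R * R -> R,
         [/\ Linfty_sobolev Om s theta,
             solves Om psi kappa delta theta0 theta
           & forall theta' : R -> R * R -> R,
               Linfty_sobolev Om s theta' ->
               solves Om psi kappa delta theta0 theta' ->
               {ae lebesgue_measure, forall t : R, 0 <= t ->
                 forall x : R * R, theta' t x = theta t x}]).
Proof.
exists (deltastar Xi0); split; first by move=> kappa s N; exact: deltastar_gt0.
split; first by move=> kappa s; exact: deltastar_cvg.
move=> Om psi mpsi psi_ge0 psi_log kappa s theta0 kappa0 s4 [[g1 fg1] fin] delta hd.
pose mu : {sigma_finite_measure set (freqsp R) -> \bar R} := freqS Om.
set N := fine (sobolev_norm Om s theta0) in hd.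
have n0 : (0 <= sobolev_norm Om s theta0)%E by exact: Lnorm_ge0.
have N0 : 0 <= N by exact: fine_ge0.
have NE : (sobolev_norm Om s theta0 <= N%:E)%E by rewrite /N fineK// ge0_fin_numE.
have d0 : 0 <= delta by case/andP: hd => /ltW.
have d1 : delta <= 1.
  by case/andP: hd => _ /ltW /le_trans; apply; have /andP[_ /ltW] := deltastar_gt0 Xi0_gt0 kappa0 s4 N0.
have s4' : 4 <= s := ltW s4.
have fh := is_fourier_hat fg1.
(* The scheme needs initial data that are Hermitian at every frequency; [g0E] records the almost
   everywhere agreement with [hat], in which [solves] is phrased. *)
have [fg0 g0E] := fourier_hermpart fh; set g0 := hermpart _ in fg0 g0E.
have /is_fourierP[[mg0 _] _] := fg0.
have [eg0 Eg0] := sobolev_bound fg0 NE.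
have psi_log' (r : R) : Xi0 < r -> lsym r <= psi r by exact: psi_log.
have small := deltastar_small Xi0_gt0 Om kappa0 s4 N0 hd.
have [g sol] := exists_solution (mu := mu) (@freqS_refl R Om) (@freqS_shift R Om) (@freqS_decay R Om)
  mpsi psi_ge0 kappa0 d0 d1 s4' Xi0_gt0 psi_log' (sqr_ge0 N) small mg0 (hermpart_herm _) eg0 Eg0.
have M0 : 0 <= Mb s Xi0 (N ^+ 2) := Mb_ge0 s Xi0_gt0 (sqr_ge0 N).
exists (physical Om g); split.
- exact: (solution_bounded d0 s4' M0 sol).
- exact: (solution_solves d0 s4' g0E sol).
- move=> theta' bd' solves'.
  exact: (solution_unique psi_ge0 kappa0 d0 d1 s4' M0 g0E sol bd' solves' mg0).
Qed.
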